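(* Let $m\ge2$ and let $x:M^m\to\mathbb{S}^{m+2}$ be an umbilic-free Wintgen ideal submanifold, with $\xi_1,\xi_2$, the Gauss map $[\xi]=[\xi_1-i\xi_2]$, the distributions $\mathbb{D},\mathbb{D}^{\bot}$ and the Möbius metric $\mathrm{g}$ as in the context. Then (quotients being understood locally on $M$): (1) The complex vector-valued function $\xi=\xi_1-i\xi_2$ defines a Gauss map $[\xi]:\overline{M^2}\to Q^{m+2}_+\subset\mathbb{C}P^{m+3}$ on a Riemann surface $\overline{M^2}$ (through which $[\xi]:M^m\to Q^{m+2}_+$ factors), whose image is a 1-isotropic complex curve, in the sense that it is holomorphic and $$\langle d\xi,d\xi\rangle=0,\qquad \langle d\xi,d\bar\xi\rangle>0 .$$ (2) The distribution $\mathbb{D}^{\bot}=\mathrm{Span}\{E_3,\dots,E_m\}$ is integrable. Its integral submanifolds define a foliation $\mathscr{D}$ of $M^m$, and there is the quotient manifold structure $\overline{M^2}=M^m/\mathscr{D}$. (3) The projection $\pi:M^m\to\overline{M^2}$ is a Riemannian submersion up to the constant factor $\mu=\sqrt{\frac{m-1}{4m}}$, where $M^m$ is endowed with the Möbius metric $\mathrm{g}$ and $\overline{M^2}$ with the metric $h$ induced from $Q^{m+2}_+$; that is, $\ker d\pi=\mathbb{D}^{\bot}$ and $h(d\pi V,d\pi V)=\mu^2\,\mathrm{g}(V,V)$ for all $V\in\mathbb{D}$. (4) The mean curvature spheres $\mathrm{Span}\{\xi_1,\xi_2\}$ form a 2-parameter family. They envelop an $m$-dimensional submanifold $\widehat{M}^m\supset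 M^m$ (which might degenerate at some points). (5) $\mathscr{D}$ extends to the whole envelope $\widehat{M}^m$ as a foliation by a 2-parameter family of $(m-2)$-dimensional spheres; in other words, $\widehat{M}^m$ can be viewed as a sphere bundle over the Riemann surface $\overline{M^2}$.
   Context: **Wintgen ideal submanifolds (codimension two).** A submanifold $x:M^m\to\mathbb{S}^{m+2}$ is Wintgen ideal if equality holds in the DDVV inequality at every point; equivalently (and this is taken as the definition), at every point there are an orthonormal basis $\{e_1,\dots,e_m\}$ of the tangent space and an orthonormal basis $\{n_1,n_2\}$ of the normal space such that the shape operators have matrices $A_{n_1}=\lambda_1 I_m+\mu_0(E_{12}+E_{21})$ and $A_{n_2}=\lambda_2 I_m+\mu_0(E_{11}-E_{22})$ for some real $\lambda_1,\lambda_2,\mu_0$, where here $E_{ij}$ (double index) are matrix units. If $M$ is umbilic-free ($\mu_0\neq0$ everywhere), the canonical distribution $\mathbb{D}=\mathrm{Span}\{e_1,e_2\}$ is well defined; $\mathbb{D}^{\bot}$ is its orthogonal complement in $TM$. **Light-cone model.** $\mathbb{R}^{m+4}_1$ is $\mathbb{R}^{m+4}$ with $\langle Y,Z\rangle=-Y_0Z_0+Y_1Z_1+\cdots+Y_{m+3}Z_{m+3}$, extended complex bilinearly to $\mathbb{C}^{m+4}_1=\mathbb{R}^{m+4}_1\otimes\mathbb{C}$. A point $y\in\mathbb{S}^{m+2}\subset\mathbb{R}^{m+3}$ is identified with the light-like line $[(1,y)]$. An oriented spacelike 2-plane with oriented orthonormal basis $\{\xi_1,\xi_2\}$ represents the round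 $m$-sphere of light-like lines orthogonal to it, and is identified with the point $[\xi_1-i\xi_2]$ of $$Q^{m+2}_+=\{[Z]\in\mathbb{C}P^{m+3}:\langle Z,Z\rangle=0,\ \langle Z,\bar Z\rangle>0\}.$$ $Q^{m+2}_+$ carries the indefinite Hermitian metric (independent of the local lift $\xi$) $$h_\xi=\frac{1}{\langle\xi,\bar\xi\rangle}\Big\langle d\xi-\frac{\langle d\xi,\bar\xi\rangle}{\langle\xi,\bar\xi\rangle}\xi,\ d\bar\xi-\frac{\langle d\bar\xi,\xi\rangle}{\langle\xi,\bar\xi\rangle}\bar\xi\Big\rangle .$$ **Möbius metric.** With $I=dx\cdot dx$ and second fundamental form $II$, put $\rho^2=\frac{m}{m-1}\,|II-\frac1m \mathrm{tr}(II)I|^2$ (positive when umbilic-free). The Möbius metric is $\mathrm{g}=\rho^2\,dx\cdot dx$. $\{E_1,\dots,E_m\}$ is a local $\mathrm{g}$-orthonormal frame with $\mathbb{D}=\mathrm{Span}\{E_1,E_2\}$ and $\mathbb{D}^{\bot}=\mathrm{Span}\{E_3,\dots,E_m\}$. **Mean curvature sphere.** For a local oriented orthonormal normal frame $\{n_1,n_2\}$ with mean curvature vector $H=\frac1m\mathrm{tr}(II)=H^1n_1+H^2n_2$, set $\xi_r=(H^r,\,n_r+H^rx)\in\mathbb{R}^{m+4}_1$. The spacelike plane $\mathrm{Span}\{\xi_1,\xi_2\}$ represents the mean curvature sphere at $x$, the unique round $m$-sphere tangent to $M$ at $x$ with the same mean curvature vector there. The Gauss map is $[\xi]=[\xi_1-i\xi_2]:M^m\to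 Q^{m+2}_+$. **Complex curves.** A complex curve in $Q^{m+2}_+$ is a holomorphic immersion $[\xi]$ of a Riemann surface into $Q^{m+2}_+$; for local lifts, $\xi_{\bar z}=\lambda\xi$ for a local function $\lambda$. It is 1-isotropic if $d\xi$ is isotropic. **Envelope.** The envelope $\widehat{M}^m$ of the family $\mathrm{Span}_{\mathbb{R}}\{\xi_1,\xi_2\}$ over $\overline{M^2}$ consists of the pairs $(q,[Y])$, $q\in\overline{M^2}$, with $[Y]$ a light-like line in the orthogonal complement of the 4-dimensional spacelike space $\mathrm{Span}_{\mathbb{R}}\{\xi_1,\xi_2,d\xi_1,d\xi_2\}$ at $q$, with the map $(q,[Y])\mapsto [Y]\in\mathbb{S}^{m+2}$, which may fail to be an immersion at some points. $M^m$ is (locally) regarded as contained in it via $p\mapsto(\pi(p),x(p))$. *)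

(* Defs.v *)
From HB Require Import structures.
From mathcomp Require Import all_boot all_order all_algebra.
From mathcomp Require Import complex.
From mathcomp Require Import all_classical all_reals all_analysis.

Set Implicit Arguments.
Unset Strict Implicit.
Unset Printing Implicit Defensive.

Import Order.TTheory GRing.Theory Num.Theory.
Import numFieldNormedType.Exports.

Local Open Scope classical_set_scope.
Local Open Scope ring_scope.

(** * Smooth maps and smooth manifolds *)

(* C^oo on an open set: every iterated directional derivative is Frechet
   differentiable there.  The predicate is meant for open U. *)
Definition smooth_on (R : realType) (V W : normedModType R)
    (U : set V) (f : V -> W) : Prop :=
  forall (vs : seq V) (a : V), U a ->
    differentiable (foldr (fun v (g : V -> W) => 'D_v g) f vs) a.

Definition basis_vec (R : realType) (n : nat) (i : 'I_n) : 'rV[R]_n :=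
  delta_mx 0 i.

(* Only the values of chart_map on chart_dom, and of chart_inv on the image
   chart_im, are meaningful. *)
Record chart (R : realType) (T : topologicalType) (n : nat) := Chart {
  chart_dom : set T;
  chart_map : T -> 'rV[R]_n;
  chart_inv : 'rV[R]_n -> T }.

Definition chart_im (R : realType) (T : topologicalType) (n : nat)
    (c : chart R T n) : set 'rV[R]_n :=
  chart_map c @` chart_dom c.

Definition is_chart (R : realType) (T : topologicalType) (n : nat)
    (c : chart R T n) : Prop :=
  [/\ open (chart_dom c), open (chart_im c),
      forall p, chart_dom c p -> chart_inv c (chart_map c p) = p,
      forall p, chart_dom c p -> {for p, continuous (chart_map c)} &
      forall u, chart_im c u -> {for u, continuous (chart_inv c)}].

Definition transition (R : realType) (T : topologicalType) (n : nat)
    (c c' : chart R T n) : 'rV[R]_n -> 'rV[R]_n :=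
  chart_map c' \o chart_inv c.

Definition overlap (R : realType) (T : topologicalType) (n : nat)
    (c c' : chart R T n) : set 'rV[R]_n :=
  chart_map c @` (chart_dom c `&` chart_dom c').

Definition compatible (R : realType) (T : topologicalType) (n : nat)
    (c c' : chart R T n) : Prop :=
  smooth_on (overlap c c') (transition c c') /\
  smooth_on (overlap c' c) (transition c' c).

Definition smooth_atlas (R : realType) (T : topologicalType) (n : nat)
    (A : set (chart R T n)) : Prop :=
  [/\ forall c, A c -> is_chart c,
      forall p, exists2 c, A c & chart_dom c p &
      forall c c', A c -> A c' -> compatible c c'].

Definition smooth_manifold (R : realType) (T : topologicalType) (n : nat)
    (A : set (chart R T n)) : Prop :=
  [/\ hausdorff_space T, @second_countable T & smooth_atlas A].

(* 'rV[R]_2 stands for the complex plane, (a, b) being a + i b. *)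
Definition cauchy_riemann (R : realType) (f : 'rV[R]_2 -> 'rV[R]_2)
    (z : 'rV[R]_2) : Prop :=
  let fx := 'D_(basis_vec R 0) f z in
  let fy := 'D_(basis_vec R 1) f z in
  fx 0 0 = fy 0 1 /\ fx 0 1 = - fy 0 0.

Definition riemann_surface (R : realType) (S : topologicalType)
    (B : set (chart R S 2)) : Prop :=
  [/\ hausdorff_space S, connected [set: S], smooth_atlas B &
      forall b b' z, B b -> B b' -> overlap b b' z ->
        cauchy_riemann (transition b b') z].

(* Smoothness on an open subset W of a manifold of a vector-valued map, of a
   map between manifolds, and of a map from a vector space to a manifold. *)
Definition smooth_from (R : realType) (T : topologicalType) (n : nat)
    (A : set (chart R T n)) (E : normedModType R) (W : set T) (f : T -> E)
    : Prop :=
  forall c, A c -> smooth_on (chart_map c @` (W `&` chart_dom c))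
                             (f \o chart_inv c).

Definition smooth_map (R : realType) (T S : topologicalType) (n k : nat)
    (A : set (chart R T n)) (B : set (chart R S k)) (W : set T) (f : T -> S)
    : Prop :=
  (forall p, W p -> {for p, continuous f}) /\
  forall c b, A c -> B b ->
    smooth_on (chart_map c @` (W `&` chart_dom c `&` f @^-1` chart_dom b))
              (chart_map b \o f \o chart_inv c).

Definition smooth_into (R : realType) (E : normedModType R)
    (T : topologicalType) (n : nat) (A : set (chart R T n))
    (U : set E) (f : E -> T) : Prop :=
  (forall s, U s -> {for s, continuous f}) /\
  forall c, A c -> smooth_on (U `&` f @^-1` chart_dom c) (chart_map c \o f).

(* k-dimensional submanifolds of R^N: S is locally the diffeomorphic image psi
   of an open subset of R^k, the inverse of psi being the restriction of a
   smooth map defined on an open subset of R^N. *)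
Definition embedded_submanifold (R : realType) (k N : nat)
    (S : set 'rV[R]_N) : Prop :=
  forall p, S p ->
  exists (U : set 'rV[R]_N) (D : set 'rV[R]_k)
         (psi : 'rV[R]_k -> 'rV[R]_N) (phi : 'rV[R]_N -> 'rV[R]_k),
    [/\ open U /\ U p, open D, smooth_on D psi /\ smooth_on U phi,
        psi @` D = S `&` U & forall t, D t -> phi (psi t) = t].

(** * Submanifolds of the unit sphere, in a local parametrization

   F is a local parametrization R^m -> R^(m+3), with values in the unit sphere
   S^(m+2), and u a point of its domain; tangent vectors at u are identified
   with elements of 'rV_m. *)

Definition dot (K : comNzRingType) (n : nat) (u v : 'rV[K]_n) : K :=
  \sum_(i < n) u 0 i * v 0 i.

Definition fff (R : realType) (m : nat) (F : 'rV[R]_m -> 'rV[R]_m.+3)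
    (u v w : 'rV[R]_m) : R :=
  dot ('D_v F u) ('D_w F u).

Definition gram_inv (R : realType) (m : nat) (F : 'rV[R]_m -> 'rV[R]_m.+3)
    (u : 'rV[R]_m) : 'M[R]_m :=
  invmx (\matrix_(i, j) fff F u (basis_vec R i) (basis_vec R j)).

Definition tangent_proj (R : realType) (m : nat)
    (F : 'rV[R]_m -> 'rV[R]_m.+3) (u : 'rV[R]_m) (X : 'rV[R]_m.+3)
    : 'rV[R]_m.+3 :=
  \sum_(i < m) \sum_(j < m)
    (gram_inv F u i j * dot X ('D_(basis_vec R i) F u))
      *: 'D_(basis_vec R j) F u.

(* Second fundamental form in S^(m+2): the component of the second derivative
   normal to the submanifold and tangent to the sphere. *)
Definition sff (R : realType) (m : nat) (F : 'rV[R]_m -> 'rV[R]_m.+3)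
    (u v w : 'rV[R]_m) : 'rV[R]_m.+3 :=
  let X := 'D_v (fun q => 'D_w F q) u in
  X - tangent_proj F u X - dot X (F u) *: F u.

Definition mean_curv (R : realType) (m : nat) (F : 'rV[R]_m -> 'rV[R]_m.+3)
    (u : 'rV[R]_m) : 'rV[R]_m.+3 :=
  m%:R^-1 *: \sum_(i < m) \sum_(j < m)
    gram_inv F u i j *: sff F u (basis_vec R i) (basis_vec R j).

Definition sff0 (R : realType) (m : nat) (F : 'rV[R]_m -> 'rV[R]_m.+3)
    (u v w : 'rV[R]_m) : 'rV[R]_m.+3 :=
  sff F u v w - fff F u v w *: mean_curv F u.

Definition sff0_norm2 (R : realType) (m : nat)
    (F : 'rV[R]_m -> 'rV[R]_m.+3) (u : 'rV[R]_m) : R :=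
  \sum_(i < m) \sum_(j < m) \sum_(k < m) \sum_(l < m)
    gram_inv F u i k * gram_inv F u j l *
    dot (sff0 F u (basis_vec R i) (basis_vec R j))
        (sff0 F u (basis_vec R k) (basis_vec R l)).

Definition moebius_metric (R : realType) (m : nat)
    (F : 'rV[R]_m -> 'rV[R]_m.+3) (u v w : 'rV[R]_m) : R :=
  m%:R / (m%:R - 1) * sff0_norm2 F u * fff F u v w.

Definition umbilic (R : realType) (m : nat) (F : 'rV[R]_m -> 'rV[R]_m.+3)
    (u : 'rV[R]_m) : Prop :=
  forall v w, sff0 F u v w = 0.

Definition orthonormal_normals (R : realType) (m : nat)
    (F : 'rV[R]_m -> 'rV[R]_m.+3) (u : 'rV[R]_m) (n1 n2 : 'rV[R]_m.+3)
    : Prop :=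
  [/\ dot n1 n1 = 1, dot n2 n2 = 1, dot n1 n2 = 0,
      dot n1 (F u) = 0 /\ dot n2 (F u) = 0 &
      forall v, dot n1 ('D_v F u) = 0 /\ dot n2 ('D_v F u) = 0].

(* The matrix of the shape operator A_n in the orthonormal basis e:
   <A_n e_i, e_j> = <II(e_i, e_j), n>. *)
Definition shape_mx (R : realType) (m : nat) (F : 'rV[R]_m -> 'rV[R]_m.+3)
    (u : 'rV[R]_m) (e : 'I_m -> 'rV[R]_m) (n : 'rV[R]_m.+3) : 'M[R]_m :=
  \matrix_(i, j) dot (sff F u (e i) (e j)) n.

(* Matrix units, with indices from 0 (mx_unit m 0 1 is E_12). *)
Definition mx_unit (R : realType) (m a b : nat) : 'M[R]_m :=
  \matrix_(i, j) ((i == a :> nat) && (j == b :> nat))%:R.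

Definition wintgen_frame (R : realType) (m : nat)
    (F : 'rV[R]_m -> 'rV[R]_m.+3) (u : 'rV[R]_m) (e : 'I_m -> 'rV[R]_m)
    (n1 n2 : 'rV[R]_m.+3) (l1 l2 mu0 : R) : Prop :=
  [/\ forall i j, fff F u (e i) (e j) = (i == j)%:R,
      orthonormal_normals F u n1 n2,
      shape_mx F u e n1 =
        l1%:M + mu0 *: (mx_unit R m 0 1 + mx_unit R m 1 0) &
      shape_mx F u e n2 =
        l2%:M + mu0 *: (mx_unit R m 0 0 - mx_unit R m 1 1)].

Definition wintgen_point (R : realType) (m : nat)
    (F : 'rV[R]_m -> 'rV[R]_m.+3) (u : 'rV[R]_m) : Prop :=
  exists e n1 n2 l1 l2 mu0, wintgen_frame F u e n1 n2 l1 l2 mu0.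

(* At a non-umbilic Wintgen point, Span{e_1, e_2} does not depend on the
   adapted frame. *)
Definition canonical_distr (R : realType) (m : nat)
    (F : 'rV[R]_m -> 'rV[R]_m.+3) (u : 'rV[R]_m) : set 'rV[R]_m :=
  [set v | exists e n1 n2 l1 l2 mu0 (a : 'I_m -> R),
     wintgen_frame F u e n1 n2 l1 l2 mu0 /\
     v = \sum_(i < m | (i < 2)%N) a i *: e i].

(* Moebius-orthogonal complement of the canonical distribution. *)
Definition distr_perp (R : realType) (m : nat)
    (F : 'rV[R]_m -> 'rV[R]_m.+3) (u : 'rV[R]_m) : set 'rV[R]_m :=
  [set v | forall w, canonical_distr F u w -> moebius_metric F u v w = 0].

(** * Immersed submanifolds x : M -> S^(m+2) *)

Definition immersion (R : realType) (M : topologicalType) (m N : nat)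
    (A : set (chart R M m)) (x : M -> 'rV[R]_N) : Prop :=
  smooth_from A [set: M] x /\
  forall c u v, A c -> chart_im c u -> v != 0 ->
    'D_v (x \o chart_inv c) u != 0.

Definition wintgen_ideal (R : realType) (M : topologicalType) (m : nat)
    (A : set (chart R M m)) (x : M -> 'rV[R]_m.+3) : Prop :=
  forall c u, A c -> chart_im c u -> wintgen_point (x \o chart_inv c) u.

Definition umbilic_free (R : realType) (M : topologicalType) (m : nat)
    (A : set (chart R M m)) (x : M -> 'rV[R]_m.+3) : Prop :=
  forall c u, A c -> chart_im c u -> ~ umbilic (x \o chart_inv c) u.

(* A smooth orthonormal normal frame on the open set V.  Its order is the
   local orientation of the normal bundle. *)
Definition normal_frame (R : realType) (M : topologicalType) (m : nat)
    (A : set (chart R M m)) (x : M -> 'rV[R]_m.+3) (V : set M)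
    (n1 n2 : M -> 'rV[R]_m.+3) : Prop :=
  [/\ smooth_from A V n1, smooth_from A V n2 &
      forall c p, A c -> V p -> chart_dom c p ->
        orthonormal_normals (x \o chart_inv c) (chart_map c p)
          (n1 p) (n2 p)].

(** * Integrability of D^perp, its foliation and its leaves *)

(* An integral submanifold, given by an injective immersion of an open subset
   U of R^(m-2). *)
Definition integral_submanifold (R : realType) (M : topologicalType)
    (m : nat) (A : set (chart R M m)) (x : M -> 'rV[R]_m.+3)
    (U : set 'rV[R]_(m - 2)) (f : 'rV[R]_(m - 2) -> M) : Prop :=
  [/\ open U, smooth_into A U f, {in U &, injective f} &
      forall s c, U s -> A c -> chart_dom c (f s) ->
        injective (fun a => 'D_a (chart_map c \o f) s) /\
        range (fun a => 'D_a (chart_map c \o f) s) =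
          distr_perp (x \o chart_inv c) (chart_map c (f s))].

Definition distr_perp_integrable (R : realType) (M : topologicalType)
    (m : nat) (A : set (chart R M m)) (x : M -> 'rV[R]_m.+3) : Prop :=
  forall p, exists U f,
    [/\ integral_submanifold A x U f, U 0 & f 0 = p].

(* Leafwise directions of a foliated chart of codimension 2. *)
Definition plaque_dir (R : realType) (m : nat) : set 'rV[R]_m :=
  [set v | forall i : 'I_m, (i < 2)%N -> v 0 i = 0].

Definition open_box (R : realType) (m : nat) (lo hi : 'I_m -> R)
    : set 'rV[R]_m :=
  [set v | forall i, lo i < v 0 i < hi i].

(* A codimension 2 foliation: an atlas by boxes whose plaques are the slices
   on which the first two coordinates are constant, and whose transition maps
   send plaques into plaques. *)
Definition foliated_atlas (R : realType) (M : topologicalType) (m : nat)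
    (A Phi : set (chart R M m)) : Prop :=
  [/\ forall c, Phi c -> is_chart c /\
        exists lo hi, chart_im c = open_box lo hi,
      forall p, exists2 c, Phi c & chart_dom c p,
      forall c c', Phi c -> A c' -> compatible c c' &
      forall c c', Phi c -> Phi c' ->
        smooth_on (overlap c c') (transition c c') /\
        forall u v, overlap c c' u -> @plaque_dir R m v ->
          @plaque_dir R m ('D_v (transition c c') u)].

Definition plaques_integral (R : realType) (M : topologicalType) (m : nat)
    (x : M -> 'rV[R]_m.+3) (Phi : set (chart R M m)) : Prop :=
  forall c u, Phi c -> chart_im c u ->
    distr_perp (x \o chart_inv c) u = @plaque_dir R m.

(* p and q are on the same leaf of the foliation restricted to W: they are
   joined by a smooth curve in W tangent to D^perp. *)
Definition same_leaf (R : realType) (M : topologicalType) (m : nat)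
    (A : set (chart R M m)) (x : M -> 'rV[R]_m.+3) (W : set M) (p q : M)
    : Prop :=
  exists (J : set R) (gam : R -> M),
  [/\ open J /\ (forall t, 0 <= t <= 1 -> J t),
      smooth_into A J gam,
      gam 0 = p /\ gam 1 = q,
      forall t, 0 <= t <= 1 -> W (gam t) &
      forall t c, 0 <= t <= 1 -> A c -> chart_dom c (gam t) ->
        distr_perp (x \o chart_inv c) (chart_map c (gam t))
          ('D_1 (chart_map c \o gam) t)].

(* pi : W -> S is the quotient of W by its leaves, and S a quotient manifold:
   the fibres of the surjective submersion pi are the leaves. *)
Definition leaf_quotient (R : realType) (M S : topologicalType) (m : nat)
    (A : set (chart R M m)) (x : M -> 'rV[R]_m.+3) (W : set M)
    (B : set (chart R S 2)) (pi : M -> S) : Prop :=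
  [/\ smooth_map A B W pi,
      pi @` W = [set: S],
      forall c b p, A c -> B b -> W p -> chart_dom c p ->
        chart_dom b (pi p) ->
        range (fun v => 'D_v (chart_map b \o pi \o chart_inv c)
                          (chart_map c p)) = [set: 'rV[R]_2] &
      forall p q, W p -> W q -> (pi p = pi q <-> same_leaf A x W p q)].

(** * Light-cone model *)

(* The Lorentz product of signature (-, +, ..., +), extended bilinearly when
   K is the field of complex numbers. *)
Definition lor (K : comNzRingType) (n : nat) (Z W : 'rV[K]_(1 + n)) : K :=
  - (lsubmx Z 0 0 * lsubmx W 0 0) + dot (rsubmx Z) (rsubmx W).

Definition to_complex (R : realType) (n : nat) (Z : 'rV[R]_n)
    : 'rV[R[i]]_n := map_mx (real_complex R) Z.

Definition re_vec (R : realType) (n : nat) (Z : 'rV[R[i]]_n) : 'rV[R]_n :=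
  map_mx (@complex.Re R) Z.

Definition im_vec (R : realType) (n : nat) (Z : 'rV[R[i]]_n) : 'rV[R]_n :=
  map_mx (@complex.Im R) Z.

Definition conj_vec (R : realType) (n : nat) (Z : 'rV[R[i]]_n)
    : 'rV[R[i]]_n := map_mx (@conjc R) Z.

Definition light_vec (R : realType) (n : nat) (y : 'rV[R]_n)
    : 'rV[R]_(1 + n) := row_mx 1%:M y.

(* The point [Z] of the projective space, as a punctured complex line. *)
Definition cline (R : realType) (n : nat) (Z : 'rV[R[i]]_n)
    : set 'rV[R[i]]_n := [set c *: Z | c in [set c | c != 0]].

Definition Qplus (R : realType) (n : nat) : set (set 'rV[R[i]]_(1 + n)) :=
  [set L | exists Z, [/\ L = cline Z, lor Z Z = 0 & 0 < lor Z (conj_vec Z)]].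

(* xi_r = (H^r, n_r + H^r x), for a unit normal n = n_r. *)
Definition curv_sphere (R : realType) (m : nat)
    (F : 'rV[R]_m -> 'rV[R]_m.+3) (u : 'rV[R]_m) (n : 'rV[R]_m.+3)
    : 'rV[R]_(1 + m.+3) :=
  let h := dot (mean_curv F u) n in row_mx h%:M (n + h *: F u).

Definition gauss_vec (R : realType) (m : nat)
    (F : 'rV[R]_m -> 'rV[R]_m.+3) (u : 'rV[R]_m) (n1 n2 : 'rV[R]_m.+3)
    : 'rV[R[i]]_(1 + m.+3) :=
  to_complex (curv_sphere F u n1) - 'i%C *: to_complex (curv_sphere F u n2).

Definition gauss_map_factors (R : realType) (M S : topologicalType)
    (m : nat) (A : set (chart R M m)) (x n1 n2 : M -> 'rV[R]_m.+3)
    (W : set M) (pi : M -> S) (G : S -> set 'rV[R[i]]_(1 + m.+3)) : Prop :=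
  forall c p, A c -> W p -> chart_dom c p ->
    G (pi p) =
    cline (gauss_vec (x \o chart_inv c) (chart_map c p) (n1 p) (n2 p)).

(** * Complex curves in Q_+ *)

Definition csmooth_on (R : realType) (N : nat) (O : set 'rV[R]_2)
    (eta : 'rV[R]_2 -> 'rV[R[i]]_N) : Prop :=
  smooth_on O (fun z => re_vec (eta z)) /\
  smooth_on O (fun z => im_vec (eta z)).

(* Derivative of eta at z in the real direction v. *)
Definition cderive (R : realType) (N : nat)
    (eta : 'rV[R]_2 -> 'rV[R[i]]_N) (z v : 'rV[R]_2) : 'rV[R[i]]_N :=
  to_complex ('D_v (fun w => re_vec (eta w)) z) +
  'i%C *: to_complex ('D_v (fun w => im_vec (eta w)) z).

Definition dbar (R : realType) (N : nat)
    (eta : 'rV[R]_2 -> 'rV[R[i]]_N) (z : 'rV[R]_2) : 'rV[R[i]]_N :=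
  2^-1 *: (cderive eta z (basis_vec R 0) +
           'i%C *: cderive eta z (basis_vec R 1)).

(* eta is a smooth local lift, in the coordinate of b, of the map G into the
   projective space. *)
Definition is_lift (R : realType) (S : topologicalType) (N : nat)
    (b : chart R S 2) (G : S -> set 'rV[R[i]]_N) (O : set 'rV[R]_2)
    (eta : 'rV[R]_2 -> 'rV[R[i]]_N) : Prop :=
  [/\ open O, O `<=` chart_im b, csmooth_on O eta &
      forall z, O z -> G (chart_inv b z) = cline (eta z)].

(* A holomorphic immersion into Q_+. *)
Definition complex_curve (R : realType) (S : topologicalType) (n : nat)
    (B : set (chart R S 2)) (G : S -> set 'rV[R[i]]_(1 + n)) : Prop :=
  [/\ forall s, @Qplus R n (G s),
      forall b s, B b -> chart_dom b s ->
        exists O eta, is_lift b G O eta /\ O (chart_map b s),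
      forall b O eta z, B b -> is_lift b G O eta -> O z ->
        exists lam : R[i], dbar eta z = lam *: eta z &
      forall b O eta z v, B b -> is_lift b G O eta -> O z -> v != 0 ->
        ~ exists a : R[i], cderive eta z v = a *: eta z].

Definition one_isotropic (R : realType) (S : topologicalType) (n : nat)
    (B : set (chart R S 2)) (G : S -> set 'rV[R[i]]_(1 + n)) : Prop :=
  forall b O eta z v w, B b -> is_lift b G O eta -> O z ->
    lor (cderive eta z v) (cderive eta z w) = 0.

Definition spacelike_differential (R : realType) (S : topologicalType)
    (n : nat) (B : set (chart R S 2)) (G : S -> set 'rV[R[i]]_(1 + n))
    : Prop :=
  forall b O eta z v, B b -> is_lift b G O eta -> O z -> v != 0 ->
    0 < lor (cderive eta z v) (conj_vec (cderive eta z v)).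

(* The quadratic form h_xi(v, v) of the metric of Q_+, pulled back by the
   lift xi. *)
Definition herm (R : realType) (n : nat)
    (xi : 'rV[R]_2 -> 'rV[R[i]]_(1 + n)) (z v : 'rV[R]_2) : R[i] :=
  let X := xi z in
  let Xb := conj_vec X in
  let dX := cderive xi z v in
  let dXb := conj_vec dX in
  (lor X Xb)^-1 *
  lor (dX - (lor dX Xb / lor X Xb) *: X)
      (dXb - (lor dXb X / lor X Xb) *: Xb).

Definition riemannian_submersion_upto (R : realType)
    (M S : topologicalType) (m : nat) (A : set (chart R M m))
    (x : M -> 'rV[R]_m.+3) (W : set M) (B : set (chart R S 2))
    (pi : M -> S) (G : S -> set 'rV[R[i]]_(1 + m.+3)) (mu : R) : Prop :=
  forall c b p, A c -> B b -> W p -> chart_dom c p -> chart_dom b (pi p) ->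
  let F := x \o chart_inv c in
  let u := chart_map c p in
  let dpi := fun v => 'D_v (chart_map b \o pi \o chart_inv c) u in
  [set v | dpi v = 0] = distr_perp F u /\
  forall O eta v, is_lift b G O eta -> O (chart_map b (pi p)) ->
    canonical_distr F u v ->
    herm eta (chart_map b (pi p)) (dpi v) =
      real_complex R (mu ^+ 2 * moebius_metric F u v v).

(** * The envelope *)

(* The row space is Span_R{xi_1, xi_2, d xi_1, d xi_2}, where xi_1 - i xi_2 is
   the lift eta; this space does not depend on the lift. *)
Definition osc_mx (R : realType) (N : nat)
    (eta : 'rV[R]_2 -> 'rV[R[i]]_N) (z : 'rV[R]_2) : 'M[R]_(6, N) :=
  \matrix_(k < 6) nth 0
    [:: re_vec (eta z); im_vec (eta z);
        re_vec (cderive eta z (basis_vec R 0));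
        re_vec (cderive eta z (basis_vec R 1));
        im_vec (cderive eta z (basis_vec R 0));
        im_vec (cderive eta z (basis_vec R 1))] k.

Definition osc_spacelike (R : realType) (S : topologicalType) (n : nat)
    (B : set (chart R S 2)) (G : S -> set 'rV[R[i]]_(1 + n)) : Prop :=
  forall b O eta z, B b -> is_lift b G O eta -> O z ->
    \rank (osc_mx eta z) = 4 /\
    forall X : 'rV[R]_(1 + n), (X <= osc_mx eta z)%MS -> X != 0 ->
      0 < lor X X.

(* The light-like line [Y] of a pair (q, [Y]) is represented by the point y of
   the unit sphere with [Y] = [(1, y)]. *)
Definition envelope (R : realType) (S : topologicalType) (n : nat)
    (B : set (chart R S 2)) (G : S -> set 'rV[R[i]]_(1 + n))
    : set (S * 'rV[R]_n) :=
  [set q | dot q.2 q.2 = 1 /\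
     forall b O eta X, B b -> is_lift b G O eta -> chart_dom b q.1 ->
       O (chart_map b q.1) -> (X <= osc_mx eta (chart_map b q.1))%MS ->
       lor X (light_vec q.2) = 0].

(* The part of a subset of S x R^n over the domain of b, in coordinates. *)
Definition in_coord (R : realType) (S : topologicalType) (n : nat)
    (b : chart R S 2) (E : set (S * 'rV[R]_n)) : set 'rV[R]_(2 + n) :=
  [set row_mx (chart_map b q.1) q.2
     | q in E `&` [set q | chart_dom b q.1]].

(* Each sphere xi(q) of the family is tangent to the envelope at the points
   over q: the velocity at (q, y) of any curve of the envelope, mapped to
   S^(m+2), is tangent to it. *)
Definition tangent_to_family (R : realType) (S : topologicalType) (n : nat)
    (B : set (chart R S 2)) (G : S -> set 'rV[R[i]]_(1 + n))
    (E : set (S * 'rV[R]_n)) : Prop :=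
  forall b O eta (z : R -> 'rV[R]_2) (y : R -> 'rV[R]_n),
    B b -> is_lift b G O eta -> O (z 0) ->
    differentiable z (0 : R) -> differentiable y (0 : R) ->
    (\forall t \near (0 : R), O (z t) /\ E (chart_inv b (z t), y t)) ->
    lor (row_mx 0 ('D_1 y 0)) (re_vec (eta (z 0))) = 0 /\
    lor (row_mx 0 ('D_1 y 0)) (im_vec (eta (z 0))) = 0.

Definition fibre (S : Type) (X : Type) (E : set (S * X)) (s : S) : set X :=
  [set y | E (s, y)].

(* The fibres are round spheres S^(k-1) with centre a, radius r > 0, in affine
   k-planes with orthonormal frames e, all depending smoothly on the base
   point; thus (z, t) |-> (z, a + r \sum_j t_j e_j) is a local trivialization
   O x S^(k-1) -> E. *)
Definition round_sphere_bundle (R : realType) (S : topologicalType)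
    (n k : nat) (B : set (chart R S 2)) (E : set (S * 'rV[R]_n)) : Prop :=
  forall b s, B b -> chart_dom b s ->
  exists (O : set 'rV[R]_2) (a : 'rV[R]_2 -> 'rV[R]_n)
         (r : 'rV[R]_2 -> R) (e : 'I_k -> 'rV[R]_2 -> 'rV[R]_n),
  [/\ [/\ open O, O (chart_map b s) & O `<=` chart_im b],
      [/\ smooth_on O a, smooth_on O r & forall j, smooth_on O (e j)],
      forall z, O z -> 0 < r z,
      forall z i j, O z -> dot (e i z) (e j z) = (i == j)%:R &
      forall z, O z -> fibre E (chart_inv b z) =
        [set a z + r z *: (\sum_(j < k) t 0 j *: e j z)
           | t in [set t : 'rV[R]_k | dot t t = 1]]].

(* Main.v *)
Require Import Defs.
From HB Require Import structures.
From mathcomp Require Import all_boot all_order all_algebra.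
From mathcomp Require Import complex.
From mathcomp Require Import all_classical all_reals all_analysis.
From mathcomp Require Import ring lra zify.
Import Order.TTheory GRing.Theory Num.Theory.
Import numFieldNormedType.Exports.
Set Implicit Arguments.
Unset Strict Implicit.
Unset Printing Implicit Defensive.
Local Open Scope classical_set_scope.
Local Open Scope ring_scope.

(** Why the theorem holds.

In an adapted frame the traceless second fundamental form of a Wintgen ideal
submanifold, contracted with n_1 - i n_2, is the square k l^2 of a single complex
linear form l with kernel D^perp, and |k| = mu_0 (wintgen_square). By the Weingarten
formula the Gauss vector satisfies d xi = - k l E + th xi + eta X, where X = (1, x) is the
light-like position vector and E = e_1 + i s e_2 is tangent and isotropic. In particular
<d xi, d xi> = 0. Differentiating this, <D_w D_v xi, D_z xi> is symmetric in w, v and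
antisymmetric in v, z, hence zero; since also <D_w D_v xi, X> = k l(v) l(w), the form eta
must be a multiple of l. So d xi = l Z + th xi with one isotropic vector Z, orthogonal to
xi and to its conjugate, and <Z, conj Z> = 2 mu_0^2 (gauss_structure).

A vector-valued map of this shape is a holomorphic curve in disguise (curve_chart). After
division by a coordinate, zeta = xi / xi_a has differential (l / xi_a) Y; some coordinate f
of zeta has d zeta = df Y / Y_b with df not zero, so f, completed by m - 2 linear
coordinates, is a chart in which zeta depends on f only, and holomorphically. The fibres of
f are tangent to D^perp. These charts form the foliated atlas of (2), because D^perp and
the mean curvature vector are independent of the chart (chart_push); the disc of values of
f is the surface of leaves and zeta the complex curve of (1); and <Z, conj Z> = 2 mu_0^2
compared with the Moebius factor 4 mu_0^2 m / (m - 1) gives the constant of (3)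
(metric_ratio).

The vectors xi and Z being isotropic and independent for the Hermitian form, the real space
spanned by xi and d xi is spacelike of dimension 4 (real_span_pos). The light-like lines
orthogonal to it are the points of the unit sphere on an affine subspace, that is, a round
(m-2)-sphere depending smoothly on the point of the curve (curve_sphere_bundle), and
together they form a regular level set of dimension m (curve_envelope_submanifold). Since X
is orthogonal to xi and Z, the map p |-> (pi(p), x(p)) takes M into this envelope, and as
the dimensions agree M is locally an open part of it (immersion_open_part).

The analysis behind these steps, on directional derivatives of maps that are smooth in the
sense of the definitions, consists of the closure properties of C^n maps, the symmetry of
second derivatives and the inverse function theorem. *)

(** * Differential calculus on normed modules *)

Section Differentials.
Variables (R : realType) (V W : normedModType R).
Implicit Types (f g : V -> W) (a v : V).

(** The little-o definition of the differential in epsilon form; a candidate L only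
needs to be continuous and linear, and is then the differential. *)
Lemma diff_epsP f a (L : {linear V -> W}) : continuous L ->
  (forall e, 0 < e -> \forall h \near (0 : V),
     `|f (h + a) - f a - L h| <= e * `|h|) ->
  differentiable f a /\ 'd f a = L :> (V -> W).
Proof.
move=> cL H.
have E : f \o shift a = cst (f a) + L +o_ 0 id.
  apply/eqaddoP => e e0; near=> h.
  rewrite /= -[(_ - _) h]/(f (h + a) - (f a + L h)) opprD addrA.
  by near: h; exact: H.
have dE := diff_unique cL E.
by split=> //; apply/diff_locallyP; rewrite dE.
Unshelve. all: by end_near. Qed.

Lemma diff_epsW f a : differentiable f a -> forall e, 0 < e ->
  \forall h \near (0 : V), `|f (h + a) - f a - 'd f a h| <= e * `|h|.
Proof.
move=> /diff_locallyP [_ /eqaddoP H] e e0; near=> h.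
rewrite -addrA -opprD; near: h; exact: H.
Unshelve. all: by end_near. Qed.

Lemma near_shift0 a (P : set V) : (\forall x \near a, P x) ->
  \forall h \near (0 : V), P (h + a).
Proof.
move=> /nbhs_ballP [e /= e0 H]; apply/nbhs_ballP; exists e => //= h.
rewrite -ball_normE /= sub0r normrN => he; apply: H.
by rewrite -ball_normE /= opprD addrCA subrr addr0 normrN.
Qed.

Lemma differentiable_near f g a : (\forall x \near a, f x = g x) ->
  differentiable f a -> differentiable g a.
Proof.
move=> fg df; have [cd _] := (diff_locallyP a f).1 df.
have fga : f a = g a by exact: nbhs_singleton fg.
apply: (proj1 (diff_epsP (L := 'd f a) cd _)) => e e0.
near=> h; have <- : f (h + a) = g (h + a).
  by near: h; apply: (near_shift0 fg).
by rewrite -fga; near: h; exact: diff_epsW.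
Unshelve. all: by end_near. Qed.

Lemma open_near (U : set V) (a : V) : open U -> U a -> \forall x \near a, U x.
Proof. by move=> oU Ua; apply: open_nbhs_nbhs. Qed.

Lemma derive_eq_on (U : set V) f g v a : open U -> U a ->
  (forall x, U x -> f x = g x) -> 'D_v f a = 'D_v g a.
Proof.
move=> oU Ua fg; apply: near_eq_derive; near=> x.
by apply: fg; near: x; exact: open_near.
Unshelve. all: by end_near. Qed.

Lemma differentiable_eq_on (U : set V) f g a : open U -> U a ->
  (forall x, U x -> f x = g x) -> differentiable f a -> differentiable g a.
Proof.
move=> oU Ua fg; apply: differentiable_near; near=> x.
by apply: fg; near: x; exact: open_near.
Unshelve. all: by end_near. Qed.

Lemma deriveZv f a k v : differentiable f a -> 'D_(k *: v) f a = k *: 'D_v f a.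
Proof. by move=> df; rewrite !deriveE // linearZ. Qed.

Lemma derive_sumv f a (I : finType) (P : pred I) (v : I -> V) :
  differentiable f a -> 'D_(\sum_(i | P i) v i) f a = \sum_(i | P i) 'D_(v i) f a.
Proof.
by move=> df; rewrite deriveE // linear_sum; apply: eq_bigr => i _; rewrite deriveE.
Qed.
End Differentials.

Section DiffMatrix.
Variable R : realType.

Lemma derive_comp (U V W : normedModType R) (f : U -> V) (g : V -> W) a v :
  differentiable f a -> differentiable g (f a) ->
  'D_v (fun x => g (f x)) a = 'D_('D_v f a) g (f a).
Proof.
move=> df dg; rewrite (_ : (fun _ => _) = g \o f) // deriveE; last exact: differentiable_comp.
by rewrite diff_comp //= !deriveE.
Qed.

Lemma differentiable_compo (U V W : normedModType R) (f : U -> V) (g : V -> W) a :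
  differentiable f a -> differentiable g (f a) ->
  differentiable (fun x => g (f x)) a.
Proof. by move=> df dg; exact: (differentiable_comp df dg). Qed.

Variable V : normedModType R.

Lemma differentiable_mxP p q (f : V -> 'M[R]_(p, q)) a :
  differentiable f a <-> forall i j, differentiable (fun x => f x i j) a.
Proof.
split=> [df i j|H].
  exact: (differentiable_comp df (differentiable_coord _ i j)).
have -> : f = \sum_(i < p) \sum_(j < q) (fun x => f x i j *: delta_mx i j).
  apply/funext => x; rewrite {1}[f x]matrix_sum_delta fct_sumE.
  by apply: eq_bigr => i _; rewrite fct_sumE.
apply: differentiable_sum => i; apply: differentiable_sum => j.
exact: differentiableZl.
Qed.

Lemma derive_mxE p q (f : V -> 'M[R]_(p, q)) a v i j : differentiable f a ->
  ('D_v f a) i j = 'D_v (fun x => f x i j) a.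
Proof. by move=> df; rewrite derive_mx ?mxE //; exact: diff_derivable. Qed.

Lemma rV_basis n (w : 'rV[R]_n) : w = \sum_(i < n) w 0 i *: basis_vec R i.
Proof. exact: row_sum_delta. Qed.

Lemma derive_rV n (W : normedModType R) (f : 'rV[R]_n -> W) a v :
  differentiable f a -> 'D_v f a = \sum_(i < n) v 0 i *: 'D_(basis_vec R i) f a.
Proof.
move=> df; rewrite {1}[v]rV_basis derive_sumv //.
by apply: eq_bigr => i _; rewrite deriveZv.
Qed.
End DiffMatrix.

(** * Functions of class C^n *)

(** The induction on n that smooth_on does not offer directly: closure properties are
proved class by class, and smooth_on is the intersection of all classes. *)
Definition Ck (R : realType) (V W : normedModType R) (n : nat) (U : set V)
    (f : V -> W) : Prop :=
  forall (vs : seq V) (a : V), (size vs <= n)%N -> U a ->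
    differentiable (foldr (fun v (g : V -> W) => 'D_v g) f vs) a.

Section Ck.
Variables (R : realType) (V : normedModType R) (U : set V).
Hypothesis oU : open U.
Variable W : normedModType R.
Implicit Types (f g : V -> W) (n : nat).

Lemma smooth_onCk f : smooth_on U f <-> forall n, Ck n U f.
Proof. by split=> [H n vs a _ /(H vs)//|H vs a /(H (size vs) vs)]; exact. Qed.

Lemma CkS n f : Ck n.+1 U f <->
  (forall a, U a -> differentiable f a) /\ forall v, Ck n U ('D_v f).
Proof.
split=> [H|[H0 H] vs].
  split=> [a|v vs a sz]; first exact: (H [::]).
  by have := H (rcons vs v) a; rewrite size_rcons ltnS foldr_rcons; exact.
case/lastP: vs => [|vs v] a; first by move=> _; exact: H0.
by rewrite size_rcons ltnS foldr_rcons; exact: H.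
Qed.

Lemma Ck_diff n f a : Ck n U f -> U a -> differentiable f a.
Proof. by move=> H; exact: (H [::]). Qed.

Lemma Ck_le n m f : (m <= n)%N -> Ck n U f -> Ck m U f.
Proof. by move=> mn H vs a s; apply: H; exact: leq_trans mn. Qed.

Lemma CkW n f : Ck n.+1 U f -> Ck n U f.
Proof. exact: Ck_le. Qed.

Lemma Ck_ext n f g : Ck n U f -> (forall x, U x -> f x = g x) -> Ck n U g.
Proof.
move=> + fg; elim: n f g fg => [|n IH] f g fg.
  by move=> H [|//] a _ Ua; apply: (differentiable_eq_on oU Ua fg); exact: (H [::]).
move=> /CkS [H0 H]; apply/CkS; split=> [a Ua|v].
  by apply: (differentiable_eq_on oU Ua fg); exact: H0.
by apply: (IH _ _ _ (H v)) => x Ux; apply: derive_eq_on oU Ux fg.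
Qed.

Lemma Ck0 f : Ck 0 U f <-> forall a, U a -> differentiable f a.
Proof. by split=> [H a|H [|//] a _]; [exact: (H [::])|exact: H]. Qed.

(** The induction step common to all closure properties: the derivative is
identified with an expression df that only involves maps of class C^n. *)
Lemma CkS_ext n f (df : V -> V -> W) :
  (forall a, U a -> differentiable f a) ->
  (forall v a, U a -> 'D_v f a = df v a) ->
  (forall v, Ck n U (df v)) -> Ck n.+1 U f.
Proof.
move=> d e H; apply/CkS; split=> // v.
by apply: (Ck_ext (H v)) => x Ux; rewrite e.
Qed.

Lemma Ck_cst n (c : W) : Ck n U (fun=> c).
Proof.
elim: n c => [|n IH] c; first by apply/Ck0 => a _; exact: differentiable_cst.
apply: (@CkS_ext _ _ (fun _ _ => 0)) => [a _|v a _|//]; first exact: differentiable_cst.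
exact: derive_cst.
Qed.

Lemma Ck_add n f g : Ck n U f -> Ck n U g -> Ck n U (fun x => f x + g x).
Proof.
elim: n f g => [|n IH] f g.
  by move=> /Ck0 df /Ck0 dg; apply/Ck0 => a Ua; apply: differentiableD; auto.
move=> /CkS [df Df] /CkS [dg Dg].
apply: (@CkS_ext _ _ (fun v x => 'D_v f x + 'D_v g x)) => [a Ua|v a Ua|v].
- by apply: differentiableD; auto.
- by apply: deriveD; apply: diff_derivable; auto.
- exact: IH.
Qed.

Lemma Ck_sum n (I : Type) (r : seq I) (P : pred I) (f : I -> V -> W) :
  (forall i, P i -> Ck n U (f i)) -> Ck n U (fun x => \sum_(i <- r | P i) f i x).
Proof.
move=> H; elim: r => [|i r IH].
  by apply: (Ck_ext (Ck_cst (n:=n) (0 : W))) => x _; rewrite big_nil.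
case Pi : (P i).
  by apply: (Ck_ext (Ck_add (H i Pi) IH)) => x _; rewrite big_cons Pi.
by apply: (Ck_ext IH) => x _; rewrite big_cons Pi.
Qed.

End Ck.

Section CkScalar.
Variables (R : realType) (V : normedModType R) (U : set V).
Hypothesis oU : open U.
Implicit Types (f g : V -> R) (n : nat).

Lemma Ck_mul n f g : Ck n U f -> Ck n U g -> Ck n U (fun x => f x * g x).
Proof.
elim: n f g => [|n IH] f g.
  by move=> /Ck0 df /Ck0 dg; apply/Ck0 => a Ua; apply: differentiableM; auto.
move=> Cf Cg; have /CkS [df Df] := Cf; have /CkS [dg Dg] := Cg.
apply: (@CkS_ext _ _ _ oU _ _ _ (fun v x => f x * 'D_v g x + g x * 'D_v f x)) => [a Ua|v a Ua|v].
- by apply: differentiableM; auto.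
- by apply: deriveM; apply: diff_derivable; auto.
- by apply: Ck_add => //; apply: IH => //; exact: CkW.
Qed.

Lemma Ck_opp n f : Ck n U f -> Ck n U (fun x => - f x).
Proof.
move=> Cf; apply: (Ck_ext oU (Ck_mul (Ck_cst oU (n:=n) (-1 : R)) Cf)) => x _.
by rewrite mulN1r.
Qed.

Lemma Ck_prod n (I : Type) (r : seq I) (P : pred I) (f : I -> V -> R) :
  (forall i, P i -> Ck n U (f i)) -> Ck n U (fun x => \prod_(i <- r | P i) f i x).
Proof.
move=> H; elim: r => [|i r IH].
  by apply: (Ck_ext oU (Ck_cst oU (n:=n) (1 : R))) => x _; rewrite big_nil.
case Pi : (P i).
  by apply: (Ck_ext oU (Ck_mul (H i Pi) IH)) => x _; rewrite big_cons Pi.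
by apply: (Ck_ext oU IH) => x _; rewrite big_cons Pi.
Qed.

Lemma Ck_inv n f : (forall x, U x -> f x != 0) -> Ck n U f ->
  Ck n U (fun x => (f x)^-1).
Proof.
move=> f0; elim: n => [|n IH].
  by move=> /Ck0 df; apply/Ck0 => a Ua; apply: differentiableV; auto.
move=> Cf; have /CkS [df Df] := Cf; have CI := IH (CkW Cf).
apply: (@CkS_ext _ _ _ oU _ _ _ (fun v x => - ((f x)^-1 * (f x)^-1 * 'D_v f x))) => [a Ua|v a Ua|v].
- by apply: differentiableV; auto.
- rewrite deriveV; [|auto|by apply: diff_derivable; auto].
  by rewrite -exprVn expr2 scaleNr.
- by apply: Ck_opp; apply: Ck_mul => //; exact: Ck_mul.
Qed.

Lemma Ck_sqrt n f : (forall x, U x -> 0 < f x) -> Ck n U f ->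
  Ck n U (fun x => Num.sqrt (f x)).
Proof.
move=> f0.
have ds (x : R) : 0 < x -> differentiable (@Num.sqrt R : R -> R) x.
  by move=> x0; apply/derivable1_diffP; have [] := is_derive1_sqrt x0.
elim: n => [|n IH].
  move=> /Ck0 df; apply/Ck0 => a Ua.
  by apply: (differentiable_comp (df a Ua)); apply: ds; auto.
move=> Cf; have /CkS [df Df] := Cf; have CI := IH (CkW Cf).
apply: (@CkS_ext _ _ _ oU _ _ _ (fun v x => 'D_v f x * (2 * Num.sqrt (f x))^-1)) => [a Ua|v a Ua|v].
- by apply: (differentiable_comp (df a Ua)); apply: ds; auto.
- rewrite (@derive_comp R _ _ _ f) //; [|auto|by apply: ds; auto].
  rewrite -[X in 'D_X _ _]mulr1 deriveZv; last by apply: ds; auto.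
  by rewrite derive_sqrt; auto.
- apply: Ck_mul => //; apply: Ck_inv => [x Ux|].
    by rewrite mulf_neq0 // ?pnatr_eq0 // lt0r_neq0 // sqrtr_gt0; auto.
  by apply: Ck_mul => //; exact: Ck_cst.
Qed.

End CkScalar.

Section CkMatrix.
Variables (R : realType) (V : normedModType R) (U : set V).
Hypothesis oU : open U.

Lemma Ck_mxP n p q (f : V -> 'M[R]_(p, q)) :
  Ck n U f <-> forall i j, Ck n U (fun x => f x i j).
Proof.
elim: n f => [|n IH] f.
  split=> [/Ck0 H i j|H]; apply/Ck0 => a Ua.
    by have /differentiable_mxP := H a Ua; apply.
  by apply/differentiable_mxP => i j; have /Ck0 := H i j; apply.
split=> [/CkS [H0 H] i j|H].
- apply: (@CkS_ext _ _ _ oU _ _ _ (fun v x => 'D_v f x i j)) => [a Ua|v a Ua|v].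
  + by have /differentiable_mxP := H0 a Ua; apply.
  + by rewrite derive_mxE; auto.
  + by have /IH := H v; apply.
- have H0 a : U a -> differentiable f a.
    by move=> Ua; apply/differentiable_mxP => i j; apply: Ck_diff (H i j) Ua.
  apply/CkS; split=> // v; apply/IH => i j.
  have /CkS [_ /(_ v) Hv] := H i j; apply: (Ck_ext oU Hv) => x Ux.
  by rewrite derive_mxE; auto.
Qed.

Lemma Ck_mulmx n p q r (f : V -> 'M[R]_(p, q)) (g : V -> 'M[R]_(q, r)) :
  Ck n U f -> Ck n U g -> Ck n U (fun x => f x *m g x).
Proof.
move=> /Ck_mxP Cf /Ck_mxP Cg; apply/Ck_mxP => i j.
apply: (Ck_ext oU (f := fun x => \sum_k f x i k * g x k j)) => [|x _]; last by rewrite mxE.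
by apply: Ck_sum => // k _; exact: Ck_mul.
Qed.

Lemma Ck_det n p (f : V -> 'M[R]_p) : Ck n U f -> Ck n U (fun x => \det (f x)).
Proof.
move=> /Ck_mxP Cf; apply: Ck_sum => // s _; apply: Ck_mul => //; first exact: Ck_cst.
by apply: Ck_prod => // i _; exact: Cf.
Qed.

(** Cramer's rule reduces inversion to determinants and one scalar inverse. *)
Lemma Ck_invmx n p (f : V -> 'M[R]_p) : (forall x, U x -> f x \in unitmx) ->
  Ck n U f -> Ck n U (fun x => invmx (f x)).
Proof.
move=> f0 Cf; apply/Ck_mxP => i j.
apply: (Ck_ext oU (f := fun x => (\det (f x))^-1 * cofactor (f x) j i)) => [|x Ux]; last by rewrite /invmx f0 // !mxE.
apply: Ck_mul => //.
  apply: Ck_inv => // [x Ux|]; last exact: Ck_det.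
  by have := f0 x Ux; rewrite unitmxE unitfE.
apply: Ck_mul => //; first exact: Ck_cst.
apply: Ck_det; apply/Ck_mxP => k l; have /Ck_mxP := Cf.
by move=> /(_ (lift j k) (lift i l)) H; apply: (Ck_ext oU H) => x _; rewrite !mxE.
Qed.

(** By the chain rule the derivative is a sum of products of coordinates of f' and of
partial derivatives of g along f, so that the induction stays within scalar g. *)
Lemma Ck_comp_scalar n p (f : V -> 'rV[R]_p) (U' : set 'rV[R]_p)
    (g : 'rV[R]_p -> R) : open U' -> (forall x, U x -> U' (f x)) ->
  Ck n U f -> Ck n U' g -> Ck n U (fun x => g (f x)).
Proof.
move=> oU' UU'; elim: n g => [|n IH] g.
  move=> /Ck0 df /Ck0 dg; apply/Ck0 => a Ua.
  by apply: (differentiable_comp (df a Ua)); apply: dg; auto.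
move=> Cf Cg; have /CkS [df Df] := Cf; have /CkS [dg Dg] := Cg.
have d a : U a -> differentiable (fun x => g (f x)) a.
  by move=> Ua; apply: (differentiable_comp (df a Ua)); auto.
apply/CkS; split=> // v.
apply: (Ck_ext oU (f := fun x => \sum_i ('D_v f x) 0 i *: 'D_(basis_vec R i) g (f x))); last first.
  move=> x Ux; have dgx := dg _ (UU' _ Ux).
  by rewrite (derive_comp v (df x Ux) dgx) -derive_rV.
apply: Ck_sum => // i _; apply: Ck_mul => //.
  by have /Ck_mxP := Df v; apply.
exact: (IH _ (CkW Cf) (Dg _)).
Qed.

End CkMatrix.

Section CkComp.
Variables (R : realType) (V : normedModType R) (U : set V).
Hypothesis oU : open U.

Lemma Ck_comp n p q r (f : V -> 'rV[R]_p) (U' : set 'rV[R]_p)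
    (g : 'rV[R]_p -> 'M[R]_(q, r)) : open U' -> (forall x, U x -> U' (f x)) ->
  Ck n U f -> Ck n U' g -> Ck n U (fun x => g (f x)).
Proof.
move=> oU' UU' Cf /(Ck_mxP oU') Cg; apply/(Ck_mxP oU) => i j.
exact: (Ck_comp_scalar oU oU' UU' Cf (Cg i j)).
Qed.

End CkComp.

Lemma nrmZ (R : realType) (V : normedModType R) (k : R) (v : V) :
  `|k *: v| = `|k| * `|v|.
Proof. exact: normrZ. Qed.

Lemma nbhsI (T : topologicalType) (a : T) (A B : set T) :
  nbhs a A -> nbhs a B -> nbhs a (A `&` B).
Proof. exact: filterI. Qed.

Lemma mixed_cancel (R : realType) (k p q r s X Y : R) : k != 0 ->
  p - q - (r - s) = k * (k * X) -> p - r - (q - s) = k * (k * Y) -> X = Y.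
Proof. by move=> k0 h1 h2; apply: (mulfI k0); apply: (mulfI k0); rewrite -h1 -h2; ring. Qed.

Lemma dist_lt_half (R : realType) (x y z e : R) :
  `|x - z| < e / 2 -> `|y - z| < e / 2 -> `|x - y| < e.
Proof. by rewrite [`|y - z|]distrC => h1 h2; apply: le_lt_trans (ler_distD z x y) _; lra. Qed.

(** * Mean value theorem and symmetry of second derivatives *)

Section MeanValue.
Variables (R : realType) (V : normedModType R).

Lemma continuous_near_lt (W : normedModType R) (g : V -> W) a e :
  {for a, continuous g} -> 0 < e -> nbhs a [set x | `|g a - g x| < e].
Proof. by move=> cg e0; exact: (cvgrPdist_lt _ _).1 cg _ e0. Qed.

Lemma is_derive_line (W : normedModType R) (f : V -> W) a d t :
  differentiable f (a + t *: d) ->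
  is_derive (t : R) 1 (fun s : R => f (a + s *: d)) ('D_d f (a + t *: d)).
Proof.
move=> df.
have Ha : is_diff (t : R) (fun s : R => a + s *: d) (0 + *:%R ^~ d).
  exact: (@is_diffD _ _ _ (cst a) (fun s : R => s *: d)).
have dl : differentiable (fun s : R => a + s *: d) t by exact: ex_diff.
have dc : differentiable (fun s : R => f (a + s *: d)) t.
  exact: (differentiable_comp (f := fun s : R => a + s *: d)).
apply: DeriveDef; first exact: diff_derivable.
rewrite (derive_comp (f := fun s : R => a + s *: d)) // [in 'D_1 _ t]deriveE //.
by rewrite (diff_val (is_diff_def := Ha)) /= add0r scale1r.
Qed.

(** The mean value theorem along the segment from a to a + d. *)
Lemma MVT_line (f : V -> R) a d :
  (forall t : R, 0 <= t <= 1 -> differentiable f (a + t *: d)) ->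
  exists t : R, 0 < t < 1 /\ f (a + d) - f a = 'D_d f (a + t *: d).
Proof.
move=> H; pose g := fun s : R => f (a + s *: d).
have D (t : R) : 0 <= t <= 1 -> is_derive t 1 g ('D_d f (a + t *: d)).
  by move=> t01; apply: is_derive_line; exact: H.
have [|||c c01] := @MVT R g (fun t => 'D_d f (a + t *: d)) 0 1.
- exact: ltr01.
- by move=> t /[!in_itv] /= /andP[t0 t1]; apply: D; rewrite !ltW.
- apply: continuous_in_subspaceT => t; rewrite inE /= in_itv /= => t01.
  by apply: differentiable_continuous; apply/derivable1_diffP; have [] := D t t01.
rewrite /g scale1r scale0r addr0 subr0 mulr1 => E.
by exists c; split=> //; move: c01; rewrite in_itv.
Qed.

(** The second difference of f is symmetric in v and w while the mean value theorem,
used twice, writes it as a mixed derivative in a chosen order; this is what makes the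
order irrelevant in the limit. *)
Lemma second_difference (f : V -> R) a v w :
  (forall s t : R, 0 <= s <= 1 -> 0 <= t <= 1 ->
     differentiable f (a + s *: v + t *: w) /\
     differentiable ('D_v f) (a + s *: v + t *: w)) ->
  exists s t : R, [/\ 0 < s < 1, 0 < t < 1 &
    f (a + v + w) - f (a + v) - (f (a + w) - f a) =
      'D_w ('D_v f) (a + s *: v + t *: w)].
Proof.
move=> H; pose g := fun x => f (x + w) - f x.
have H0 (s : R) : 0 <= s <= 1 -> differentiable f (a + s *: v).
  by move=> s01; have := (H s 0 s01 _).1; rewrite scale0r addr0; apply; rewrite lexx ler01.
have H1 (s : R) : 0 <= s <= 1 -> differentiable f (a + s *: v + w).
  by move=> s01; have := (H s 1 s01 _).1; rewrite scale1r; apply; rewrite lexx ler01.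
have sh x : is_diff x (fun y : V => y + w) (id + 0).
  by apply: (@is_diffD _ _ _ id (cst w)).
have dsh x : differentiable (fun y : V => y + w) x by apply: ex_diff.
have dg (s : R) : 0 <= s <= 1 -> differentiable (fun y => f (y + w)) (a + s *: v).
  by move=> s01; apply: (differentiable_comp (f := fun y : V => y + w)) => //; exact: H1.
have Dg (s : R) : 0 <= s <= 1 -> 'D_v g (a + s *: v) = 'D_v f (a + s *: v + w) - 'D_v f (a + s *: v).
  move=> s01; rewrite deriveB; try by apply: diff_derivable; auto.
  rewrite (derive_comp v (dsh _) (H1 _ s01)) (deriveE v (dsh _)).
  by rewrite (diff_val (is_diff_def := sh _)) /= addr0.
have [|s [s01 Es]] := @MVT_line g a v.
  by move=> t t01; apply: differentiableB; auto.
have s01' : 0 <= s <= 1 by case/andP: s01 => ? ?; rewrite !ltW.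
have [|t [t01 Et]] := @MVT_line ('D_v f) (a + s *: v) w.
  by move=> t t01; exact: (H _ _ s01' t01).2.
by exists s, t; split=> //; rewrite -Et -Dg // -Es.
Qed.

Lemma derive_swap (U : set V) (f : V -> R) a v w : open U -> Ck 3 U f -> U a ->
  'D_v ('D_w f) a = 'D_w ('D_v f) a.
Proof.
move=> oU Cf Ua.
have /CkS [df Df] := Cf.
have D1 u x : U x -> differentiable ('D_u f) x by move=> Ux; exact: Ck_diff (Df u) Ux.
have c2 u u' : {for a, continuous ('D_u ('D_u' f))}.
  apply: differentiable_continuous.
  by have /CkS [_ /(_ u) /Ck_diff] := Df u'; apply.
apply/eqP; rewrite -subr_eq0; apply/negPn/negP => ne0.
pose e := `|'D_v ('D_w f) a - 'D_w ('D_v f) a|.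
have e0 : 0 < e by rewrite normr_gt0.
have e2 : 0 < e / 2 by rewrite divr_gt0.
have A2 := continuous_near_lt (c2 v w) e2.
have A3 := continuous_near_lt (c2 w v) e2.
have := nbhsI (open_near oU Ua) (nbhsI A2 A3).
move=> /nbhs_ballP [r /= r0 Hr].
have [k kE] : exists k, k = r / (`|v| + `|w| + 1) by eexists.
have N0 : 0 < `|v| + `|w| + 1 by rewrite ltr_wpDl ?addr_ge0 ?ltr01.
have k0 : 0 < k by rewrite kE divr_gt0.
have inb (s t : R) : 0 <= s <= 1 -> 0 <= t <= 1 -> ball a r (a + s *: (k *: v) + t *: (k *: w)).
  move=> /andP[s0 s1] /andP[t0 t1]; rewrite -ball_normE /= -addrA opprD addrA subrr sub0r normrN.
  apply: (le_lt_trans (ler_normD _ _)); rewrite !nrmZ (ger0_norm s0) (ger0_norm t0) (gtr0_norm k0).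
  apply: (@le_lt_trans _ _ (k * `|v| + k * `|w|)).
    by apply: lerD; rewrite ler_piMl // mulr_ge0 // ltW.
  by rewrite -mulrDr kE -mulrA gtr_pMr // mulrC ltr_pdivrMr // mul1r ltrDl.
have Q (u1 u2 P : V) : P = a + k *: u1 + k *: u2 -> (forall s t : R, 0 <= s <= 1 -> 0 <= t <= 1 -> ball a r (a + s *: (k *: u1) + t *: (k *: u2))) ->
  exists x, ball a r x /\ f P - f (a + k *: u1) - (f (a + k *: u2) - f a)
    = k * (k * 'D_u2 ('D_u1 f) x).
  move=> -> B; have [|s [t [s01 t01 ->]]] := @second_difference f a (k *: u1) (k *: u2).
    by move=> s t s01 t01; have [Ux _] := Hr _ (B s t s01 t01); split; [exact: df|exact: D1].
  set x := (X in 'D_ _ _ X).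
  have bx : ball a r x by apply: B; [case/andP: s01|case/andP: t01] => ? ?; rewrite !ltW.
  have [Ux _] := Hr _ bx; exists x; split=> //.
  rewrite deriveZv; last exact: D1.
  congr (_ * _).
  rewrite (@derive_eq_on _ _ _ U _ (k *: 'D_u1 f)) //; last first.
    by move=> y Uy; rewrite deriveZv //; exact: df.
  by rewrite deriveZ //; apply: diff_derivable; exact: D1.
have [x [bx Ex]] := Q v w _ erefl inb.
have [|y [By Ey]] := Q w v (a + k *: v + k *: w) (addrAC _ _ _).
  by move=> s t s01 t01; rewrite addrAC; exact: inb.
have E := mixed_cancel (lt0r_neq0 k0) Ex Ey.
have [_ [_ hx]] := Hr _ bx; have [_ [hy _]] := Hr _ By.
move: hx hy; rewrite /= E => hx hy.
by have := dist_lt_half hy hx; rewrite ltxx.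
Qed.

End MeanValue.

(** * The inverse function theorem *)

Lemma continuous_eps (R : realType) (V W : normedModType R) (f : V -> W) a :
  (forall e, 0 < e -> exists2 d, 0 < d &
     forall x, `|a - x| < d -> `|f a - f x| < e) -> {for a, continuous f}.
Proof.
move=> H; apply/cvgrPdist_lt => e e0; have [d d0 Hd] := H e e0.
by apply/nbhs_ballP; exists d => //= x; rewrite -ball_normE /=; exact: Hd.
Qed.

Lemma nrm_addle (R : realType) (V : normedModType R) (x y : V) (a b c : R) :
  `|x| <= a -> `|y| <= b -> a + b <= c -> `|x + y| <= c.
Proof. by move=> xa yb; apply: le_trans; apply: (le_trans (ler_normD _ _)); exact: lerD. Qed.

Lemma expanding_of_contraction (R : realType) (V : normedModType R) (u w : V) :
  `|u - w| <= 2^-1 * `|u| -> `|u| <= 2 * `|w|.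
Proof.
have : `|u| <= `|u - w| + `|w| by rewrite -{1}(subrK w u); exact: ler_normD.
by lra.
Qed.

Lemma nbhs_finite_forall (T : topologicalType) (I : finType) (a : T) (P : I -> set T) :
  (forall i, nbhs a (P i)) -> nbhs a [set x | forall i, P i x].
Proof. by move=> H; apply: filter_forall. Qed.

Lemma mxsubE (Z : zmodType) p q (A B : 'M[Z]_(p, q)) i j :
  (A - B) i j = A i j - B i j.
Proof. by rewrite !mxE. Qed.

Section MatrixNorm.
Variable R : realType.

Lemma mx_coord_le p q (M : 'M[R]_(p, q)) i j : `|M i j| <= `|M|.
Proof. by rewrite [leRHS]/Num.Def.normr /= mx_normrE; exact: (le_bigmax _ _ (i, j)). Qed.

Lemma mx_norm_le p q (M : 'M[R]_(p, q)) c : 0 <= c ->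
  (forall i j, `|M i j| <= c) -> `|M| <= c.
Proof.
move=> c0 H; rewrite [leLHS]/Num.Def.normr /= mx_normrE.
by apply: bigmax_le => //= ij _; exact: H.
Qed.

Lemma mulmx_norm_le p q (v : 'rV[R]_p) (M : 'M[R]_(p, q)) c : 0 <= c ->
  (forall i j, `|M i j| <= c) -> `|v *m M| <= p%:R * c * `|v|.
Proof.
move=> c0 H; have n0 : 0 <= p%:R * c * `|v| by rewrite !mulr_ge0.
apply: mx_norm_le => // i j; rewrite mxE.
apply: (le_trans (ler_norm_sum _ _ _)).
rewrite -mulrA mulr_natl -[X in _ *+ X]card_ord -sumr_const.
apply: ler_sum => k _; rewrite normrM mulrC; apply: ler_pM => //.
by rewrite ord1; exact: mx_coord_le.
Qed.

Lemma mulmx_bound p q (M : 'M[R]_(p, q)) :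
  exists2 K, 0 < K & forall v : 'rV[R]_p, `|v *m M| <= K * `|v|.
Proof.
exists (p%:R * `|M| + 1) => [|v]; first by rewrite ltr_wpDl // mulr_ge0.
apply: (le_trans (mulmx_norm_le v (normr_ge0 M) (mx_coord_le M))).
by rewrite ler_wpM2r // lerDl.
Qed.

Lemma mulmxr_continuous p q (M : 'M[R]_(p, q)) :
  continuous (fun v : 'rV[R]_p => v *m M).
Proof.
move=> v; apply: continuous_eps => e e0; have [K K0 HK] := mulmx_bound M.
exists (e / K); first by rewrite divr_gt0.
move=> w wv; rewrite -mulmxBl.
by apply: (le_lt_trans (HK _)); rewrite mulrC -ltr_pdivlMr.
Qed.

Lemma diff_mulmxr p q (M : 'M[R]_(p, q)) a v :
  differentiable (fun w : 'rV[R]_p => w *m M) a /\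
  'D_v (fun w : 'rV[R]_p => w *m M) a = v *m M.
Proof.
have c := @mulmxr_continuous p q M.
have d : differentiable (fun w : 'rV[R]_p => w *m M) a.
  exact: (linear_differentiable (f := mulmxr M)).
split=> //; rewrite deriveE // (_ : (fun _ => _) = mulmxr M) // diff_lin //.
Qed.

(** Row convention: the differential is v |-> v *m Jac f x. *)
Definition Jac n q (f : 'rV[R]_n -> 'rV[R]_q) (x : 'rV[R]_n) : 'M[R]_(n, q) :=
  \matrix_(i, j) ('D_(basis_vec R i) f x) 0 j.

Lemma derive_Jac n q (f : 'rV[R]_n -> 'rV[R]_q) x v :
  differentiable f x -> 'D_v f x = v *m Jac f x.
Proof.
move=> df; rewrite derive_rV //; apply/rowP => j; rewrite summxE !mxE.
by apply: eq_bigr => i _; rewrite !mxE.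
Qed.

Lemma Jac_unit n (f : 'rV[R]_n -> 'rV[R]_n) x : differentiable f x ->
  (forall v, 'D_v f x = 0 -> v = 0) -> Jac f x \in unitmx.
Proof.
move=> df inj; rewrite -row_free_unit -kermx_eq0; apply/eqP/row_matrixP => i.
rewrite row0; apply: inj; rewrite derive_Jac // -row_mul.
by rewrite mulmx_ker row0.
Qed.
End MatrixNorm.

Lemma continuous_dist (R : realType) (V : normedModType R) (T : V -> V) (x : V) :
  {for x, continuous T} -> {for x, continuous (fun z : V => `|z - T z| : R)}.
Proof.
move=> cT; apply: continuous_eps => e e0.
have e2 : 0 < e / 2 by rewrite divr_gt0.
have /nbhs_ballP [d /= d0 Hd] := continuous_near_lt cT e2.
exists (Num.min d (e / 2)); first by rewrite lt_min d0.
move=> z; rewrite lt_min => /andP[zd ze].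
have := Hd z; rewrite -ball_normE /= => /(_ zd) TT.
apply: (@le_lt_trans _ _ (`|x - z| + `|T x - T z|)); last by lra.
apply: (le_trans (ler_dist_dist _ _)); rewrite opprD addrACA -opprD.
exact: ler_normB.
Qed.

(** On a compact ball the continuous function |x - T x| attains its minimum, and a
contraction would decrease a nonzero minimum. *)
Lemma contraction_fixpoint (R : realType) n (T : 'rV[R]_n -> 'rV[R]_n) a (r : R) :
  0 < r -> let K := [set x : 'rV[R]_n | `|a - x| <= r] in
  (forall x, K x -> K (T x)) ->
  (forall x y, K x -> K y -> `|T x - T y| <= 2^-1 * `|x - y|) ->
  (forall x, K x -> {for x, continuous T}) ->
  exists2 x, K x & T x = x.
Proof.
move=> r0 K TK TC Tc.
have K0 : K !=set0 by exists a; rewrite /K /= subrr normr0 ltW.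
have KE : K = closed_ball a r by rewrite closed_ballE.
have cK : compact K.
  apply: bounded_closed_compact; last by rewrite KE; exact: closed_ball_closed.
  exists (`|a| + r); split=> [|M HM x Kx]; first exact: num_real.
  apply/ltW/le_lt_trans/HM; rewrite -(subKr a x).
  by apply: nrm_addle (lexx _) _ _; rewrite ?normrN; [exact: Kx|].
have wc : {within K, continuous (fun x : 'rV[R]_n => `|x - T x| : R)}.
  by apply: continuous_in_subspaceT => x; rewrite inE => Kx; exact: continuous_dist (Tc _ Kx).
have [c cK' Hc] := EVT_min_rV K0 cK wc.
rewrite inE in cK'; exists c; first exact: cK'.
have := Hc (T c); rewrite inE => /(_ (TK _ cK')).
have := TC c (T c) cK' (TK _ cK').
move: (normr_ge0 (c - T c)) => h1 h2 /le_trans /(_ h2) h3.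
apply/esym/eqP; rewrite -subr_eq0 -normr_le0; move: h1 h3.
by set q := `|_|; clearbody q; lra.
Qed.

Section InverseFunction.
Variables (R : realType) (n : nat) (U : set 'rV[R]_n).
Variables (f : 'rV[R]_n -> 'rV[R]_n) (a : 'rV[R]_n).
Hypotheses (oU : open U) (Ua : U a) (fs : smooth_on U f).
Hypothesis inj : forall v, 'D_v f a = 0 -> v = 0.

Let J x := Jac f x.
Let L := invmx (J a).
Let phi x := x - f x *m L.

Let fC k : Ck k U f. Proof. by have /smooth_onCk := fs; apply. Qed.
Let df x : U x -> differentiable f x. Proof. by move=> Ux; exact: Ck_diff (@fC 0%N) Ux. Qed.

Let Ja : J a \in unitmx. Proof. by apply: Jac_unit inj; exact: df. Qed.

Let JC k : Ck k U J.
Proof.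
apply/(Ck_mxP oU) => i j; have /CkS [_ /(_ (basis_vec R i))] := @fC k.+1.
by move=> /(Ck_mxP oU) /(_ 0 j) H; apply: (Ck_ext oU H) => x _; rewrite mxE.
Qed.

Let dphi x v : U x -> differentiable phi x /\ 'D_v phi x = v *m (1%:M - J x *m L).
Proof.
move=> Ux; have dfx := df Ux; have [dL DL] := diff_mulmxr L (f x) ('D_v f x).
have dc : differentiable (fun y => f y *m L) x by exact: differentiable_compo dfx dL.
have di : differentiable (id : 'rV[R]_n -> 'rV[R]_n) x by apply: ex_diff.
split; first exact: differentiableB.
rewrite deriveB; [|exact: diff_derivable..].
by rewrite derive_id (derive_comp v dfx dL) DL derive_Jac // mulmxBr mulmx1 mulmxA.
Qed.

(* phi x = x - f x L has derivative 0 at a, hence is a contraction near a. *)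
Let contr : exists r, [/\ 0 < r, ball a r `<=` U,
  forall x, ball a r x -> J x \in unitmx &
  forall x y, ball a r x -> ball a r y -> `|phi x - phi y| <= 2^-1 * `|x - y|].
Proof.
pose d : R := (n.+1%:R * 2)^-1.
have d0 : 0 < d by rewrite invr_gt0 mulr_gt0.
have nd : n%:R * d <= 2^-1.
  rewrite /d invfM mulrA ler_piMl // ler_pdivrMr // mul1r ler_nat //.
have H : nbhs a [set x | forall i j, `|(1%:M - J x *m L) i j| < d].
  apply: nbhs_finite_forall => i; apply: nbhs_finite_forall => j.
  have c : {for a, continuous (fun x => (J x *m L) i j)}.
    apply: differentiable_continuous.
    have : Ck 0 U (fun x => J x *m L) by apply: (Ck_mulmx oU); [exact: JC|exact: Ck_cst].
    by move=> /(Ck_mxP oU) /(_ i j) /Ck_diff; apply.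
  apply: filterS (continuous_near_lt c d0) => x /=.
  by rewrite -(mxsubE (J a *m L) (J x *m L)) (mulmxV Ja).
have /nbhs_ballP [r /= r0 Hr] := nbhsI (open_near oU Ua) H.
exists r; split; [exact: r0|by move=> x /Hr[]|move=> x /Hr [Ux Hx]|move=> x y bx By].
  apply: Jac_unit => [|v v0]; first exact: df.
  have := mulmx_norm_le v (ltW d0) (fun i j => ltW (Hx i j)).
  rewrite mulmxBr mulmx1 mulmxA -derive_Jac ?v0; last exact: df.
  rewrite mul0mx subr0 => le; apply/eqP; rewrite -normr_le0.
  have := ler_wpM2r (normr_ge0 v) nd; move: le (normr_ge0 v); lra.
have seg (t : R) : 0 <= t <= 1 -> ball a r (y + t *: (x - y)).
  move=> /andP[t0 t1]; move: bx By; rewrite -!ball_normE /= => bx By.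
  rewrite (_ : a - _ = t *: (a - x) + (1 - t) *: (a - y)); last first.
    by rewrite !scalerBr !scalerBl !scale1r; apply/rowP => k; rewrite !mxE; ring.
  have t1' : 0 <= 1 - t by rewrite subr_ge0.
  apply: (le_lt_trans (ler_normD _ _)); rewrite !nrmZ (ger0_norm t0) (ger0_norm t1').
  have [->|tn0] := eqVneq t 0; first by rewrite mul0r add0r subr0 mul1r.
  rewrite [ltRHS](_ : r = t * r + (1 - t) * r); last by ring.
  apply: ltr_leD; first by rewrite ltr_pM2l // lt_neqAle eq_sym tn0.
  by apply: ler_wpM2l => //; exact: ltW.
apply: mx_norm_le => [|i k]; first by rewrite mulr_ge0 // invr_ge0.
rewrite ord1.
have dk (t : R) : 0 <= t <= 1 -> differentiable (fun z => phi z 0 k) (y + t *: (x - y)).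
  move=> t01; have [Uz _] := Hr _ (seg t t01).
  by have [/differentiable_mxP h _] := dphi 0 Uz; exact: h.
have [t [t01]] := MVT_line dk.
have t01' : 0 <= t <= 1 by case/andP: t01 => ? ?; rewrite !ltW.
have [Uz Hz] := Hr _ (seg t t01').
have [dz Dz] := dphi (x - y) Uz.
rewrite -derive_mxE // Dz (addrC y) subrK -mxsubE => ->.
have le := mulmx_norm_le (x - y) (ltW d0) (fun i j => ltW (Hz i j)).
apply: (le_trans (mx_coord_le _ _ _)); apply: (le_trans le).
by rewrite ler_wpM2r.
Qed.

(** To solve f x = y means to find a fixed point of x - f x L + y L, L being the inverse
of the Jacobian at a: a contraction of a small ball. The inverse h is Lipschitz, hence
differentiable with differential the inverse Jacobian at h y, and that formula gives
its smoothness class by class. *)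
Theorem inverse_function : exists (U' V' : set 'rV[R]_n) (h : 'rV[R]_n -> 'rV[R]_n),
  [/\ [/\ open U', U' a & U' `<=` U], open V' /\ V' = f @` U',
      forall x, U' x -> h (f x) = x, smooth_on V' h &
      forall y, V' y -> U' (h y) /\ f (h y) = y].
Proof.
have [r [r0 rU Ju C]] := contr.
have lip x y : ball a r x -> ball a r y -> `|x - y| <= 2 * `|f x *m L - f y *m L|.
  move=> bx By; have := C x y bx By.
  rewrite (_ : phi x - phi y = (x - y) - (f x *m L - f y *m L)); last first.
    by rewrite /phi; move: (f x *m L) (f y *m L) => p q; apply/rowP => k; rewrite !mxE; ring.
  exact: expanding_of_contraction.
pose g x := f x *m L.
have gc x : U x -> {for x, continuous g}.
  move=> Ux; apply: differentiable_continuous.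
  exact: differentiable_compo (df Ux) (diff_mulmxr L (f x) 0).1.
pose U' := [set x | ball a r x /\ `|g a - g x| < r / 4].
have oU' : open U'.
  rewrite openE => x [bx gx]; rewrite /interior.
  have e0 : 0 < r / 4 - `|g a - g x| by rewrite subr_gt0.
  have ob : open (ball a r) by exact: ball_open.
  apply: filterS (nbhsI (open_near ob bx) (continuous_near_lt (gc x (rU _ bx)) e0)).
  move=> y [By /= gy]; split=> //; apply: le_lt_trans (ler_distD (g x) _ _) _.
  by rewrite -ltrBrDl.
pose V' := [set y : 'rV[R]_n | `|g a - y *m L| < r / 4].
have oV' : open V'.
  rewrite openE => y Vy; rewrite /interior.
  have e0 : 0 < r / 4 - `|g a - y *m L| by rewrite subr_gt0.
  have cL : {for y, continuous (fun w : 'rV[R]_n => w *m L)} by exact: mulmxr_continuous.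
  apply: filterS (continuous_near_lt cL e0).
  move=> z /= gz; rewrite /V' /=; apply: le_lt_trans (ler_distD (y *m L) _ _) _.
  by rewrite -ltrBrDl.
have U'a : U' a by split; [exact: ballxx|rewrite subrr normr0 divr_gt0].
have V'E : V' = f @` U'.
  apply/seteqP; split=> [y Vy|_ [x [bx gx] <-] //].
  have [x bx gx] : exists2 x, ball a r x & g x = y *m L.
    pose K := [set x : 'rV[R]_n | `|a - x| <= r / 2].
    have Kr x : K x -> ball a r x.
      by rewrite -ball_normE /= => /le_lt_trans; apply; rewrite ltr_pdivrMr // mulr_natr mulr2n ltrDl.
    pose T x := phi x + y *m L.
    have TK x : K x -> K (T x).
      move=> Kx; rewrite /K /= (_ : a - T x = phi a - phi x + (g a - y *m L)); last first.
        by rewrite /T /phi /g opprD !addrA; congr (_ - _); rewrite addrAC subrK.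
      apply: nrm_addle (C a x (ballxx a r0) (Kr _ Kx)) (ltW Vy) _.
      by move: Kx; rewrite /K /=; lra.
    have Tc x : K x -> {for x, continuous T}.
      move=> Kx; have [dp _] := dphi 0 (rU _ (Kr _ Kx)).
      apply: differentiable_continuous; apply: (differentiableD dp).
      exact: differentiable_cst.
    have TC x z : K x -> K z -> `|T x - T z| <= 2^-1 * `|x - z|.
      move=> Kx Kz; have -> : T x - T z = phi x - phi z by rewrite /T opprD addrACA subrr addr0.
      exact: C (Kr _ Kx) (Kr _ Kz).
    have [x Kx xE] := contraction_fixpoint (divr_gt0 r0 (ltr0Sn _ 1)) TK TC Tc.
    exists x; first exact: Kr.
    move: xE; rewrite /T /phi -addrA -[RHS]addr0 => /addrI /eqP.
    by rewrite addrC subr_eq0 => /eqP ->.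
  exists x; first by split=> //; rewrite gx.
  by apply: (can_inj (mulmxK (_ : L \in unitmx))) => //; rewrite unitmx_inv.
have ex y : exists x, V' y -> U' x /\ f x = y.
  have [Vy|] := pselect (V' y); last by exists a.
  by move: (Vy); rewrite {1}V'E => -[x Ux <-]; exists x.
pose h y := sval (cid (ex y)).
have hP y : V' y -> U' (h y) /\ f (h y) = y by exact: svalP (cid (ex y)).
have hf x : U' x -> h (f x) = x.
  move=> Ux; have [[bh _] E] : U' (h (f x)) /\ f (h (f x)) = f x.
    by apply: hP; rewrite V'E; exists x.
  apply/eqP; rewrite -subr_eq0 -normr_le0.
  by have := lip _ _ bh Ux.1; rewrite E subrr normr0 mulr0.
exists U', V', h; split=> //; first by split=> // x [/rU].
have [KL KL0 HKL] := mulmx_bound L.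
have hlip y z : V' y -> V' z -> `|h y - h z| <= 2 * KL * `|y - z|.
  move=> Vy Vz; have [[b1 _] E1] := hP y Vy; have [[b2 _] E2] := hP z Vz.
  apply: (le_trans (lip _ _ b1 b2)); rewrite E1 E2 -mulmxBl -mulrA.
  by rewrite ler_wpM2l.
have dh y : V' y -> differentiable h y /\
    'd h y = mulmxr (invmx (J (h y))) :> ('rV[R]_n -> 'rV[R]_n).
  move=> Vy; have [[bh _] E] := hP y Vy.
  have [K K0 HK] := mulmx_bound (invmx (J (h y))).
  apply: diff_epsP => [|e e0]; first exact: mulmxr_continuous.
  pose e' := e / (K * (2 * KL)).
  have e'0 : 0 < e' by rewrite divr_gt0 // !mulr_gt0.
  have /nbhs_ballP [d /= d0 Hd] := diff_epsW (df (rU _ bh)) e'0.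
  have d'0 : 0 < d / (2 * KL) by rewrite divr_gt0 // mulr_gt0.
  have nb : nbhs (0 : 'rV[R]_n) (ball (0 : 'rV[R]_n) (d / (2 * KL))) by exact: nbhsx_ballx.
  have nV := near_shift0 (open_near oV' Vy).
  apply: filterS (nbhsI nV nb) => k [/= Vk]; rewrite -ball_normE /= sub0r normrN => kd.
  have [_ Ek] := hP _ Vk.
  pose w := h (k + y) - h y.
  have lw : `|w| <= 2 * KL * `|k|.
    by have := hlip _ _ Vk Vy; rewrite addrK.
  have := Hd w; rewrite -ball_normE /= sub0r normrN.
  have wd : `|w| < d by apply: (le_lt_trans lw); rewrite mulrC -ltr_pdivlMr // mulr_gt0.
  move=> /(_ wd); rewrite /w subrK Ek E addrK -/w -deriveE; last by apply: df; exact: rU.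
  rewrite derive_Jac; last by apply: df; exact: rU.
  move=> le; rewrite -normrN opprB.
  have -> : k *m invmx (J (h y)) - w = (k - w *m J (h y)) *m invmx (J (h y)).
    by rewrite mulmxBl (mulmxK (Ju _ bh)).
  apply: (le_trans (HK _)); apply: (@le_trans _ _ (K * (e' * (2 * KL * `|k|)))).
    by rewrite ler_pM2l //; apply: (le_trans le); rewrite ler_pM2l.
  have c0 : K * (2 * KL) != 0 by rewrite gt_eqF // !mulr_gt0.
  have -> : K * (e' * (2 * KL * `|k|)) = e' * (K * (2 * KL)) * `|k| by ring.
  by rewrite /e' divfK.
apply/smooth_onCk; elim=> [|k IH]; first by apply/Ck0 => y Vy; have [] := dh y Vy.
apply: (@CkS_ext _ _ _ oV' _ _ _ (fun v y => v *m invmx (J (h y)))) => [y Vy|v y Vy|v].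
- by have [] := dh y Vy.
- by have [d E] := dh y Vy; rewrite deriveE // E.
- apply: (Ck_mulmx oV'); first exact: Ck_cst.
  apply: (Ck_invmx oV') => [y Vy|]; first by have [[bh _] _] := hP y Vy; exact: Ju.
  apply: (Ck_comp oV' oU _ IH (@JC k)) => y Vy.
  by have [[bh _] _] := hP y Vy; exact: rU.
Qed.

End InverseFunction.

(** * Smooth maps *)

Section SmoothRules.
Variables (R : realType) (V : normedModType R) (U : set V).
Hypothesis oU : open U.

Lemma smooth_diff (W : normedModType R) (f : V -> W) a :
  smooth_on U f -> U a -> differentiable f a.
Proof. by move=> H; exact: (H [::]). Qed.

Lemma smooth_derive (W : normedModType R) (f : V -> W) v :
  smooth_on U f -> smooth_on U ('D_v f).
Proof. by move=> H vs a Ua; have := H (rcons vs v) a Ua; rewrite foldr_rcons. Qed.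

Lemma smooth_subset (W : normedModType R) (U' : set V) (f : V -> W) :
  U' `<=` U -> smooth_on U f -> smooth_on U' f.
Proof. by move=> s H vs a /s; exact: H. Qed.

Lemma smooth_ext (W : normedModType R) (f g : V -> W) :
  smooth_on U f -> (forall x, U x -> f x = g x) -> smooth_on U g.
Proof. by move=> /smooth_onCk H e; apply/smooth_onCk => n; exact: (Ck_ext oU (H n)). Qed.

Lemma smooth_local (W : normedModType R) (f : V -> W) :
  (forall a, U a -> exists2 U1, U1 a & smooth_on U1 f) -> smooth_on U f.
Proof. by move=> H vs a Ua; have [U1 Ua1 H1] := H a Ua; exact: H1. Qed.

Lemma smooth_cst (W : normedModType R) (c : W) : smooth_on U (fun=> c).
Proof. by apply/smooth_onCk => n; exact: Ck_cst. Qed.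

Lemma smooth_add (W : normedModType R) (f g : V -> W) :
  smooth_on U f -> smooth_on U g -> smooth_on U (fun x => f x + g x).
Proof. by move=> /smooth_onCk F /smooth_onCk G; apply/smooth_onCk => n; exact: Ck_add. Qed.

Lemma smooth_sum (W : normedModType R) (I : Type) (r : seq I) (P : pred I) (f : I -> V -> W) :
  (forall i, P i -> smooth_on U (f i)) -> smooth_on U (fun x => \sum_(i <- r | P i) f i x).
Proof.
move=> F; apply/smooth_onCk => n; apply: Ck_sum => // i Pi.
by have /smooth_onCk := F i Pi; apply.
Qed.

Lemma smooth_mul (f g : V -> R) :
  smooth_on U f -> smooth_on U g -> smooth_on U (fun x => f x * g x).
Proof. by move=> /smooth_onCk F /smooth_onCk G; apply/smooth_onCk => n; exact: Ck_mul. Qed.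

Lemma smooth_opp (f : V -> R) : smooth_on U f -> smooth_on U (fun x => - f x).
Proof. by move=> /smooth_onCk F; apply/smooth_onCk => n; exact: Ck_opp. Qed.

Lemma smooth_sub (f g : V -> R) :
  smooth_on U f -> smooth_on U g -> smooth_on U (fun x => f x - g x).
Proof. by move=> F G; apply: smooth_add => //; exact: smooth_opp. Qed.

Lemma smooth_inv (f : V -> R) : (forall x, U x -> f x != 0) ->
  smooth_on U f -> smooth_on U (fun x => (f x)^-1).
Proof. by move=> f0 /smooth_onCk F; apply/smooth_onCk => n; exact: Ck_inv. Qed.

Lemma smooth_sqrt (f : V -> R) : (forall x, U x -> 0 < f x) ->
  smooth_on U f -> smooth_on U (fun x => Num.sqrt (f x)).
Proof. by move=> f0 /smooth_onCk F; apply/smooth_onCk => n; exact: Ck_sqrt. Qed.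

Lemma smooth_mxP p q (f : V -> 'M[R]_(p, q)) :
  smooth_on U f <-> forall i j, smooth_on U (fun x => f x i j).
Proof.
split=> [/smooth_onCk F i j|F]; apply/smooth_onCk => n.
  by have /(Ck_mxP oU) := F n; apply.
by apply/(Ck_mxP oU) => i j; have /smooth_onCk := F i j; apply.
Qed.

Lemma smooth_mulmx p q r (f : V -> 'M[R]_(p, q)) (g : V -> 'M[R]_(q, r)) :
  smooth_on U f -> smooth_on U g -> smooth_on U (fun x => f x *m g x).
Proof. by move=> /smooth_onCk F /smooth_onCk G; apply/smooth_onCk => n; exact: Ck_mulmx. Qed.

Lemma smooth_invmx p (f : V -> 'M[R]_p) : (forall x, U x -> f x \in unitmx) ->
  smooth_on U f -> smooth_on U (fun x => invmx (f x)).
Proof. by move=> u /smooth_onCk F; apply/smooth_onCk => n; exact: Ck_invmx. Qed.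

Lemma smooth_det p (f : V -> 'M[R]_p) :
  smooth_on U f -> smooth_on U (fun x => \det (f x)).
Proof. by move=> /smooth_onCk F; apply/smooth_onCk => n; exact: Ck_det. Qed.

Lemma smooth_comp p q r (f : V -> 'rV[R]_p) (U' : set 'rV[R]_p)
    (g : 'rV[R]_p -> 'M[R]_(q, r)) : open U' -> (forall x, U x -> U' (f x)) ->
  smooth_on U f -> smooth_on U' g -> smooth_on U (fun x => g (f x)).
Proof.
move=> oU' UU' /smooth_onCk F /smooth_onCk G; apply/smooth_onCk => n.
exact: (Ck_comp oU oU' UU' (@F n) (@G n)).
Qed.

Lemma smooth_comp_scalar p (f : V -> 'rV[R]_p) (U' : set 'rV[R]_p)
    (g : 'rV[R]_p -> R) : open U' -> (forall x, U x -> U' (f x)) ->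
  smooth_on U f -> smooth_on U' g -> smooth_on U (fun x => g (f x)).
Proof.
move=> oU' UU' /smooth_onCk F /smooth_onCk G; apply/smooth_onCk => n.
exact: (Ck_comp_scalar oU oU' UU' (@F n) (@G n)).
Qed.

Lemma smooth_scale p q (f : V -> R) (g : V -> 'M[R]_(p, q)) :
  smooth_on U f -> smooth_on U g -> smooth_on U (fun x => f x *: g x).
Proof.
move=> F /smooth_mxP G; apply/smooth_mxP => i j.
by apply: (smooth_ext (smooth_mul F (G i j))) => x _; rewrite mxE.
Qed.

Lemma smooth_mxsub p q (f g : V -> 'M[R]_(p, q)) :
  smooth_on U f -> smooth_on U g -> smooth_on U (fun x => f x - g x).
Proof.
move=> /smooth_mxP F /smooth_mxP G; apply/smooth_mxP => i j.
by apply: (smooth_ext (smooth_sub (F i j) (G i j))) => x _; rewrite !mxE.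
Qed.

Lemma smooth_dot p (f g : V -> 'rV[R]_p) :
  smooth_on U f -> smooth_on U g -> smooth_on U (fun x => dot (f x) (g x)).
Proof.
move=> /smooth_mxP F /smooth_mxP G.
by apply: smooth_sum => i _; exact: smooth_mul.
Qed.

Lemma smooth_row_mx p q (f : V -> 'rV[R]_p) (g : V -> 'rV[R]_q) :
  smooth_on U f -> smooth_on U g -> smooth_on U (fun x => row_mx (f x) (g x)).
Proof.
move=> /smooth_mxP F /smooth_mxP G; apply/smooth_mxP => i j.
by case: (split_ordP j) => k ->;
  [apply: (smooth_ext (F i k))|apply: (smooth_ext (G i k))] => x _;
  rewrite ?row_mxEl ?row_mxEr.
Qed.

Lemma smooth_linear (W : normedModType R) (f : {linear V -> W}) :
  continuous f -> smooth_on U f.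
Proof.
move=> cf; apply/smooth_onCk; elim=> [|n IH].
  by apply/Ck0 => a _; exact: linear_differentiable.
apply: (@CkS_ext _ _ _ oU _ _ _ (fun v _ => f v)) => [a _|v a _|v].
- exact: linear_differentiable.
- by rewrite deriveE ?diff_lin //; exact: linear_differentiable.
- exact: Ck_cst.
Qed.

Lemma smooth_id : smooth_on U (id : V -> V).
Proof. by apply: (smooth_linear (f := idfun)) => x; exact: cvg_id. Qed.

End SmoothRules.

Section SmoothLinear.
Variables (R : realType).

Lemma smooth_mulmxr p q (U : set 'rV[R]_p) (M : 'M[R]_(p, q)) : open U ->
  smooth_on U (fun w : 'rV[R]_p => w *m M).
Proof. by move=> oU; apply: (smooth_mulmx oU); [exact: smooth_id|exact: smooth_cst]. Qed.

Lemma smooth_coord p (U : set 'rV[R]_p) j : open U ->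
  smooth_on U (fun w : 'rV[R]_p => w 0 j).
Proof. by move=> oU; have /(smooth_mxP oU) := smooth_id oU; apply. Qed.

Lemma smooth_lsubmx p q (U : set 'rV[R]_(p + q)) : open U ->
  smooth_on U (fun w : 'rV[R]_(p + q) => lsubmx w).
Proof.
move=> oU; apply/(smooth_mxP oU) => i j.
by apply: (smooth_ext oU (smooth_coord (lshift q j) oU)) => w _; rewrite mxE ord1.
Qed.

Lemma smooth_rsubmx p q (U : set 'rV[R]_(p + q)) : open U ->
  smooth_on U (fun w : 'rV[R]_(p + q) => rsubmx w).
Proof.
move=> oU; apply/(smooth_mxP oU) => i j.
by apply: (smooth_ext oU (smooth_coord (rshift p j) oU)) => w _; rewrite mxE ord1.
Qed.

Lemma derive_mx_eq (V : normedModType R) p q (g h : V -> 'M[R]_(p, q)) a v w :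
  differentiable g a -> differentiable h a ->
  (forall i j, 'D_v (fun x => g x i j) a = 'D_w (fun x => h x i j) a) ->
  'D_v g a = 'D_w h a.
Proof. by move=> dg dh H; apply/matrixP => i j; rewrite !derive_mxE. Qed.

Lemma smooth_derive_swap (V : normedModType R) p q (U : set V) (f : V -> 'M[R]_(p, q)) a v w :
  open U -> smooth_on U f -> U a -> 'D_v ('D_w f) a = 'D_w ('D_v f) a.
Proof.
move=> oU F Ua; have df u x : U x -> differentiable ('D_u f) x.
  by move=> Ux; exact: smooth_diff (smooth_derive u F) Ux.
have df0 x : U x -> differentiable f x by exact: smooth_diff F.
apply: (derive_mx_eq (df w a Ua) (df v a Ua)) => i j.
have D u x : U x -> ('D_u f x) i j = 'D_u (fun y => f y i j) x.
  by move=> Ux; exact: derive_mxE (df0 x Ux).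
rewrite (derive_eq_on v oU Ua (D w)) (derive_eq_on w oU Ua (D v)).
apply: (derive_swap v w oU _ Ua); have /(smooth_mxP oU) /(_ i j) /smooth_onCk := F.
by apply.
Qed.

End SmoothLinear.

Section RealRules.
Variables (R : realType) (V : normedModType R).
Implicit Types (f g : V -> R) (a v : V).

Lemma dvD f g a v : differentiable f a -> differentiable g a ->
  'D_v (fun x => f x + g x) a = 'D_v f a + 'D_v g a.
Proof. by move=> df dg; apply: deriveD; apply: diff_derivable. Qed.

Lemma dvB f g a v : differentiable f a -> differentiable g a ->
  'D_v (fun x => f x - g x) a = 'D_v f a - 'D_v g a.
Proof. by move=> df dg; apply: deriveB; apply: diff_derivable. Qed.

Lemma dvM f g a v : differentiable f a -> differentiable g a ->
  'D_v (fun x => f x * g x) a = 'D_v f a * g a + f a * 'D_v g a.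
Proof.
move=> df dg; have := deriveM (diff_derivable (v := v) df) (diff_derivable (v := v) dg).
move=> E; rewrite [LHS]E addrC; congr (_ + _); exact: mulrC.
Qed.

Lemma dv_cst (c : R) a v : 'D_v (fun _ : V => c) a = 0.
Proof. exact: derive_cst. Qed.
End RealRules.

(** * Differentiation of complex-valued functions of real variables *)

Section ComplexRules.
Variables (R : realType) (V : normedModType R).
Implicit Types (f g : V -> R[i]) (a v : V).

Definition cdiff f a : Prop :=
  differentiable (fun x => complex.Re (f x)) a /\
  differentiable (fun x => complex.Im (f x)) a.

Definition cD v f a : R[i] :=
  Complex ('D_v (fun x => complex.Re (f x)) a) ('D_v (fun x => complex.Im (f x)) a).

(** Smoothness over the reals: these maps depend on real variables, and their
holomorphy, where it holds, is a statement on the values of cD. *)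
Definition csm (U : set V) f : Prop :=
  smooth_on U (fun x => complex.Re (f x)) /\
  smooth_on U (fun x => complex.Im (f x)).

Lemma ReD (z w : R[i]) : complex.Re (z + w) = complex.Re z + complex.Re w.
Proof. by case: z; case: w. Qed.
Lemma ImD (z w : R[i]) : complex.Im (z + w) = complex.Im z + complex.Im w.
Proof. by case: z; case: w. Qed.
Lemma ReM (z w : R[i]) :
  complex.Re (z * w) = complex.Re z * complex.Re w - complex.Im z * complex.Im w.
Proof. by case: z; case: w. Qed.
Lemma ImM (z w : R[i]) :
  complex.Im (z * w) = complex.Re z * complex.Im w + complex.Im z * complex.Re w.
Proof. by case: z; case: w. Qed.

Lemma complexP (z w : R[i]) :
  complex.Re z = complex.Re w -> complex.Im z = complex.Im w -> z = w.
Proof. by case: z; case: w => ? ? ? ? /= -> ->. Qed.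

Lemma csm_cdiff U f a : csm U f -> U a -> cdiff f a.
Proof. by move=> [h1 h2] Ua; split; [exact: smooth_diff h1 Ua|exact: smooth_diff h2 Ua]. Qed.

Lemma csm_subset (U U' : set V) f : U' `<=` U -> csm U f -> csm U' f.
Proof. by move=> s [h1 h2]; split; [apply: smooth_subset s h1|apply: smooth_subset s h2]. Qed.

Lemma csm_ext U f g : open U -> csm U f -> (forall x, U x -> f x = g x) -> csm U g.
Proof.
by move=> oU [h1 h2] e; split; [apply: (smooth_ext oU h1)|apply: (smooth_ext oU h2)] => x Ux;
  rewrite e.
Qed.

Lemma cD_ext U f g a v : open U -> U a -> (forall x, U x -> f x = g x) ->
  cD v f a = cD v g a.
Proof.
by move=> oU Ua e; congr Complex; apply: (derive_eq_on v oU Ua) => x Ux; rewrite e.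
Qed.

Lemma cD_cst (c : R[i]) a v : cD v (fun=> c) a = 0.
Proof. by rewrite /cD !dv_cst. Qed.

Lemma cdiff_cst (c : R[i]) a : cdiff (fun=> c) a.
Proof. by split; exact: differentiable_cst. Qed.

Lemma cdiffD f g a : cdiff f a -> cdiff g a -> cdiff (fun x => f x + g x) a.
Proof.
move=> [f1 f2] [g1 g2]; split.
  by under eq_fun do rewrite ReD; exact: differentiableD.
by under eq_fun do rewrite ImD; exact: differentiableD.
Qed.

Lemma cD_add f g a v : cdiff f a -> cdiff g a ->
  cD v (fun x => f x + g x) a = cD v f a + cD v g a.
Proof.
move=> [f1 f2] [g1 g2]; apply: complexP; rewrite ?ReD ?ImD /=.
  by under eq_fun do rewrite ReD; rewrite dvD.
by under eq_fun do rewrite ImD; rewrite dvD.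
Qed.

Lemma cdiffM f g a : cdiff f a -> cdiff g a -> cdiff (fun x => f x * g x) a.
Proof.
move=> [f1 f2] [g1 g2]; split.
  by under eq_fun do rewrite ReM; apply: differentiableB; exact: differentiableM.
by under eq_fun do rewrite ImM; apply: differentiableD; exact: differentiableM.
Qed.

Lemma cD_mul f g a v : cdiff f a -> cdiff g a ->
  cD v (fun x => f x * g x) a = cD v f a * g a + f a * cD v g a.
Proof.
move=> [f1 f2] [g1 g2]; apply: complexP; rewrite ?ReD ?ImD !(ReM, ImM) /=.
  under eq_fun do rewrite ReM.
  rewrite dvB; [|exact: differentiableM..].
  by rewrite !dvM //; move: ('D_v _ _) ('D_v _ _) ('D_v _ _) ('D_v _ _) => p q r s; ring.
under eq_fun do rewrite ImM.
rewrite dvD; [|exact: differentiableM..].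
by rewrite !dvM //; move: ('D_v _ _) ('D_v _ _) ('D_v _ _) ('D_v _ _) => p q r s; ring.
Qed.

Lemma csm_mul U f g : open U -> csm U f -> csm U g -> csm U (fun x => f x * g x).
Proof.
move=> oU [f1 f2] [g1 g2]; split.
  by under eq_fun do rewrite ReM; apply: smooth_sub => //; exact: smooth_mul.
by under eq_fun do rewrite ImM; apply: smooth_add => //; exact: smooth_mul.
Qed.

Lemma cdiff_sum (I : Type) (r : seq I) (P : pred I) (F : I -> V -> R[i]) a :
  (forall i, cdiff (F i) a) -> cdiff (fun x => \sum_(i <- r | P i) F i x) a.
Proof.
move=> H; elim: r => [|i r IH].
  by under eq_fun do rewrite big_nil; exact: cdiff_cst.
under eq_fun do rewrite big_cons.
by case: (P i) => //; exact: cdiffD.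
Qed.

Lemma cD_sum (I : Type) (r : seq I) (P : pred I) (F : I -> V -> R[i]) a v :
  (forall i, cdiff (F i) a) ->
  cD v (fun x => \sum_(i <- r | P i) F i x) a = \sum_(i <- r | P i) cD v (F i) a.
Proof.
move=> H; elim: r => [|i r IH].
  by under eq_fun do rewrite big_nil; rewrite cD_cst big_nil.
under eq_fun do rewrite big_cons; rewrite big_cons.
by case: (P i) => //; rewrite cD_add ?IH //; exact: cdiff_sum.
Qed.

Lemma csm_inv U f : open U -> (forall x, U x -> f x != 0) -> csm U f ->
  csm U (fun x => (f x)^-1).
Proof.
move=> oU f0 [f1 f2].
pose N x := complex.Re (f x) * complex.Re (f x) + complex.Im (f x) * complex.Im (f x).
have sN : smooth_on U N by apply: smooth_add => //; exact: smooth_mul.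
have N0 x : U x -> N x != 0.
  move=> Ux; have := f0 x Ux; apply: contraNneq => N0; move: N0; rewrite /N.
  case: (f x) => p q /= N0; rewrite eq_complex /=.
  have p0 : 0 <= p * p by rewrite -expr2 sqr_ge0.
  have q0 : 0 <= q * q by rewrite -expr2 sqr_ge0.
  have /eqP : p * p = 0 by lra.
  have /eqP : q * q = 0 by lra.
  by rewrite !mulf_eq0 !orbb => -> ->.
have sI := smooth_inv oU N0 sN.
split.
  apply: (smooth_ext oU (smooth_mul oU f1 sI)) => x Ux.
  by rewrite /N; case: (f x) => p q /=; rewrite !expr2.
apply: (smooth_ext oU (smooth_opp oU (smooth_mul oU f2 sI))) => x Ux.
by rewrite /N; case: (f x) => p q /=; rewrite !expr2.
Qed.

Lemma csm_cD U f v : csm U f -> csm U (cD v f).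
Proof. by move=> [h1 h2]; split; exact: smooth_derive. Qed.

Lemma csm_real U (r : V -> R) : open U -> smooth_on U r -> csm U (fun x => real_complex R (r x)).
Proof. by move=> oU sr; split=> //=; exact: smooth_cst. Qed.

End ComplexRules.

Lemma cD_comp (R : realType) (V W : normedModType R) (f : W -> V) (g : V -> R[i]) a v :
  differentiable f a -> cdiff g (f a) ->
  cD v (fun x => g (f x)) a = cD ('D_v f a) g (f a).
Proof.
move=> df [g1 g2]; congr Complex.
  exact: (derive_comp v df g1).
exact: (derive_comp v df g2).
Qed.

Lemma cD_swap (R : realType) (V : normedModType R) (U : set V) (f : V -> R[i]) a v w :
  open U -> csm U f -> U a -> cD v (cD w f) a = cD w (cD v f) a.
Proof.
move=> oU [/smooth_onCk f1 /smooth_onCk f2] Ua.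
apply: complexP.
  exact: (derive_swap v w oU (@f1 3%N) Ua).
exact: (derive_swap v w oU (@f2 3%N) Ua).
Qed.

Lemma csm_comp (R : realType) (V : normedModType R) p (U : set V) (f : V -> 'rV[R]_p)
    (U' : set 'rV[R]_p) (g : 'rV[R]_p -> R[i]) : open U -> open U' ->
  (forall x, U x -> U' (f x)) -> smooth_on U f -> csm U' g ->
  csm U (fun x => g (f x)).
Proof.
move=> oU oU' UU' sf [g1 g2]; split.
  exact: (smooth_comp_scalar oU oU' UU' sf g1).
exact: (smooth_comp_scalar oU oU' UU' sf g2).
Qed.

(** * The complexified Lorentz product *)

Section LorentzAlgebra.
Variables (K : comNzRingType) (n : nat).
Implicit Types (X Y Z : 'rV[K]_(1 + n)).

(** The signature of the Lorentz product, which turns it into a single sum over all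
coordinates. *)
Definition lsg (j : 'I_(1 + n)) : K := if (j == 0 :> nat) then -1 else 1.

Lemma lorE X Y : lor X Y = \sum_j lsg j * (X 0 j * Y 0 j).
Proof.
rewrite big_split_ord /= big_ord1 /lor /dot !mxE /lsg /= mulN1r.
by congr (_ + _); apply: eq_bigr => i _; rewrite !mxE mul1r.
Qed.

Lemma lorC X Y : lor X Y = lor Y X.
Proof. by rewrite !lorE; apply: eq_bigr => j _; rewrite [X 0 j * _]mulrC. Qed.

Lemma lorDl X Y Z : lor (X + Y) Z = lor X Z + lor Y Z.
Proof. by rewrite !lorE -big_split; apply: eq_bigr => j _ /=; rewrite !mxE; ring. Qed.

Lemma lorZl c X Y : lor (c *: X) Y = c * lor X Y.
Proof. by rewrite !lorE mulr_sumr; apply: eq_bigr => j _ /=; rewrite !mxE; ring. Qed.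

Lemma lorDr X Y Z : lor Z (X + Y) = lor Z X + lor Z Y.
Proof. by rewrite ![lor Z _]lorC lorDl. Qed.

Lemma lorZr c X Y : lor Y (c *: X) = c * lor Y X.
Proof. by rewrite ![lor Y _]lorC lorZl. Qed.

Lemma lorNl X Y : lor (- X) Y = - lor X Y.
Proof. by rewrite -scaleN1r lorZl mulN1r. Qed.

Lemma lorNr X Y : lor Y (- X) = - lor Y X.
Proof. by rewrite ![lor Y _]lorC lorNl. Qed.

Lemma lorBl X Y Z : lor (X - Y) Z = lor X Z - lor Y Z.
Proof. by rewrite lorDl lorNl. Qed.

Lemma lorBr X Y Z : lor Z (X - Y) = lor Z X - lor Z Y.
Proof. by rewrite lorDr lorNr. Qed.

Lemma lor0l X : lor 0 X = 0.
Proof. by rewrite -(scale0r 0) lorZl mul0r. Qed.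

Lemma lor_suml (I : finType) (P : pred I) (F : I -> 'rV[K]_(1 + n)) Z :
  lor (\sum_(i | P i) F i) Z = \sum_(i | P i) lor (F i) Z.
Proof. by elim/big_rec2: _ => [|i y1 y2 _ <-]; rewrite ?lor0l ?lorDl. Qed.
End LorentzAlgebra.

Definition lorlin := (lorDl, lorDr, lorZl, lorZr, lorNl, lorNr, lorBl, lorBr).

Section DotAlgebra.
Variables (K : comNzRingType) (n : nat).
Implicit Types (X Y Z : 'rV[K]_n).

Lemma dotC X Y : dot X Y = dot Y X.
Proof. by apply: eq_bigr => j _; rewrite mulrC. Qed.

Lemma dotDl X Y Z : dot (X + Y) Z = dot X Z + dot Y Z.
Proof. by rewrite /dot -big_split; apply: eq_bigr => j _ /=; rewrite !mxE; ring. Qed.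

Lemma dotZl c X Y : dot (c *: X) Y = c * dot X Y.
Proof. by rewrite /dot mulr_sumr; apply: eq_bigr => j _ /=; rewrite !mxE; ring. Qed.

Lemma dotDr X Y Z : dot Z (X + Y) = dot Z X + dot Z Y.
Proof. by rewrite ![dot Z _]dotC dotDl. Qed.

Lemma dotZr c X Y : dot Y (c *: X) = c * dot Y X.
Proof. by rewrite ![dot Y _]dotC dotZl. Qed.

Lemma dotNl X Y : dot (- X) Y = - dot X Y.
Proof. by rewrite -scaleN1r dotZl mulN1r. Qed.

Lemma dotNr X Y : dot Y (- X) = - dot Y X.
Proof. by rewrite ![dot Y _]dotC dotNl. Qed.

Lemma dotBl X Y Z : dot (X - Y) Z = dot X Z - dot Y Z.
Proof. by rewrite dotDl dotNl. Qed.

Lemma dotBr X Y Z : dot Z (X - Y) = dot Z X - dot Z Y.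
Proof. by rewrite dotDr dotNr. Qed.

Lemma dot0l X : dot 0 X = 0.
Proof. by rewrite -(scale0r 0) dotZl mul0r. Qed.

Lemma dot0r X : dot X 0 = 0.
Proof. by rewrite dotC dot0l. Qed.

Lemma dot_suml (I : finType) (P : pred I) (F : I -> 'rV[K]_n) Z :
  dot (\sum_(i | P i) F i) Z = \sum_(i | P i) dot (F i) Z.
Proof. by elim/big_rec2: _ => [|i y1 y2 _ <-]; rewrite ?dot0l ?dotDl. Qed.

Lemma dot_sumr (I : finType) (P : pred I) (F : I -> 'rV[K]_n) Z :
  dot Z (\sum_(i | P i) F i) = \sum_(i | P i) dot Z (F i).
Proof. by elim/big_rec2: _ => [|i y1 y2 _ <-]; rewrite ?dot0r ?dotDr. Qed.

Lemma dot_mulmx X Y : dot X Y = (X *m Y^T) 0 0.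
Proof. by rewrite !mxE; apply: eq_bigr => i _; rewrite mxE. Qed.
End DotAlgebra.

Definition dotlin := (dotDl, dotDr, dotZl, dotZr, dotNl, dotNr, dotBl, dotBr).

Section RealDot.
Variables (R : realType) (n : nat).
Implicit Types (X Y : 'rV[R]_n).

Lemma dot_ge0 X : 0 <= dot X X.
Proof. by apply: sumr_ge0 => i _; rewrite -expr2 sqr_ge0. Qed.

Lemma dot_eq0 X : dot X X = 0 -> X = 0.
Proof.
move=> /eqP; rewrite psumr_eq0 => [/allP H|i _]; last by rewrite -expr2 sqr_ge0.
apply/rowP => i; have := H i (mem_index_enum _); rewrite mxE /= mulf_eq0 orbb.
by move=> /eqP.
Qed.

End RealDot.

Section ComplexLorentz.
Variables (R : realType) (n : nat).
Implicit Types (X Y : 'rV[R[i]]_(1 + n)).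

Lemma lor_to_complex (X Y : 'rV[R]_(1 + n)) :
  lor (to_complex X) (to_complex Y) = real_complex R (lor X Y).
Proof.
rewrite !lorE rmorph_sum; apply: eq_bigr => j _; rewrite !mxE !rmorphM /lsg.
by case: ifP; rewrite ?rmorphN rmorph1.
Qed.

Lemma lor_conj X Y : lor (conj_vec X) (conj_vec Y) = conjc (lor X Y).
Proof.
rewrite !lorE rmorph_sum; apply: eq_bigr => j _; rewrite !mxE !rmorphM /lsg.
by case: ifP; rewrite ?rmorphN rmorph1.
Qed.
End ComplexLorentz.

(** * Complex vector-valued maps *)

Section ComplexVectors.
Variables (R : realType) (V : normedModType R) (N : nat).
Implicit Types (f g : V -> 'rV[R[i]]_N) (a v : V).

Definition cdiffv f a : Prop := forall j, cdiff (fun x => f x 0 j) a.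
Definition csmv (U : set V) f : Prop := forall j, csm U (fun x => f x 0 j).
Definition cDv v f a : 'rV[R[i]]_N := \row_j cD v (fun x => f x 0 j) a.

Lemma cDvE v f a j : cDv v f a 0 j = cD v (fun x => f x 0 j) a.
Proof. by rewrite mxE. Qed.

Lemma cDv_eq v w f g a :
  (forall j, cD v (fun x => f x 0 j) a = cD w (fun x => g x 0 j) a) ->
  cDv v f a = cDv w g a.
Proof. by move=> H; apply/rowP => j; rewrite [LHS]mxE H [RHS]mxE. Qed.

Lemma csmv_cdiffv U f a : csmv U f -> U a -> cdiffv f a.
Proof. by move=> H Ua j; exact: csm_cdiff (H j) Ua. Qed.

Lemma cDv_ext U f g a v : open U -> U a -> (forall x, U x -> f x = g x) ->
  cDv v f a = cDv v g a.
Proof. by move=> oU Ua e; apply/rowP => j; rewrite !mxE; apply: (cD_ext v oU Ua) => x Ux; rewrite e. Qed.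

Lemma csmv_cDv U f v : csmv U f -> csmv U (cDv v f).
Proof.
move=> H j; have [h1 h2] := csm_cD v (H j).
have e x : cDv v f x 0 j = cD v (fun x => f x 0 j) x by rewrite mxE.
by split; under eq_fun do rewrite e.
Qed.

Lemma csmv_subset (U U' : set V) f : U' `<=` U -> csmv U f -> csmv U' f.
Proof. by move=> s H j; exact: csm_subset s (H j). Qed.

Lemma cDv_swap U f a v w : open U -> csmv U f -> U a ->
  cDv v (cDv w f) a = cDv w (cDv v f) a.
Proof.
move=> oU H Ua; apply: cDv_eq => j.
have e u : (fun x => cDv u f x 0 j) = cD u (fun x => f x 0 j).
  by apply/funext => x; exact: cDvE.
by rewrite (e v) (e w); exact: (cD_swap v w oU (H j) Ua).
Qed.

Lemma cDv_scale (k : V -> R[i]) f a v : cdiff k a -> cdiffv f a ->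
  cDv v (fun x => k x *: f x) a = cD v k a *: f a + k a *: cDv v f a.
Proof.
move=> dk df; apply/rowP => j; rewrite !mxE.
have e x : (k x *: f x) 0 j = k x * f x 0 j by rewrite mxE.
by under eq_fun do rewrite e; rewrite cD_mul.
Qed.
End ComplexVectors.

Section ComplexLorVectors.
Variables (R : realType) (V : normedModType R) (n : nat).
Implicit Types (f g : V -> 'rV[R[i]]_(1 + n)) (a v : V).

Lemma cD_lor f g a v : cdiffv f a -> cdiffv g a ->
  cD v (fun x => lor (f x) (g x)) a = lor (cDv v f a) (g a) + lor (f a) (cDv v g a).
Proof.
move=> df dg; under eq_fun do rewrite lorE.
rewrite cD_sum => [|j]; last by apply: cdiffM; [exact: cdiff_cst|exact: cdiffM].
rewrite !lorE -big_split; apply: eq_bigr => j _ /=.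
rewrite cD_mul; [|exact: cdiff_cst|exact: cdiffM].
by rewrite cD_cst mul0r add0r cD_mul // !mxE mulrDr.
Qed.

Lemma cD_lor_const U f g c a v : open U -> csmv U f -> csmv U g ->
  (forall x, U x -> lor (f x) (g x) = c) -> U a ->
  lor (cDv v f a) (g a) = - lor (f a) (cDv v g a).
Proof.
move=> oU sf sg H Ua; apply/eqP; rewrite -addr_eq0; apply/eqP.
rewrite -cD_lor; [|exact: csmv_cdiffv sf Ua|exact: csmv_cdiffv sg Ua].
by rewrite (cD_ext v oU Ua H) cD_cst.
Qed.
End ComplexLorVectors.

Section LinkWithDefs.
Variables (R : realType) (N : nat).

Lemma csmooth_csmv (O1 : set 'rV[R]_2) (eta : 'rV[R]_2 -> 'rV[R[i]]_N) : open O1 ->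
  csmooth_on O1 eta <-> csmv O1 eta.
Proof.
move=> oO; split=> [[h1 h2] j|H].
  have /(smooth_mxP oO) /(_ 0 j) e1 := h1; have /(smooth_mxP oO) /(_ 0 j) e2 := h2.
  by split; [apply: (smooth_ext oO e1)|apply: (smooth_ext oO e2)] => x _; rewrite mxE.
split; apply/(smooth_mxP oO) => i j; have [h1 h2] := H j.
  by apply: (smooth_ext oO h1) => x _; rewrite mxE ord1.
by apply: (smooth_ext oO h2) => x _; rewrite mxE ord1.
Qed.

Lemma cderiveE (O1 : set 'rV[R]_2) (eta : 'rV[R]_2 -> 'rV[R[i]]_N) z v :
  open O1 -> csmooth_on O1 eta -> O1 z -> cderive eta z v = cDv v eta z.
Proof.
move=> oO [h1 h2] Oz; apply/rowP => j; rewrite !mxE.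
rewrite (derive_mxE v 0 j (smooth_diff h1 Oz)) (derive_mxE v 0 j (smooth_diff h2 Oz)).
have e1 x : (re_vec (eta x)) 0 j = complex.Re (eta x 0 j) by rewrite mxE.
have e2 x : (im_vec (eta x)) 0 j = complex.Im (eta x 0 j) by rewrite mxE.
under eq_fun do rewrite e1; under [in X in _ + X]eq_fun do rewrite e2.
by apply: complexP; rewrite ?(ReD, ImD, ReM, ImM) /=; ring.
Qed.

End LinkWithDefs.

(** * Orthonormal frames of an immersion into the sphere *)

Lemma mulmx_double_sum (K : comNzRingType) p q (X : 'rV[K]_q) (J : 'M[K]_(p, q)) (G : 'M[K]_p) :
  X *m J^T *m G *m J =
    \sum_(i < p) \sum_(j < p) (G i j * dot X (row i J)) *: row j J.
Proof.
apply/rowP => l; rewrite exchange_big summxE mxE; apply: eq_bigr => j _ /=.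
rewrite summxE mxE mulr_suml; apply: eq_bigr => i _.
rewrite !mxE; congr (_ * _); rewrite mulrC; congr (_ * _).
by rewrite /dot; apply: eq_bigr => k _; rewrite !mxE.
Qed.

Section OrthonormalFrame.
Variables (R : realType) (m : nat) (U : set 'rV[R]_m) (F : 'rV[R]_m -> 'rV[R]_m.+3).
Variable u : 'rV[R]_m.
Hypotheses (oU : open U) (Uu : U u) (sF : smooth_on U F).
Variable e : 'I_m -> 'rV[R]_m.
Hypothesis eON : forall i j, fff F u (e i) (e j) = (i == j)%:R.

Let dF : differentiable F u. Proof. exact: smooth_diff sF Uu. Qed.
Let E : 'M[R]_m := \matrix_i e i.
Let T : 'M[R]_(m, m.+3) := E *m Jac F u.

Lemma frame_rowT k : row k T = 'D_(e k) F u.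
Proof. by rewrite row_mul rowK derive_Jac. Qed.

Lemma frame_TT : T *m T^T = 1%:M.
Proof.
apply/matrixP => i j; rewrite !mxE -eON /fff -!frame_rowT.
by apply: eq_bigr => k _; rewrite !mxE.
Qed.

(** A frame E that is orthonormal for the Gram matrix G satisfies E G E^T = 1, so that
G^-1 = E^T E. All traces are computed with this formula. *)
Lemma frame_gram_inv : gram_inv F u = E^T *m E.
Proof.
rewrite /gram_inv; set G := (X in invmx X).
have GE : G = Jac F u *m (Jac F u)^T.
  apply/matrixP => i j; rewrite !mxE /fff /dot; apply: eq_bigr => k _.
  by rewrite !mxE.
have H : E *m (G *m E^T) = 1%:M.
  by rewrite GE -frame_TT /T trmx_mul !mulmxA.
have H2 := mulmx1C H; rewrite -mulmxA in H2.
have [Gu _] := mulmx1_unit H2.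
by rewrite -[RHS]mul1mx -(mulVmx Gu) -mulmxA H2 mulmx1.
Qed.

Lemma frame_unit : E \in unitmx.
Proof. by have [] := mulmx1_unit (_ : E *m (Jac F u *m T^T) = 1%:M) => //; rewrite mulmxA frame_TT. Qed.

Lemma frame_coord v : v = \sum_k fff F u v (e k) *: e k.
Proof.
have -> : \sum_k fff F u v (e k) *: e k = (v *m Jac F u *m T^T) *m E.
  apply/rowP => j; rewrite summxE !mxE; apply: eq_bigr => k _.
  rewrite !mxE; congr (_ * _); rewrite /fff dot_mulmx -frame_rowT derive_Jac // !mxE.
  by apply: eq_bigr => l _; rewrite !mxE.
have H : E *m (Jac F u *m T^T) = 1%:M by rewrite mulmxA frame_TT.
by rewrite -!mulmxA [_ *m (_ *m E)]mulmxA (mulmx1C H) mulmx1.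
Qed.

Lemma frame_tangent_proj X :
  tangent_proj F u X = \sum_k dot X ('D_(e k) F u) *: 'D_(e k) F u.
Proof.
have -> : \sum_k dot X ('D_(e k) F u) *: 'D_(e k) F u = X *m T^T *m T.
  apply/rowP => j; rewrite summxE mxE; apply: eq_bigr => k _.
  rewrite -frame_rowT dot_mulmx !mxE; congr (_ * _).
  by apply: eq_bigr => l _; rewrite !mxE.
rewrite /tangent_proj frame_gram_inv.
have -> : X *m T^T *m T = X *m (Jac F u)^T *m (E^T *m E) *m Jac F u.
  by rewrite /T trmx_mul !mulmxA.
rewrite mulmx_double_sum; apply: eq_bigr => i _; apply: eq_bigr => j _.
by rewrite !derive_Jac // /basis_vec -!rowE.
Qed.

End OrthonormalFrame.

Section FrameNormals.
Variables (R : realType) (m : nat) (U : set 'rV[R]_m) (F : 'rV[R]_m -> 'rV[R]_m.+3).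
Variable u : 'rV[R]_m.
Hypotheses (oU : open U) (Uu : U u) (sF : smooth_on U F).
Hypothesis F1 : forall q, U q -> dot (F q) (F q) = 1.

Let dF q : U q -> differentiable F q. Proof. by move=> Uq; exact: smooth_diff sF Uq. Qed.

Lemma dv_dot p (f g : 'rV[R]_m -> 'rV[R]_p) q v : differentiable f q -> differentiable g q ->
  'D_v (fun x => dot (f x) (g x)) q = dot ('D_v f q) (g q) + dot (f q) ('D_v g q).
Proof.
move=> df dg; have /differentiable_mxP df' := df; have /differentiable_mxP dg' := dg.
have -> : (fun x => dot (f x) (g x)) = \sum_(i < p) (fun x => f x 0 i * g x 0 i).
  by apply/funext => x; rewrite fct_sumE.
rewrite derive_sum => [|i]; last by apply: diff_derivable; exact: differentiableM.
rewrite /dot -big_split; apply: eq_bigr => i _ /=.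
by rewrite dvM // -!derive_mxE.
Qed.

Lemma dot_F_dF q v : U q -> dot (F q) ('D_v F q) = 0.
Proof.
move=> Uq; have := derive_eq_on v oU Uq F1.
by rewrite dv_cst (dv_dot v (dF Uq) (dF Uq)) dotC; lra.
Qed.

(** The second derivative in R^(m+3); its normal part is the second fundamental form. *)
Definition hess v w : 'rV[R]_m.+3 := 'D_v (fun q => 'D_w F q) u.

Lemma hess_differentiable w : differentiable (fun q => 'D_w F q) u.
Proof. by exact: smooth_diff (smooth_derive w sF) Uu. Qed.

Lemma hess_sum_l (I : finType) (P : pred I) (k : I -> R) (b : I -> 'rV[R]_m) w :
  hess (\sum_(i | P i) k i *: b i) w = \sum_(i | P i) k i *: hess (b i) w.
Proof.
rewrite /hess derive_sumv; last exact: hess_differentiable.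
by apply: eq_bigr => i _; rewrite deriveZv //; exact: hess_differentiable.
Qed.

Lemma hess_swap v w : hess v w = hess w v.
Proof. exact: smooth_derive_swap oU sF Uu. Qed.

Lemma hess_sum_r (I : finType) (P : pred I) (k : I -> R) (b : I -> 'rV[R]_m) w :
  hess w (\sum_(i | P i) k i *: b i) = \sum_(i | P i) k i *: hess w (b i).
Proof. by rewrite hess_swap hess_sum_l; apply: eq_bigr => i _; rewrite hess_swap. Qed.

Variable e : 'I_m -> 'rV[R]_m.
Hypothesis eON : forall i j, fff F u (e i) (e j) = (i == j)%:R.
Variables n1 n2 : 'rV[R]_m.+3.
Hypothesis nON : orthonormal_normals F u n1 n2.

Lemma normal_ext X : (forall k, dot X ('D_(e k) F u) = 0) -> dot X (F u) = 0 ->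
  dot X n1 = 0 -> dot X n2 = 0 -> X = 0.
Proof.
move=> h0 h1 h2 h3; have [n11 n22 n12 [n1F n2F] nT] := nON.
pose T : 'M[R]_(m, m.+3) := \matrix_k 'D_(e k) F u.
pose A := col_mx T (col_mx (F u) (col_mx n1 n2)).
have d p q (Y Z : 'rV[R]_q) (B : 'M[R]_(p, q)) : Y *m Z^T = (dot Y Z)%:M.
  by apply/rowP => i; rewrite ord1 [LHS]mxE [RHS]mxE eqxx mulr1n; apply: eq_bigr => k _; rewrite mxE.
have TZ Z : (forall k, dot ('D_(e k) F u) Z = 0) -> T *m Z^T = 0.
  move=> H; apply/matrixP => i j; rewrite ord1 [RHS]mxE -(H i) [LHS]mxE.
  by apply: eq_bigr => k _; rewrite !mxE.
have TT : T *m T^T = 1%:M.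
  apply/matrixP => i j; rewrite [RHS]mxE -eON [LHS]mxE.
  by apply: eq_bigr => k _; rewrite !mxE.
have tn1 k : dot ('D_(e k) F u) n1 = 0 by rewrite dotC; have [] := nT (e k).
have tn2 k : dot ('D_(e k) F u) n2 = 0 by rewrite dotC; have [] := nT (e k).
have tF k : dot ('D_(e k) F u) (F u) = 0 by rewrite dotC; exact: dot_F_dF.
have ZT Z : (forall k, dot ('D_(e k) F u) Z = 0) -> Z *m T^T = 0.
  by move=> /TZ H; rewrite -[Z *m _]trmxK trmx_mul trmxK H trmx0.
have AA : A *m A^T = 1%:M.
  rewrite /A !tr_col_mx !mul_col_mx !mul_mx_row TT !TZ // !ZT // !(d 0%N) //; try exact: 0.
  have Fn1 : dot (F u) n1 = 0 by rewrite dotC.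
  have Fn2 : dot (F u) n2 = 0 by rewrite dotC.
  have n21 : dot n2 n1 = 0 by rewrite dotC.
  rewrite F1 // n11 n22 n12 n21 n1F n2F Fn1 Fn2 !raddf0 !row_mx0.
  rewrite -[col_mx (row_mx 0 (row_mx 0 (row_mx 1 0))) _]block_mxEv block_mxEh col_mx0.
  rewrite -[col_mx (row_mx 0 (row_mx 1%:M 0)) _]block_mxEv block_mxEh col_mx0.
  rewrite -[col_mx (row_mx 0 (row_mx 1 0)) _]block_mxEv block_mxEh col_mx0.
  by rewrite !scalar_mx_block /block_mx.
have rA : \rank A = m.+3.
  apply/eqP; rewrite eqn_leq rank_leq_col -[X in (X <= _)%N](_ : m + (1 + (1 + 1)) = _)%N; last by rewrite addnC.
  by apply: leq_trans (mxrankM_maxl A A^T); rewrite AA mxrank1.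
have XA : X *m A^T = 0.
  rewrite /A !tr_col_mx !mul_mx_row !(d 0%N) ?h1 ?h2 ?h3; try exact: 0.
  rewrite ZT; last by move=> k; rewrite dotC.
  by rewrite !raddf0 !row_mx0.
apply/eqP; rewrite -(mulmx_free_eq0 X (_ : row_free A^T)) ?XA //.
by rewrite /row_free mxrank_tr rA.
Qed.

(** The tangent frame, F itself and the two normals form an orthonormal basis of
R^(m+3). *)
Lemma normal_expand X :
  X = \sum_k dot X ('D_(e k) F u) *: 'D_(e k) F u + dot X (F u) *: F u
      + dot X n1 *: n1 + dot X n2 *: n2.
Proof.
have [n11 n22 n12 [n1F n2F] nT] := nON.
have tn1 k : dot ('D_(e k) F u) n1 = 0 by rewrite dotC; have [] := nT (e k).
have tn2 k : dot ('D_(e k) F u) n2 = 0 by rewrite dotC; have [] := nT (e k).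
have tF k : dot ('D_(e k) F u) (F u) = 0 by rewrite dotC; exact: dot_F_dF.
have n1t k : dot n1 ('D_(e k) F u) = 0 by have [] := nT (e k).
have n2t k : dot n2 ('D_(e k) F u) = 0 by have [] := nT (e k).
have Ft k : dot (F u) ('D_(e k) F u) = 0 by exact: dot_F_dF.
set t := \sum_k _.
have st Z : (forall k, dot ('D_(e k) F u) Z = 0) -> dot t Z = 0.
  by move=> H; rewrite /t dot_suml big1 // => k _; rewrite dotZl H mulr0.
have tt k : dot t ('D_(e k) F u) = dot X ('D_(e k) F u).
  rewrite /t dot_suml (bigD1 k) //= big1 ?addr0 => [|j jk].
    by rewrite dotZl [dot ('D_(e k) _ _) _]eON eqxx mulr1.
  by rewrite dotZl [dot ('D_(e j) _ _) _]eON (negbTE jk) mulr0.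
apply/eqP; rewrite -subr_eq0; apply/eqP; apply: normal_ext => [k|||]; rewrite !dotlin.
- by rewrite tt n1t n2t Ft; ring.
- by rewrite st // n1F n2F F1 //; ring.
- by rewrite st // [dot (F u) _]dotC n1F n11 [dot n2 _]dotC n12; ring.
- by rewrite st // [dot (F u) _]dotC n2F n22 n12; ring.
Qed.

Lemma sff_normal v w : sff F u v w = dot (hess v w) n1 *: n1 + dot (hess v w) n2 *: n2.
Proof.
rewrite /sff (frame_tangent_proj Uu sF eON) -/(hess v w).
rewrite {1}(normal_expand (hess v w)).
move: (\sum_k _) (_ *: F u) (_ *: n1) (_ *: n2) => p q r s.
by apply/rowP => i; rewrite !mxE; ring.
Qed.

Lemma dot_sff1 v w : dot (sff F u v w) n1 = dot (hess v w) n1.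
Proof.
have [n11 n22 n12 _ _] := nON; rewrite sff_normal !dotlin n11 [dot n2 _]dotC n12; ring.
Qed.

Lemma dot_sff2 v w : dot (sff F u v w) n2 = dot (hess v w) n2.
Proof. by have [n11 n22 n12 _ _] := nON; rewrite sff_normal !dotlin n22 n12; ring. Qed.

End FrameNormals.

(** * Curvature in a Wintgen frame *)

Section IndexSums.
Variables (R : comNzRingType) (m : nat) (m2 : (2 <= m)%N).

Definition ix0 : 'I_m := Ordinal (ltnW m2).
Definition ix1 : 'I_m := Ordinal m2.

Lemma sum_ix (j : 'I_m) (k : nat) (x : 'I_m -> R) : (k = j :> nat) ->
  \sum_(i < m) x i * (i == k :> nat)%:R = x j.
Proof.
move=> ->; rewrite (bigD1 j) //= eqxx mulr1 big1 ?addr0 // => i ij.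
by rewrite (_ : (i == j :> nat) = (i == j)) // (negbTE ij) mulr0.
Qed.

Lemma sum_delta (j : 'I_m) (x : 'I_m -> R) : \sum_(i < m) x i * (i == j)%:R = x j.
Proof. by rewrite -[RHS](sum_ix x (erefl (j : nat))). Qed.

Lemma sum_form (x y : 'I_m -> R) (l mu : R) (B : 'I_m -> 'I_m -> R) a b a' b' s (ja jb ja' jb' : 'I_m) :
  (forall i j, B i j = l * (i == j)%:R + mu * ((i == a :> nat)%:R * (j == b :> nat)%:R
                    + s * ((i == a' :> nat)%:R * (j == b' :> nat)%:R))) ->
  a = ja -> b = jb -> a' = ja' -> b' = jb' ->
  \sum_i \sum_j x i * (y j * B i j) =
    l * (\sum_i x i * y i) + mu * (x ja * y jb + s * (x ja' * y jb')).
Proof.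
move=> H ea eb ea' eb'.
transitivity (\sum_i (x i * (l * y i) + (x i * (i == a :> nat)%:R * (mu * y jb)
    + x i * (i == a' :> nat)%:R * (mu * s * y jb')))).
  apply: eq_bigr => i _; rewrite -mulr_sumr -mulrA -[X in _ + (_ + X)]mulrA -!mulrDr; congr (_ * _).
  transitivity (\sum_j (y j * (j == i)%:R * l + (y j * (j == b :> nat)%:R * ((i == a :> nat)%:R * mu) +
      y j * (j == b' :> nat)%:R * ((i == a' :> nat)%:R * (mu * s))))).
    by apply: eq_bigr => j _; rewrite H eq_sym; ring.
  by rewrite !big_split /= -!mulr_suml sum_delta !(sum_ix _ eb) (sum_ix _ eb'); ring.
rewrite !big_split /= -!mulr_suml (sum_ix _ ea) (sum_ix _ ea').
have -> : \sum_i x i * (l * y i) = l * (\sum_i x i * y i).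
  by rewrite mulr_sumr; apply: eq_bigr => i _; ring.
by ring.
Qed.
End IndexSums.

Lemma dot_lin2 (K : comNzRingType) m n (x y : 'I_m -> K) (H : 'I_m -> 'rV[K]_n)
    (B : 'I_m -> 'I_m -> 'rV[K]_n) (N : 'rV[K]_n) :
  (forall i, H i = \sum_j y j *: B i j) ->
  dot (\sum_i x i *: H i) N = \sum_i \sum_j x i * (y j * dot (B i j) N).
Proof.
move=> HE; rewrite dot_suml; apply: eq_bigr => i _.
rewrite dotZl HE dot_suml mulr_sumr; apply: eq_bigr => j _; by rewrite dotZl.
Qed.

Lemma dot_on2 (K : comNzRingType) n (n1 n2 : 'rV[K]_n) (a b c d : K) :
  dot n1 n1 = 1 -> dot n2 n2 = 1 -> dot n1 n2 = 0 ->
  dot (a *: n1 + b *: n2) (c *: n1 + d *: n2) = a * c + b * d.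
Proof. by move=> h1 h2 h3; rewrite !dotlin h1 h2 [dot n2 n1]dotC h3; ring. Qed.

Lemma on2_null (K : idomainType) n (n1 n2 : 'rV[K]_n) (mu p q : K) : mu != 0 ->
  dot n1 n1 = 1 -> dot n2 n2 = 1 -> dot n1 n2 = 0 ->
  (mu * (p * 0 + q * 1)) *: n1 + (mu * (p * 1 - q * 0)) *: n2 = 0 -> p = 0 /\ q = 0.
Proof.
move=> m0 h1 h2 h3 E.
have E1 := congr1 (fun X => dot X n1) E; have E2 := congr1 (fun X => dot X n2) E.
move: E1 E2; rewrite /= !dotlin !dot0l h1 h2 [dot n2 n1]dotC h3 !mulr0 !mulr1 !addr0 !add0r subr0.
move=> /eqP; rewrite mulf_eq0 (negbTE m0) => /eqP ->.
by move=> /eqP; rewrite mulf_eq0 (negbTE m0) => /eqP ->.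
Qed.

(** Contractions with the inverse metric g of the coefficients al of an orthonormal
coframe: gal says that g is dual to it. *)
Section GramContraction.
Variables (R : comNzRingType) (m : nat).
Variables (g f : 'I_m -> 'I_m -> R) (al : 'I_m -> 'I_m -> R).
Hypothesis gal : forall k l, \sum_i \sum_j g i j * (al k i * al l j) = (k == l)%:R.
Hypothesis gf : \sum_i \sum_j g i j * f i j = m%:R.

Lemma contract_lin (l mu s : R) (a b a' b' : 'I_m) :
  \sum_i \sum_j g i j * (l * f i j + mu * (al a i * al b j + s * (al a' i * al b' j)))
  = l * m%:R + mu * ((a == b)%:R + s * (a' == b')%:R).
Proof.
rewrite -gf -(gal a b) -(gal a' b').
rewrite [s * _]mulr_sumr -big_split /= mulr_sumr mulr_sumr -big_split /=; apply: eq_bigr => i _.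
rewrite [s * _]mulr_sumr -big_split /= mulr_sumr mulr_sumr -big_split /=; apply: eq_bigr => j _.
ring.
Qed.

Lemma contract_quad (x y x' y' : 'I_m -> R) :
  \sum_i \sum_j \sum_k \sum_l g i k * g j l * (x i * y j * (x' k * y' l)) =
  (\sum_i \sum_k g i k * (x i * x' k)) * (\sum_j \sum_l g j l * (y j * y' l)).
Proof.
rewrite mulr_suml; apply: eq_bigr => i _; rewrite mulr_sumr; apply: eq_bigr => j _.
rewrite mulr_suml; apply: eq_bigr => k _; rewrite mulr_sumr; apply: eq_bigr => l _.
by ring.
Qed.

Lemma contract_norm2 (mu : R) (a b : 'I_m) : a != b ->
  \sum_i \sum_j \sum_k \sum_l g i k * g j l *
    (mu * (al a i * al b j + al b i * al a j) * (mu * (al a k * al b l + al b k * al a l)) +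
     mu * (al a i * al a j - al b i * al b j) * (mu * (al a k * al a l - al b k * al b l)))
  = 4 * mu ^+ 2.
Proof.
move=> ab; have ba : (b == a) = false by rewrite eq_sym (negbTE ab).
pose Q p q p' q' := \sum_i \sum_j \sum_k \sum_l g i k * g j l *
   (al p i * al q j * (al p' k * al q' l)).
have QE p q p' q' : Q p q p' q' = (p == p')%:R * (q == q')%:R.
  by rewrite /Q contract_quad !gal.
transitivity (mu ^+ 2 * (((Q a b a b + Q a b b a) + (Q b a a b + Q b a b a)) +
    ((Q a a a a + -1 * Q a a b b) + (-1 * Q b b a a + Q b b b b)))); last first.
  by rewrite !QE !eqxx (negbTE ab) ba /=; ring.
rewrite /Q.
do 4! (rewrite ![-1 * _]mulr_sumr -!big_split /= mulr_sumr; apply: eq_bigr => ? _).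
by ring.
Qed.

Lemma contract_pair (E : 'I_m -> 'I_m -> R) (x y : 'I_m -> R) :
  (forall i j, g i j = \sum_p E p i * E p j) ->
  \sum_i \sum_j g i j * (x i * y j) =
  \sum_p (\sum_i E p i * x i) * (\sum_j E p j * y j).
Proof.
move=> gE; under [RHS]eq_bigr do rewrite mulr_suml; rewrite [RHS]exchange_big; apply: eq_bigr => i _.
under [RHS]eq_bigr do rewrite mulr_sumr; rewrite [RHS]exchange_big; apply: eq_bigr => j _.
by rewrite gE mulr_suml; apply: eq_bigr => p _; ring.
Qed.

Lemma contract_vec (W : lmodType R) (S : 'I_m -> 'I_m -> W) (A B : 'I_m -> 'I_m -> R) (n1 n2 : W) :
  (forall i j, S i j = A i j *: n1 + B i j *: n2) ->
  \sum_i \sum_j g i j *: S i j =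
  (\sum_i \sum_j g i j * A i j) *: n1 + (\sum_i \sum_j g i j * B i j) *: n2.
Proof.
move=> H; rewrite !scaler_suml -big_split; apply: eq_bigr => i _ /=.
rewrite !scaler_suml -big_split; apply: eq_bigr => j _ /=.
by rewrite H scalerDr !scalerA.
Qed.

Lemma contract_diag : f = (fun i j => \sum_k al k i * al k j) ->
  \sum_i \sum_j g i j * f i j = m%:R.
Proof.
move=> ->; under eq_bigr do under eq_bigr do rewrite mulr_sumr.
under eq_bigr do rewrite exchange_big; rewrite exchange_big /=.
under eq_bigr do rewrite gal eqxx.
by rewrite sumr_const card_ord.
Qed.
End GramContraction.

Section Wintgen.
Variables (R : realType) (m : nat) (m2 : (2 <= m)%N).
Variables (U : set 'rV[R]_m) (F : 'rV[R]_m -> 'rV[R]_m.+3) (u : 'rV[R]_m).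
Hypotheses (oU : open U) (Uu : U u) (sF : smooth_on U F).
Hypothesis F1 : forall q, U q -> dot (F q) (F q) = 1.

Let dF : differentiable F u. Proof. exact: smooth_diff sF Uu. Qed.

Section Frame.
Variable e : 'I_m -> 'rV[R]_m.
Hypothesis eON : forall i j, fff F u (e i) (e j) = (i == j)%:R.

(** The k-th coordinate of v in the orthonormal frame e. *)
Definition frame_co k v : R := fff F u v (e k).

Lemma fff_sum_l (I : finType) (P : pred I) (k : I -> R) (b : I -> 'rV[R]_m) w :
  fff F u (\sum_(i | P i) k i *: b i) w = \sum_(i | P i) k i * fff F u (b i) w.
Proof.
rewrite /fff derive_sumv // dot_suml; apply: eq_bigr => i _.
by rewrite deriveZv // dotZl.
Qed.

Lemma fff_sym v w : fff F u v w = fff F u w v.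
Proof. exact: dotC. Qed.

Lemma fff_coord v w : fff F u v w = \sum_k frame_co k v * frame_co k w.
Proof.
rewrite [in LHS](frame_coord Uu sF eON v) fff_sum_l.
by apply: eq_bigr => k _; rewrite (fff_sym (e k)).
Qed.

Lemma fco_basis p k : \sum_i (e p) 0 i * frame_co k (basis_vec R i) = (p == k)%:R.
Proof. by rewrite -fff_sum_l -rV_basis eON. Qed.

Lemma gram_fco k l :
  \sum_i \sum_j gram_inv F u i j * (frame_co k (basis_vec R i) * frame_co l (basis_vec R j)) = (k == l)%:R.
Proof.
rewrite (contract_pair (E := fun p i => e p 0 i)) => [|i j]; last first.
  by rewrite (frame_gram_inv Uu sF eON) mxE; apply: eq_bigr => p _; rewrite !mxE.
rewrite -[RHS](sum_delta l (fun p => (k == p)%:R)); apply: eq_bigr => p _.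
by congr (_ * _); rewrite -?[k == p]eq_sym; exact: fco_basis.
Qed.

Lemma gram_fff :
  \sum_i \sum_j gram_inv F u i j * fff F u (basis_vec R i) (basis_vec R j) = m%:R.
Proof.
apply: (contract_diag gram_fco (f := fun i j => fff F u (basis_vec R i) (basis_vec R j))).
by apply/funext => i; apply/funext => j; exact: fff_coord.
Qed.
End Frame.

Variables (e : 'I_m -> 'rV[R]_m) (n1 n2 : 'rV[R]_m.+3) (l1 l2 mu0 : R).
Hypothesis wf : wintgen_frame F u e n1 n2 l1 l2 mu0.

Let eON i j : fff F u (e i) (e j) = (i == j)%:R. Proof. by case: wf. Qed.
Let nON : orthonormal_normals F u n1 n2. Proof. by case: wf. Qed.
Local Notation c := (frame_co e).
Local Notation i0 := (ix0 m2).
Local Notation i1 := (ix1 m2).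

Lemma wintgen_hess1 v w : dot (hess F u v w) n1 = 
  l1 * fff F u v w + mu0 * (c i0 v * c i1 w + c i1 v * c i0 w).
Proof.
have H i j : dot (hess F u (e i) (e j)) n1 = l1 * (i == j)%:R + mu0 *
    ((i == 0%N :> nat)%:R * (j == 1%N :> nat)%:R + (1) * ((i == 1%N :> nat)%:R * (j == 0%N :> nat)%:R)).
  rewrite -(dot_sff1 oU Uu sF F1 eON nON).
  have [_ _ H _] := wf; have := congr1 (fun A : 'M[R]_m => A i j) H; rewrite !mxE => ->.
  rewrite -[l1 *+ _]mulr_natr mul1r; do 4! case: (_ == _ :> nat) => /=; rewrite ?mulr0 ?mulr1 //.
rewrite {1}(frame_coord Uu sF eON v) {1}(frame_coord Uu sF eON w).
rewrite (hess_sum_l Uu sF).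
rewrite (dot_lin2 _ n1 (fun i => hess_sum_r oU Uu sF xpredT (fun j => c j w) e (e i))).
rewrite (sum_form (fun i => c i v) (fun i => c i w) H (ja := i0) (jb := i1) (ja' := i1) (jb' := i0) erefl erefl erefl erefl).
by rewrite (fff_coord eON) mul1r.
Qed.

Lemma wintgen_hess2 v w : dot (hess F u v w) n2 = 
  l2 * fff F u v w + mu0 * (c i0 v * c i0 w - c i1 v * c i1 w).
Proof.
have H i j : dot (hess F u (e i) (e j)) n2 = l2 * (i == j)%:R + mu0 *
    ((i == 0%N :> nat)%:R * (j == 0%N :> nat)%:R + (-1) * ((i == 1%N :> nat)%:R * (j == 1%N :> nat)%:R)).
  rewrite -(dot_sff2 oU Uu sF F1 eON nON).
  have [_ _ _ H] := wf; have := congr1 (fun A : 'M[R]_m => A i j) H; rewrite !mxE => ->.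
  rewrite -[l2 *+ _]mulr_natr mulN1r; do 4! case: (_ == _ :> nat) => /=; rewrite ?mulr0 ?mulr1 //.
rewrite {1}(frame_coord Uu sF eON v) {1}(frame_coord Uu sF eON w).
rewrite (hess_sum_l Uu sF).
rewrite (dot_lin2 _ n2 (fun i => hess_sum_r oU Uu sF xpredT (fun j => c j w) e (e i))).
rewrite (sum_form (fun i => c i v) (fun i => c i w) H (ja := i0) (jb := i0) (ja' := i1) (jb' := i1) erefl erefl erefl erefl).
by rewrite (fff_coord eON) mulN1r.
Qed.

Lemma wintgen_sff v w : sff F u v w =
  (l1 * fff F u v w + mu0 * (c i0 v * c i1 w + c i1 v * c i0 w)) *: n1 +
  (l2 * fff F u v w + mu0 * (c i0 v * c i0 w - c i1 v * c i1 w)) *: n2.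
Proof. by rewrite (sff_normal oU Uu sF F1 eON nON) wintgen_hess1 wintgen_hess2. Qed.

Lemma wintgen_mean_curv : mean_curv F u = l1 *: n1 + l2 *: n2.
Proof.
have i01 : (i0 == i1) = false by [].
have i10 : (i1 == i0) = false by [].
have m0 : m%:R != 0 :> R by rewrite pnatr_eq0 -lt0n (ltnW m2).
rewrite /mean_curv.
transitivity (m%:R^-1 *: ((l1 * m%:R + mu0 * ((i0 == i1)%:R + 1 * (i1 == i0)%:R)) *: n1 +
   (l2 * m%:R + mu0 * ((i0 == i0)%:R + (-1) * (i1 == i1)%:R)) *: n2)); last first.
  rewrite i01 i10 !eqxx mulN1r subrr !mulr0 addr0 !mulr0 !addr0 scalerDr !scalerA.
  by rewrite ![m%:R^-1 * _]mulrC !mulfK.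
congr (_ *: _); have gl := contract_lin (gram_fco eON) (gram_fff eON).
rewrite -(gl l1 mu0 1 i0 i1 i1 i0) -(gl l2 mu0 (-1) i0 i0 i1 i1).
apply: contract_vec => i j; rewrite mul1r mulN1r; exact: wintgen_sff.
Qed.

(** The traceless second fundamental form in the coordinates c of the frame: in the
complex notation c_0 + i c_1 its two components are the imaginary and real parts of
mu0 (c_0 + i c_1)(v) (c_0 + i c_1)(w). *)
Lemma wintgen_sff0 v w : sff0 F u v w =
  (mu0 * (c i0 v * c i1 w + c i1 v * c i0 w)) *: n1 +
  (mu0 * (c i0 v * c i0 w - c i1 v * c i1 w)) *: n2.
Proof.
rewrite /sff0 wintgen_sff wintgen_mean_curv; move: (fff F u v w) (c _ _ ) (c _ _) (c _ _) (c _ _) => p q r s t.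
by apply/rowP => k; rewrite !mxE; ring.
Qed.

Lemma wintgen_mu0_neq0 : ~ umbilic F u -> mu0 != 0.
Proof.
move=> nu; apply/eqP => m0; apply: nu => v w.
by rewrite wintgen_sff0 m0 !mul0r !scale0r addr0.
Qed.

Lemma frame_co_e k j : c k (e j) = (j == k)%:R. Proof. by rewrite -eON. Qed.

(** The null space of the traceless second fundamental form is Span{e_3, ..., e_m}; it is
defined without reference to the frame. *)
Lemma wintgen_sff0_null v : mu0 != 0 ->
  (forall w, sff0 F u v w = 0) <-> c i0 v = 0 /\ c i1 v = 0.
Proof.
move=> m0; split=> [H|[h0 h1] w]; last first.
  rewrite wintgen_sff0; move: h0 h1; move: (c i0 v) (c i1 v) (c i0 w) (c i1 w) => p q r s -> ->.
  by rewrite !mul0r subr0 addr0 !mulr0 !scale0r addr0.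
have [n11 n22 n12 _ _] := nON.
have E := H (e i0); rewrite wintgen_sff0 (frame_co_e i0 i0) (frame_co_e i1 i0) in E.
move: E; move: (c i0 v) (c i1 v) => p q E.
by apply: (on2_null m0 n11 n22 n12 E).
Qed.

Lemma wintgen_sff0_norm2 : sff0_norm2 F u = 4 * mu0 ^+ 2.
Proof.
have [n11 n22 n12 _ _] := nON.
rewrite -(contract_norm2 (gram_fco eON) mu0 (_ : i0 != i1)) //.
apply: eq_bigr => i _; apply: eq_bigr => j _; apply: eq_bigr => k _; apply: eq_bigr => l _.
congr (_ * _); rewrite (wintgen_sff0 (basis_vec R i)) (wintgen_sff0 (basis_vec R k)).
exact: dot_on2.
Qed.

Lemma wintgen_moebius v w : moebius_metric F u v w =
  m%:R / (m%:R - 1) * (4 * mu0 ^+ 2) * fff F u v w.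
Proof. by rewrite /moebius_metric wintgen_sff0_norm2. Qed.

End Wintgen.

(** * The distribution orthogonal to Span{e_1, e_2} *)

Lemma dv_sum_mul (R : realType) (V : normedModType R) m (a b : 'I_m -> V -> R) u v :
  (forall k, differentiable (a k) u) -> (forall k, differentiable (b k) u) ->
  (forall k, b k u = 0) ->
  'D_v (fun q => \sum_k a k q * b k q) u = \sum_k a k u * 'D_v (b k) u.
Proof.
move=> da db b0.
have -> : (fun q => \sum_k a k q * b k q) = \sum_k (fun q => a k q * b k q).
  by apply/funext => q; rewrite fct_sumE.
rewrite derive_sum => [|k]; last by apply: diff_derivable; exact: differentiableM.
by apply: eq_bigr => k _; rewrite dvM // b0 mulr0 add0r.
Qed.

Section PerpDistribution.
Variables (R : realType) (m : nat) (m2 : (2 <= m)%N).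
Variables (U : set 'rV[R]_m) (F : 'rV[R]_m -> 'rV[R]_m.+3) (u : 'rV[R]_m).
Hypotheses (oU : open U) (Uu : U u) (sF : smooth_on U F).
Hypothesis F1 : forall q, U q -> dot (F q) (F q) = 1.
Hypothesis nu : ~ umbilic F u.
Local Notation i0 := (ix0 m2).
Local Notation i1 := (ix1 m2).

Lemma ix_lt2 (x : 'I_m -> R) : x i0 = 0 -> x i1 = 0 ->
  forall i : 'I_m, (i < 2)%N -> x i = 0.
Proof.
move=> h0 h1 [[|[|k]] lk] //= _.
  by rewrite -h0; congr x; apply: val_inj.
by rewrite -h1; congr x; apply: val_inj.
Qed.

Lemma moebius_const (mu0 : R) : mu0 != 0 -> m%:R / (m%:R - 1) * (4 * mu0 ^+ 2) != 0 :> R.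
Proof.
move=> m0; rewrite !mulf_neq0 ?expf_neq0 ?invr_neq0 //.
- by rewrite pnatr_eq0 -lt0n (ltnW m2).
- by rewrite subr_eq0 pnatr_eq1 gtn_eqF.
Qed.

(** The distribution D^perp is defined by quantifying over all adapted frames. It can be
computed in one of them because it is the null space of the traceless second
fundamental form. *)
Lemma distr_perpE e n1 n2 l1 l2 mu0 v : wintgen_frame F u e n1 n2 l1 l2 mu0 ->
  distr_perp F u v <-> frame_co F u e i0 v = 0 /\ frame_co F u e i1 v = 0.
Proof.
move=> wf; have m0 := wintgen_mu0_neq0 m2 oU Uu sF F1 wf nu.
have M w := wintgen_moebius m2 oU Uu sF F1 wf v w.
split=> [H|/(wintgen_sff0_null m2 oU Uu sF F1 wf v m0) N w].
  have K (k : 'I_m) : (k < 2)%N -> frame_co F u e k v = 0.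
    move=> k2; have /H : canonical_distr F u (e k).
      exists e, n1, n2, l1, l2, mu0, (fun i => (i == k)%:R); split=> //.
      rewrite (bigD1 k) //= eqxx scale1r big1 ?addr0 // => i /andP[_ /negbTE ->].
      by rewrite scale0r.
    rewrite M => /eqP; rewrite mulf_eq0 (negbTE (moebius_const m0)) => /eqP.
    exact.
  by split; apply: K.
move=> [e' [n1' [n2' [l1' [l2' [mu0' [a [wf' ->]]]]]]]].
have m0' := wintgen_mu0_neq0 m2 oU Uu sF F1 wf' nu.
have [c0 c1] := (wintgen_sff0_null m2 oU Uu sF F1 wf' v m0').1 N.
rewrite M; apply/eqP; rewrite mulf_eq0; apply/orP; right; apply/eqP.
rewrite fff_sym (fff_sum_l Uu sF) big1 // => i i2.
have z : fff F u v (e' i) = 0 := ix_lt2 (x := fun i => frame_co F u e' i v) c0 c1 i2.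
by rewrite fff_sym z mulr0.
Qed.
End PerpDistribution.

Section Push.
Variables (R : realType) (m : nat).
Variables (U U' : set 'rV[R]_m) (F F' : 'rV[R]_m -> 'rV[R]_m.+3) (phi : 'rV[R]_m -> 'rV[R]_m).
Variable u : 'rV[R]_m.
Hypotheses (oU : open U) (Uu : U u) (sF : smooth_on U F) (oU' : open U') (sF' : smooth_on U' F').
Hypothesis F1 : forall q, U q -> dot (F q) (F q) = 1.
Hypothesis F1' : forall q, U' q -> dot (F' q) (F' q) = 1.
Hypotheses (sphi : smooth_on U phi) (UU' : forall q, U q -> U' (phi q)).
Hypothesis FE : forall q, U q -> F q = F' (phi q).

Lemma push_derive q v : U q -> 'D_v F q = 'D_('D_v phi q) F' (phi q).
Proof.
move=> Uq; rewrite (derive_eq_on v oU Uq FE).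
exact: derive_comp (smooth_diff sphi Uq) (smooth_diff sF' (UU' Uq)).
Qed.

Lemma push_fff v w : fff F u v w = fff F' (phi u) ('D_v phi u) ('D_w phi u).
Proof. by rewrite /fff !push_derive. Qed.

(** The second derivative of F' o phi contains a tangential term from phi'', which a normal
vector does not see. *)
Lemma push_hess n v w : (forall v', dot n ('D_v' F' (phi u)) = 0) ->
  dot (hess F u v w) n = dot (hess F' (phi u) ('D_v phi u) ('D_w phi u)) n.
Proof.
move=> nT; have dphi := smooth_diff sphi Uu; have U'u := UU' Uu.
pose a k q : R := ('D_w phi q) 0 k.
pose b k q : R := dot ('D_(basis_vec R k) F' (phi q)) n.
have da k : differentiable (a k) u.
  have /differentiable_mxP := smooth_diff (smooth_derive w sphi) Uu; exact.
have dD k : differentiable (fun q => 'D_(basis_vec R k) F' (phi q)) u.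
  exact: differentiable_compo dphi (smooth_diff (smooth_derive _ sF') U'u).
have dn q : differentiable (fun _ : 'rV[R]_m => n) q by exact: differentiable_cst.
have Ddot (g : 'rV[R]_m -> 'rV[R]_m.+3) : differentiable g u ->
    'D_v (fun q => dot (g q) n) u = dot ('D_v g u) n.
  by move=> dg; rewrite (dv_dot v dg (dn u)) derive_cst dot0r addr0.
have db k : differentiable (b k) u.
  rewrite (_ : b k = \sum_(i < m.+3) (fun q => 'D_(basis_vec R k) F' (phi q) 0 i * n 0 i)).
    apply: differentiable_sum => i; apply: differentiableM; last exact: differentiable_cst.
    by have /differentiable_mxP := dD k; apply.
  by apply/funext => q; rewrite fct_sumE.
have E1 : dot (hess F u v w) n = 'D_v (fun q => \sum_k a k q * b k q) u.
  rewrite /hess -Ddot; last exact: smooth_diff (smooth_derive w sF) Uu.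
  apply: (derive_eq_on v oU Uu) => q Uq.
  rewrite (push_derive w Uq) derive_rV; last exact: smooth_diff sF' (UU' Uq).
  by rewrite dot_suml; apply: eq_bigr => k _; rewrite dotZl.
have b0 k : b k u = 0 by rewrite /b dotC nT.
apply: (etrans E1); apply: (etrans (dv_sum_mul v da db b0)).
rewrite [in RHS](rV_basis ('D_w phi u)) (hess_sum_r oU' U'u sF') dot_suml.
apply: eq_bigr => k _; rewrite dotZl; congr (_ * _).
have E2 : 'D_v (fun q => 'D_(basis_vec R k) F' (phi q)) u =
    hess F' (phi u) ('D_v phi u) (basis_vec R k).
  exact: derive_comp dphi (smooth_diff (smooth_derive _ sF') U'u).
by apply: (etrans (Ddot _ (dD k))); rewrite E2.
Qed.

Variables (e : 'I_m -> 'rV[R]_m) (n1 n2 : 'rV[R]_m.+3) (l1 l2 mu0 : R).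
Hypothesis wf : wintgen_frame F u e n1 n2 l1 l2 mu0.
Let e' i := 'D_(e i) phi u.

(** Adapted frames are geometric: the differential of a reparametrization maps them to
adapted frames with the same normals and the same invariants. *)
Lemma push_wintgen : wintgen_frame F' (phi u) e' n1 n2 l1 l2 mu0.
Proof.
have [eON nON S1 S2] := wf; have U'u := UU' Uu.
have eON' i j : fff F' (phi u) (e' i) (e' j) = (i == j)%:R by rewrite -eON push_fff.
have nON' : orthonormal_normals F' (phi u) n1 n2.
  have [n11 n22 n12 [n1F n2F] nT] := nON; split=> //; first by rewrite -FE.
  move=> v'; rewrite (frame_coord U'u sF' eON' v') derive_sumv; last exact: smooth_diff sF' U'u.
  rewrite !dot_sumr !big1 // => k _; rewrite deriveZv ?dotZr; try exact: smooth_diff sF' U'u.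
    by rewrite /e' -push_derive // (nT (e k)).2 mulr0.
  by rewrite /e' -push_derive // (nT (e k)).1 mulr0.
have [_ _ _ _ nT'] := nON'.
split=> //.
  rewrite -S1; apply/matrixP => i j; rewrite !mxE.
  rewrite (dot_sff1 oU' U'u sF' F1' eON' nON') (dot_sff1 oU Uu sF F1 eON nON).
  exact: esym (push_hess (e i) (e j) (fun v' => (nT' v').1)).
rewrite -S2; apply/matrixP => i j; rewrite !mxE.
rewrite (dot_sff2 oU' U'u sF' F1' eON' nON') (dot_sff2 oU Uu sF F1 eON nON).
exact: esym (push_hess (e i) (e j) (fun v' => (nT' v').2)).
Qed.

Lemma push_fco k v : frame_co F u e k v = frame_co F' (phi u) e' k ('D_v phi u).
Proof. by rewrite /frame_co push_fff. Qed.

End Push.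

(** * The derivative of the mean curvature spheres *)

Section MatrixDerivatives.
Variables (R : realType) (V : normedModType R).

Lemma dv_row_mx p q (f : V -> 'rV[R]_p) (g : V -> 'rV[R]_q) a v :
  differentiable f a -> differentiable g a ->
  differentiable (fun x => row_mx (f x) (g x)) a /\
  'D_v (fun x => row_mx (f x) (g x)) a = row_mx ('D_v f a) ('D_v g a).
Proof.
move=> df dg; have /differentiable_mxP df' := df; have /differentiable_mxP dg' := dg.
have El k : (fun x => row_mx (f x) (g x) 0 (lshift q k)) = (fun x => f x 0 k).
  by apply/funext => x; rewrite row_mxEl.
have Er k : (fun x => row_mx (f x) (g x) 0 (rshift p k)) = (fun x => g x 0 k).
  by apply/funext => x; rewrite row_mxEr.
have d : differentiable (fun x => row_mx (f x) (g x)) a.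
  apply/differentiable_mxP => i j; rewrite ord1.
  by case: (split_ordP j) => k ->; rewrite ?El ?Er.
split=> //; apply/rowP => j; rewrite (derive_mxE v 0 j d).
by case: (split_ordP j) => k ->; rewrite ?El ?Er ?row_mxEl ?row_mxEr derive_mxE.
Qed.

Lemma dv_scale_mx p q (k : V -> R) (g : V -> 'M[R]_(p, q)) a v :
  differentiable k a -> differentiable g a ->
  differentiable (fun x => k x *: g x) a /\
  'D_v (fun x => k x *: g x) a = 'D_v k a *: g a + k a *: 'D_v g a.
Proof.
move=> dk dg; have /differentiable_mxP dg' := dg.
have E i j : (fun x => (k x *: g x) i j) = (fun x => k x * g x i j).
  by apply/funext => x; rewrite mxE.
have d : differentiable (fun x => k x *: g x) a.
  by apply/differentiable_mxP => i j; rewrite E; exact: differentiableM.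
split=> //; apply/matrixP => i j; rewrite (derive_mxE v i j d) E dvM //.
by rewrite 3!mxE derive_mxE.
Qed.

Lemma dv_scalar_mx (k : V -> R) a v : differentiable k a ->
  differentiable (fun x => (k x)%:M : 'rV[R]_1) a /\
  'D_v (fun x => (k x)%:M : 'rV[R]_1) a = ('D_v k a)%:M.
Proof.
move=> dk; have E i j : (fun x => ((k x)%:M : 'rV[R]_1) i j) = k.
  by apply/funext => x; rewrite mxE !ord1 mulr1n.
have d : differentiable (fun x => (k x)%:M : 'rV[R]_1) a.
  by apply/differentiable_mxP => i j; rewrite E.
split=> //; apply/matrixP => i j; rewrite (derive_mxE v i j d) E mxE.
by rewrite !ord1 mulr1n.
Qed.

Lemma dv_addmx p q (f g : V -> 'M[R]_(p, q)) a v :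
  differentiable f a -> differentiable g a ->
  differentiable (fun x => f x + g x) a /\
  'D_v (fun x => f x + g x) a = 'D_v f a + 'D_v g a.
Proof.
move=> df dg; split; first exact: differentiableD.
by apply: deriveD; exact: diff_derivable.
Qed.

Lemma diff_dot p (f g : V -> 'rV[R]_p) a : differentiable f a -> differentiable g a ->
  differentiable (fun x => dot (f x) (g x)) a.
Proof.
move=> /differentiable_mxP df /differentiable_mxP dg.
have -> : (fun x => dot (f x) (g x)) = \sum_(i < p) (fun x => f x 0 i * g x 0 i).
  by apply/funext => x; rewrite fct_sumE.
by apply: differentiable_sum => i; exact: differentiableM.
Qed.
End MatrixDerivatives.

Section MeanCurvatureSmooth.
Variables (R : realType) (m : nat) (U : set 'rV[R]_m) (F : 'rV[R]_m -> 'rV[R]_m.+3).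
Hypotheses (oU : open U) (sF : smooth_on U F).
Hypothesis fr : forall q, U q -> exists e : 'I_m -> 'rV[R]_m,
  forall i j, fff F q (e i) (e j) = (i == j)%:R.

Lemma gram_unit q : U q ->
  \matrix_(i, j) fff F q (basis_vec R i) (basis_vec R j) \in unitmx.
Proof.
move=> Uq; have [e eON] := fr Uq.
have GE : \matrix_(i, j) fff F q (basis_vec R i) (basis_vec R j) = Jac F q *m (Jac F q)^T.
  by apply/matrixP => i j; rewrite !mxE /fff /dot; apply: eq_bigr => k _; rewrite !mxE.
pose E : 'M[R]_m := \matrix_i e i.
have H : E *m (Jac F q *m (Jac F q)^T *m E^T) = 1%:M.
  by rewrite -(frame_TT Uq sF eON) trmx_mul !mulmxA.
move: H; rewrite -GE; move: (\matrix_(i, j) _) => G H.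
have H2 := mulmx1C H; rewrite -mulmxA in H2.
by have [] := mulmx1_unit H2.
Qed.

Lemma smooth_gram_inv i j : smooth_on U (fun q => gram_inv F q i j).
Proof.
suff : smooth_on U (fun q => gram_inv F q) by move=> /(smooth_mxP oU); apply.
apply: (smooth_invmx oU) => [q Uq|]; first exact: gram_unit.
apply/(smooth_mxP oU) => k l.
apply: (smooth_ext oU (smooth_dot oU (smooth_derive (basis_vec R k) sF) (smooth_derive (basis_vec R l) sF))).
by move=> q _; rewrite mxE.
Qed.

Lemma smooth_sff v w : smooth_on U (fun q => sff F q v w).
Proof.
have sX : smooth_on U (fun q => 'D_v (fun q => 'D_w F q) q).
  exact: (smooth_derive v (smooth_derive w sF)).
apply: (smooth_mxsub oU); first apply: (smooth_mxsub oU) => //; last first.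
  by apply: (smooth_scale oU) => //; exact: smooth_dot.
apply: smooth_sum => // i _; apply: smooth_sum => // j _.
apply: (smooth_scale oU); last exact: smooth_derive.
apply: (smooth_mul oU); first exact: smooth_gram_inv.
by apply: (smooth_dot oU) => //; exact: smooth_derive.
Qed.

Lemma smooth_mean_curv : smooth_on U (fun q => mean_curv F q).
Proof.
apply: (smooth_scale oU); first exact: smooth_cst.
apply: smooth_sum => // i _; apply: smooth_sum => // j _.
by apply: (smooth_scale oU); [exact: smooth_gram_inv|exact: smooth_sff].
Qed.
End MeanCurvatureSmooth.

Section ComplexVectorAlgebra.
Variables (R : realType).

Lemma to_complex_sum n (I : finType) (X : I -> 'rV[R]_n) :
  to_complex (\sum_i X i) = \sum_i to_complex (X i).
Proof. by apply/rowP => j; rewrite !mxE !summxE rmorph_sum; apply: eq_bigr => i _; rewrite mxE. Qed.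
Lemma conj_to_complex n (Y : 'rV[R]_n) : conj_vec (to_complex Y) = to_complex Y.
Proof. by apply/rowP => j; rewrite !mxE /= oppr0. Qed.
Lemma conj_vecD n (X Y : 'rV[R[i]]_n) : conj_vec (X + Y) = conj_vec X + conj_vec Y.
Proof. by apply/rowP => j; rewrite !mxE rmorphD. Qed.
Lemma conj_vecZ n k (Y : 'rV[R[i]]_n) : conj_vec (k *: Y) = conjc k *: conj_vec Y.
Proof. by apply/rowP => j; rewrite !mxE rmorphM. Qed.
Lemma conj_vecN n (Y : 'rV[R[i]]_n) : conj_vec (- Y) = - conj_vec Y.
Proof. by apply/rowP => j; rewrite !mxE rmorphN. Qed.

Definition hatv n (y : 'rV[R]_n) : 'rV[R]_(1 + n) := row_mx 0 y.

Lemma lor_hatv n (y z : 'rV[R]_n) : lor (hatv y) (hatv z) = dot y z.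
Proof. by rewrite /lor !row_mxKl !row_mxKr !mxE mul0r oppr0 add0r. Qed.
Lemma lor_light_hatv n (y z : 'rV[R]_n) : lor (light_vec y) (hatv z) = dot y z.
Proof. by rewrite /lor !row_mxKl !row_mxKr !mxE mulr0 oppr0 add0r. Qed.
Lemma lor_light n (y z : 'rV[R]_n) : lor (light_vec y) (light_vec z) = dot y z - 1.
Proof. by rewrite /lor !row_mxKl !row_mxKr !mxE mulr1 addrC. Qed.
Lemma hatvD n (y z : 'rV[R]_n) : hatv (y + z) = hatv y + hatv z.
Proof. by rewrite /hatv add_row_mx addr0. Qed.
Lemma hatvZ n k (z : 'rV[R]_n) : hatv (k *: z) = k *: hatv z.
Proof. by rewrite /hatv scale_row_mx scaler0. Qed.
Lemma hatv_sum n (I : finType) (X : I -> 'rV[R]_n) : hatv (\sum_i X i) = \sum_i hatv (X i).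
Proof.
rewrite /hatv; elim/big_rec2: _ => [|i y1 y2 _ <-]; first by rewrite row_mx0.
by rewrite add_row_mx addr0.
Qed.
End ComplexVectorAlgebra.

(** The algebraic core of the Wintgen condition. Read in any orthonormal normal frame,
the two traceless forms combine to k l(v) l(w) with l = c_0 + i s c_1 a complex linear
form. The sign s = 1 or -1 tells whether the frame (a, b), (c, d) is a rotation or a
reflection of the adapted one. *)
Lemma wintgen_square (R : realType) (a b c d mu0 : R) :
  a * a + b * b = 1 -> c * c + d * d = 1 -> a * c + b * d = 0 ->
  exists (s : R) (k : R[i]), [/\ s * s = 1, k * conjc k = real_complex R (mu0 ^+ 2) &
    forall v0 v1 w0 w1 : R,
      Complex (a * (mu0 * (v0 * w1 + v1 * w0)) + b * (mu0 * (v0 * w0 - v1 * w1)))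
          (- (c * (mu0 * (v0 * w1 + v1 * w0)) + d * (mu0 * (v0 * w0 - v1 * w1))))
      = k * (Complex v0 (s * v1) * Complex w0 (s * w1))].
Proof.
move=> h1 h2 h3; pose s := a * d - b * c.
have s2 : s * s = 1.
  transitivity ((a * a + b * b) * (c * c + d * d) - (a * c + b * d) * (a * c + b * d)).
    by rewrite /s; ring.
  by rewrite h1 h2 h3; ring.
have cE : c = - (s * b).
  transitivity ((a * a + b * b) * c); first by rewrite h1 mul1r.
  transitivity (a * (a * c + b * d) - s * b); first by rewrite /s; ring.
  by rewrite h3; ring.
have dE : d = s * a.
  transitivity ((a * a + b * b) * d); first by rewrite h1 mul1r.
  transitivity (b * (a * c + b * d) + s * a); first by rewrite /s; ring.
  by rewrite h3; ring.
exists s, (Complex (mu0 * b) (- (s * mu0 * a))); split=> //.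
  apply: complexP => /=; last by ring.
  transitivity (mu0 ^+ 2 * (b * b + (s * s) * (a * a))); first by ring.
  by rewrite s2 mul1r addrC h1 mulr1.
move=> v0 v1 w0 w1; rewrite cE dE; apply: complexP => /=.
  transitivity (a * (mu0 * ((s * s) * (v0 * w1 + v1 * w0))) + b * (mu0 * (v0 * w0 - (s * s) * (v1 * w1)))).
    by rewrite s2 !mul1r.
  by ring.
transitivity (- (- (s * b) * (mu0 * (v0 * w1 + v1 * w0)) + s * a * (mu0 * (v0 * w0 - (s * s) * (v1 * w1))))).
  by rewrite s2 mul1r.
by ring.
Qed.

Section NormalDerivative.
Variables (R : realType) (m : nat) (U : set 'rV[R]_m) (F n n' : 'rV[R]_m -> 'rV[R]_m.+3).
Hypotheses (oU : open U) (sF : smooth_on U F).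
Hypothesis F1 : forall q, U q -> dot (F q) (F q) = 1.
Hypotheses (sn : smooth_on U n).
Hypothesis nON : forall q, U q -> orthonormal_normals F q (n q) (n' q).
Variables (q : 'rV[R]_m) (Uq : U q) (e : 'I_m -> 'rV[R]_m).
Hypothesis eON : forall i j, fff F q (e i) (e j) = (i == j)%:R.

Let dn : differentiable n q. Proof. exact: smooth_diff sn Uq. Qed.
Let dF : differentiable F q. Proof. exact: smooth_diff sF Uq. Qed.

Lemma derive_normal_tangent v w : dot ('D_v n q) ('D_w F q) = - dot (hess F q v w) (n q).
Proof.
have H x : U x -> dot (n x) ('D_w F x) = 0.
  by move=> Ux; have [_ _ _ _ nT] := nON Ux; have [] := nT w.
have := derive_eq_on v oU Uq H.
rewrite dv_cst (dv_dot v dn (smooth_diff (smooth_derive w sF) Uq)).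
by rewrite [dot (n q) _]dotC => /eqP; rewrite addr_eq0 => /eqP.
Qed.

(** The Weingarten formula; the last term is the normal connection. *)
Lemma derive_normal v : 'D_v n q =
  \sum_k (- dot (hess F q v (e k)) (n q)) *: 'D_(e k) F q + dot ('D_v n q) (n' q) *: n' q.
Proof.
rewrite {1}(normal_expand oU Uq sF F1 eON (nON Uq) ('D_v n q)).
have nF : dot ('D_v n q) (F q) = 0.
  have H x : U x -> dot (n x) (F x) = 0 by move=> Ux; have [_ _ _ []] := nON Ux.
  have := derive_eq_on v oU Uq H; rewrite dv_cst (dv_dot v dn dF).
  by have [_ _ _ _ nT] := nON Uq; rewrite (nT v).1 addr0.
have nn : dot ('D_v n q) (n q) = 0.
  have H x : U x -> dot (n x) (n x) = 1 by move=> Ux; have [] := nON Ux.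
  by have := derive_eq_on v oU Uq H; rewrite dv_cst (dv_dot v dn dn) [dot (n q) _]dotC; lra.
rewrite nF nn !scale0r !addr0; congr (_ + _); apply: eq_bigr => k _.
by rewrite derive_normal_tangent.
Qed.
End NormalDerivative.

Section GaussVector.
Variables (R : realType) (m : nat) (m2 : (2 <= m)%N).
Variables (U : set 'rV[R]_m) (F n1 n2 : 'rV[R]_m -> 'rV[R]_m.+3).
Hypotheses (oU : open U) (sF : smooth_on U F).
Hypothesis F1 : forall q, U q -> dot (F q) (F q) = 1.
Hypotheses (sn1 : smooth_on U n1) (sn2 : smooth_on U n2).
Hypothesis nON : forall q, U q -> orthonormal_normals F q (n1 q) (n2 q).
Hypothesis wp : forall q, U q -> wintgen_point F q.
Hypothesis nu : forall q, U q -> ~ umbilic F q.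
Local Notation i0 := (ix0 m2).
Local Notation i1 := (ix1 m2).

(** The Gauss vector xi = xi_1 - i xi_2 along the parametrization. *)
Definition gvec q := gauss_vec F q (n1 q) (n2 q).
Definition lvec q : 'rV[R[i]]_(1 + m.+3) := to_complex (light_vec (F q)).

Let sH : smooth_on U (fun q => mean_curv F q).
Proof.
apply: smooth_mean_curv => // q Uq.
have [e [? [? [? [? [? wf]]]]]] := wp Uq; have [eON _ _ _] := wf.
by exists e; exact: eON.
Qed.

Section OneNormal.
Variable n : 'rV[R]_m -> 'rV[R]_m.+3.
Hypothesis sn : smooth_on U n.

Let h q := dot (mean_curv F q) (n q).
Let sh : smooth_on U h. Proof. exact: (smooth_dot oU sH sn). Qed.

Lemma smooth_curv_sphere : smooth_on U (fun q => curv_sphere F q (n q)).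
Proof.
apply: (smooth_row_mx oU).
  apply/(smooth_mxP oU) => i j.
  by apply: (smooth_ext oU sh) => q _; rewrite mxE !ord1 mulr1n.
exact: (smooth_add oU sn (smooth_scale oU sh sF)).
Qed.

Lemma derive_curv_sphere q v : U q ->
  'D_v (fun q => curv_sphere F q (n q)) q =
    'D_v h q *: light_vec (F q) + hatv ('D_v n q + h q *: 'D_v F q).
Proof.
move=> Uq; have dh := smooth_diff sh Uq; have dn := smooth_diff sn Uq.
have dF := smooth_diff sF Uq.
have [d1 e1] := dv_scalar_mx v dh; have [d2 e2] := dv_scale_mx v dh dF.
have [d3 e3] := dv_addmx v dn d2; have [d4 e4] := dv_row_mx v d1 d3.
rewrite [LHS]e4 e1 e3 e2 /light_vec /hatv scale_row_mx add_row_mx addr0.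
rewrite scalemx1; congr row_mx.
by rewrite addrA [X in X + _]addrC addrA.
Qed.
End OneNormal.

Let xr n q := curv_sphere F q (n q).

Lemma gvec_coord q j : gvec q 0 j = Complex (xr n1 q 0 j) (- xr n2 q 0 j).
Proof. by rewrite !mxE; apply: complexP => /=; ring. Qed.

Lemma csmv_gvec : csmv U gvec.
Proof.
move=> j; have /(smooth_mxP oU) /(_ 0 j) s1 := smooth_curv_sphere sn1.
have /(smooth_mxP oU) /(_ 0 j) s2 := smooth_curv_sphere sn2.
split; first by apply: (smooth_ext oU s1) => q _; rewrite gvec_coord.
by apply: (smooth_ext oU (smooth_opp oU s2)) => q _; rewrite gvec_coord.
Qed.

Lemma csmv_lvec : csmv U lvec.
Proof.
move=> j; apply: (csm_ext oU (f := fun q => real_complex R (light_vec (F q) 0 j))) => [|q _]; last by rewrite [RHS]mxE.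
apply: (csm_real oU); have : smooth_on U (fun q => light_vec (F q)).
  by apply: (smooth_row_mx oU) => //; exact: smooth_cst.
by move=> /(smooth_mxP oU); apply.
Qed.

Lemma cDv_real (g : 'rV[R]_m -> 'rV[R]_(1 + m.+3)) q v : differentiable g q ->
  cDv v (fun x => to_complex (g x)) q = to_complex ('D_v g q).
Proof.
move=> dg; apply/rowP => j; rewrite cDvE mxE (derive_mxE v 0 j dg).
have e x : (to_complex (g x)) 0 j = real_complex R (g x 0 j) by rewrite mxE.
by under eq_fun do rewrite e; rewrite /cD /= dv_cst.
Qed.

Lemma cDv_lvec q v : U q -> cDv v lvec q = to_complex (hatv ('D_v F q)).
Proof.
move=> Uq; have dc : differentiable (fun _ : 'rV[R]_m => 1%:M : 'rV[R]_1) q.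
  exact: differentiable_cst.
have [d e] := dv_row_mx v dc (smooth_diff sF Uq).
by rewrite /lvec (cDv_real v d) e derive_cst.
Qed.

Lemma cDv_gvec q v : U q -> cDv v gvec q =
  to_complex ('D_v (xr n1) q) - 'i%C *: to_complex ('D_v (xr n2) q).
Proof.
move=> Uq; have d1 := smooth_diff (smooth_curv_sphere sn1) Uq.
have d2 := smooth_diff (smooth_curv_sphere sn2) Uq.
have /differentiable_mxP d2' := d2.
apply/rowP => j; rewrite cDvE.
have -> : (fun x => gvec x 0 j) = (fun x => Complex (xr n1 x 0 j) (- xr n2 x 0 j)).
  by apply/funext => x; rewrite gvec_coord.
have := derive_mxE v 0 j d1; have := derive_mxE v 0 j d2; rewrite /cD /=.
rewrite -/(xr n1) -/(xr n2).
move: (deriveN (diff_derivable (v := v) (d2' 0 j))) => E3 E2 E1.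
rewrite -E1 [X in Complex _ X](_ : _ = - ('D_v (xr n2) q) 0 j).
  move: ('D_v (xr n1) q) ('D_v (xr n2) q) => A B.
  by rewrite !mxE; apply: complexP => /=; ring.
by rewrite E2; exact: E3.
Qed.

Section AtPoint.
Variables (q : 'rV[R]_m) (Uq : U q).
Variables (e : 'I_m -> 'rV[R]_m) (nu1 nu2 : 'rV[R]_m.+3) (l1 l2 mu0 : R).
Hypothesis wf : wintgen_frame F q e nu1 nu2 l1 l2 mu0.

Let eON i j : fff F q (e i) (e j) = (i == j)%:R. Proof. by case: wf. Qed.
Let nuON : orthonormal_normals F q nu1 nu2. Proof. by case: wf. Qed.
Local Notation c k v := (frame_co F q e k v).

Lemma hess_traceless n v w : (forall v', dot n ('D_v' F q) = 0) -> dot n (F q) = 0 ->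
  dot (hess F q v w) n - dot (mean_curv F q) n * fff F q v w =
  dot n nu1 * (mu0 * (c i0 v * c i1 w + c i1 v * c i0 w)) +
  dot n nu2 * (mu0 * (c i0 v * c i0 w - c i1 v * c i1 w)).
Proof.
move=> nT nF.
have nE : n = dot n nu1 *: nu1 + dot n nu2 *: nu2.
  rewrite {1}(normal_expand oU Uq sF F1 eON nuON n) nF scale0r addr0.
  by rewrite big1 ?add0r // => k _; rewrite nT scale0r.
rewrite {1}nE dotDr !dotZr (wintgen_hess1 m2 oU Uq sF F1 wf) (wintgen_hess2 m2 oU Uq sF F1 wf).
rewrite (wintgen_mean_curv m2 oU Uq sF F1 wf) dotDl !dotZl ![dot _ n]dotC.
move: (dot n nu1) (dot n nu2) (fff _ _ _ _) (c _ _) (c _ _) (c _ _) (c _ _) => p1 p2 p3 p4 p5 p6 p7.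
by ring.
Qed.

Let hh n := fun x => dot (mean_curv F x) (n x).

(** The trace part of the Weingarten formula is cancelled by the term h F of the mean
curvature sphere; only the traceless second fundamental form remains. *)
Lemma derive_sphere n n' v : smooth_on U n ->
  (forall x, U x -> orthonormal_normals F x (n x) (n' x)) ->
  'D_v (fun x => curv_sphere F x (n x)) q =
    'D_v (hh n) q *: light_vec (F q) + dot ('D_v n q) (n' q) *: hatv (n' q)
    - \sum_k (dot (n q) nu1 * (mu0 * (c i0 v * c i1 (e k) + c i1 v * c i0 (e k))) +
              dot (n q) nu2 * (mu0 * (c i0 v * c i0 (e k) - c i1 v * c i1 (e k)))) *: hatv ('D_(e k) F q).
Proof.
move=> sn nON'; rewrite (derive_curv_sphere sn v Uq) -addrA; congr (_ + _).
have [_ _ _ [nF _] nT] := nON' _ Uq.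
have nT1 v' := (nT v').1.
rewrite {1}(derive_normal oU sF F1 sn nON' Uq eON v).
have dFE : 'D_v F q = \sum_k c k v *: 'D_(e k) F q.
  rewrite {1}(frame_coord Uq sF eON v) derive_sumv; last exact: smooth_diff sF Uq.
  by apply: eq_bigr => k _; rewrite deriveZv //; exact: smooth_diff sF Uq.
rewrite dFE; set th := dot _ (n' q); set hq := dot (mean_curv F q) (n q).
transitivity (hatv (th *: n' q + - \sum_k (dot (n q) nu1 * (mu0 * (c i0 v * c i1 (e k) + c i1 v * c i0 (e k))) +
              dot (n q) nu2 * (mu0 * (c i0 v * c i0 (e k) - c i1 v * c i1 (e k)))) *: 'D_(e k) F q)).
  congr hatv; rewrite addrAC addrC; congr (_ + _); rewrite scaler_sumr -big_split -sumrN.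
  apply: eq_bigr => k _ /=; rewrite scalerA -scalerDl -scaleNr; congr (_ *: _).
  by rewrite -(hess_traceless v (e k) nT1 nF) opprB addrC.
rewrite hatvD hatvZ; congr (_ + _); rewrite -sumrN hatv_sum -sumrN; apply: eq_bigr => k _.
by rewrite -scaleNr hatvZ scaleNr.
Qed.

End AtPoint.

End GaussVector.

(** * The differential of the Gauss vector *)

Section PureLor.
Variables (R : realType) (N : nat).
Implicit Types (A B C : 'rV[R[i]]_(1 + N)).

Lemma lor_comb0 A B C z : lor A B = 0 -> lor A C = 0 -> lor A (B + z *: C) = 0.
Proof. by move=> h1 h2; rewrite lorDr lorZr h1 h2 mulr0 addr0. Qed.

Lemma lor_comb3_null A B C (a1 b1 c1 a2 b2 c2 : R[i]) : lor A A = 0 -> lor B B = 0 ->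
  lor C C = 0 -> lor B A = 0 -> lor C A = 0 -> lor C B = 0 ->
  lor (a1 *: A + b1 *: B + c1 *: C) (a2 *: A + b2 *: B + c2 *: C) = 0.
Proof.
move=> h1 h2 h3 h4 h5 h6; rewrite !lorlin [lor A B]lorC [lor A C]lorC [lor B C]lorC h1 h2 h3 h4 h5 h6.
ring.
Qed.

Lemma lor_comb3_0 A B C D (a b c : R[i]) : lor D A = 0 -> lor D B = 0 -> lor D C = 0 ->
  lor D (a *: A + b *: B + c *: C) = 0.
Proof. by move=> h1 h2 h3; rewrite !lorDr !lorZr h1 h2 h3 !mulr0 !addr0. Qed.

Lemma lor_comb2_0 A B D (a b : R[i]) : lor D A = 0 -> lor D B = 0 ->
  lor D (a *: A + b *: B) = 0.
Proof. by move=> h1 h2; rewrite !lorDr !lorZr h1 h2 !mulr0 !addr0. Qed.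

Lemma lor_comb2_null A B (a b : R[i]) : lor A A = 0 -> lor B B = 0 -> lor B A = 0 ->
  lor (a *: A + b *: B) (a *: A + b *: B) = 0.
Proof. by move=> h1 h2 h3; rewrite !lorlin [lor A B]lorC h1 h2 h3; ring. Qed.

Lemma lor_comb2_two A B A' (a b a' b' c : R[i]) : lor A A' = c -> lor B B = 0 -> lor B A' = 0 ->
  lor A B = 0 -> lor (a *: A + b *: B) (a' *: A' + b' *: B) = a * a' * c.
Proof. by move=> h1 h2 h3 h4; rewrite !lorlin h1 h2 h3 h4; ring. Qed.

Lemma lor_comb3r A B C D (a b c x : R[i]) : lor A D = x -> lor B D = 0 -> lor C D = 0 ->
  lor (a *: A + b *: B + c *: C) D = a * x.
Proof. by move=> h1 h2 h3; rewrite !lorDl !lorZl h1 h2 h3 !mulr0 !addr0. Qed.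

Lemma lor_comb3l A B C D (a b c x y : R[i]) : lor D A = x -> lor D B = 0 -> lor D C = y ->
  lor D (a *: A + b *: B + c *: C) = a * x + c * y.
Proof. by move=> h1 h2 h3; rewrite !lorDr !lorZr h1 h2 h3 mulr0 addr0. Qed.

Lemma eta_solve (k l c h : R[i]) : k != 0 -> - (k * l) * c + h * (k * 1 * 1) = 0 -> h = c * l.
Proof. by move=> k0 H; apply: (mulfI k0); apply/eqP; rewrite -subr_eq0 -H; apply/eqP; ring. Qed.

Lemma factor_form A B C (k l c t : R[i]) :
  - (k * l) *: A + t *: B + (c * l) *: C = l *: (- k *: A + c *: C) + t *: B.
Proof. by apply/rowP => j; rewrite !mxE; ring. Qed.

Lemma self_opp0 (x : R[i]) : x = - x -> x = 0.
Proof.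
case: x => a b [] h1 h2; apply: complexP => /=; lra.
Qed.

Lemma lor_comb_null A B (s : R) : s * s = 1 -> lor A A = 1%:C%C -> lor A B = 0%:C%C ->
  lor B B = 1%:C%C -> lor (A + Complex 0 s *: B) (A + Complex 0 s *: B) = 0.
Proof.
move=> s2 h1 h2 h3; rewrite !lorlin [lor B A]lorC h1 h2 h3.
by apply: complexP => /=; ring: s2.
Qed.

Lemma lor_comb_two A B (s : R) : s * s = 1 -> lor A A = 1%:C%C -> lor A B = 0%:C%C ->
  lor B B = 1%:C%C -> lor (A + Complex 0 s *: B) (A + (- Complex 0 s) *: B) = 2.
Proof.
move=> s2 h1 h2 h3; rewrite !lorlin [lor B A]lorC h1 h2 h3.
by apply: complexP => /=; ring: s2.
Qed.

Lemma lor_comb_form A B C (s a b : R) : lor A C = a%:C%C -> lor B C = b%:C%C ->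
  lor (A + Complex 0 s *: B) C = Complex a (s * b).
Proof. by move=> h1 h2; rewrite lorDl lorZl h1 h2; apply: complexP => /=; ring. Qed.

Lemma conj_comb (A B : 'rV[R]_(1 + N)) (s : R) :
  conj_vec (to_complex A + Complex 0 s *: to_complex B) =
  to_complex A + (- Complex 0 s) *: to_complex B.
Proof. by apply/rowP => j; rewrite !mxE; apply: complexP => /=; ring. Qed.
End PureLor.

Section PureComplex.
Variables (R : realType) (N : nat).
Implicit Types (A B C Xv : 'rV[R]_N).

Lemma complex_pair A B C (h1 h2 : R) :
  to_complex (A + h1 *: C) - 'i%C *: to_complex (B + h2 *: C) =
  to_complex A - 'i%C *: to_complex B + Complex h1 (- h2) *: to_complex C.
Proof. by apply/rowP => j; rewrite !mxE; apply: complexP => /=; ring. Qed.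

Lemma gauss_assemble m Xv N1 N2 (Ek : 'I_m -> 'rV[R]_N) (dh1 dh2 th h1 h2 : R) (p1 p2 : 'I_m -> R) :
  to_complex (dh1 *: Xv + th *: N2 - \sum_k p1 k *: Ek k) -
  'i%C *: to_complex (dh2 *: Xv + (- th) *: N1 - \sum_k p2 k *: Ek k) =
  - (\sum_k Complex (p1 k) (- p2 k) *: to_complex (Ek k)) +
  ('i%C * real_complex R th) *: (to_complex N1 - 'i%C *: to_complex N2 + Complex h1 (- h2) *: to_complex Xv) +
  (Complex dh1 (- dh2) - 'i%C * real_complex R th * Complex h1 (- h2)) *: to_complex Xv.
Proof.
have -> : \sum_k Complex (p1 k) (- p2 k) *: to_complex (Ek k) =
    to_complex (\sum_k p1 k *: Ek k) - 'i%C *: to_complex (\sum_k p2 k *: Ek k).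
  rewrite !to_complex_sum scaler_sumr -sumrB; apply: eq_bigr => k _.
  by apply/rowP => j; rewrite !mxE; apply: complexP => /=; ring.
move: (\sum_k _) (\sum_k _) => A B.
by apply/rowP => j; rewrite !mxE; apply: complexP => /=; ring.
Qed.

Lemma sum_two_ix m (i0 i1 : 'I_m) (E : 'I_m -> 'rV[R[i]]_N) (k : R[i]) (l0 l1 : 'I_m -> R) (t : R) :
  i0 != i1 -> (forall j, l0 j = (j == i0)%:R) -> (forall j, l1 j = (j == i1)%:R) ->
  \sum_j (k * Complex (l0 j) (t * l1 j)) *: E j = k *: (E i0 + Complex 0 t *: E i1).
Proof.
move=> i01 h0 h1; rewrite (bigD1 i0) //= (bigD1 i1) /=; last by rewrite eq_sym i01.
rewrite big1 => [|j /andP[j0 j1]]; last first.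
  rewrite h0 h1 (negbTE j0) (negbTE j1) mulr0.
  by rewrite (_ : Complex 0 0 = 0) // mulr0 scale0r.
have a0 : l0 i0 = 1 by rewrite h0 eqxx.
have a1 : l0 i1 = 0 by rewrite h0 eq_sym (negbTE i01).
have b0 : l1 i0 = 0 by rewrite h1 (negbTE i01).
have b1 : l1 i1 = 1 by rewrite h1 eqxx.
by rewrite a0 a1 b0 b1 mulr0 mulr1 addr0 scalerDr scalerA (_ : Complex 1 0 = 1) // mulr1.
Qed.
End PureComplex.

Section GaussStructure.
Variables (R : realType) (m : nat) (m2 : (2 <= m)%N).
Variables (U : set 'rV[R]_m) (F n1 n2 : 'rV[R]_m -> 'rV[R]_m.+3).
Hypotheses (oU : open U) (sF : smooth_on U F).
Hypothesis F1 : forall q, U q -> dot (F q) (F q) = 1.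
Hypotheses (sn1 : smooth_on U n1) (sn2 : smooth_on U n2).
Hypothesis nON : forall q, U q -> orthonormal_normals F q (n1 q) (n2 q).
Hypothesis wp : forall q, U q -> wintgen_point F q.
Hypothesis nu : forall q, U q -> ~ umbilic F q.
Local Notation i0 := (ix0 m2).
Local Notation i1 := (ix1 m2).
Local Notation xi := (gvec F n1 n2).
Local Notation X := (lvec F).

Lemma normals_swap q (a b : 'rV[R]_m.+3) :
  orthonormal_normals F q a b -> orthonormal_normals F q b a.
Proof.
move=> [h1 h2 h3 [h4 h5] h6]; split=> //; first by rewrite dotC.
by move=> v; have [] := h6 v.
Qed.

Let csmx : csmv U xi. Proof. exact: csmv_gvec. Qed.
Let csmX : csmv U X. Proof. exact: csmv_lvec. Qed.

(** The complex linear form with kernel D^perp. *)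
Definition lform q e (s : R) v : R[i] :=
  Complex (frame_co F q e i0 v) (s * frame_co F q e i1 v).
(** The isotropic tangent vector e_1 + i s e_2 that represents the form lform. *)
Definition evec q (e : 'I_m -> 'rV[R]_m) (s : R) : 'rV[R[i]]_(1 + m.+3) :=
  to_complex (hatv ('D_(e i0) F q)) + Complex 0 s *: to_complex (hatv ('D_(e i1) F q)).

Lemma gvecE q : xi q = to_complex (hatv (n1 q)) - 'i%C *: to_complex (hatv (n2 q)) +
  Complex (dot (mean_curv F q) (n1 q)) (- dot (mean_curv F q) (n2 q)) *: X q.
Proof.
have cs n : curv_sphere F q n = hatv n + dot (mean_curv F q) n *: light_vec (F q).
  by rewrite /curv_sphere /hatv /light_vec scale_row_mx add_row_mx add0r scalemx1.
by rewrite /gvec /gauss_vec !cs /lvec; exact: complex_pair.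
Qed.

(** By the Weingarten formula d xi is a combination of E, xi and the light-like vector
X = (1, F), which are isotropic and mutually orthogonal. The form eta is still unknown. *)
Lemma gauss_pre q e nu1 nu2 l1 l2 mu0 : U q -> wintgen_frame F q e nu1 nu2 l1 l2 mu0 ->
  exists s k, [/\ s * s = 1, k * conjc k = real_complex R (mu0 ^+ 2) &
    exists th eta : 'rV[R]_m -> R[i], forall v, cDv v xi q =
      - (k * lform q e s v) *: evec q e s + th v *: xi q + eta v *: X q].
Proof.
move=> Uq wf; have [eON nuON _ _] := wf.
have [h11 h22 h12 [h1F h2F] hT] := nON Uq.
have nE n : (forall v', dot n ('D_v' F q) = 0) -> dot n (F q) = 0 ->
    n = dot n nu1 *: nu1 + dot n nu2 *: nu2.
  move=> nT nF; rewrite {1}(normal_expand oU Uq sF F1 eON nuON n) nF scale0r addr0.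
  by rewrite big1 ?add0r // => k _; rewrite nT scale0r.
have [v11 v22 v12 _ _] := nuON.
have E1 := nE _ (fun v => (hT v).1) h1F; have E2 := nE _ (fun v => (hT v).2) h2F.
set a := dot (n1 q) nu1 in E1; set b := dot (n1 q) nu2 in E1.
set c := dot (n2 q) nu1 in E2; set d := dot (n2 q) nu2 in E2.
have o11 : a * a + b * b = 1 by rewrite -h11 {1 2}E1 dot_on2.
have o22 : c * c + d * d = 1 by rewrite -h22 {1 2}E2 dot_on2.
have o12 : a * c + b * d = 0 by rewrite -h12 E1 E2 dot_on2.
have [s [k [s2 kk K]]] := wintgen_square mu0 o11 o22 o12.
exists s, k; split=> //.
pose th v := dot ('D_v n1 q) (n2 q).
pose h1 := dot (mean_curv F q) (n1 q); pose h2 := dot (mean_curv F q) (n2 q).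
exists (fun v => 'i%C * real_complex R (th v)).
exists (fun v => Complex ('D_v (fun x => dot (mean_curv F x) (n1 x)) q)
   (- 'D_v (fun x => dot (mean_curv F x) (n2 x)) q) - 'i%C * real_complex R (th v) * Complex h1 (- h2)) => v.
have th' : dot ('D_v n2 q) (n1 q) = - th v.
  have H x : U x -> dot (n2 x) (n1 x) = 0 by move=> Ux; have [_ _ + _ _] := nON Ux; rewrite dotC.
  have := derive_eq_on v oU Uq H.
  rewrite dv_cst (dv_dot v (smooth_diff sn2 Uq) (smooth_diff sn1 Uq)) [dot (n2 q) _]dotC.
  by move=> /eqP; rewrite addr_eq0 => /eqP.
rewrite (cDv_gvec oU sF sn1 sn2 wp v Uq).
pose p1 j := a * (mu0 * (frame_co F q e i0 v * frame_co F q e i1 (e j) + frame_co F q e i1 v * frame_co F q e i0 (e j))) +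
             b * (mu0 * (frame_co F q e i0 v * frame_co F q e i0 (e j) - frame_co F q e i1 v * frame_co F q e i1 (e j))).
pose p2 j := c * (mu0 * (frame_co F q e i0 v * frame_co F q e i1 (e j) + frame_co F q e i1 v * frame_co F q e i0 (e j))) +
             d * (mu0 * (frame_co F q e i0 v * frame_co F q e i0 (e j) - frame_co F q e i1 v * frame_co F q e i1 (e j))).
pose dh1 := 'D_v (fun x => dot (mean_curv F x) (n1 x)) q.
pose dh2 := 'D_v (fun x => dot (mean_curv F x) (n2 x)) q.
have D1 : 'D_v (fun x => curv_sphere F x (n1 x)) q = dh1 *: light_vec (F q) + th v *: hatv (n2 q)
    - \sum_j p1 j *: hatv ('D_(e j) F q) := derive_sphere m2 oU sF F1 wp Uq wf v sn1 nON.
have D2 : 'D_v (fun x => curv_sphere F x (n2 x)) q = dh2 *: light_vec (F q) + (- th v) *: hatv (n1 q)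
    - \sum_j p2 j *: hatv ('D_(e j) F q).
  by rewrite -th'; exact: (derive_sphere m2 oU sF F1 wp Uq wf v sn2 (fun x Ux => normals_swap (nON Ux))).
have S : \sum_j Complex (p1 j) (- p2 j) *: to_complex (hatv ('D_(e j) F q)) =
    (k * lform q e s v) *: evec q e s.
  have i01 : i0 != i1 by [].
  have H := sum_two_ix (fun j => to_complex (hatv ('D_(e j) F q))) (k * lform q e s v) s
    i01 (frame_co_e wf i0) (frame_co_e wf i1).
  rewrite -[RHS]H.
  by apply: eq_bigr => j _; rewrite /p1 /p2 K mulrA.
by rewrite D1 D2 gvecE (gauss_assemble _ _ _ _ _ _ _ h1 h2) S scaleNr.
Qed.

Lemma lor_XX q : U q -> lor (X q) (X q) = 0.
Proof. by move=> Uq; rewrite lor_to_complex lor_light F1 // subrr. Qed.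

Lemma lor_Xhat q y : dot (F q) y = 0 -> lor (X q) (to_complex (hatv y)) = 0.
Proof. by move=> h; rewrite lor_to_complex lor_light_hatv h. Qed.

Lemma lor_hat (y z : 'rV[R]_m.+3) :
  lor (to_complex (hatv y)) (to_complex (hatv z)) = real_complex R (dot y z).
Proof. by rewrite lor_to_complex lor_hatv. Qed.

Lemma conj_gvec q : conj_vec (xi q) = to_complex (hatv (n1 q)) + 'i%C *: to_complex (hatv (n2 q)) +
  Complex (dot (mean_curv F q) (n1 q)) (dot (mean_curv F q) (n2 q)) *: X q.
Proof.
rewrite gvecE !conj_vecD conj_vecN !conj_vecZ !conj_to_complex.
congr (_ + _ + _); last by rewrite /= opprK.
by rewrite -scaleNr; congr (_ *: _); apply: complexP => /=; ring.
Qed.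

Section Products.
Variables (q : 'rV[R]_m) (Uq : U q).
Variables (e : 'I_m -> 'rV[R]_m) (s : R).
Hypothesis eON : forall i j, fff F q (e i) (e j) = (i == j)%:R.
Hypothesis s2 : s * s = 1.

Let Fn1 : dot (F q) (n1 q) = 0. Proof. by have [_ _ _ [h _] _] := nON Uq; rewrite dotC. Qed.
Let Fn2 : dot (F q) (n2 q) = 0. Proof. by have [_ _ _ [_ h] _] := nON Uq; rewrite dotC. Qed.
Let FdF w : dot (F q) ('D_w F q) = 0. Proof. by have := dot_F_dF oU sF F1 w Uq. Qed.
Let n1T w : dot (n1 q) ('D_w F q) = 0. Proof. by have [_ _ _ _ h] := nON Uq; have [] := h w. Qed.
Let n2T w : dot (n2 q) ('D_w F q) = 0. Proof. by have [_ _ _ _ h] := nON Uq; have [] := h w. Qed.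

Lemma lor_Xxi : lor (X q) (xi q) = 0.
Proof. by rewrite gvecE !lorlin lor_XX // !lor_Xhat //; ring. Qed.

Lemma lor_Xxib : lor (X q) (conj_vec (xi q)) = 0.
Proof. by rewrite conj_gvec !lorlin lor_XX // !lor_Xhat //; ring. Qed.

Lemma lor_Xdhat w : lor (X q) (to_complex (hatv ('D_w F q))) = 0.
Proof. exact: lor_Xhat (FdF w). Qed.

Lemma conj_evec : conj_vec (evec q e s) =
  to_complex (hatv ('D_(e i0) F q)) + (- Complex 0 s) *: to_complex (hatv ('D_(e i1) F q)).
Proof.
exact: conj_comb.
Qed.

Lemma lor_XE : lor (X q) (evec q e s) = 0.
Proof. exact: lor_comb0 (lor_Xdhat _) (lor_Xdhat _). Qed.

Lemma lor_XEb : lor (X q) (conj_vec (evec q e s)) = 0.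
Proof. rewrite conj_evec; exact: lor_comb0 (lor_Xdhat _) (lor_Xdhat _). Qed.

Lemma lor_xidhat w : lor (xi q) (to_complex (hatv ('D_w F q))) = 0.
Proof. by rewrite gvecE lorDl lorBl !lorZl lor_Xdhat !lor_hat n1T n2T rmorph0; ring. Qed.

Lemma lor_xibdhat w : lor (conj_vec (xi q)) (to_complex (hatv ('D_w F q))) = 0.
Proof. by rewrite conj_gvec !lorDl !lorZl lor_Xdhat !lor_hat n1T n2T rmorph0; ring. Qed.

Lemma lor_xiE : lor (xi q) (evec q e s) = 0.
Proof. exact: lor_comb0 (lor_xidhat _) (lor_xidhat _). Qed.

Lemma lor_Exib : lor (evec q e s) (conj_vec (xi q)) = 0.
Proof. rewrite lorC; exact: lor_comb0 (lor_xibdhat _) (lor_xibdhat _). Qed.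

Let ii : 'i%C * 'i%C = -1 :> R[i]. Proof. by apply: complexP => /=; ring. Qed.

Lemma lor_xixi : lor (xi q) (xi q) = 0.
Proof.
have [h1 h2 h3 _ _] := nON Uq.
rewrite gvecE !lorlin ![lor (to_complex (hatv _)) (X q)]lorC !lor_Xhat // lor_XX // !lor_hat h1 h2 h3.
rewrite [dot (n2 q) _]dotC h3 rmorph0 rmorph1.
by transitivity (1 + 'i%C * 'i%C : R[i]); [ring|rewrite ii subrr].
Qed.

Lemma lor_xixib : lor (xi q) (conj_vec (xi q)) = 2.
Proof.
have [h1 h2 h3 _ _] := nON Uq.
rewrite conj_gvec gvecE !lorlin ![lor (to_complex (hatv _)) (X q)]lorC !lor_Xhat // lor_XX // !lor_hat h1 h2 h3.
rewrite [dot (n2 q) _]dotC h3 rmorph0 rmorph1.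
by transitivity (1 - 'i%C * 'i%C : R[i]); [ring|rewrite ii opprK].
Qed.

Let e01 : fff F q (e i0) (e i1) = 0. Proof. by rewrite eON. Qed.
Let e10 : fff F q (e i1) (e i0) = 0. Proof. by rewrite eON. Qed.
Let e00 : fff F q (e i0) (e i0) = 1. Proof. by rewrite eON eqxx. Qed.
Let e11 : fff F q (e i1) (e i1) = 1. Proof. by rewrite eON eqxx. Qed.
Let lor_hat_fff v w c : fff F q v w = c ->
  lor (to_complex (hatv ('D_v F q))) (to_complex (hatv ('D_w F q))) = real_complex R c.
Proof. by move=> <-; exact: lor_hat. Qed.

Lemma lor_EE : lor (evec q e s) (evec q e s) = 0.
Proof.
exact: lor_comb_null s2 (lor_hat_fff e00) (lor_hat_fff e01) (lor_hat_fff e11).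
Qed.

Lemma lor_EEb : lor (evec q e s) (conj_vec (evec q e s)) = 2.
Proof.
rewrite conj_evec.
exact: lor_comb_two s2 (lor_hat_fff e00) (lor_hat_fff e01) (lor_hat_fff e11).
Qed.

Lemma lor_Edhat w : lor (evec q e s) (to_complex (hatv ('D_w F q))) = lform q e s w.
Proof.
rewrite /lform /frame_co; exact: lor_comb_form (lor_hat_fff (fff_sym _ _ _ _)) (lor_hat_fff (fff_sym _ _ _ _)).
Qed.
End Products.

Lemma gvec_isotropic q v w : U q -> lor (cDv v xi q) (cDv w xi q) = 0.
Proof.
move=> Uq; have [e [nu1 [nu2 [l1 [l2 [mu0 wf]]]]]] := wp Uq; have [eON _ _ _] := wf.
have [s [k [s2 _ [th [eta D]]]]] := gauss_pre Uq wf.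
rewrite (D v) (D w).
apply: lor_comb3_null.
- exact: (lor_EE eON s2).
- exact: (lor_xixi Uq).
- exact: (lor_XX Uq).
- exact: (lor_xiE Uq).
- exact: (lor_XE Uq).
- exact: (lor_Xxi Uq).
Qed.

Section Structure.
Variables (q : 'rV[R]_m) (Uq : U q).

Let S w v z := lor (cDv w (cDv v xi) q) (cDv z xi q).

(** <D_w D_v xi, D_z xi> is symmetric in w and v, and antisymmetric in v and z since
d xi is isotropic. Such a trilinear form vanishes. *)
Lemma gvec_hess_orth w v z : S w v z = 0.
Proof.
have sym a b d : S a b d = S b a d by rewrite /S (cDv_swap a b oU csmx Uq).
have anti a b d : S a b d = - S a d b.
  rewrite /S [in RHS]lorC.
  exact: cD_lor_const oU (csmv_cDv b csmx) (csmv_cDv d csmx) (fun x => gvec_isotropic b d (q := x)) Uq.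
have H : S w v z = - S w v z.
  by rewrite {1}anti (sym w z v) (anti z w v) opprK (sym z v w) (anti v z w) (sym v w z).
exact: self_opp0.
Qed.

Lemma gvec_hess_xi w v : lor (cDv w (cDv v xi) q) (xi q) = 0.
Proof.
have H x : U x -> lor (cDv v xi x) (xi x) = 0.
  move=> Ux; have [e [nu1 [nu2 [l1 [l2 [mu0 wf]]]]]] := wp Ux.
  have [s [k [s2 _ [th [eta D]]]]] := gauss_pre Ux wf.
  rewrite D lorC; exact: lor_comb3_0 (lor_xiE Ux e s) (lor_xixi Ux) (etrans (lorC _ _) (lor_Xxi Ux)).
rewrite (cD_lor_const w oU (csmv_cDv v csmx) csmx H Uq).
by rewrite (gvec_isotropic v w Uq) oppr0.
Qed.

Variables (e : 'I_m -> 'rV[R]_m) (nu1 nu2 : 'rV[R]_m.+3) (l1 l2 mu0 : R).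
Hypothesis wf : wintgen_frame F q e nu1 nu2 l1 l2 mu0.

(** The integrability condition: since D_w D_v xi is orthogonal to D_z xi, to xi, and has
product k l(v) l(w) with X, the unknown form eta of gauss_pre is a multiple of l. Hence
d xi is a multiple of one isotropic vector Z modulo xi, and the factor is the form l. *)
Theorem gauss_structure : exists s Z (th : 'rV[R]_m -> R[i]),
  [/\ s * s = 1,
     forall v, cDv v xi q = lform q e s v *: Z + th v *: xi q,
     [/\ lor (xi q) (xi q) = 0, lor (xi q) Z = 0 & lor Z Z = 0],
     [/\ lor (xi q) (conj_vec (xi q)) = 2, lor Z (conj_vec (xi q)) = 0 &
         lor Z (conj_vec Z) = real_complex R (2 * mu0 ^+ 2)] &
     lor (X q) (xi q) = 0 /\ lor (X q) Z = 0].
Proof.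
have [eON nuON _ _] := wf.
have m0 := wintgen_mu0_neq0 m2 oU Uq sF F1 wf (nu Uq).
have [s [k [s2 kk [th [eta D]]]]] := gauss_pre Uq wf.
pose E := evec q e s; pose l v := lform q e s v.
have k0 : k != 0.
  apply: contra_neq m0 => k0; move: kk; rewrite k0 mul0r => /(congr1 (@complex.Re R)) /= /esym /eqP.
  by rewrite sqrf_eq0 => /eqP.
have lX v : lor (cDv v xi q) (X q) = 0.
  rewrite D lorC; exact: lor_comb3_0 (lor_XE Uq e s) (lor_Xxi Uq) (lor_XX Uq).
have HX w v : lor (cDv w (cDv v xi) q) (X q) = k * l v * l w.
  have H x : U x -> lor (cDv v xi x) (X x) = 0.
    move=> Ux; have [e' [? [? [? [? [? wf']]]]]] := wp Ux.
    have [s' [k' [_ _ [th' [eta' D']]]]] := gauss_pre Ux wf'.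
    rewrite D' lorC; exact: lor_comb3_0 (lor_XE Ux e' s') (lor_Xxi Ux) (lor_XX Ux).
  rewrite (cD_lor_const w oU (csmv_cDv v csmx) csmX H Uq) (cDv_lvec sF w Uq) D.
  rewrite (lor_comb3r _ _ _ (lor_Edhat q e s w) (lor_xidhat Uq w) (lor_Xdhat Uq w)).
  by rewrite mulNr opprK.
have lw : l (e i0) = 1.
  by apply: complexP; rewrite /= (frame_co_e wf) ?eqxx // mulr0.
pose c := lor (cDv (e i0) (cDv (e i0) xi) q) E.
have etaE v : eta v = c * l v.
  have := gvec_hess_orth (e i0) (e i0) v; rewrite /S D.
  rewrite (lor_comb3l _ _ _ erefl (gvec_hess_xi (e i0) (e i0)) (HX (e i0) (e i0))) -/E -/c lw.
  exact: eta_solve.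
exists s, ((- k) *: E + c *: X q), th; split=> //.
- by move=> v; rewrite D etaE; exact: factor_form.
- split; first exact: lor_xixi.
    exact: lor_comb2_0 (lor_xiE Uq e s) (etrans (lorC _ _) (lor_Xxi Uq)).
  exact: lor_comb2_null (lor_EE eON s2) (lor_XX Uq) (lor_XE Uq e s).
- split; first exact: lor_xixib.
    rewrite lorC; apply: lor_comb2_0; rewrite lorC; [exact: lor_Exib|exact: lor_Xxib].
  rewrite conj_vecD !conj_vecZ conj_to_complex.
  rewrite (lor_comb2_two _ _ _ _ (lor_EEb eON s2) (lor_XX Uq) (lor_XEb Uq e s) (etrans (lorC _ _) (lor_XE Uq e s))).
  rewrite rmorphN mulrNN kk; apply: complexP => /=; ring.
- by split; [exact: lor_Xxi|exact: lor_comb2_0 (lor_XE Uq e s) (lor_XX Uq)].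
Qed.
End Structure.
End GaussStructure.

(** * Cubical charts *)

Section BoxCharts.
Variables (R : realType) (m : nat).
Implicit Types (y : 'rV[R]_m).

Lemma rV_ballE (n : nat) (y : 'rV[R]_n) r z : ball y r z <-> `|y - z| < r.
Proof. by rewrite -ball_normE. Qed.

Lemma ball_open_box (y : 'rV[R]_m) r : 0 < r ->
  ball y r = open_box (fun i => y 0 i - r) (fun i => y 0 i + r).
Proof.
move=> r0; apply/seteqP; split=> z.
  move=> /rV_ballE h i; have := le_lt_trans (mx_coord_le (y - z) 0 i) h.
  by rewrite mxsubE ltr_norml; lra.
move=> h; apply/rV_ballE; pose c := \big[Num.max/0]_i `|y 0 i - z 0 i|.
have cr : c < r.
  by apply/bigmax_ltP; split=> // i _; have := h i; rewrite ltr_norml; lra.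
apply: le_lt_trans cr; apply: mx_norm_le; first exact: bigmax_ge_id.
by move=> i j; rewrite ord1 mxsubE; exact: (le_bigmax _ (fun k => `|y 0 k - z 0 k|) j).
Qed.

Lemma rV_ball_segment (n : nat) (y a b : 'rV[R]_n) r (t : R) : 0 <= t <= 1 ->
  `|y - a| < r -> `|y - b| < r -> `|y - (a + t *: (b - a))| < r.
Proof.
move=> /andP[t0 t1] ha hb.
have -> : y - (a + t *: (b - a)) = (1 - t) *: (y - a) + t *: (y - b).
  by apply/rowP => j; rewrite !mxE; ring.
apply: le_lt_trans (ler_normD _ _) _; rewrite !nrmZ ger0_norm ?subr_ge0 // (ger0_norm t0).
have [->|tn] := eqVneq t 0; first by rewrite mul0r addr0 subr0 mul1r.
have tp : 0 < t by rewrite lt_neqAle eq_sym tn.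
have : t * `|y - b| < t * r by rewrite ltr_pM2l.
have : (1 - t) * `|y - a| <= (1 - t) * r by apply: ler_wpM2l; [rewrite subr_ge0|exact: ltW].
lra.
Qed.

(** A diffeomorphism Phi of a neighbourhood of u0 onto a cube centred at Phi u0 (a ball
of the sup norm), with inverse h. *)
Definition box_chart (U : set 'rV[R]_m) u0 (Phi h : 'rV[R]_m -> 'rV[R]_m) r : Prop :=
  [/\ [/\ open U, U u0 & 0 < r], smooth_on U Phi, smooth_on (ball (Phi u0) r) h,
      forall u, U u -> ball (Phi u0) r (Phi u) /\ h (Phi u) = u &
      forall y, ball (Phi u0) r y -> U (h y) /\ Phi (h y) = y].

Lemma open_preimage_in (V W : topologicalType) (U : set V) (f : V -> W) (B : set W) :
  open U -> (forall u, U u -> {for u, continuous f}) -> open B ->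
  open (U `&` [set u | B (f u)]).
Proof.
move=> oU cf oB; rewrite openE => u [Uu Bu]; apply: nbhsI; first exact: open_nbhs_nbhs.
by apply: (cf u Uu); exact: open_nbhs_nbhs.
Qed.

Lemma box_chart_shrink U u0 Phi h r (U2 : set 'rV[R]_m) : box_chart U u0 Phi h r ->
  open U2 -> U2 u0 -> exists U3 r', [/\ box_chart U3 u0 Phi h r', U3 `<=` U2, U3 `<=` U & r' <= r].
Proof.
move=> [[oU Uu r0] sP sh H1 H2] oU2 U2u.
have bc : ball (Phi u0) r (Phi u0) by exact: ballxx.
have ch : {for Phi u0, continuous h} by apply: differentiable_continuous; exact: smooth_diff sh bc.
have : nbhs (Phi u0) (h @^-1` U2).
  by apply: ch; rewrite (H1 _ Uu).2; exact: open_nbhs_nbhs.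
move=> /nbhs_ballP[e /= e0 he].
pose r' := Num.min e r.
have sub : ball (Phi u0) r' `<=` ball (Phi u0) r by apply: le_ball; rewrite ge_min lexx orbT.
have sub2 : ball (Phi u0) r' `<=` ball (Phi u0) e by apply: le_ball; rewrite ge_min lexx.
exists (U `&` [set u | ball (Phi u0) r' (Phi u)]), r'.
have r'0 : 0 < r' by rewrite lt_min e0.
split; last by rewrite ge_min lexx orbT.
- split.
  + split=> //; last by split=> //; exact: ballxx.
    apply: open_preimage_in => //; last exact: ball_open.
    by move=> u Uu'; apply: differentiable_continuous; exact: smooth_diff sP Uu'.
  + exact: smooth_subset _ sP.
  + exact: smooth_subset _ sh.
  + by move=> u [Uu' Bu]; split=> //; have [] := H1 u Uu'.
  + move=> y By; have [h1 h2] := H2 y (sub _ By); split=> //; split=> //=; by rewrite h2.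
- by move=> u [Uu' /sub2/he /=]; rewrite (H1 u Uu').2.
- by move=> u [].
Qed.

Lemma inverse_box (U : set 'rV[R]_m) f u0 : open U -> U u0 -> smooth_on U f ->
  (forall v, 'D_v f u0 = 0 -> v = 0) ->
  exists U' h r, U' `<=` U /\ box_chart U' u0 f h r.
Proof.
move=> oU Uu fs inj.
have [U' [V' [h [[oU' U'u sub] [oV VE] h1 hs h2]]]] := inverse_function oU Uu fs inj.
have V'0 : V' (f u0) by rewrite VE; exists u0.
have /nbhs_ballP[r /= r0 hr] := open_nbhs_nbhs (conj oV V'0).
exists (U' `&` [set u | ball (f u0) r (f u)]), h, r.
split; first by move=> u [/sub].
split.
- split=> //; last by split=> //; exact: ballxx.
  apply: open_preimage_in => //; last exact: ball_open.
  by move=> u Uu'; apply: differentiable_continuous; exact: smooth_diff fs (sub _ Uu').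
- by apply: smooth_subset fs => u [/sub].
- exact: smooth_subset hr hs.
- by move=> u [U'u' Bu]; split=> //; exact: h1.
- move=> y By; have [a1 a2] := h2 y (hr _ By); split=> //; split=> //=; by rewrite a2.
Qed.
End BoxCharts.

Section FirstTwo.
Variables (R : realType) (m : nat) (m2 : (2 <= m)%N).

(** The projection p2 to the first two coordinates is written as a matrix product, which
gives its derivative; q2 y0 is its affine section through y0. *)
Definition P2 : 'M[R]_(m, 2) := \matrix_(i, j) (i == j :> nat)%:R.
Definition p2 (v : 'rV[R]_m) : 'rV[R]_2 := v *m P2.
Definition q2 (y0 : 'rV[R]_m) (z : 'rV[R]_2) : 'rV[R]_m := y0 + (z - p2 y0) *m P2^T.

Lemma p2E v j : p2 v 0 j = v 0 (widen_ord m2 j).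
Proof.
rewrite mxE (bigD1 (widen_ord m2 j)) //= mxE eqxx mulr1 big1 ?addr0 // => i ij.
by rewrite mxE (_ : (i == j :> nat) = false) ?mulr0 //; apply: contra_neqF ij => /eqP h; exact: val_inj.
Qed.

Lemma P2_inv : P2^T *m P2 = 1%:M.
Proof.
apply/matrixP => i j; rewrite !mxE (bigD1 (widen_ord m2 i)) //= !mxE /= eqxx mul1r big1 ?addr0.
  by rewrite -val_eqE.
move=> k ki; rewrite !mxE (_ : (k == i :> nat) = false) ?mul0r //.
by apply: contra_neqF ki => /eqP h; exact: val_inj.
Qed.

Lemma p2_q2 y0 z : p2 (q2 y0 z) = z.
Proof. by rewrite /p2 /q2 mulmxDl -mulmxA P2_inv mulmx1 addrC subrK. Qed.

Lemma p2B v w : p2 (v - w) = p2 v - p2 w. Proof. exact: mulmxBl. Qed.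
Lemma plaque_dirE v : plaque_dir v <-> p2 v = 0.
Proof.
split=> [h|/rowP h i i2].
  by apply/rowP => j; rewrite p2E h ?mxE //=.
by have := h (Ordinal i2); rewrite p2E mxE => <-; congr (v 0 _); exact: val_inj.
Qed.

Lemma p2_norm v : `|p2 v| <= `|v|.
Proof. by apply: mx_norm_le => // i j; rewrite ord1 p2E; exact: mx_coord_le. Qed.

Lemma P2T_norm (z : 'rV[R]_2) : `|z *m P2^T| <= `|z|.
Proof.
apply: mx_norm_le => // i j; rewrite ord1 mxE.
have [j2|j2] := ltnP j 2.
  rewrite (bigD1 (Ordinal j2)) //= big1 ?addr0 => [|k kj].
    by rewrite !mxE /= eqxx mulr1; exact: mx_coord_le.
  rewrite !mxE (_ : (j == k :> nat) = false) ?mulr0 //.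
  by apply: contra_neqF kj => /eqP h; exact: val_inj.
rewrite big1 ?normr0 // => k _; rewrite !mxE (_ : (j == k :> nat) = false) ?mulr0 //.
by apply/eqP => jk; have := ltn_ord k; rewrite -jk ltnNge j2.
Qed.

Lemma q2_ball y0 r z : `|p2 y0 - z| < r -> `|y0 - q2 y0 z| < r.
Proof.
apply: le_lt_trans; rewrite /q2 opprD addrA subrr sub0r normrN distrC.
exact: P2T_norm.
Qed.

Lemma p2_ball y0 r y : `|y0 - y| < r -> `|p2 y0 - p2 y| < r.
Proof. by apply: le_lt_trans; rewrite -p2B; exact: p2_norm. Qed.

Lemma diff_p2 y v : differentiable p2 y /\ 'D_v p2 y = p2 v.
Proof. exact: diff_mulmxr. Qed.

Lemma diff_q2 y0 z w : differentiable (q2 y0) z /\ 'D_w (q2 y0) z = w *m P2^T.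
Proof.
have e : q2 y0 = fun z => z *m P2^T + (y0 - p2 y0 *m P2^T).
  by apply/funext => z'; rewrite /q2 mulmxBl addrCA.
have [d1 d2] := diff_mulmxr P2^T z w.
rewrite e; split; first by apply: differentiableD => //; exact: differentiable_cst.
by rewrite deriveD ?d2 ?derive_cst ?addr0 //; exact: diff_derivable.
Qed.

Lemma smooth_q2 y0 (O : set 'rV[R]_2) : open O -> smooth_on O (q2 y0).
Proof.
move=> oO; apply: smooth_add => //; first exact: smooth_cst.
apply: smooth_mulmx => //; last exact: smooth_cst.
by apply: smooth_mxsub => //; [exact: smooth_id|exact: smooth_cst].
Qed.

(** A cube is convex, so a point is joined to its image under the section by a segment on
which the first two coordinates are constant. *)
Lemma const_on_plaques y0 r (g : 'rV[R]_m -> R) :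
  (forall y, ball y0 r y -> differentiable g y) ->
  (forall y d, ball y0 r y -> p2 d = 0 -> 'D_d g y = 0) ->
  forall y, ball y0 r y -> g y = g (q2 y0 (p2 y)).
Proof.
move=> dg g0 y /rV_ballE By; set a := q2 y0 (p2 y); pose d := y - a.
have Ba : `|y0 - a| < r by apply: q2_ball; exact: p2_ball.
have Bt (t : R) : 0 <= t <= 1 -> ball y0 r (a + t *: d).
  by move=> t01; apply/rV_ballE; exact: rV_ball_segment.
have [t [/andP[t0 t1] E]] := MVT_line (fun t t01 => dg _ (Bt t t01)).
have ad : a + d = y by rewrite addrC subrK.
apply/eqP; rewrite -subr_eq0 -ad E g0 //.
  by apply: Bt; rewrite !ltW.
by rewrite /d p2B /a p2_q2 subrr.
Qed.
End FirstTwo.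

(** * Maps of rank one over the complex numbers *)

Lemma cDv_comp (R : realType) (V W : normedModType R) N (f : W -> V) (g : V -> 'rV[R[i]]_N) a v :
  differentiable f a -> cdiffv g (f a) -> cDv v (fun x => g (f x)) a = cDv ('D_v f a) g (f a).
Proof.
move=> df dg; apply/rowP => j; rewrite [LHS]cDvE [RHS]cDvE; exact: (cD_comp v df (dg j)).
Qed.

Section NonVanishing.
Variables (R : realType) (V : normedModType R) (U : set V).

Lemma open_smooth_neq0 (g : V -> R) : open U -> smooth_on U g -> open (U `&` [set u | g u != 0]).
Proof.
move=> oU sg; rewrite openE => u [Uu /= gu]; apply: nbhsI; first exact: open_nbhs_nbhs.
have cg : {for u, continuous g} by apply: differentiable_continuous; exact: smooth_diff sg Uu.
have g0 : 0 < `|g u| by rewrite normr_gt0.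
apply: filterS (continuous_near_lt cg g0) => x /= h.
by apply: contraTneq h => ->; rewrite subr0 ltxx.
Qed.

Lemma open_csm_neq0 (f : V -> R[i]) : open U -> csm U f -> open (U `&` [set u | f u != 0]).
Proof.
move=> oU [f1 f2]; pose g x := complex.Re (f x) * complex.Re (f x) + complex.Im (f x) * complex.Im (f x).
have sg : smooth_on U g by apply: smooth_add => //; exact: smooth_mul.
have e x : (f x != 0) = (g x != 0).
  rewrite /g; case: (f x) => a b /=; congr negb; rewrite -!expr2 paddr_eq0 ?sqr_ge0 //.
  by rewrite !sqrf_eq0; apply/eqP/andP => [[-> ->]|[/eqP-> /eqP->]]; rewrite ?eqxx.
have -> : U `&` [set u | f u != 0] = U `&` [set u | g u != 0].
  by apply/seteqP; split=> x [Ux]; rewrite /= e.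
exact: open_smooth_neq0.
Qed.
End NonVanishing.

Lemma row_neq0 (K : nzRingType) n (X : 'rV[K]_n) : X != 0 -> exists j, X 0 j != 0.
Proof.
move=> X0; apply/existsP; rewrite -[[exists _, _]]negbK; apply: contra X0.
by rewrite negb_exists => /forallP h; apply/eqP/rowP => j; rewrite mxE; apply/eqP; have := h j; rewrite negbK.
Qed.

(** The quotient rule for xi / xi_a, obtained from xi = xi_a ze. *)
Lemma quotient_derivative (R : realType) N (a : 'I_N) (xi ze dxi dze Z : 'rV[R[i]]_N) (c l th : R[i]) :
  c != 0 -> xi = c *: ze -> ze 0 a = 1 -> dxi = l *: Z + th *: xi ->
  dxi = dxi 0 a *: ze + c *: dze -> dze = (l / c) *: (Z - Z 0 a *: ze).
Proof.
move=> c0 E za D D2; have da : dxi 0 a = l * Z 0 a + th * c by rewrite D E !mxE za mulr1.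
apply: (scalerI c0); rewrite scalerA mulrC divfK //.
have -> : c *: dze = dxi - dxi 0 a *: ze by rewrite {1}D2 addrC addKr.
by rewrite da D E scalerBr scalerDl opprD !scalerA addrACA subrr addr0.
Qed.

(** The complex number a + i b of the point (a, b). *)
Definition cx (R : realType) (w : 'rV[R]_2) : R[i] := Complex (w 0 0) (w 0 1).

Lemma cx_eq0 (R : realType) (w : 'rV[R]_2) : cx w = 0 -> w = 0.
Proof.
move=> [] h0 h1; apply/rowP => j; rewrite mxE.
by case: j => [[|[|//]] p]; [rewrite -[RHS]h0|rewrite -[RHS]h1]; congr (w 0 _); exact: val_inj.
Qed.

Lemma cx_basis0 (R : realType) : cx (basis_vec R 0) = 1.
Proof. by apply: complexP; rewrite /= !mxE. Qed.

(** The class of xi in projective space has a differential of complex rank one at q: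
modulo xi it is a nonzero complex form l times the vector Z. *)
Definition rank_one (R : realType) m N (xi : 'rV[R]_m -> 'rV[R[i]]_N) q
    (l th : 'rV[R]_m -> R[i]) (Z : 'rV[R[i]]_N) : Prop :=
  [/\ forall v, cDv v xi q = l v *: Z + th v *: xi q, forall c, Z <> c *: xi q &
      exists w, l w != 0].

Section CurveChart.
Variables (R : realType) (m : nat) (m2 : (2 <= m)%N) (N : nat).
Variables (U : set 'rV[R]_m) (xi : 'rV[R]_m -> 'rV[R[i]]_N) (u0 : 'rV[R]_m).
Hypotheses (oU : open U) (sxi : csmv U xi) (Uu0 : U u0) (xi0 : xi u0 != 0).
Hypothesis st : forall q, U q -> exists l th Z, rank_one xi q l th Z.
Variable K : 'M[R]_m.
Hypothesis Ku : K \in unitmx.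
Hypothesis stK : exists l th Z, rank_one xi u0 l th Z /\
  forall v, l v = 0 -> p2 (v *m K) = 0.

Section Quotient.
Variable a : 'I_N.
Let W1 := U `&` [set u | xi u 0 a != 0].
Let ze u := (xi u 0 a)^-1 *: xi u.
Let oW1 : open W1. Proof. exact: open_csm_neq0. Qed.
Let ca : csm W1 (fun u => xi u 0 a). Proof. by apply: csm_subset (sxi a) => u []. Qed.

Lemma quotient_coord u : W1 u -> ze u 0 a = 1.
Proof. by move=> [_ /= h]; rewrite mxE mulVf. Qed.

Lemma quotient_smooth : csmv W1 ze.
Proof.
move=> j; apply: (csm_ext oW1 (f := fun u => (xi u 0 a)^-1 * xi u 0 j)); last by move=> u _; rewrite mxE.
apply: csm_mul => //; first by apply: csm_inv => // u [].
by apply: csm_subset (sxi j) => u [].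
Qed.

Lemma quotient_xi u : W1 u -> xi u = xi u 0 a *: ze u.
Proof. by move=> [_ /= h]; rewrite /ze scalerA divff // scale1r. Qed.

Lemma quotient_cDv u v l th Z : W1 u -> rank_one xi u l th Z ->
  cDv v ze u = (l v / xi u 0 a) *: (Z - Z 0 a *: ze u).
Proof.
move=> Wu [D _ _]; have [Uu /= c0] := Wu.
apply: (quotient_derivative c0 (quotient_xi Wu) (quotient_coord Wu) (D v)).
rewrite {1}(cDv_ext v oW1 Wu quotient_xi) cDv_scale ?cDvE //.
  exact: csm_cdiff ca Wu.
exact: csmv_cdiffv quotient_smooth Wu.
Qed.

Lemma quotient_dir u l th Z : W1 u -> rank_one xi u l th Z -> Z - Z 0 a *: ze u != 0.
Proof.
by move=> Wu [_ nZ _]; apply/eqP => /eqP; rewrite subr_eq0 /ze scalerA => /eqP; exact: nZ.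
Qed.
End Quotient.

(** Let zeta = xi / xi_a. Its differential is a complex multiple of one vector Y, and
some coordinate f of zeta satisfies d zeta = df Y / Y_b. Hence f and m - 2 linear
coordinates transverse to its kernel form a chart, zeta is constant on the plaques of
this chart, and it is a holomorphic function zt of f. *)
Theorem curve_chart : exists (U1 : set 'rV[R]_m) (Phi h : 'rV[R]_m -> 'rV[R]_m)
    (r : R) (a : 'I_N) (zt : 'rV[R]_2 -> 'rV[R[i]]_N),
  let Q := ball (p2 (Phi u0)) r in
  [/\ U1 `<=` U, box_chart U1 u0 Phi h r,
   csmv Q zt /\ (forall z, Q z -> zt z 0 a = 1),
   forall z w, Q z -> cDv w zt z = cx w *: cDv (basis_vec R 0) zt z &
   forall u, U1 u -> [/\ xi u 0 a != 0, xi u = xi u 0 a *: zt (p2 (Phi u)) &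
     forall l th Z, rank_one xi u l th Z -> exists p t,
       [/\ p != 0, cDv (basis_vec R 0) zt (p2 (Phi u)) = p *: Z + t *: xi u &
        forall v, cx (p2 ('D_v Phi u)) * (p * xi u 0 a) = l v]]].
Proof.
(* zeta is the quotient by the coordinate a, and f its coordinate b. *)
have [a ca0] := row_neq0 xi0.
pose W1 := U `&` [set u | xi u 0 a != 0]; pose ze u := (xi u 0 a)^-1 *: xi u.
have oW1 : open W1 by exact: open_csm_neq0.
have Wu0 : W1 u0 by [].
have sze : csmv W1 ze := quotient_smooth a.
have [l0 [th0 [Z0 [st0 lK]]]] := stK.
have [_ _ [w lw]] := st0.
have [b Yb] := row_neq0 (quotient_dir Wu0 st0).
pose f u := ze u 0 b.
have sf : csm W1 f := sze b.
(* Near u0 the derivative of f in one fixed direction w does not vanish. *)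
pose W2 := W1 `&` [set u | cD w f u != 0].
have oW2 : open W2 by apply: open_csm_neq0 => //; exact: csm_cD.
have Df u v l th Z : W1 u -> rank_one xi u l th Z ->
    cD v f u = l v / xi u 0 a * (Z - Z 0 a *: ze u) 0 b.
  by move=> Wu s; rewrite -[cD v f u](cDvE v ze) (quotient_cDv v Wu s) mxE.
have W2u0 : W2 u0.
  by split=> //=; rewrite (Df _ _ _ _ _ Wu0 st0) !mulf_neq0 // invr_neq0.
have Dze u l th Z : W2 u -> rank_one xi u l th Z ->
    (Z - Z 0 a *: ze u) 0 b != 0 /\
    forall v, cDv v ze u = cD v f u *: (((Z - Z 0 a *: ze u) 0 b)^-1 *: (Z - Z 0 a *: ze u)).
  move=> [Wu /= dw] s; have Y0 : (Z - Z 0 a *: ze u) 0 b != 0.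
    by apply: contra_neq dw => h; rewrite (Df _ _ _ _ _ Wu s) h mulr0.
  split=> // v; rewrite (quotient_cDv v Wu s) (Df _ _ _ _ _ Wu s) [RHS]scalerA mulfK //.
pose fr u : 'rV[R]_2 := \row_j (if j == 0 then complex.Re (f u) else complex.Im (f u)).
have sfr : smooth_on W2 fr.
  apply/(smooth_mxP oW2) => i j; rewrite ord1.
  have [s1 s2] : csm W2 f by apply: csm_subset sf => u [].
  case: (eqVneq j 0) => [->|j0].
    by apply: (smooth_ext oW2 s1) => u _; rewrite mxE.
  by apply: (smooth_ext oW2 s2) => u _; rewrite mxE (negbTE j0).
have Dfr u v : W2 u -> cx ('D_v fr u) = cD v f u.
  move=> Wu; have d := smooth_diff sfr Wu; apply: complexP; rewrite /= (derive_mxE v 0 _ d).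
    by congr ('D_v _ u); apply/funext => x; rewrite mxE.
  by congr ('D_v _ u); apply/funext => x; rewrite mxE.
pose C : 'M[R]_m := K *m (1%:M - P2 R m *m (P2 R m)^T).
pose Phi u := fr u *m (P2 R m)^T + u *m C.
have p2Phi u : p2 (Phi u) = fr u.
  rewrite /p2 mulmxDl -!mulmxA mulmxBl mul1mx -!mulmxA P2_inv //.
  by rewrite !mulmx1 subrr !mulmx0 addr0.
have sPhi : smooth_on W2 Phi.
  apply: smooth_add => //; first by apply: smooth_mulmx => //; exact: smooth_cst.
  exact: smooth_mulmxr.
have p2D u v : W2 u -> p2 ('D_v Phi u) = 'D_v fr u.
  move=> Wu; have [d1 <-] := diff_p2 (Phi u) ('D_v Phi u).
  rewrite -(derive_comp v (smooth_diff sPhi Wu) d1).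
  by congr ('D_v _ u); apply/funext => x; exact: p2Phi.
have DPhi u v : W2 u -> 'D_v Phi u = 'D_v fr u *m (P2 R m)^T + v *m C.
  move=> Wu; have df := smooth_diff sfr Wu.
  have [c1 c2] := diff_mulmxr C u v.
  have [d1 d2] := diff_mulmxr (P2 R m)^T (fr u) ('D_v fr u).
  have [_ ->] := dv_addmx v (differentiable_compo df d1) c1.
  by rewrite c2 (derive_comp v df d1) d2.
have inj v : 'D_v Phi u0 = 0 -> v = 0.
  move=> h; have f0 : 'D_v fr u0 = 0 by rewrite -p2D // h /p2 mul0mx.
  have : l0 v = 0.
    have := Dfr _ v W2u0; rewrite f0 (Df _ _ _ _ _ Wu0 st0) => /esym/eqP.
    rewrite (_ : cx 0 = 0); last by apply: complexP; rewrite /= mxE.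
    by rewrite !mulf_eq0 invr_eq0 (negbTE ca0) (negbTE Yb) !orbF => /eqP.
  move=> /lK k0; have := DPhi _ v W2u0; rewrite h f0 mul0mx add0r /C mulmxA mulmxBr mulmx1 mulmxA.
  rewrite -/(p2 _) k0 mul0mx subr0 => /esym vK.
  by rewrite -(mulmxK Ku v) vK mul0mx.
have [U1 [h [r [sub bc]]]] := inverse_box oW2 W2u0 sPhi inj.
have [[oU1 U1u0 r0] _ sh bc1 bc2] := bc.
pose y0 := Phi u0; pose zt z := ze (h (q2 y0 z)).
have bq z : ball (p2 y0) r z -> ball y0 r (q2 y0 z).
  by move=> /rV_ballE hz; apply/rV_ballE; exact: q2_ball.
have obq : open (ball (p2 y0) r) by exact: ball_open.
have obr : open (ball y0 r) by exact: ball_open.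
have sze2 : csmv W2 ze by apply: csmv_subset sze => u [].
have szh : csmv (ball y0 r) (fun y => ze (h y)).
  by move=> j; apply: (csm_comp obr oW2 _ sh (sze2 j)) => y /bc2[/sub].
have szt : csmv (ball (p2 y0) r) zt.
  by move=> j; apply: (csm_comp obq obr _ (smooth_q2 y0 obq) (szh j)).
have hW y : ball y0 r y -> W2 (h y) by move=> /bc2[/sub].
have hU y : ball y0 r y -> U (h y) by move=> /hW[[]].
(* In the chart, f is the first complex coordinate. *)
have Dh y v : ball y0 r y -> cD ('D_v h y) f (h y) = cx (p2 v).
  move=> By; rewrite -Dfr; last exact: hW.
  have dh := smooth_diff sh By.
  rewrite -(derive_comp v dh (smooth_diff sfr (hW _ By))).
  have [_ <-] := diff_p2 y v; congr (cx _).
  by apply: (derive_eq_on v obr By) => x Bx; rewrite -p2Phi (bc2 _ Bx).2.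
have Dzh y v l th Z : ball y0 r y -> rank_one xi (h y) l th Z ->
    cDv v (fun y => ze (h y)) y = cx (p2 v) *:
      (((Z - Z 0 a *: ze (h y)) 0 b)^-1 *: (Z - Z 0 a *: ze (h y))).
  move=> By s; have [_ D] := Dze _ _ _ _ (hW _ By) s.
  have dh := smooth_diff sh By.
  by rewrite -(Dh _ v By) -D (cDv_comp v dh (csmv_cdiffv sze2 (hW _ By))).
(* zeta is constant on the plaques. *)
have cst y : ball y0 r y -> ze (h y) = zt (p2 y).
  have key j d y' : ball y0 r y' -> p2 d = 0 -> cD d (fun y => ze (h y) 0 j) y' = 0.
    move=> By d0; have [l [th [Z s]]] := st (hU _ By).
    rewrite -(cDvE d (fun y => ze (h y))) (Dzh _ _ _ _ _ By s) d0.
    by rewrite (_ : cx 0 = 0) ?scale0r ?mxE //; apply: complexP; rewrite /= mxE.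
  move=> By; apply/rowP => j; apply: complexP.
    apply: (const_on_plaques m2 (g := fun y => complex.Re (ze (h y) 0 j)) (r := r)) => //.
      by move=> y' By'; have [d _] := csmv_cdiffv szh By' j.
    by move=> y' d By' d0; have [] := key j d y' By' d0.
  apply: (const_on_plaques m2 (g := fun y => complex.Im (ze (h y) 0 j)) (r := r)) => //.
    by move=> y' By'; have [_ d] := csmv_cdiffv szh By' j.
  by move=> y' d By' d0; have [] := key j d y' By' d0.
have Dzt z v l th Z : ball (p2 y0) r z -> rank_one xi (h (q2 y0 z)) l th Z ->
    cDv v zt z = cx v *: (((Z - Z 0 a *: zt z) 0 b)^-1 *: (Z - Z 0 a *: zt z)).
  move=> Bz s; have [dq eq] := diff_q2 y0 z v.
  have -> : cDv v zt z = cDv ('D_v (q2 y0) z) (fun y => ze (h y)) (q2 y0 z).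
    exact: (cDv_comp (g := fun y => ze (h y)) v dq (csmv_cdiffv szh (bq _ Bz))).
  by rewrite eq (Dzh _ _ _ _ _ (bq _ Bz) s) /p2 -mulmxA P2_inv // mulmx1.
exists U1, Phi, h, r, a, zt; split=> //.
- by move=> u /sub[[]].
- by split=> // z Bz; apply: quotient_coord; have [] := hW _ (bq _ Bz).
- move=> z v Bz; have [l [th [Z s]]] := st (hU _ (bq _ Bz)).
  by rewrite !(Dzt _ _ _ _ _ Bz s) cx_basis0 scale1r.
move=> u U1u; have [Wu dw] := sub _ U1u; have [Uu ca] := Wu.
have [Bu hu] := bc1 _ U1u.
have zu : ze u = zt (p2 (Phi u)) by rewrite -cst // hu.
have xu : xi u = xi u 0 a *: zt (p2 (Phi u)) by rewrite -zu; exact: quotient_xi.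
split=> // l th Z s.
have Bpu : ball (p2 y0) r (p2 (Phi u)).
  by apply/rV_ballE; apply: (p2_ball m2); exact/rV_ballE.
have [Y0 D] := Dze _ _ _ _ (sub _ U1u) s.
pose Yb' := (Z - Z 0 a *: ze u) 0 b.
exists (Yb'^-1), (- (Yb'^-1 * (Z 0 a / xi u 0 a))); split; first by rewrite invr_neq0.
- have [l' [th' [Z' s']]] := st (hU _ (bq _ Bpu)).
  have D1 := Dzt _ (basis_vec R 0) _ _ _ Bpu s'.
  rewrite cx_basis0 scale1r in D1.
  set Y1 := _ *: _ in D1.
  have ch v : cDv v ze u = cD v f u *: Y1.
    have -> : cDv v ze u = cDv ('D_v fr u) zt (fr u).
      have -> : cDv v ze u = cDv v (fun x => zt (fr x)) u.
        by apply: (cDv_ext v oU1 U1u) => x U1x; rewrite -p2Phi -cst ?(bc1 _ U1x).2 //; exact: (bc1 _ U1x).1.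
      apply: (cDv_comp v (smooth_diff sfr (sub _ U1u))).
      by apply: csmv_cdiffv szt _; rewrite -p2Phi.
    rewrite -(Dfr u v (sub _ U1u)) -p2Phi; exact: (Dzt _ ('D_v fr u) _ _ _ Bpu s').
  rewrite D1; have := ch w; rewrite D => /(scalerI dw) <-.
  by rewrite -/Yb' scalerBr scaleNr !scalerA -mulrA.
- move=> v; rewrite p2D ?Dfr ?(Df _ _ _ _ _ Wu s); try exact: sub.
  rewrite -/Yb'; have Y0' : Yb' != 0 by [].
  by field; rewrite Y0' ca.
Qed.
End CurveChart.

(** * Spacelike spans of isotropic vectors *)

Lemma gt0_complexE (R : realType) (z : R[i]) : (0 < z) = (complex.Im z == 0) && (0 < complex.Re z).
Proof. by rewrite ltcE /= eq_sym. Qed.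

Lemma gt0_real_complex (R : realType) (x : R) : (0 < real_complex R x) = (0 < x).
Proof. by rewrite gt0_complexE /= eqxx. Qed.

Lemma ge0_mul_conjc (R : realType) (z : R[i]) : 0 <= z * conjc z.
Proof.
case: z => x y; rewrite lecE /=; apply/andP; split; first by apply/eqP; ring.
by have := sqr_ge0 x; have := sqr_ge0 y; rewrite !expr2; lra.
Qed.

Lemma gt0_mul_conjc (R : realType) (z : R[i]) : z != 0 -> 0 < z * conjc z.
Proof.
move=> z0; rewrite lt_neqAle ge0_mul_conjc andbT eq_sym mulf_neq0 //.
by apply: contra_neq z0; case: z => x y [-> /eqP]; rewrite oppr_eq0 => /eqP ->.
Qed.

(** An isotropic vector has real and imaginary parts of equal length, orthogonal to each
other. *)
Lemma lor_re (R : realType) n (X : 'rV[R[i]]_(1 + n)) : lor X X = 0 ->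
  real_complex R (2 * lor (re_vec X) (re_vec X)) = lor X (conj_vec X).
Proof.
move=> h0.
have E : X + conj_vec X = to_complex (re_vec X) + to_complex (re_vec X).
  apply/rowP => j; rewrite !mxE; case: (X 0 j) => p q; apply: complexP => /=; ring.
have h0' : lor (conj_vec X) (conj_vec X) = 0 by rewrite lor_conj h0 conjc0.
have := congr1 (fun Y => lor Y Y) E; rewrite /= !lorDl !lorDr h0 h0' [lor (conj_vec X) X]lorC lor_to_complex.
move=> H; apply: (mulfI (x := 2)); first by rewrite pnatr_eq0.
rewrite rmorphM rmorph_nat; transitivity (2 * (2 * real_complex R (lor (re_vec X) (re_vec X)))); first ring.
set r := real_complex R _ in H *; set q := lor X _ in H *.
transitivity (r + r + (r + r)); first ring.
by rewrite -H; ring.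
Qed.

Section SpacelikePair.
Variables (R : realType) (n : nat).
Implicit Types (X Y Z : 'rV[R[i]]_(1 + n)).

Definition normal_part X Y := Y - (lor Y (conj_vec X) / lor X (conj_vec X)) *: X.

(** X is a lift of an isotropic curve and Y its complex derivative. The last two clauses
state, after orthogonalisation, that the Hermitian form is positive definite on their
span. *)
Definition spacelike_pair X Y : Prop :=
  [/\ lor X X = 0, lor X Y = 0, lor Y Y = 0, 0 < lor X (conj_vec X) &
      0 < lor (normal_part X Y) (conj_vec (normal_part X Y))].

Lemma normal_part_orth X Y : 0 < lor X (conj_vec X) -> lor (normal_part X Y) (conj_vec X) = 0.
Proof. by move=> h; rewrite lorBl lorZl divfK ?subrr // gt_eqF. Qed.

Lemma normal_part_comb X Y (c d : R[i]) : 0 < lor X (conj_vec X) ->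
  normal_part X (c *: X + d *: Y) = d *: normal_part X Y.
Proof.
move=> h; have h0 : lor X (conj_vec X) != 0 by rewrite gt_eqF.
rewrite /normal_part lorDl !lorZl.
apply/rowP => j; rewrite !mxE; field; exact: h0.
Qed.

Lemma normal_part_scale X Y (c : R[i]) : c != 0 -> 0 < lor X (conj_vec X) ->
  normal_part (c *: X) Y = normal_part X Y.
Proof.
move=> c0 h; have cc0 : conjc c != 0.
  by apply: contra_neq c0; case: (c) => x y [-> /eqP]; rewrite oppr_eq0 => /eqP ->.
rewrite /normal_part conj_vecZ !lorZl !lorZr scalerA; congr (_ - _ *: _).
by field; rewrite cc0 c0 gt_eqF.
Qed.

Lemma spacelike_pair_comb X Y (c d e : R[i]) : c != 0 -> d != 0 ->
  spacelike_pair X Y -> spacelike_pair (c *: X) (e *: X + d *: Y).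
Proof.
move=> c0 d0 [h1 h2 h3 h4 h5].
have p1 : 0 < lor (c *: X) (conj_vec (c *: X)).
  rewrite conj_vecZ lorZl lorZr mulrA; apply: mulr_gt0 => //; exact: gt0_mul_conjc.
split; [| | |exact: p1|].
- by rewrite !lorlin h1 !mulr0.
- by rewrite !lorlin h1 h2 !mulr0 addr0.
- by rewrite !lorlin [lor Y X]lorC h1 h2 h3 !mulr0 !addr0.
rewrite (normal_part_scale _ c0 h4) (normal_part_comb Y e d h4).
rewrite conj_vecZ lorZl lorZr mulrA; apply: mulr_gt0 => //; exact: gt0_mul_conjc.
Qed.

Variables X Y : 'rV[R[i]]_(1 + n).
Hypothesis sp : spacelike_pair X Y.

Lemma pair_pos (c d : R[i]) : (c != 0) || (d != 0) ->
  0 < lor (c *: X + d *: Y) (conj_vec (c *: X + d *: Y)).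
Proof.
have [h1 h2 h3 h4 h5] := sp; move=> cd.
set k := lor Y (conj_vec X) / lor X (conj_vec X).
have -> : c *: X + d *: Y = (c + d * k) *: X + d *: normal_part X Y.
  by rewrite /normal_part -/k; apply/rowP => j; rewrite !mxE; ring.
have o := normal_part_orth Y h4.
have o' : lor X (conj_vec (normal_part X Y)) = 0.
  have : conjc (lor (normal_part X Y) (conj_vec X)) = 0 by rewrite o conjc0.
  rewrite -lor_conj lorC => <-; congr lor; apply/rowP => j.
  by rewrite [RHS]mxE [in RHS]mxE conjcK.
move: (normal_part X Y) o o' h5 => W o o' h5.
set A := lor X _ in h4 *; set B := lor W _ in h5.
rewrite conj_vecD !conj_vecZ !lorlin o o' -/A -/B.
have -> : (c + d * k) * (conjc (c + d * k) * A) + (c + d * k) * (conjc d * 0) +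
   (d * (conjc (c + d * k) * 0) + d * (conjc d * B)) =
   ((c + d * k) * conjc (c + d * k)) * A + (d * conjc d) * B by ring.
have [d0|d0] := eqVneq d 0.
  rewrite d0 !mul0r !addr0; apply: mulr_gt0 => //; apply: gt0_mul_conjc.
  by move: cd; rewrite d0 eqxx orbF.
apply: ltr_wpDl; first by apply: mulr_ge0; [exact: ge0_mul_conjc|exact: ltW].
by apply: mulr_gt0 => //; exact: gt0_mul_conjc.
Qed.

(** A basis of the real osculating space. *)
Definition real_span : 'M[R]_(4, 1 + n) :=
  \matrix_(k < 4) nth 0 [:: re_vec X; im_vec X; re_vec Y; im_vec Y] k.

Lemma real_spanE (c : 'rV[R]_4) : c *m real_span =
  re_vec (Complex (c 0 0) (- c 0 1) *: X + Complex (c 0 (inord 2)) (- c 0 (inord 3)) *: Y).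
Proof.
have e0 : widen_ord (leqnSn 3) (widen_ord (leqnSn 2) (widen_ord (leqnSn 1) ord_max)) = 0 :> 'I_4 by exact: val_inj.
have e1 : widen_ord (leqnSn 3) (widen_ord (leqnSn 2) ord_max) = 1 :> 'I_4 by exact: val_inj.
have e2 : widen_ord (leqnSn 3) ord_max = inord 2 :> 'I_4 by apply: val_inj; rewrite /= inordK.
have e3 : ord_max = inord 3 :> 'I_4 by apply: val_inj; rewrite /= inordK.
rewrite mulmx_sum_row !big_ord_recr big_ord0 /= e0 e1 e2 e3 !rowK.
have -> : nth 0 [:: re_vec X; im_vec X; re_vec Y; im_vec Y] (inord 2 : 'I_4) = re_vec Y by rewrite inordK.
have -> : nth 0 [:: re_vec X; im_vec X; re_vec Y; im_vec Y] (inord 3 : 'I_4) = im_vec Y by rewrite inordK.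
move: (c 0 _) (c 0 _) (c 0 _) (c 0 _) => a0 a1 a2 a3 /=.
by apply/rowP => j; rewrite !mxE ?(ReM, ImM, ReD, ImD) /=; ring.
Qed.

(** A real combination of the rows is the real part of a complex combination of X and Y,
which is isotropic; its length is half the value of the Hermitian form. *)
Lemma real_span_pos (c : 'rV[R]_4) : c != 0 -> 0 < lor (c *m real_span) (c *m real_span).
Proof.
move=> c0; rewrite real_spanE.
set z := Complex _ _; set w := Complex _ _.
have [h1 h2 h3 h4 h5] := sp.
have zw : (z != 0) || (w != 0).
  rewrite -negb_and; apply: contra c0 => /andP[/eqP[q0 /eqP q1] /eqP[q2' /eqP q3]].
  rewrite !oppr_eq0 in q1 q3; apply/eqP/rowP => j; rewrite mxE.
  case: j => [[|[|[|[|//]]]] p].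
  - by rewrite -[RHS]q0; congr (c 0 _); exact: val_inj.
  - by rewrite -[RHS](eqP q1); congr (c 0 _); exact: val_inj.
  - by rewrite -[RHS]q2'; congr (c 0 _); apply: val_inj; rewrite /= inordK.
  - by rewrite -[RHS](eqP q3); congr (c 0 _); apply: val_inj; rewrite /= inordK.
have i0 : lor (z *: X + w *: Y) (z *: X + w *: Y) = 0.
  by rewrite !lorlin [lor Y X]lorC h1 h2 h3 !mulr0 !addr0.
have := pair_pos zw; rewrite -(lor_re i0) gt0_real_complex.
by rewrite pmulr_rgt0.
Qed.

Lemma real_span_inj (c : 'rV[R]_4) : c *m real_span = 0 -> c = 0.
Proof.
by move=> h; apply/eqP; apply: contraT => /real_span_pos; rewrite h lor0l ltxx.
Qed.

Lemma real_span_rank : \rank real_span = 4.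
Proof.
apply/eqP; change (row_free real_span); rewrite -kermx_eq0; apply/eqP/row_matrixP => i.
by rewrite row0; apply: real_span_inj; rewrite -row_mul mulmx_ker row0.
Qed.
End SpacelikePair.

Section ComplexSpan.
Variables (R : realType) (N p : nat) (A : 'M[R]_(p, N)).
Implicit Types (X Y Z : 'rV[R[i]]_N).

(** Membership in the complexification of the row space of A. *)
Definition csub Z : Prop := (re_vec Z <= A)%MS /\ (im_vec Z <= A)%MS.

Lemma csubD X Y : csub X -> csub Y -> csub (X + Y).
Proof.
move=> [h1 h2] [h3 h4]; split.
  have -> : re_vec (X + Y) = re_vec X + re_vec Y by apply/rowP => j; rewrite !mxE ReD.
  exact: addmx_sub.
have -> : im_vec (X + Y) = im_vec X + im_vec Y by apply/rowP => j; rewrite !mxE ImD.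
exact: addmx_sub.
Qed.

Lemma csubZ c X : csub X -> csub (c *: X).
Proof.
move=> [h1 h2]; split.
  have -> : re_vec (c *: X) = complex.Re c *: re_vec X + (- complex.Im c) *: im_vec X.
    by apply/rowP => j; rewrite !mxE ReM mulNr.
  by apply: addmx_sub; exact: scalemx_sub.
have -> : im_vec (c *: X) = complex.Re c *: im_vec X + complex.Im c *: re_vec X.
  by apply/rowP => j; rewrite !mxE ImM.
by apply: addmx_sub; exact: scalemx_sub.
Qed.
End ComplexSpan.

Lemma real_span_csub (R : realType) n (X Y : 'rV[R[i]]_(1 + n)) :
  csub (real_span X Y) X /\ csub (real_span X Y) Y.
Proof.
have r k (kp : (k < 4)%N) : (nth 0 [:: re_vec X; im_vec X; re_vec Y; im_vec Y] k <= real_span X Y)%MS.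
  by have := row_sub (Ordinal kp) (real_span X Y); rewrite rowK.
by split; split; [exact: (r 0%N)|exact: (r 1%N)|exact: (r 2%N)|exact: (r 3%N)].
Qed.

Lemma real_span_sub (R : realType) n p (X Y : 'rV[R[i]]_(1 + n)) (A : 'M[R]_(p, 1 + n)) :
  csub A X -> csub A Y -> (real_span X Y <= A)%MS.
Proof.
move=> [h1 h2] [h3 h4]; apply/row_subP => -[k kp]; rewrite rowK.
by case: k kp => [|[|[|[|//]]]].
Qed.

(** * Isotropic complex curves *)

Lemma dv_lor (R : realType) (V : normedModType R) n (f g : V -> 'rV[R]_(1 + n)) q v :
  differentiable f q -> differentiable g q ->
  'D_v (fun x => lor (f x) (g x)) q = lor ('D_v f q) (g q) + lor (f q) ('D_v g q).
Proof.
move=> df dg; have /differentiable_mxP df' := df; have /differentiable_mxP dg' := dg.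
have -> : (fun x => lor (f x) (g x)) =
    \sum_(i < 1 + n) (fun x => lsg R i * (f x 0 i * g x 0 i)).
  by apply/funext => x; rewrite fct_sumE lorE.
have dp i : differentiable (fun x => f x 0 i * g x 0 i) q by exact: differentiableM.
rewrite derive_sum => [|i]; last first.
  by apply: diff_derivable; apply: differentiableM => //; exact: differentiable_cst.
rewrite !lorE -big_split; apply: eq_bigr => i _ /=.
by rewrite dvM ?dv_cst ?mul0r ?add0r ?dvM -?derive_mxE ?mulrDr //; exact: differentiable_cst.
Qed.

Lemma derive_near0 (R : realType) (V : normedModType R) (f : V -> R) a v :
  (\forall x \near a, f x = 0) -> 'D_v f a = 0.
Proof.
move=> h; have ai : [set x | f x = 0]^° a := h.
have e x : [set x | f x = 0]^° x -> f x = (fun=> 0) x by move=> /nbhs_singleton.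
by rewrite (derive_eq_on v (@open_interior _ _) ai e) dv_cst.
Qed.

Lemma dbar_comb (R : realType) n (X Y : 'rV[R[i]]_n) (t0 t1 lam : R[i]) :
  2^-1 *: (t0 *: X + (lam * 1) *: Y + 'i%C *: (t1 *: X + (lam * 'i%C) *: Y)) =
  (2^-1 * (t0 + 'i%C * t1)) *: X.
Proof.
have ii : 'i%C * 'i%C = -1 :> R[i] by apply: complexP => /=; ring.
apply/rowP => j; rewrite !mxE; move: (X 0 j) (Y 0 j) => x y.
transitivity (2^-1 * (t0 + 'i%C * t1) * x + 2^-1 * (1 + 'i%C * 'i%C) * lam * y); first ring.
by rewrite ii subrr; ring.
Qed.

Lemma clineP (R : realType) n (X Y : 'rV[R[i]]_n) : cline X = cline Y ->
  exists2 c, c != 0 & X = c *: Y.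
Proof.
move=> e; have : cline X X by exists 1; [exact: oner_neq0|rewrite scale1r].
by rewrite e => -[c c0 <-]; exists c.
Qed.

Lemma cline_scale (R : realType) n (X : 'rV[R[i]]_n) c : c != 0 -> cline (c *: X) = cline X.
Proof.
move=> c0; apply/seteqP; split=> Y [d d0 <-].
  by exists (d * c); [exact: mulf_neq0|rewrite scalerA].
by exists (d / c); [exact: mulf_neq0 (invr_neq0 c0)|rewrite scalerA divfK].
Qed.

(** An isotropic holomorphic curve in affine normalisation (the coordinate a of
the lift zt is 1), on the image of a single chart b of the surface S. *)
Section CurveSection.
Variables (R : realType) (n : nat) (S : topologicalType) (b : chart R S 2).
Variables (zt : 'rV[R]_2 -> 'rV[R[i]]_(1 + n)) (a : 'I_(1 + n)).
Local Notation Q := (chart_im b).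
Local Notation zp := (cDv (basis_vec R 0) zt).
Hypotheses (bch : is_chart b) (bdom : chart_dom b = [set: S]).
Hypotheses (szt : csmv Q zt) (za : forall z, Q z -> zt z 0 a = 1).
Hypothesis hol : forall z w, Q z -> cDv w zt z = cx w *: zp z.
Hypothesis sp : forall z, Q z -> spacelike_pair (zt z) (zp z).

Definition curve_map (s : S) : set 'rV[R[i]]_(1 + n) := cline (zt (chart_map b s)).
Local Notation G := curve_map.

Let oQ : open Q. Proof. by case: bch. Qed.

Lemma chart_im_map s : Q (chart_map b s). Proof. by exists s => //; rewrite bdom. Qed.

Lemma chart_map_inv z : Q z -> chart_map b (chart_inv b z) = z.
Proof. by case: bch => _ _ h _ _ [s ds <-]; rewrite h. Qed.

Lemma std_lift : is_lift b G Q zt.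
Proof.
split=> //; first exact/csmooth_csmv.
by move=> z Qz; rewrite /G chart_map_inv.
Qed.

Section Lift.
Variables (O : set 'rV[R]_2) (eta : 'rV[R]_2 -> 'rV[R[i]]_(1 + n)) (z : 'rV[R]_2).
Hypotheses (L : is_lift b G O eta) (Oz : O z).
Local Notation X := (zt z).
Local Notation Y := (zp z).

Let oO : open O. Proof. by case: L. Qed.
Let OQ w : O w -> Q w. Proof. by case: L => _ h _ _ /h. Qed.
Let seta : csmv O eta. Proof. by case: L => _ _ h _; apply/csmooth_csmv. Qed.

Lemma lift_coord w : O w -> eta w 0 a != 0 /\ eta w = eta w 0 a *: zt w.
Proof.
case: L => _ _ _ h Ow; have := h _ Ow; rewrite /G chart_map_inv; last exact: OQ.
move=> /esym/clineP[c c0 E]; have e1 := za (OQ Ow).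
by rewrite E !mxE e1 mulr1.
Qed.

Let lam := eta z 0 a.
Lemma lift_lam0 : lam != 0. Proof. exact: (lift_coord Oz).1. Qed.
Lemma lift_val : eta z = lam *: X. Proof. exact: (lift_coord Oz).2. Qed.

Let th v := cD v (fun w => eta w 0 a) z.

(** Every lift is eta = eta_a zt, because zt has coordinate 1 at a; the derivative of the
factor only contributes multiples of zt. *)
Lemma lift_cderive v : cderive eta z v = th v *: X + (lam * cx v) *: Y.
Proof.
case: (L) => _ _ sO _; rewrite (cderiveE v oO sO Oz).
have e w : O w -> eta w = eta w 0 a *: zt w by move=> /lift_coord[].
rewrite (cDv_ext v oO Oz e) (cDv_scale v (csm_cdiff (seta a) Oz) (csmv_cdiffv szt (OQ Oz))).
by rewrite hol ?scalerA //; exact: OQ.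
Qed.

Let spz : spacelike_pair X Y. Proof. exact: sp (OQ Oz). Qed.

Let cx_neq0 (v : 'rV[R]_2) : v != 0 -> lam * cx v != 0.
Proof. by move=> v0; rewrite mulf_neq0 ?lift_lam0 //; apply: contra_neq v0; exact: cx_eq0. Qed.

Lemma lift_holomorphic : exists mu : R[i], dbar eta z = mu *: eta z.
Proof.
exists (2^-1 * (th (basis_vec R 0) + 'i%C * th (basis_vec R 1)) / lam).
rewrite /dbar !lift_cderive lift_val [RHS]scalerA divfK ?lift_lam0 //.
have c0 : cx (basis_vec R 0) = 1 by exact: cx_basis0.
have c1 : cx (basis_vec R 1) = 'i%C by apply: complexP; rewrite /= !mxE.
rewrite c0 c1; exact: dbar_comb.
Qed.

Lemma lift_immersion v : v != 0 -> ~ exists c : R[i], cderive eta z v = c *: eta z.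
Proof.
move=> v0 [c]; rewrite lift_cderive lift_val scalerA => E.
have h : (lam * cx v != 0) := cx_neq0 v0.
have := @pair_pos _ _ _ _ spz (th v - c * lam) (lam * cx v); rewrite h orbT => /(_ isT).
rewrite scalerBl addrAC E subrr.
by rewrite lor0l ltxx.
Qed.

Lemma lift_isotropic v w : lor (cderive eta z v) (cderive eta z w) = 0.
Proof.
have [h1 h2 h3 _ _] := spz; rewrite !lift_cderive !lorDl !lorDr !lorZl !lorZr.
by rewrite [lor Y X]lorC h1 h2 h3 !mulr0 !addr0.
Qed.

Lemma lift_spacelike v : v != 0 -> 0 < lor (cderive eta z v) (conj_vec (cderive eta z v)).
Proof. by move=> v0; rewrite lift_cderive; apply: (pair_pos spz); rewrite (cx_neq0 v0) orbT. Qed.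

(** Changing the lift multiplies the vectors by a factor that cancels in the quotient. *)
Lemma lift_herm v : herm eta z v = cx v * conjc (cx v) *
  (lor (normal_part X Y) (conj_vec (normal_part X Y)) / lor X (conj_vec X)).
Proof.
have [_ _ _ h4 _] := spz; have l0 := lift_lam0.
have cj (V W : 'rV[R[i]]_(1 + n)) : conjc (lor V W) = lor (conj_vec V) (conj_vec W) by rewrite lor_conj.
have cM (p q : R[i]) : conjc (p * q) = conjc p * conjc q by exact: rmorphM.
have cV (p : R[i]) : conjc p^-1 = (conjc p)^-1 by exact: fmorphV.
have cK (V : 'rV[R[i]]_(1 + n)) : conj_vec (conj_vec V) = V.
  by apply/rowP => j; rewrite !mxE conjcK.
pose E := eta z; pose D := cderive eta z v.
have -> : herm eta z v = (lor E (conj_vec E))^-1 * lor (normal_part E D) (conj_vec (normal_part E D)).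
  rewrite /herm -/E -/D; congr (_ * lor _ _).
  rewrite /normal_part conj_vecD conj_vecN conj_vecZ; congr (_ - _ *: _).
  by rewrite cM cV !cj !cK [lor (conj_vec E) E]lorC.
rewrite {}/E {}/D lift_val lift_cderive (normal_part_scale _ l0 h4) (normal_part_comb _ _ _ h4) !conj_vecZ !lorZl !lorZr.
move: (normal_part _ _) h4 => W; set A := lor X _; set B := lor W _ => A0.
have cl0 : conjc lam != 0 by rewrite fmorph_eq0.
rewrite cM; have An0 : A != 0 by rewrite gt_eqF.
by field; rewrite An0 cl0 l0.
Qed.

(** The osculating space is the same for all lifts: each lift and its derivatives are
complex combinations of zt and its derivative, and conversely. *)
Lemma osc_real_span : (osc_mx eta z :=: real_span X Y)%MS.
Proof.
have [s1 s2] := real_span_csub X Y.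
have cE : csub (real_span X Y) (eta z) by rewrite lift_val; exact: csubZ.
have cD v : csub (real_span X Y) (cderive eta z v).
  by rewrite lift_cderive; apply: csubD; exact: csubZ.
apply/eqmxP/andP; split.
  apply/row_subP => -[k kp]; rewrite rowK.
  have [e1 e2] := cE; have [d1 d2] := cD (basis_vec R 0); have [d3 d4] := cD (basis_vec R 1).
  by case: k kp => [|[|[|[|[|[|k]]]]]] kp; [exact: e1|exact: e2|exact: d1|exact: d3|exact: d2|exact: d4|].
have r k (kp : (k < 6)%N) : (nth 0 [:: re_vec (eta z); im_vec (eta z);
        re_vec (cderive eta z (basis_vec R 0));
        re_vec (cderive eta z (basis_vec R 1));
        im_vec (cderive eta z (basis_vec R 0));
        im_vec (cderive eta z (basis_vec R 1))] k <= osc_mx eta z)%MS.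
  by have := row_sub (Ordinal kp) (osc_mx eta z); rewrite rowK.
have oE : csub (osc_mx eta z) (eta z) by split; [exact: (r 0%N)|exact: (r 1%N)].
have oD : csub (osc_mx eta z) (cderive eta z (basis_vec R 0)).
  by split; [exact: (r 2%N)|exact: (r 4%N)].
have oX : csub (osc_mx eta z) X.
  have -> : X = lam^-1 *: eta z by rewrite lift_val scalerA mulVf ?scale1r // lift_lam0.
  exact: csubZ.
apply: real_span_sub => //.
have -> : Y = lam^-1 *: (cderive eta z (basis_vec R 0) + (- th (basis_vec R 0)) *: X).
  rewrite lift_cderive cx_basis0 mulr1 scaleNr addrAC subrr add0r scalerA mulVf ?scale1r //.
  exact: lift_lam0.
by apply: csubZ; apply: csubD => //; exact: csubZ.
Qed.
End Lift.

Theorem curve_is_complex : complex_curve [set b] G.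
Proof.
split.
- move=> s; exists (zt (chart_map b s)); have [h1 _ _ h4 _] := sp (chart_im_map s).
  by split.
- move=> _ s -> _; exists Q, zt; split; [exact: std_lift|exact: chart_im_map].
- by move=> _ O eta z -> L Oz; exact: lift_holomorphic L Oz.
- by move=> _ O eta z v -> L Oz v0; have := lift_immersion L Oz v0.
Qed.

Theorem curve_one_isotropic : one_isotropic [set b] G.
Proof. by move=> _ O eta z v w -> L Oz; have := lift_isotropic L Oz v w. Qed.

Theorem curve_spacelike_differential : spacelike_differential [set b] G.
Proof. by move=> _ O eta z v -> L Oz v0; have := lift_spacelike L Oz v0. Qed.

Theorem curve_osc_spacelike : osc_spacelike [set b] G.
Proof.
move=> _ O eta z -> L Oz; have Qz : Q z by case: L => _ h _ _; exact: h.
split; first by rewrite (osc_real_span L Oz) (real_span_rank (sp Qz)).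
move=> X; rewrite (osc_real_span L Oz) => /submxP[c ->] X0.
by apply: (real_span_pos (sp Qz)); apply: contraNneq X0 => ->; rewrite mul0mx.
Qed.

Lemma curve_envelopeE s y : envelope [set b] G (s, y) <->
  dot y y = 1 /\ forall X, (X <= real_span (zt (chart_map b s)) (zp (chart_map b s)))%MS ->
    lor X (light_vec y) = 0.
Proof.
split=> -[/= h1 h2]; split=> //.
  move=> X; rewrite -(osc_real_span std_lift (chart_im_map s)) => h.
  by apply: (h2 b Q zt X) => //; [exact: std_lift|rewrite bdom|exact: chart_im_map].
move=> _ O eta X /= -> L _ Oz; rewrite (osc_real_span L Oz); exact: h2.
Qed.

(** Differentiate <eta, (1, y)> = 0 along the curve: the derivative of eta stays in the
osculating space, which is orthogonal to (1, y). *)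
Theorem curve_tangent : tangent_to_family [set b] G (envelope [set b] G).
Proof.
move=> _ O eta z y -> L Oz dz dy H.
have [oO OQ sO _] := L; have [sr si] := sO.
have key (f : 'rV[R]_2 -> 'rV[R]_(1 + n)) : smooth_on O f ->
    (forall z, O z -> (f z <= osc_mx eta z)%MS) ->
    ('D_('D_1 z 0) f (z 0) <= osc_mx eta (z 0))%MS ->
    lor (row_mx 0 ('D_1 y 0)) (f (z 0)) = 0.
  move=> sf fO DfO.
  have perp t X : O (z t) -> envelope [set b] G (chart_inv b (z t), y t) ->
      (X <= osc_mx eta (z t))%MS -> lor X (light_vec (y t)) = 0.
    move=> Ot [_ /= h2] XO; have := h2 b O eta X erefl L.
    rewrite bdom (chart_map_inv (OQ _ Ot)) => h3; exact: h3.
  have h0 : \forall t \near (0 : R), lor (f (z t)) (light_vec (y t)) = 0.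
    by apply: filterS H => t [Ot E]; apply: (perp t _ Ot E); exact: fO.
  have [_ Ez] := nbhs_singleton H.
  have df := smooth_diff sf Oz.
  have dfz := differentiable_compo dz df.
  have d0 : differentiable (fun _ : R => 1%:M : 'rV[R]_1) (0 : R) by exact: differentiable_cst.
  have [d1 e1] := dv_row_mx (1 : R) d0 dy.
  have := derive_near0 (1 : R) h0; rewrite (dv_lor (1 : R) dfz d1) (derive_comp (1 : R) dz df) e1 derive_cst.
  by rewrite (perp 0 _ Oz Ez DfO) add0r lorC.
have rs := osc_real_span L Oz.
have oE : forall w, O w -> csub (osc_mx eta w) (eta w).
  move=> w Ow; have [s1 _] := real_span_csub (zt w) (zp w).
  have [h1 h2] : csub (real_span (zt w) (zp w)) (eta w) by rewrite (lift_val L Ow); exact: csubZ.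
  by split; rewrite (osc_real_span L Ow).
have [s1 s2] := real_span_csub (zt (z 0)) (zp (z 0)).
have cD v : csub (real_span (zt (z 0)) (zp (z 0))) (cderive eta (z 0) v).
  by rewrite (lift_cderive L Oz); apply: csubD; exact: csubZ.
have [re im] : re_vec (cderive eta (z 0) ('D_1 z 0)) = 'D_('D_1 z 0) (fun w => re_vec (eta w)) (z 0) /\
    im_vec (cderive eta (z 0) ('D_1 z 0)) = 'D_('D_1 z 0) (fun w => im_vec (eta w)) (z 0).
  by split; rewrite /cderive; move: ('D__ _ _) ('D__ _ _) => A B; apply/rowP => j; rewrite !mxE ?(ReD, ImD, ReM, ImM) /=; ring.
have [d1 d2] := cD ('D_1 z 0).
split.
  apply: (key (fun w => re_vec (eta w)) sr); first by move=> w /oE[].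
  by rewrite -re rs.
apply: (key (fun w => im_vec (eta w)) si); first by move=> w /oE[].
by rewrite -im rs.
Qed.
End CurveSection.

(** * Orthonormal completion and level sets *)

Section LinearAlgebra.
Variables (R : realType).

(** Linear independence of the rows, in the form used with scalar products. *)
Definition mx_inj d N (W : 'M[R]_(d, N)) : Prop := forall c : 'rV[R]_d, c *m W = 0 -> c = 0.

Lemma mx_injP d N (W : 'M[R]_(d, N)) : mx_inj W <-> row_free W.
Proof.
split=> [h|/row_freeP[V WV] c cW]; last by rewrite -(mulmx1 c) -WV mulmxA cW mul0mx.
rewrite -kermx_eq0; apply/eqP/row_matrixP => i.
by rewrite row0; apply: h; rewrite -row_mul mulmx_ker row0.
Qed.

Lemma gram_unit_mx d N (W : 'M[R]_(d, N)) : mx_inj W -> W *m W^T \in unitmx.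
Proof.
move=> h; rewrite -row_free_unit; apply/mx_injP => c cG; apply: h.
apply: dot_eq0; rewrite dot_mulmx trmx_mul mulmxA -(mulmxA c) cG mul0mx mxE //.
Qed.

(** Gaussian elimination writes J as an invertible matrix times the projection to the first
d coordinates; K reads the other k coordinates. *)
Lemma complement_coords d k (J : 'M[R]_(d + k, d)) : row_free J^T ->
  exists K : 'M[R]_(d + k, k), forall v : 'rV[R]_(d + k), v *m J = 0 -> v *m K = 0 -> v = 0.
Proof.
rewrite /row_free mxrank_tr => /eqP rJ.
exists (col_ebase J *m col_mx 0 1%:M) => v.
rewrite -{1}(mulmx_ebase J) rJ !mulmxA; set w := v *m col_ebase J => h1 h2.
have h1' : w *m pid_mx d = 0 :> 'rV[R]_d.
  by rewrite -[LHS](mulmxK (row_ebase_unit J)) h1 mul0mx.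
have w0 : w = 0.
  rewrite -[w]hsubmxK -[lsubmx w]mulmx1 -[rsubmx w]mulmx1.
  rewrite -[w]hsubmxK pid_mx_col mul_row_col mulmx0 addr0 in h1'.
  by rewrite -[w]hsubmxK mul_row_col mulmx0 add0r in h2; rewrite h1' h2 row_mx0.
by rewrite -(mulmxK (col_ebase_unit J) v) -/w w0 mul0mx.
Qed.

Lemma mx_inj_col k d N (E : 'M[R]_(k, N)) (W : 'M[R]_(d, N)) :
  E *m E^T = 1%:M -> W *m E^T = 0 -> mx_inj W -> mx_inj (col_mx E W).
Proof.
move=> EE WE iW c; rewrite -[c]hsubmxK mul_row_col => h.
have h1 : lsubmx c = 0.
  have := congr1 (mulmx^~ E^T) h; rewrite /= mulmxDl -!mulmxA EE WE mulmx1 mulmx0 addr0 mul0mx //.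
have := h; rewrite h1 mul0mx add0r => /iW ->.
by rewrite row_mx0.
Qed.

Lemma orth_col k N (e : 'rV[R]_N) (E : 'M[R]_(k, N)) : e *m e^T = 1%:M -> E *m E^T = 1%:M ->
  E *m e^T = 0 -> col_mx e E *m (col_mx e E)^T = 1%:M.
Proof.
move=> h1 h2 h3; have h4 : e *m E^T = 0 by rewrite -[LHS]trmxK trmx_mul trmxK h3 trmx0.
by rewrite tr_col_mx mul_col_row h1 h2 h3 h4 -scalar_mx_block.
Qed.

Lemma orth_col0 k d N (e : 'rV[R]_N) (E : 'M[R]_(k, N)) (W : 'M[R]_(d, N)) :
  W *m e^T = 0 -> W *m E^T = 0 -> W *m (col_mx e E)^T = 0.
Proof. by move=> h1 h2; rewrite tr_col_mx mul_mx_row h1 h2 row_mx0. Qed.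

(** By the dimension count k + d = N, the rows of E and W form a basis. *)
Lemma orth_expand k d N (E : 'M[R]_(k, N)) (W : 'M[R]_(d, N)) (y : 'rV[R]_N) :
  E *m E^T = 1%:M -> W *m E^T = 0 -> mx_inj W -> (k + d)%N = N ->
  y *m W^T = 0 -> y = (y *m E^T) *m E.
Proof.
move=> EE WE iW kd yW; set z := y - (y *m E^T) *m E.
have /mx_injP rf := mx_inj_col EE WE iW.
have full : row_full (col_mx E W) by rewrite /row_full -[X in _ == X]kd.
have /submxP[c zc] : (z <= col_mx E W)%MS by exact: submx_full.
have zE : z *m E^T = 0 by rewrite /z mulmxBl -!mulmxA EE mulmx1 subrr.
have EW : E *m W^T = 0 by rewrite -[LHS]trmxK trmx_mul trmxK WE trmx0.
have zW : z *m W^T = 0 by rewrite /z mulmxBl yW -!mulmxA EW !mulmx0 subrr.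
have z0 : z = 0.
  by apply: dot_eq0; rewrite dot_mulmx {2}zc trmx_mul tr_col_mx mulmxA mul_mx_row zE zW row_mx0 mul0mx mxE.
by apply/eqP; rewrite -subr_eq0 -/z z0.
Qed.
End LinearAlgebra.

Section SmoothCompletion.
Variables (R : realType) (V : normedModType R) (z0 : V).

Lemma smooth_trmx p q (U : set V) (f : V -> 'M[R]_(p, q)) : open U ->
  smooth_on U f -> smooth_on U (fun z => (f z)^T).
Proof.
move=> oU /(smooth_mxP oU) h; apply/(smooth_mxP oU) => i j.
by apply: (smooth_ext oU (h j i)) => x _; rewrite mxE.
Qed.

(** A constant vector outside the row space of W z0, projected along it and normalised,
stays nonzero near z0. *)
Lemma smooth_unit_vector d N (U : set V) (W : V -> 'M[R]_(d, N)) : open U -> U z0 ->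
  smooth_on U W -> mx_inj (W z0) -> (d < N)%N ->
  exists U' (e : V -> 'rV[R]_N), [/\ [/\ open U', U' z0 & U' `<=` U], smooth_on U' e &
    forall z, U' z -> [/\ e z *m (e z)^T = 1%:M, W z *m (e z)^T = 0 & mx_inj (W z)]].
Proof.
move=> oU Uz sW iW dN.
pose G z := W z *m (W z)^T.
have sG : smooth_on U G by apply: smooth_mulmx => //; exact: smooth_trmx.
pose U1 := U `&` [set z | \det (G z) != 0].
have oU1 : open U1 by apply: open_smooth_neq0 => //; exact: smooth_det.
have U1z : U1 z0 by split=> //=; rewrite -unitfE -unitmxE; exact: gram_unit_mx.
have Gu z : U1 z -> G z \in unitmx by move=> [_ /=]; rewrite -unitfE -unitmxE.
have [i ni] : exists i, ~~ (row i (1%:M : 'M[R]_N) <= W z0)%MS.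
  apply/existsP; rewrite -[[exists _, _]]negbK negb_exists; apply/negP => /forallP h.
  have : (1%:M <= W z0)%MS by apply/row_subP => i; have := h i; rewrite negbK.
  move=> /mxrankS; rewrite mxrank1 => /leq_trans/(_ (rank_leq_row _)).
  by rewrite leqNgt dN.
pose c := row i (1%:M : 'M[R]_N).
pose P z := c - c *m (W z)^T *m invmx (G z) *m W z.
have sW1 : smooth_on U1 W by apply: smooth_subset sW => z [].
have sP : smooth_on U1 P.
  apply: smooth_mxsub => //; first exact: smooth_cst.
  apply: smooth_mulmx => //; apply: smooth_mulmx => //; last first.
    by apply: smooth_invmx => //; apply: smooth_subset sG => z [].
  by apply: smooth_mulmx => //; [exact: smooth_cst|exact: smooth_trmx].
have PW z : U1 z -> P z *m (W z)^T = 0.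
  by move=> Uz'; rewrite mulmxBl -[X in _ - X]mulmxA -/(G z) mulmxKV ?subrr //; exact: Gu.
have sq : smooth_on U1 (fun z => dot (P z) (P z)) by exact: smooth_dot.
pose U2 := U1 `&` [set z | dot (P z) (P z) != 0].
have oU2 : open U2 by exact: open_smooth_neq0.
have sq2 : smooth_on U2 (fun z => dot (P z) (P z)) by apply: smooth_subset sq => z [].
have pos z : U2 z -> 0 < dot (P z) (P z).
  by move=> [_ /= h]; rewrite lt_neqAle eq_sym h dot_ge0.
have U2z : U2 z0.
  split=> //=; apply: contra ni => /eqP/dot_eq0/eqP; rewrite subr_eq0 => /eqP E.
  by rewrite -/c E submxMl.
pose s z := (Num.sqrt (dot (P z) (P z)))^-1.
have ss : smooth_on U2 s.
  apply: smooth_inv => //; first by move=> z /pos h; rewrite gt_eqF // sqrtr_gt0.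
  exact: smooth_sqrt.
exists U2, (fun z => s z *: P z); split.
- by split=> // z [[]].
- by apply: smooth_scale => //; apply: smooth_subset sP => z [].
move=> z U2z'; have U1z' : U1 z by case: U2z'.
have p := pos z U2z'; split.
- rewrite linearZ /= -scalemxAl -scalemxAr scalerA [P z *m _]mx11_scalar -dot_mulmx scale_scalar_mx.
  congr (_%:M); rewrite /s -invfM -expr2 sqr_sqrtr; last exact: ltW.
  by rewrite mulVf // gt_eqF.
- by rewrite linearZ /= -scalemxAr -[W z *m _]trmxK trmx_mul trmxK PW // trmx0 scaler0.
- move=> c' h; rewrite -(mulmxK (Gu z U1z') c') /G mulmxA h.
  by rewrite !mul0mx.
Qed.

(** Unit vectors are added one at a time. *)
Theorem smooth_completion k d N (U : set V) (W : V -> 'M[R]_(d, N)) : open U -> U z0 ->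
  smooth_on U W -> mx_inj (W z0) -> (k + d < N.+1)%N -> (0 < k)%N ->
  exists U' (E : V -> 'M[R]_(k, N)), [/\ [/\ open U', U' z0 & U' `<=` U], smooth_on U' E &
    forall z, U' z -> [/\ E z *m (E z)^T = 1%:M, W z *m (E z)^T = 0 & mx_inj (W z)]].
Proof.
move=> oU Uz sW iW; elim: k => // k IH kd _.
have [k0|k0] := posnP k.
  by rewrite k0 in kd *; exact: (smooth_unit_vector oU Uz sW iW).
have [U1 [E [[oU1 U1z sub1] sE h1]]] := IH (ltnW kd) k0.
have sW1 : smooth_on U1 (fun z => col_mx (E z) (W z)).
  apply/(smooth_mxP oU1) => i j; have sW' := smooth_subset sub1 sW.
  case: (split_ordP i) => i' ->.
    by apply: (smooth_ext oU1 ((smooth_mxP oU1 _).1 sE i' j)) => x _; rewrite col_mxEu.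
  by apply: (smooth_ext oU1 ((smooth_mxP oU1 _).1 sW' i' j)) => x _; rewrite col_mxEd.
have i1 : mx_inj (col_mx (E z0) (W z0)) by have [a b c] := h1 _ U1z; exact: mx_inj_col.
have [U2 [e [[oU2 U2z sub2] se h2]]] := smooth_unit_vector oU1 U1z sW1 i1 kd.
exists U2, (fun z => col_mx (e z) (E z)); split.
- by split=> // z /sub2/sub1.
- apply/(smooth_mxP oU2) => i j; have sE' := smooth_subset sub2 sE.
  case: (split_ordP (i : 'I_(1 + k))) => i' ->.
    by apply: (smooth_ext oU2 ((smooth_mxP oU2 _).1 se i' j)) => x _; rewrite [RHS](col_mxEu (e x) (E x)).
  by apply: (smooth_ext oU2 ((smooth_mxP oU2 _).1 sE' i' j)) => x _; rewrite [RHS](col_mxEd (e x) (E x)).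
move=> z U2z'; have [a1 b1 c1] := h1 _ (sub2 _ U2z'); have [a2 b2 c2] := h2 _ U2z'.
have /eq_col_mx[Ee We] : col_mx (E z *m (e z)^T) (W z *m (e z)^T) = col_mx 0 0.
  by rewrite -mul_col_mx b2 col_mx0.
split=> //.
- exact: (orth_col a2 a1 Ee).
- exact: (orth_col0 We b1).
Qed.
End SmoothCompletion.

(** Linear coordinates that complete g to a local diffeomorphism parametrize the level
set. *)
Lemma regular_level (R : realType) d k (O : set 'rV[R]_(d + k)) (S : set 'rV[R]_(d + k))
    (g : 'rV[R]_(d + k) -> 'rV[R]_d) : open O -> smooth_on O g ->
  (forall p, S p <-> O p /\ g p = 0) ->
  (forall p (c : 'rV[R]_d), S p -> (forall v, dot c ('D_v g p) = 0) -> c = 0) ->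
  embedded_submanifold k S.
Proof.
move=> oO sg SE reg p Sp; have [Op gp] := (SE p).1 Sp.
have dg := smooth_diff sg Op.
have rJ : row_free (Jac g p)^T.
  apply/mx_injP => c cJ; apply: (reg p c Sp) => v.
  by rewrite derive_Jac // dot_mulmx trmx_mul mulmxA cJ mul0mx mxE.
have [K HK] := complement_coords rJ.
pose f q : 'rV[R]_(d + k) := row_mx (g q) (q *m K).
have sf : smooth_on O f by apply: smooth_row_mx => //; exact: smooth_mulmxr.
have inj v : 'D_v f p = 0 -> v = 0.
  have [dK eK] := diff_mulmxr K p v.
  have [_ ->] := dv_row_mx v dg dK; rewrite eK derive_Jac // => h.
  have /eq_row_mx[] : row_mx (v *m Jac g p) (v *m K) = row_mx 0 0 by rewrite row_mx0.
  exact: HK.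
have [U' [V' [h [[oU' U'p sub] [oV VE] h1 hs h2]]]] := inverse_function oO Op sf inj.
pose j (t : 'rV[R]_k) : 'rV[R]_(d + k) := row_mx 0 t.
have sj (B : set 'rV[R]_k) : open B -> smooth_on B j.
  by move=> oB; apply: smooth_row_mx => //; [exact: smooth_cst|exact: smooth_id].
pose D := [set t : 'rV[R]_k | V' (j t)].
have oD : open D.
  have := open_preimage_in (openT : open [set: 'rV[R]_k]) (f := j) _ oV; rewrite setTI; apply.
  by move=> t _; apply: differentiable_continuous; exact: (smooth_diff (sj _ openT)).
exists U', D, (fun t => h (j t)), (fun q => q *m K); split=> //.
- by split; [apply: (smooth_comp oD oV _ (sj _ oD) hs)|exact: smooth_mulmxr].
- apply/seteqP; split=> q.
    move=> [t Dt <-]; have [a1 a2] := h2 _ Dt; split=> //; apply/SE; split; first exact: sub.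
    by move: a2; rewrite /f /j => /eq_row_mx[].
  move=> [/SE[Oq gq] U'q]; have e : f q = j (q *m K) by rewrite /f gq.
  by exists (q *m K); rewrite /= /D /= -e ?h1 // VE; exists q.
- by move=> t Dt; have [_] := h2 _ Dt; rewrite /f /j => /eq_row_mx[].
Qed.

(** * The envelope of an isotropic complex curve *)

Section BlockDerivatives.
Variables (R : realType) (p q : nat).

Lemma dv_lsubmx (x v : 'rV[R]_(p + q)) :
  differentiable (fun x : 'rV[R]_(p + q) => lsubmx x) x /\
  'D_v (fun x : 'rV[R]_(p + q) => lsubmx x) x = lsubmx v.
Proof.
have e (u : 'rV[R]_(p + q)) : lsubmx u = u *m col_mx 1%:M 0.
  by rewrite -{2}(hsubmxK u) mul_row_col mulmx1 mulmx0 addr0.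
have -> : (fun u : 'rV[R]_(p + q) => lsubmx u) = fun u => u *m col_mx 1%:M 0 by apply/funext.
by rewrite e; exact: diff_mulmxr.
Qed.

Lemma dv_rsubmx (x v : 'rV[R]_(p + q)) :
  differentiable (fun x : 'rV[R]_(p + q) => rsubmx x) x /\
  'D_v (fun x : 'rV[R]_(p + q) => rsubmx x) x = rsubmx v.
Proof.
have e (u : 'rV[R]_(p + q)) : rsubmx u = u *m col_mx 0 1%:M.
  by rewrite -{2}(hsubmxK u) mul_row_col mulmx1 mulmx0 add0r.
have -> : (fun u : 'rV[R]_(p + q) => rsubmx u) = fun u => u *m col_mx 0 1%:M by apply/funext.
by rewrite e; exact: diff_mulmxr.
Qed.

Lemma dot_row_split (c : 'rV[R]_(1 + q)) (t : R) (y : 'rV[R]_q) :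
  dot c (row_mx t%:M y) = c 0 (lshift q 0) * t + dot (rsubmx c) y.
Proof.
rewrite /dot big_split_ord big_ord1 row_mxEl mxE eqxx mulr1n; congr (_ + _).
by apply: eq_bigr => i _; rewrite row_mxEr [rsubmx c _ _]mxE.
Qed.

Lemma derive0v (V W : normedModType R) (f : V -> W) a : differentiable f a -> 'D_0 f a = 0.
Proof. by move=> d; rewrite -(scale0r 0) deriveZv // scale0r. Qed.
End BlockDerivatives.

Lemma lor_rowsP (R : realType) n p (A : 'M[R]_(p, 1 + n)) (Y : 'rV[R]_(1 + n)) :
  (forall X : 'rV[R]_(1 + n), (X <= A)%MS -> lor X Y = 0) <-> forall k, lor (row k A) Y = 0.
Proof.
split=> [h k|h X /submxP[c ->]]; first by apply: h; exact: row_sub.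
by rewrite mulmx_sum_row lor_suml big1 // => k _; rewrite lorZl h mulr0.
Qed.

Lemma lor_row_light (R : realType) n (s : R) (x y : 'rV[R]_n) :
  lor (row_mx s%:M x) (light_vec y) = dot x y - s.
Proof. by rewrite /lor /light_vec !row_mxKl !row_mxKr !mxE !eqxx !mulr1n mulr1 addrC. Qed.

Lemma lor_row_hat (R : realType) n (X : 'rV[R]_(1 + n)) (w : 'rV[R]_n) :
  lor X (hatv w) = dot (rsubmx X) w.
Proof.
rewrite /lor /hatv row_mxKl row_mxKr; have -> : (0 : 'rV[R]_1) 0 0 = 0 by rewrite mxE.
by rewrite mulr0 oppr0 add0r.
 Qed.

Lemma dot_ext (R : realType) n (x y : 'rV[R]_n) : (forall w, dot x w = dot y w) -> x = y.
Proof.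
by move=> h; apply/eqP; rewrite -subr_eq0; apply/eqP/dot_eq0; rewrite dotBl h subrr.
Qed.

Section CurveEnvelope.
Variables (R : realType) (n : nat) (S : topologicalType) (b : chart R S 2).
Variables (zt : 'rV[R]_2 -> 'rV[R[i]]_(1 + n)) (a : 'I_(1 + n)).
Local Notation Q := (chart_im b).
Local Notation zp := (cDv (basis_vec R 0) zt).
Hypotheses (bch : is_chart b) (bdom : chart_dom b = [set: S]).
Hypotheses (szt : csmv Q zt) (za : forall z, Q z -> zt z 0 a = 1).
Hypothesis hol : forall z w, Q z -> cDv w zt z = cx w *: zp z.
Hypothesis sp : forall z, Q z -> spacelike_pair (zt z) (zp z).
Local Notation G := (curve_map b zt).
Local Notation Mhat := (envelope [set b] G).
Local Notation A z := (real_span (zt z) (zp z)).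

Let oQ : open Q. Proof. by case: bch. Qed.

Lemma smooth_span : smooth_on Q (fun z => A z).
Proof.
have re (f : 'rV[R]_2 -> 'rV[R[i]]_(1 + n)) j : csmv Q f -> smooth_on Q (fun z => re_vec (f z) 0 j).
  by move=> /(_ j)[h _]; apply: (smooth_ext oQ h) => z _; rewrite mxE.
have im (f : 'rV[R]_2 -> 'rV[R[i]]_(1 + n)) j : csmv Q f -> smooth_on Q (fun z => im_vec (f z) 0 j).
  by move=> /(_ j)[_ h]; apply: (smooth_ext oQ h) => z _; rewrite mxE.
have szp : csmv Q zp by exact: csmv_cDv.
apply/(smooth_mxP oQ) => -[k kp] j.
have ext (f g : 'rV[R]_2 -> R) : smooth_on Q f -> (forall z, f z = g z) -> smooth_on Q g.
  by move=> h e; apply: (smooth_ext oQ h) => z _; exact: e.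
case: k kp => [|[|[|[|k]]]] kp.
- by apply: ext (re zt j szt) _ => z; rewrite [RHS]mxE.
- by apply: ext (im zt j szt) _ => z; rewrite [RHS]mxE.
- by apply: ext (re _ j szp) _ => z; rewrite [RHS]mxE.
- by apply: ext (im _ j szp) _ => z; rewrite [RHS]mxE.
- by [].
Qed.

Lemma in_coord_envelope (p : 'rV[R]_(2 + n)) : in_coord b Mhat p <->
  [/\ Q (lsubmx p), dot (rsubmx p) (rsubmx p) = 1 &
      forall k, lor (row k (A (lsubmx p))) (light_vec (rsubmx p)) = 0].
Proof.
have E s y := curve_envelopeE bch bdom szt za hol s y.
split.
  move=> [[s y] /= [/E[h1 h2] _] <-]; rewrite row_mxKl row_mxKr; split=> //.
    exact: chart_im_map.
  exact/lor_rowsP.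
move=> [h1 h2 h3]; exists (chart_inv b (lsubmx p), rsubmx p).
  split; last by rewrite /= bdom.
  by apply/E; rewrite (chart_map_inv bch h1); split=> //; exact/lor_rowsP.
by rewrite /= (chart_map_inv bch h1) hsubmxK.
Qed.

(** The equations |y|^2 = 1 and <w_k, (1, y)> = 0 are independent in the y directions: a
relation between their differentials puts a multiple of the light-like vector (1, y)
into the spacelike span of the w_k. *)
Lemma span_light_indep z y (c : 'rV[R]_4) (al : R) : Q z -> dot y y = 1 ->
  (forall k, lor (row k (A z)) (light_vec y) = 0) ->
  (forall w, 2 * al * dot y w + \sum_k c 0 k * lor (row k (A z)) (hatv w) = 0) ->
  al = 0 /\ c = 0.
Proof.
move=> Qz y1 hy H; set X := c *m A z.
have XE w : lor X w = \sum_k c 0 k * lor (row k (A z)) w.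
  by rewrite /X mulmx_sum_row lor_suml; apply: eq_bigr => k _; rewrite lorZl.
have Xy : lor X (light_vec y) = 0 by rewrite XE big1 // => k _; rewrite hy mulr0.
have xr : rsubmx X = (- (2 * al)) *: y.
  apply: dot_ext => w; rewrite -lor_row_hat XE dotZl mulNr.
  by apply/eqP; rewrite -addr_eq0 addrC H.
have xl : lsubmx X = (- (2 * al))%:M.
  have := Xy; rewrite -[X]hsubmxK xr [lsubmx X]mx11_scalar lor_row_light dotZl y1 mulr1.
  by move=> /eqP; rewrite subr_eq0 => /eqP ->; exact: row_mxKl.
have XL : X = (- (2 * al)) *: light_vec y.
  by rewrite -[X]hsubmxK xl xr /light_vec scale_row_mx scalemx1.
have c0 : c = 0.
  apply/eqP; apply: contraT => /(real_span_pos (sp Qz)).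
  by rewrite -/X XL lorZl lorZr lor_light y1 subrr !mulr0 ltxx.
split=> //; have := xl; rewrite /X c0 mul0mx => /matrixP/(_ 0 0).
by rewrite !mxE eqxx mulr1n; lra.
Qed.

Section Spheres.
Variables (k : nat) (kn : (k + 4)%N = n) (k0 : (0 < k)%N).
(* The equations <w_k, (1, y)> = 0 read y W^T = s. *)
Let W z : 'M[R]_(4, n) := rsubmx (A z).
Let s z : 'rV[R]_4 := (lsubmx (A z))^T.

Let orthE z y : (forall X : 'rV[R]_(1 + n), (X <= A z)%MS -> lor X (light_vec y) = 0) <-> y *m (W z)^T = s z.
Proof.
rewrite lor_rowsP; have e j : lor (row j (A z)) (light_vec y) = (y *m (W z)^T) 0 j - s z 0 j.
  rewrite -[row j (A z)]hsubmxK [lsubmx (row j _)]mx11_scalar lor_row_light !mxE; congr (_ - _).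
  by apply: eq_bigr => i _; rewrite !mxE mulrC.
split=> [h|h j]; last by rewrite e h subrr.
by apply/rowP => j; apply/eqP; rewrite -subr_eq0 -e h.
Qed.

Let spanE z (c : 'rV[R]_4) : c *m A z = row_mx (dot c (s z))%:M (c *m W z).
Proof.
rewrite -[A z]hsubmxK mul_mx_row -/(W z); congr row_mx.
by rewrite [LHS]mx11_scalar dot_mulmx /s trmxK.
Qed.

Let lor_rows (t : R) (x : 'rV[R]_n) : lor (row_mx t%:M x) (row_mx t%:M x) = dot x x - t * t.
Proof. by rewrite /lor !row_mxKl !row_mxKr !mxE eqxx mulr1n addrC. Qed.

Let W_inj z : Q z -> mx_inj (W z).
Proof.
move=> Qz c cW; apply/eqP; apply: contraT => /(real_span_pos (sp Qz)).
rewrite spanE cW lor_rows dot0l sub0r oppr_gt0 => h.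
by have := sqr_ge0 (dot c (s z)); rewrite expr2 leNgt h.
Qed.

Let be z := s z *m invmx (W z *m (W z)^T).
Let ce z := be z *m W z.

Let ceW z : Q z -> ce z *m (W z)^T = s z.
Proof. by move=> Qz; rewrite /ce /be -mulmxA mulmxKV // gram_unit_mx //; exact: W_inj. Qed.

(* The vector of the span with spatial part ce has squared length |ce|^2 - |ce|^4. *)
Let ce_lt1 z : Q z -> dot (ce z) (ce z) < 1.
Proof.
move=> Qz; have e : dot (ce z) (ce z) = dot (be z) (s z).
  by rewrite dot_mulmx {2}/ce trmx_mul mulmxA ceW // dotC dot_mulmx.
have [b0|b0] := eqVneq (be z) 0; first by rewrite /ce b0 mul0mx dot0l ltr01.
have := real_span_pos (sp Qz) b0; rewrite spanE lor_rows -/(ce z) -e.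
by have := dot_ge0 (ce z); nra.
Qed.

(** Over z the envelope is the intersection of the unit sphere with the affine space of
the y such that <w_k, (1, y)> = 0. Its centre is the point of that space nearest to the
origin, which lies inside the unit ball because the span of the w_k is spacelike. *)
Theorem curve_sphere_bundle : round_sphere_bundle k [set b] Mhat.
Proof.
move=> _ s0 -> _; set z0 := chart_map b s0.
have Qz0 : Q z0 by exact: chart_im_map.
have sA := smooth_span.
have sW : smooth_on Q W.
  apply/(smooth_mxP oQ) => i j.
  by apply: (smooth_ext oQ ((smooth_mxP oQ _).1 sA i (rshift 1 j))) => z _; rewrite [RHS]mxE.
have ss : smooth_on Q s.
  apply/(smooth_mxP oQ) => i j.
  by apply: (smooth_ext oQ ((smooth_mxP oQ _).1 sA j (lshift n i))) => z _; rewrite [RHS]mxE [RHS]mxE.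
have k4 : (k + 4 < n.+1)%N by rewrite kn.
have [U1 [Et [[oU1 U1z0 U1Q] sE HE]]] := smooth_completion oQ Qz0 sW (W_inj Qz0) k4 k0.
have sW' := smooth_subset U1Q sW.
have sce : smooth_on U1 ce.
  apply: smooth_mulmx => //; apply: smooth_mulmx => //; first exact: smooth_subset U1Q ss.
  apply: smooth_invmx => //.
    by move=> z Oz; apply: gram_unit_mx; exact: W_inj (U1Q _ Oz).
  by apply: smooth_mulmx => //; exact: smooth_trmx.
have r0 z : U1 z -> 0 < 1 - dot (ce z) (ce z) by move=> /U1Q/ce_lt1; rewrite subr_gt0.
have sr : smooth_on U1 (fun z => Num.sqrt (1 - dot (ce z) (ce z))).
  apply: smooth_sqrt => //; apply: smooth_sub => //; first exact: smooth_cst.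
  exact: smooth_dot.
have tE z (t : 'rV[R]_k) : \sum_(j < k) t 0 j *: row j (Et z) = t *m Et z by rewrite -mulmx_sum_row.
exists U1, ce, (fun z => Num.sqrt (1 - dot (ce z) (ce z))), (fun j z => row j (Et z)); split.
- by [].
- split=> // j; apply/(smooth_mxP oU1) => i j'.
  by apply: (smooth_ext oU1 ((smooth_mxP oU1 _).1 sE j j')) => z _; rewrite mxE.
- by move=> z Oz; rewrite sqrtr_gt0 r0.
- move=> z i j Oz; have [EE _ _] := HE z Oz; move/matrixP: EE => /(_ i j).
  rewrite !mxE => <-; apply: eq_bigr => l _; by rewrite !mxE.
move=> z Oz; have [EE WE iW] := HE z Oz; have Qz := U1Q _ Oz.
have r0' : 0 < Num.sqrt (1 - dot (ce z) (ce z)) by rewrite sqrtr_gt0 r0.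
have rr : Num.sqrt (1 - dot (ce z) (ce z)) ^+ 2 = 1 - dot (ce z) (ce z).
  by rewrite sqr_sqrtr // ltW // r0.
set r := Num.sqrt _ in r0' rr *.
have EW : Et z *m (W z)^T = 0 by rewrite -[LHS]trmxK trmx_mul trmxK WE trmx0.
have perp (y : 'rV[R]_n) : y *m (W z)^T = 0 -> dot (ce z) y = 0.
  by move=> h; rewrite dotC dot_mulmx /ce trmx_mul mulmxA h mul0mx mxE.
apply/seteqP; split=> y.
  move=> /(curve_envelopeE bch bdom szt za hol)[y1].
  rewrite (chart_map_inv bch Qz) => /orthE yW.
  pose y' := y - ce z; have y'W : y' *m (W z)^T = 0 by rewrite mulmxBl yW ceW // subrr.
  have y'Et : y' = (y' *m (Et z)^T) *m Et z by apply: orth_expand WE iW kn y'W.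
  have yy : y = ce z + y' by rewrite /y' addrC subrK.
  clearbody y'.
  have n' : dot y' y' = r ^+ 2.
    have : dot y y = dot (ce z) (ce z) + dot y' y'.
      by rewrite {1 2}yy dotDl !dotDr [dot y' (ce z)]dotC (perp _ y'W) addr0 add0r.
    by rewrite rr y1 => ->; rewrite addrAC subrr add0r.
  exists (r^-1 *: (y' *m (Et z)^T)).
    rewrite /= dotZl dotZr dot_mulmx trmx_mul trmxK mulmxA -y'Et -dot_mulmx n'.
    by field; rewrite gt_eqF.
  by rewrite tE -scalemxAl -y'Et scalerA divff ?scale1r // gt_eqF.
move=> [t /= t1 <-]; rewrite tE.
have tW : (t *m Et z) *m (W z)^T = 0 by rewrite -mulmxA EW mulmx0.
have tn : dot (t *m Et z) (t *m Et z) = 1.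
  by rewrite dot_mulmx trmx_mul mulmxA -(mulmxA t) EE mulmx1 -dot_mulmx.
apply/(curve_envelopeE bch bdom szt za hol); split.
  rewrite dotDl !dotDr !dotZl !dotZr [dot (t *m _) (ce z)]dotC (perp _ tW) tn.
  by rewrite mulr0 addr0 add0r mulr1 -expr2 rr addrC subrK.
rewrite (chart_map_inv bch Qz); apply/orthE.
by rewrite mulmxDl ceW // -scalemxAl tW scaler0 addr0.
Qed.
End Spheres.
End CurveEnvelope.

Section EnvelopeSubmanifold.
Variables (R : realType) (m : nat) (S : topologicalType) (b : chart R S 2).
Variables (zt : 'rV[R]_2 -> 'rV[R[i]]_(1 + m.+3)) (a : 'I_(1 + m.+3)).
Local Notation Q := (chart_im b).
Local Notation zp := (cDv (basis_vec R 0) zt).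
Hypotheses (bch : is_chart b) (bdom : chart_dom b = [set: S]).
Hypotheses (szt : csmv Q zt) (za : forall z, Q z -> zt z 0 a = 1).
Hypothesis hol : forall z w, Q z -> cDv w zt z = cx w *: zp z.
Hypothesis sp : forall z, Q z -> spacelike_pair (zt z) (zp z).
Local Notation A z := (real_span (zt z) (zp z)).

(** The five equations of span_light_indep define it as a regular level set; 5 + m is the
dimension 2 + (m + 3) of the ambient space. *)
Theorem curve_envelope_submanifold :
  embedded_submanifold m (in_coord b (envelope [set b] (curve_map b zt))).
Proof.
have oQ : open Q by case: bch.
pose O := [set p : 'rV[R]_(2 + m.+3) | Q (lsubmx p)].
have sl : smooth_on [set: 'rV[R]_(2 + m.+3)] (fun p => lsubmx p) by exact: smooth_lsubmx openT.
have oO : open O.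
  have := open_preimage_in (openT : open [set: 'rV[R]_(2 + m.+3)]) (f := fun p => lsubmx p) _ oQ.
  by rewrite setTI; apply=> p _; apply: differentiable_continuous; exact: (smooth_diff sl).
pose gk k (p : 'rV[R]_(2 + m.+3)) : R := lor (row k (A (lsubmx p))) (light_vec (rsubmx p)).
pose g (p : 'rV[R]_(2 + m.+3)) : 'rV[R]_(1 + 4) :=
  row_mx (dot (rsubmx p) (rsubmx p) - 1)%:M (\row_k gk k p).
have sr : smooth_on O (fun p => rsubmx p) by exact: smooth_rsubmx.
have slO : smooth_on O (fun p => lsubmx p) by exact: smooth_lsubmx.
have slt : smooth_on O (fun p => light_vec (rsubmx p)).
  by apply: smooth_row_mx => //; exact: smooth_cst.
have sA : smooth_on Q (fun z => A z) := smooth_span bch szt.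
have srQ k : smooth_on Q (fun z => row k (A z)).
  apply/(smooth_mxP oQ) => i j.
  by apply: (smooth_ext oQ ((smooth_mxP oQ _).1 sA k j)) => z _; rewrite [RHS]mxE.
have srow k : smooth_on O (fun p => row k (A (lsubmx p))).
  by apply: (smooth_comp oO oQ (f := fun p => lsubmx p) (g := fun z => row k (A z))).
have sgk k : smooth_on O (gk k).
  have h : smooth_on O (fun p => \sum_j lsg R j * (row k (A (lsubmx p)) 0 j * light_vec (rsubmx p) 0 j)).
    apply: smooth_sum => // j _; apply: smooth_mul => //; first exact: smooth_cst.
    by apply: smooth_mul => //; [exact: (smooth_mxP oO _).1 (srow k) 0 j|exact: (smooth_mxP oO _).1 slt 0 j].
  by apply: (smooth_ext oO h) => p _; rewrite /gk lorE.
have sd : smooth_on O (fun p => dot (rsubmx p) (rsubmx p) - 1).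
  by apply: smooth_sub => //; [exact: smooth_dot|exact: smooth_cst].
have sd1 : smooth_on O (fun p => (dot (rsubmx p) (rsubmx p) - 1)%:M : 'rV[R]_1).
  apply/(smooth_mxP oO) => i j; rewrite !ord1.
  by apply: (smooth_ext oO sd) => p _; rewrite mxE eqxx mulr1n.
have sg4 : smooth_on O (fun p => \row_k gk k p).
  apply/(smooth_mxP oO) => i j; rewrite ord1.
  by apply: (smooth_ext oO (sgk j)) => p _; rewrite mxE.
have sg : smooth_on O g by exact: smooth_row_mx.
have mem (p : 'rV[R]_(2 + m.+3)) : in_coord b (envelope [set b] (curve_map b zt)) p <-> O p /\ g p = 0.
  split.
    move=> /(in_coord_envelope bch bdom szt za hol)[h1 h2 h3]; split=> //.
    have e1 : \row_k gk k p = 0 by apply/rowP => k; rewrite !mxE; exact: h3.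
    by rewrite /g h2 subrr e1 raddf0 row_mx0.
  move=> [Op gp]; apply/(in_coord_envelope bch bdom szt za hol).
  have /eq_row_mx[h1 /rowP h2] : row_mx (dot (rsubmx p) (rsubmx p) - 1)%:M (\row_k gk k p) = row_mx 0 0.
    by rewrite row_mx0; exact: gp.
  split=> //; last by move=> k; have := h2 k; rewrite !mxE.
  by move/matrixP: h1 => /(_ 0 0); rewrite !mxE eqxx mulr1n => /eqP; rewrite subr_eq0 => /eqP.
apply: (@regular_level R 5 m O _ g oO sg mem).
change (forall (p : 'rV[R]_(2 + m.+3)) (c : 'rV[R]_(1 + 4)),
  in_coord b (envelope [set b] (curve_map b zt)) p ->
  (forall v : 'rV[R]_(2 + m.+3), dot c ('D_v g p) = 0) -> c = 0).
move=> p c /(in_coord_envelope bch bdom szt za hol)[Qp y1 hy] H.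
have Op : O p by [].
have Dg w : dot c ('D_(row_mx 0 w) g p) =
    2 * c 0 (lshift 4 0) * dot (rsubmx p) w + \sum_k (rsubmx c) 0 k * lor (row k (A (lsubmx p))) (hatv w).
  set v := row_mx 0 w.
  have [dl el] := dv_lsubmx p v; have [dr er] := dv_rsubmx p v.
  rewrite row_mxKl in el; rewrite row_mxKr in er.
  have [ds es] := dv_scalar_mx v (smooth_diff sd Op).
  have [_ ->] := dv_row_mx v ds (smooth_diff sg4 Op).
  have e1 : 'D_v (fun p => dot (rsubmx p) (rsubmx p) - 1) p = 2 * dot (rsubmx p) w.
    rewrite (dvB v (diff_dot dr dr) (differentiable_cst _ _)) dv_cst subr0.
    by rewrite (dv_dot v dr dr) er [dot w _]dotC; ring.
  have e2 k : ('D_v (fun p => \row_k gk k p) p) 0 k = lor (row k (A (lsubmx p))) (hatv w).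
    rewrite (derive_mxE v 0 k (smooth_diff sg4 Op)).
    have -> : (fun p => (\row_k gk k p) 0 k) = gk k by apply/funext => p'; rewrite mxE.
    rewrite /gk (dv_lor v (smooth_diff (srow k) Op) (smooth_diff slt Op)).
    have dA : differentiable (fun z => row k (A z)) (lsubmx p) by exact: smooth_diff (srQ k) Qp.
    have -> : 'D_v (fun p => row k (A (lsubmx p))) p = 0.
      by rewrite (derive_comp v dl dA) el derive0v.
    have d1 : differentiable (fun _ : 'rV[R]_(2 + m.+3) => 1%:M : 'rV[R]_1) p by exact: differentiable_cst.
    have [_ ->] := dv_row_mx v d1 dr.
    by rewrite derive_cst er lor0l add0r.
  rewrite es e1 dot_row_split; congr (_ + _); first by ring.
  by rewrite /dot; apply: eq_bigr => k _; rewrite e2.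
have [al0 r0] : c 0 (lshift 4 0) = 0 /\ rsubmx c = 0.
  apply: (span_light_indep sp Qp y1 hy) => w.
  by rewrite -Dg; exact: H.
rewrite -[c]hsubmxK r0 [lsubmx c]mx11_scalar mxE al0 raddf0.
exact: row_mx0.
Qed.
End EnvelopeSubmanifold.

(** * Coordinate discs *)

Lemma cst_cvg (T U : topologicalType) (s : T) (c : U) : (fun _ : T => c) @ s --> c.
Proof. exact: (@cvg_cst _ _ _ (nbhs s) (nbhs_filter s)). Qed.
Arguments cst_cvg {T U} s c.

(** The homeomorphism s |-> z0 + r s / (1 + |s|) of R^n onto a ball; for n = 2 it is the
only chart of the base surface. *)
Section Disc.
Variables (R : realType) (n : nat) (z0 : 'rV[R]_n) (r : R).
Hypothesis r0 : 0 < r.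

Definition disc_map (s : 'rV[R]_n) : 'rV[R]_n := z0 + (r / (1 + `|s|)) *: s.
Definition disc_inv (w : 'rV[R]_n) : 'rV[R]_n := (r - `|w - z0|)^-1 *: (w - z0).
Definition disc_chart : chart R 'rV[R]_n n := Chart [set: 'rV[R]_n] disc_map disc_inv.

Let pos1 (s : 'rV[R]_n) : 0 < 1 + `|s|.
Proof. by rewrite ltr_pwDl. Qed.

Let nrm (s : 'rV[R]_n) : `|disc_map s - z0| = r * `|s| / (1 + `|s|).
Proof.
rewrite /disc_map addrAC subrr add0r nrmZ ger0_norm ?divr_ge0 ?ltW //.
by rewrite mulrAC.
Qed.

Lemma disc_map_ball s : ball z0 r (disc_map s).
Proof.
apply/rV_ballE; rewrite distrC nrm ltr_pdivrMr // ltr_pM2l //.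
by rewrite ltrDr ltr01.
Qed.

Lemma disc_mapK s : disc_inv (disc_map s) = s.
Proof.
have e : r - r * `|s| / (1 + `|s|) = r / (1 + `|s|) by field; rewrite gt_eqF.
rewrite /disc_inv nrm e /disc_map addrAC subrr add0r scalerA mulVf ?scale1r //.
by rewrite mulf_neq0 ?invr_neq0 // gt_eqF.
Qed.

Lemma disc_invK w : ball z0 r w -> disc_map (disc_inv w) = w.
Proof.
move=> /rV_ballE; rewrite distrC => h; have p : 0 < r - `|w - z0| by rewrite subr_gt0.
rewrite /disc_map /disc_inv nrmZ ger0_norm ?invr_ge0 ?ltW // scalerA.
have -> : r / (1 + (r - `|w - z0|)^-1 * `|w - z0|) * (r - `|w - z0|)^-1 = 1.
  have -> : 1 + (r - `|w - z0|)^-1 * `|w - z0| = r / (r - `|w - z0|) by field; rewrite gt_eqF.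
  by field; rewrite !gt_eqF.
by rewrite scale1r addrC subrK.
Qed.

Lemma disc_im : chart_im disc_chart = ball z0 r.
Proof.
apply/seteqP; split=> w; first by move=> [s _ <-]; exact: disc_map_ball.
by move=> Bw; exists (disc_inv w) => //; exact: disc_invK.
Qed.

Lemma disc_is_chart : is_chart disc_chart.
Proof.
split; rewrite ?disc_im.
- exact: openT.
- exact: ball_open.
- by move=> s _; exact: disc_mapK.
- move=> s _; rewrite /= /continuous_at /disc_map; have ff : Filter (nbhs s) by exact: nbhs_filter.
  have hn : (fun x : 'rV[R]_n => `|x|) @ s --> `|s| by exact: norm_continuous.
  have h1 : (fun x : 'rV[R]_n => 1 + `|x|) @ s --> 1 + `|s| := cvgD (FF := ff) (cst_cvg s (1 : R)) hn.
  have n0 : 1 + `|s| != 0 by rewrite gt_eqF.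
  have h3 := cvgM (FF := ff) (cst_cvg s r) (cvgV (FF := ff) n0 h1).
  exact: (cvgD (FF := ff) (cst_cvg s z0) (cvgZ (FF := ff) h3 (@cvg_id _ (nbhs s)))).
move=> w /rV_ballE; rewrite distrC => h; rewrite /= /continuous_at /disc_inv.
have ff : Filter (nbhs w) by exact: nbhs_filter.
have d : (fun w : 'rV[R]_n => w - z0) @ w --> w - z0.
  exact: (cvgB (FF := ff) (@cvg_id _ (nbhs w)) (cst_cvg w z0)).
have nd := cvg_norm (FF := ff) d.
have n0 : r - `|w - z0| != 0 by rewrite gt_eqF // subr_gt0.
exact: (cvgZ (FF := ff) (cvgV (FF := ff) n0 (cvgB (FF := ff) (cst_cvg w r) nd)) d).
Qed.

(** The union of the lines through 0. *)
Lemma rV_connected : connected [set: 'rV[R]_n].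
Proof.
have -> : [set: 'rV[R]_n] = \bigcup_(v in [set: 'rV[R]_n]) range (fun t : R => t *: v).
  apply/seteqP; split=> // v _; exists v => //; exists 1 => //.
  exact: scale1r.
apply: bigcup_connected.
  by exists 0 => v _; exists 0 => //; rewrite scale0r.
move=> v _; apply: connected_continuous_connected.
  by apply/connected_intervalP.
apply: continuous_subspaceT => t.
have ff : Filter (nbhs t) by exact: nbhs_filter.
have hi : (fun t : R => t) @ t --> (t : R) by [].
have := cvgZ (FF := ff) hi (cst_cvg t v); exact.
Qed.

Lemma disc_compatible : compatible disc_chart disc_chart.
Proof.
have e : overlap disc_chart disc_chart = ball z0 r.
  by rewrite -disc_im /overlap /chart_im setIid.
have ob : open (ball z0 r) by exact: ball_open.
have s : smooth_on (overlap disc_chart disc_chart) (transition disc_chart disc_chart).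
  rewrite e; apply: (smooth_ext ob (smooth_id ob)) => w Bw.
  by rewrite /transition /= disc_invK.
by [].
Qed.
End Disc.

Lemma disc_riemann_surface (R : realType) (z0 : 'rV[R]_2) (r : R) : 0 < r ->
  riemann_surface [set disc_chart z0 r].
Proof.
move=> r0; split.
- exact: norm_hausdorff.
- exact: rV_connected.
- split.
  + by move=> _ ->; exact: disc_is_chart.
  + by move=> p; exists (disc_chart z0 r).
  + by move=> _ _ -> ->; exact: disc_compatible.
move=> _ _ z -> -> [s _ <-]; set w := chart_map _ s.
have ob : open (ball z0 r) by exact: ball_open.
have Bw : ball z0 r w by exact: disc_map_ball.
have D v : 'D_v (transition (disc_chart z0 r) (disc_chart z0 r)) w = v.
  have e x : ball z0 r x -> transition (disc_chart z0 r) (disc_chart z0 r) x = id x.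
    by move=> Bx; rewrite /transition /= disc_invK.
  by rewrite (derive_eq_on v ob Bw e) derive_id.
by rewrite /cauchy_riemann !D !mxE oppr0.
Qed.

(** * The complex curve of a local parametrization *)

Definition wintgen_param (R : realType) m (U : set 'rV[R]_m) (F : 'rV[R]_m -> 'rV[R]_m.+3) : Prop :=
  [/\ open U, smooth_on U F, forall q, U q -> dot (F q) (F q) = 1,
      forall q, U q -> wintgen_point F q & forall q, U q -> ~ umbilic F q].

Lemma lor_re_real (R : realType) n (Z : 'rV[R[i]]_(1 + n)) (Y : 'rV[R]_(1 + n)) :
  lor (re_vec Z) Y = complex.Re (lor Z (to_complex Y)).
Proof.
rewrite !lorE (big_morph (@complex.Re R) (@ReD R) (erefl _)); apply: eq_bigr => j _.
rewrite !mxE /lsg; case: (Z 0 j) => p q; case: ifP => _ /=; ring.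
Qed.

(** The vectors xi and Z of gauss_structure are already orthogonal for the Hermitian form. *)
Lemma spacelike_orth (R : realType) n (X Z : 'rV[R[i]]_(1 + n)) (c : R) :
  lor X X = 0 -> lor X Z = 0 -> lor Z Z = 0 -> lor X (conj_vec X) = 2 -> lor Z (conj_vec X) = 0 ->
  lor Z (conj_vec Z) = real_complex R (2 * c ^+ 2) -> c != 0 ->
  normal_part X Z = Z /\ spacelike_pair X Z.
Proof.
move=> h1 h2 h3 h4 h5 h6 c0.
have nZ : normal_part X Z = Z by rewrite /normal_part h5 mul0r scale0r subr0.
split=> //; split; [exact: h1|exact: h2|exact: h3| |].
  by rewrite h4 ltr0n.
rewrite nZ h6 gt0_real_complex; apply: mulr_gt0; first by rewrite ltr0n.
by rewrite lt_neqAle sqr_ge0 eq_sym expf_eq0 /= c0.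
Qed.

Lemma not_multiple (R : realType) n (X Z : 'rV[R[i]]_(1 + n)) c : spacelike_pair X Z ->
  Z <> c *: X.
Proof.
move=> sp E; have := @pair_pos _ _ _ _ sp (- c) 1; rewrite oner_neq0 orbT => /(_ isT).
by rewrite scale1r E scaleNr addNr lor0l ltxx.
Qed.

(** The pullback of the metric of Q_+ at a vector v is c^2 |l v|^2, for c = mu0: the factors
of the lift cancel and <Z, conj Z> = 2 mu0^2 while <xi, conj xi> = 2. *)
Lemma metric_ratio (R : realType) n (xi Z : 'rV[R[i]]_(1 + n)) (xa p t w l : R[i]) (c N : R) :
  xa != 0 -> p != 0 -> w * (p * xa) = l -> l * conjc l = real_complex R N ->
  normal_part xi Z = Z -> lor xi (conj_vec xi) = 2 ->
  lor Z (conj_vec Z) = real_complex R (2 * c ^+ 2) ->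
  let X := xa^-1 *: xi in let Y := p *: Z + t *: xi in
  w * conjc w * (lor (normal_part X Y) (conj_vec (normal_part X Y)) / lor X (conj_vec X)) =
  real_complex R (c ^+ 2 * N).
Proof.
move=> xa0 p0 wl lN nZ h4 h6 X Y.
have p2' : 0 < lor xi (conj_vec xi) by rewrite h4 ltr0n.
have -> : normal_part X Y = p *: Z.
  rewrite /X /Y (normal_part_scale _ (invr_neq0 xa0) p2') addrC.
  by rewrite (normal_part_comb Z t p p2') nZ.
rewrite /X !conj_vecZ !lorZl !lorZr h4 h6.
have cM (q r : R[i]) : conjc (q * r) = conjc q * conjc r by exact: rmorphM.
have cV (q : R[i]) : conjc q^-1 = (conjc q)^-1 by exact: fmorphV.
have cxa : conjc xa != 0 by rewrite fmorph_eq0.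
have -> : real_complex R (c ^+ 2 * N) = real_complex R (c ^+ 2) * (l * conjc l) by rewrite lN rmorphM.
have -> : real_complex R (2 * c ^+ 2) = 2 * real_complex R (c ^+ 2) by rewrite rmorphM rmorph_nat.
rewrite -wl !cM cV; move: (real_complex R _) (conjc xa) cxa (conjc p) (conjc w) => k cxa' cxa0 cp cw.
by field; rewrite xa0 cxa0.
Qed.

Lemma complex_form_eq0 (R : realType) (a b s : R) : s != 0 -> Complex a (s * b) = 0 -> a = 0 /\ b = 0.
Proof. by move=> s0 [-> /eqP]; rewrite mulf_eq0 (negbTE s0) => /eqP ->. Qed.

Lemma sum_two_sq (R : realType) m (m2 : (2 <= m)%N) (x : 'I_m -> R) (s : R) : s * s = 1 ->
  (forall k : 'I_m, ~~ (k < 2)%N -> x k = 0) ->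
  Complex (x (ix0 m2)) (s * x (ix1 m2)) * conjc (Complex (x (ix0 m2)) (s * x (ix1 m2))) =
  real_complex R (\sum_k x k * x k).
Proof.
move=> s2 x0; have i01 : ix1 m2 != ix0 m2 by [].
rewrite (bigD1 (ix0 m2)) //= (bigD1 (ix1 m2)) //= big1 ?addr0 => [|k /andP[k0 k1]].
  by apply: complexP => /=; ring: s2.
rewrite x0 ?mul0r //; apply: contra k0 => k2.
by case: k k1 k2 => [[|[|//]] kp] //=.
Qed.

Section LocalCurve.
Variables (R : realType) (m : nat) (m2 : (2 <= m)%N).
Variables (U : set 'rV[R]_m) (F n1 n2 : 'rV[R]_m -> 'rV[R]_m.+3).
Hypothesis par : wintgen_param U F.
Hypotheses (sn1 : smooth_on U n1) (sn2 : smooth_on U n2).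
Hypothesis nON : forall q, U q -> orthonormal_normals F q (n1 q) (n2 q).
Local Notation i0 := (ix0 m2).
Local Notation i1 := (ix1 m2).
Local Notation xi := (gvec F n1 n2).
Local Notation l q e s := (lform m2 F q e s).

Let oU : open U. Proof. by case: par. Qed.
Let sF : smooth_on U F. Proof. by case: par. Qed.
Let F1 q : U q -> dot (F q) (F q) = 1. Proof. by case: par => _ _ h _ _; exact: h. Qed.
Let wp q : U q -> wintgen_point F q. Proof. by case: par => _ _ _ h _; exact: h. Qed.
Let nu q : U q -> ~ umbilic F q. Proof. by case: par => _ _ _ _ h; exact: h. Qed.

Lemma gauss_rank_one q e nu1 nu2 l1 l2 mu0 : U q -> wintgen_frame F q e nu1 nu2 l1 l2 mu0 ->
  exists s Z th, [/\ s * s = 1, rank_one xi q (l q e s) th Z,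
    normal_part (xi q) Z = Z /\ spacelike_pair (xi q) Z,
    lor (xi q) (conj_vec (xi q)) = 2 /\ lor Z (conj_vec Z) = real_complex R (2 * mu0 ^+ 2) &
    lor (lvec F q) (xi q) = 0 /\ lor (lvec F q) Z = 0].
Proof.
move=> Uq wf; have m0 := wintgen_mu0_neq0 m2 oU Uq sF F1 wf (nu Uq).
have [s [Z [th [s2 D [h1 h2 h3] [h4 h5 h6] h7]]]] :=
  gauss_structure m2 oU sF F1 sn1 sn2 nON wp nu Uq wf.
have [nZ sp] := spacelike_orth h1 h2 h3 h4 h5 h6 m0.
exists s, Z, th; split=> //; split=> //; first by move=> c; exact: not_multiple.
exists (e i0); apply/eqP => -[/eqP]; rewrite (frame_co_e wf) eqxx.
by rewrite oner_eq0.
Qed.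

Lemma frame_coords q e nu1 nu2 l1 l2 mu0 : U q -> wintgen_frame F q e nu1 nu2 l1 l2 mu0 ->
  exists2 K : 'M[R]_m, K \in unitmx & forall v, v *m K = \row_k frame_co F q e k v.
Proof.
move=> Uq [eON _ _ _]; pose E : 'M[R]_m := \matrix_i e i.
have Eu : E \in unitmx := frame_unit Uq sF eON.
exists (invmx E); first by rewrite unitmx_inv.
move=> v; rewrite {1}(frame_coord Uq sF eON v).
have -> : \sum_k fff F q v (e k) *: e k = (\row_k frame_co F q e k v) *m E.
  by rewrite mulmx_sum_row; apply: eq_bigr => k _; rewrite mxE rowK.
by rewrite mulmxK.
Qed.

(** The complex curve zt of xi together with all pointwise relations between the
parametrization and the curve. *)
Theorem local_curve u0 : U u0 -> exists (U1 : set 'rV[R]_m) (Phi h : 'rV[R]_m -> 'rV[R]_m)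
    (r : R) (a : 'I_(1 + m.+3)) (zt : 'rV[R]_2 -> 'rV[R[i]]_(1 + m.+3)),
  let Q := ball (p2 (Phi u0)) r in let zp := cDv (basis_vec R 0) zt in
  [/\ U1 `<=` U, box_chart U1 u0 Phi h r,
   csmv Q zt /\ (forall z, Q z -> zt z 0 a = 1),
   forall z w, Q z -> cDv w zt z = cx w *: zp z &
   forall u, U1 u -> let z := p2 (Phi u) in
     [/\ exists2 c, c != 0 & xi u = c *: zt z, spacelike_pair (zt z) (zp z),
      forall v, distr_perp F u v <-> p2 ('D_v Phi u) = 0,
      forall v, canonical_distr F u v -> let w := p2 ('D_v Phi u) in
        cx w * conjc (cx w) * (lor (normal_part (zt z) (zp z)) (conj_vec (normal_part (zt z) (zp z)))
          / lor (zt z) (conj_vec (zt z))) =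
        real_complex R (Num.sqrt ((m%:R - 1) / (4 * m%:R)) ^+ 2 * moebius_metric F u v v) &
      forall X, (X <= real_span (zt z) (zp z))%MS -> lor X (light_vec (F u)) = 0]].
Proof.
move=> Uu0.
have st q : U q -> exists l th Z, rank_one xi q l th Z.
  move=> Uq; have [e [? [? [? [? [mu0 wf]]]]]] := wp Uq.
  by have [s [Z [th [_ h _ _ _]]]] := gauss_rank_one Uq wf; exists (l q e s), th, Z.
have [e [nu1 [nu2 [l1 [l2 [mu0 wf]]]]]] := wp Uu0.
have [s [Z [th [s2 rk [_ sp] [x2 _] _]]]] := gauss_rank_one Uu0 wf.
have s0 : s != 0 by apply: contra_eq_neq s2 => ->; rewrite mul0r eq_sym oner_neq0.
have [K Ku vK] := frame_coords Uu0 wf.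
have stK : exists l th Z, rank_one xi u0 l th Z /\ forall v, l v = 0 -> p2 (v *m K) = 0.
  exists (l u0 e s), th, Z; split=> // v [h0 /eqP].
  rewrite mulf_eq0 (negbTE s0) => /eqP h1; apply/rowP => j; rewrite (p2E m2) vK !mxE.
  have j2 : (widen_ord m2 j < 2)%N := ltn_ord j.
  by have := ix_lt2 (m2 := m2) (x := fun k => frame_co F u0 e k v) h0 h1 j2.
have xi0 : xi u0 != 0.
  apply/eqP => h; move: x2; rewrite h lor0l => /eqP.
  by rewrite eq_sym pnatr_eq0.
have csx : csmv U xi := csmv_gvec oU sF sn1 sn2 wp.
have [U1 [Phi [h [r [a [zt [sub bc [szt za] hol H]]]]]]] := curve_chart m2 oU csx Uu0 xi0 st Ku stK.
exists U1, Phi, h, r, a, zt; split=> // u U1u.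
have Uu := sub _ U1u; have [xa0 xE Hu] := H u U1u; rewrite /=.
set z := p2 (Phi u) in xE Hu *.
have ztE : zt z = (xi u 0 a)^-1 *: xi u by rewrite {2}xE scalerA mulVf ?scale1r.
split.
- by exists (xi u 0 a).
- have [e' [? [? [? [? [mu' wf']]]]]] := wp Uu.
  have [s' [Z' [th' [_ rk' [_ sp'] _ _]]]] := gauss_rank_one Uu wf'.
  have [p [t [p0 -> _]]] := Hu _ _ _ rk'.
  rewrite ztE addrC; apply: spacelike_pair_comb => //; exact: invr_neq0.
- move=> v; have [e' [? [? [? [? [mu' wf']]]]]] := wp Uu.
  have [s' [Z' [th' [s2' rk' _ _ _]]]] := gauss_rank_one Uu wf'.
  have [p [t [p0 _ /(_ v) lv]]] := Hu _ _ _ rk'.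
  have s0' : s' != 0 by apply: contra_eq_neq s2' => ->; rewrite mul0r eq_sym oner_neq0.
  rewrite (distr_perpE m2 oU Uu sF F1 (nu Uu) v wf'); split.
    move=> [h0 h1]; apply: cx_eq0; apply/eqP.
    have : cx (p2 ('D_v Phi u)) * (p * xi u 0 a) == 0.
      by rewrite lv /lform h0 h1 mulr0.
    by rewrite !mulf_eq0 (negbTE p0) (negbTE xa0) !orbF.
  move=> h0; move: lv; rewrite h0 (_ : cx 0 = 0) ?mul0r; last by apply: complexP; rewrite /= mxE.
  by move=> hl; have := complex_form_eq0 s0' (esym hl).
- move=> v [e' [? [? [? [? [mu' [b [wf' vE]]]]]]]].
  have [s' [Z' [th' [s2' rk' [nZ _] [h4 h6] _]]]] := gauss_rank_one Uu wf'.
  have [p [t [p0 zpE /(_ v) lv]]] := Hu _ _ _ rk'.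
  have [eON _ _ _] := wf'.
  rewrite zpE ztE.
  have fk k : frame_co F u e' k v = if (k < 2)%N then b k else 0.
    rewrite /frame_co vE (fff_sum_l Uu sF) big_mkcond /=.
    rewrite (bigD1 k) //= eON eqxx mulr1 big1 ?addr0 // => j jk.
    by rewrite eON (negbTE jk) mulr0; case: ifP.
  (* A vector of D only has its first two coordinates, so |l v|^2 is its squared length. *)
  have ll : l u e' s' v * conjc (l u e' s' v) = real_complex R (fff F u v v).
    rewrite (fff_coord Uu sF eON v v); apply: (sum_two_sq m2 (x := fun k => frame_co F u e' k v)) s2' _ => k k2.
    by rewrite fk (negbTE k2).
  rewrite (wintgen_moebius m2 oU Uu sF F1 wf') (metric_ratio t xa0 p0 lv ll nZ h4 h6).
  congr (real_complex R _); have m0 : m%:R != 0 :> R by rewrite pnatr_eq0 -lt0n ltnW.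
  have m1 : m%:R - 1 != 0 :> R by rewrite subr_eq0 -[1]/(1%:R) eqr_nat neq_ltn m2 orbT.
  rewrite sqr_sqrtr; last by rewrite divr_ge0 ?mulr_ge0 ?subr_ge0 ?ler1n // ltnW.
  by move: (fff F u v v) => N; field; rewrite m0 m1.
- have [e' [? [? [? [? [mu' wf']]]]]] := wp Uu.
  have [s' [Z' [th' [_ rk' _ _ [h7 h8]]]]] := gauss_rank_one Uu wf'.
  have [p [t [p0 zpE _]]] := Hu _ _ _ rk'.
  have c1 : lor (zt z) (lvec F u) = 0 by rewrite ztE lorZl lorC h7 mulr0.
  have c2 : lor (cDv (basis_vec R 0) zt z) (lvec F u) = 0.
    by rewrite zpE lorDl !lorZl [lor Z' _]lorC [lor (xi u) _]lorC h7 h8 !mulr0 addr0.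
  move=> X /submxP[c ->]; rewrite real_spanE lor_re_real lorDl !lorZl c1 c2.
  by rewrite !mulr0 addr0.
Qed.
End LocalCurve.

(** * Changes of parametrization and of chart *)

Section ParamPush.
Variables (R : realType) (m : nat) (m2 : (2 <= m)%N).

Lemma frame_not_umbilic (U : set 'rV[R]_m) (F : 'rV[R]_m -> 'rV[R]_m.+3) u e n1 n2 l1 l2 mu0 :
  open U -> U u -> smooth_on U F -> (forall q, U q -> dot (F q) (F q) = 1) ->
  wintgen_frame F u e n1 n2 l1 l2 mu0 -> mu0 != 0 -> ~ umbilic F u.
Proof.
move=> oU Uu sF F1 wf m0 um.
have := um (e (ix0 m2)) (e (ix0 m2)); rewrite (wintgen_sff0 m2 oU Uu sF F1 wf) !(frame_co_e wf) eqxx.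
have [_ [_ n22 _ _ _] _ _] := wf.
have -> : (ix0 m2 == ix1 m2) = false by [].
move=> /(congr1 (fun y => dot y n2)); rewrite /= dotDl !dotZl n22 dot0l.
rewrite !mulr0 !mul0r !mulr1 addr0 subr0 mulr0 mul0r add0r mulr1 => /eqP.
by rewrite (negbTE m0).
Qed.

(** Everything read off an adapted frame is independent of the parametrization, since
adapted frames are mapped to adapted frames. *)
Lemma param_push (U U' : set 'rV[R]_m) (F F' : 'rV[R]_m -> 'rV[R]_m.+3) (phi : 'rV[R]_m -> 'rV[R]_m) u :
  wintgen_param U F -> open U' -> smooth_on U' F' -> (forall q, U' q -> dot (F' q) (F' q) = 1) ->
  smooth_on U phi -> (forall q, U q -> U' (phi q)) -> (forall q, U q -> F q = F' (phi q)) -> U u ->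
  [/\ mean_curv F u = mean_curv F' (phi u), wintgen_point F' (phi u), ~ umbilic F' (phi u),
      forall v, distr_perp F u v <-> distr_perp F' (phi u) ('D_v phi u) &
      forall v, (canonical_distr F u v -> canonical_distr F' (phi u) ('D_v phi u)) /\
        moebius_metric F u v v = moebius_metric F' (phi u) ('D_v phi u) ('D_v phi u)].
Proof.
move=> [oU sF F1 wp nu] oU' sF' F1' sphi UU' FE Uu.
have [e [n1 [n2 [l1 [l2 [mu0 wf]]]]]] := wp u Uu.
have wf' : wintgen_frame F' (phi u) (fun i => 'D_(e i) phi u) n1 n2 l1 l2 mu0.
  exact: (push_wintgen oU Uu sF oU' sF' F1 F1' sphi UU' FE wf).
have m0 := wintgen_mu0_neq0 m2 oU Uu sF F1 wf (nu u Uu).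
have nu' := frame_not_umbilic oU' (UU' _ Uu) sF' F1' wf' m0.
split; [| |exact: nu'| |].
- by rewrite (wintgen_mean_curv m2 oU Uu sF F1 wf) (wintgen_mean_curv m2 oU' (UU' _ Uu) sF' F1' wf').
- by exists (fun i => 'D_(e i) phi u), n1, n2, l1, l2, mu0.
- move=> v; rewrite (distr_perpE m2 oU Uu sF F1 (nu u Uu) v wf).
  rewrite (distr_perpE m2 oU' (UU' _ Uu) sF' F1' nu' _ wf').
  have P k : frame_co F u e k v = frame_co F' (phi u) (fun i => 'D_(e i) phi u) k ('D_v phi u).
    exact: (push_fco oU Uu sF' sphi UU' FE).
  by rewrite !P.
move=> v; split; last first.
  rewrite (wintgen_moebius m2 oU Uu sF F1 wf) (wintgen_moebius m2 oU' (UU' _ Uu) sF' F1' wf').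
  by rewrite (push_fff oU Uu sF' sphi UU' FE).
move=> [e' [k1 [k2 [j1 [j2 [mu' [b [wf2 ->]]]]]]]].
exists (fun i => 'D_(e' i) phi u), k1, k2, j1, j2, mu', b; split.
  exact: (push_wintgen oU Uu sF oU' sF' F1 F1' sphi UU' FE wf2).
rewrite (derive_sumv _ _ (smooth_diff sphi Uu)); apply: eq_bigr => i _.
by rewrite deriveZv //; exact: smooth_diff sphi Uu.
Qed.

(** The position vector and the tangent vectors are completed orthonormally. *)
Lemma normal_frame_exists (U : set 'rV[R]_m) (F : 'rV[R]_m -> 'rV[R]_m.+3) u0 :
  wintgen_param U F -> U u0 -> exists U' n1 n2, [/\ [/\ open U', U' u0 & U' `<=` U],
    smooth_on U' n1, smooth_on U' n2 & forall q, U' q -> orthonormal_normals F q (n1 q) (n2 q)].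
Proof.
move=> [oU sF F1 wp nu] Uu.
pose W q : 'M[R]_(1 + m, m.+3) := col_mx (F q) (Jac F q).
have sJ : smooth_on U (fun q => Jac F q).
  apply/(smooth_mxP oU) => i j.
  have s := (smooth_mxP oU _).1 (smooth_derive (basis_vec R i) sF) 0 j.
  by apply: (smooth_ext oU s) => q _; rewrite mxE.
have sW : smooth_on U W.
  apply/(smooth_mxP oU) => i j; case: (split_ordP i) => i' ->.
    by rewrite ord1; apply: (smooth_ext oU ((smooth_mxP oU _).1 sF 0 j)) => x _; rewrite col_mxEu.
  by apply: (smooth_ext oU ((smooth_mxP oU _).1 sJ i' j)) => x _; rewrite col_mxEd.
have iW : mx_inj (W u0).
  move=> c; rewrite -[c]hsubmxK mul_row_col [lsubmx c]mx11_scalar mul_scalar_mx.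
  set t := lsubmx c 0 0; set v := rsubmx c => h.
  have D : v *m Jac F u0 = 'D_v F u0 by rewrite derive_Jac //; exact: smooth_diff sF Uu.
  have t0 : t = 0.
    have := congr1 (fun y => dot y (F u0)) h; rewrite /= dotDl dotZl F1 // mulr1 D dot0l.
    by rewrite dotC (dot_F_dF oU sF F1 v Uu) addr0.
  have v0 : v = 0.
    have [e [n1 [n2 [l1 [l2 [mu0 [eON _ _ _]]]]]]] := wp u0 Uu.
    move: h; rewrite t0 scale0r add0r D => Dv.
    rewrite (frame_coord Uu sF eON v) big1 // => k _.
    by rewrite /fff Dv dot0l scale0r.
  by rewrite t0 v0 raddf0 row_mx0.
have [U' [E [[oU' U'u sub] sE H]]] := smooth_completion (k := 2) oU Uu sW iW (ltnSn _) isT.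
have sr i : smooth_on U' (fun q => row i (E q)).
  apply/(smooth_mxP oU') => i' j.
  by apply: (smooth_ext oU' ((smooth_mxP oU' _).1 sE i j)) => x _; rewrite mxE.
exists U', (fun q => row 0 (E q)), (fun q => row 1 (E q)); split=> // q U'q.
have [EE WE _] := H q U'q.
have dE i j : dot (row i (E q)) (row j (E q)) = (i == j)%:R.
  have := congr1 (fun X : 'M[R]_(2, 2) => X i j) EE; rewrite !mxE => <-.
  by apply: eq_bigr => l _; rewrite !mxE.
have FE : F q *m (E q)^T = 0 /\ Jac F q *m (E q)^T = 0.
  by apply: eq_col_mx; rewrite col_mx0 -mul_col_mx.
have nF i : dot (row i (E q)) (F q) = 0.
  rewrite dotC; have := congr1 (fun X : 'M[R]_(1, 2) => X 0 i) FE.1; rewrite !mxE => <-.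
  by apply: eq_bigr => l _; rewrite !mxE.
have nT i v : dot (row i (E q)) ('D_v F q) = 0.
  rewrite derive_Jac; last exact: smooth_diff sF (sub _ U'q).
  rewrite dotC; have : v *m Jac F q *m (E q)^T = 0 by rewrite -mulmxA FE.2 mulmx0.
  move=> /(congr1 (fun X : 'M[R]_(1, 2) => X 0 i)); rewrite [RHS]mxE [LHS]mxE => <-.
  by apply: eq_bigr => l _; congr (_ * _); rewrite !mxE.
by split; rewrite ?dE //.
Qed.
End ParamPush.

Section Charts.
Variables (R : realType) (M : topologicalType) (m : nat).
Implicit Types c : chart R M m.

Lemma chart_mapK c p : is_chart c -> chart_dom c p -> chart_inv c (chart_map c p) = p.
Proof. by case=> _ _ h _ _ /h. Qed.

Lemma chart_invK c u : is_chart c -> chart_im c u ->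
  chart_dom c (chart_inv c u) /\ chart_map c (chart_inv c u) = u.
Proof. by move=> ic [p dp <-]; rewrite chart_mapK. Qed.

Lemma chart_im_dom c p : chart_dom c p -> chart_im c (chart_map c p).
Proof. by move=> dp; exists p. Qed.

Lemma overlapE c c' u : is_chart c -> overlap c c' u <-> chart_im c u /\ chart_dom c' (chart_inv c u).
Proof.
move=> ic; split; first by move=> [p [dp dp'] <-]; rewrite chart_mapK //; split=> //; exists p.
by move=> [iu d']; have [d e] := chart_invK ic iu; exists (chart_inv c u).
Qed.

Lemma overlap_open c c' : is_chart c -> open (chart_dom c') -> open (overlap c c').
Proof.
move=> ic o'; have [_ oi _ _ ci] := ic.
have -> : overlap c c' = chart_im c `&` [set u | chart_dom c' (chart_inv c u)].
  by apply/seteqP; split=> u /(overlapE c' u ic).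
exact: open_preimage_in.
Qed.

Lemma transition_overlap c c' u : is_chart c -> is_chart c' -> overlap c c' u ->
  overlap c' c (transition c c' u) /\ transition c' c (transition c c' u) = u.
Proof.
move=> ic ic' [p [dp dp'] <-]; rewrite /transition /= chart_mapK // chart_mapK //.
by split=> //; exists p.
Qed.

Lemma chart_overlap c c' p : chart_dom c p -> chart_dom c' p -> overlap c c' (chart_map c p).
Proof. by move=> h h'; exists p. Qed.

Variables (A : set (chart R M m)) (sA : smooth_atlas A).

(** A chart of the maximal atlas of A. *)
Definition atlas_chart c := is_chart c /\ forall c', A c' -> compatible c c'.

Lemma atlas_chartA c : A c -> atlas_chart c.
Proof. by case: sA => h1 _ h3 Ac; split; [exact: h1|move=> c'; exact: h3]. Qed.

(** Near each point the transition factors through a chart of A. *)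
Lemma atlas_transition c c' : atlas_chart c -> atlas_chart c' ->
  smooth_on (overlap c c') (transition c c').
Proof.
move=> [ic co] [ic' co']; have [ich cov _] := sA.
apply: smooth_local => u Ou; have [iu d'] := (overlapE c' u ic).1 Ou.
have [a Aa dap] := cov (chart_inv c u); have ia := ich _ Aa.
have [q1 q2 q3] : [/\ open (overlap c c'), open (overlap c a) & open (overlap a c')].
  by split; apply: overlap_open => //; [case: ic'|case: ia|case: ic'].
have oO1 : open (overlap c c' `&` overlap c a) by exact: openI.
exists (overlap c c' `&` overlap c a).
  by split=> //; apply/(overlapE a u ic).
have s1 : smooth_on (overlap c c' `&` overlap c a) (transition c a).
  by apply: smooth_subset (co _ Aa).1 => q [].
have e q : (overlap c c' `&` overlap c a) q -> overlap a c' (transition c a q) /\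
    transition a c' (transition c a q) = transition c c' q.
  move=> [/(overlapE c' q ic)[iq dq'] /(overlapE a q ic)[_ dqa]].
  rewrite /transition /= chart_mapK //; split=> //; exact: chart_overlap.
apply: (smooth_ext oO1 (f := fun q => transition a c' (transition c a q))); last by move=> q /e[].
by apply: (smooth_comp oO1 q3 _ s1 (co' _ Aa).2) => q /e[].
Qed.

Lemma transition_derive_inv c c' u v : atlas_chart c -> atlas_chart c' -> overlap c c' u ->
  'D_('D_v (transition c c') u) (transition c' c) (transition c c' u) = v.
Proof.
move=> ac ac' Ou; have [ic _] := ac; have [ic' _] := ac'.
have [Ou' _] := transition_overlap ic ic' Ou.
have oo : open (overlap c c') by apply: overlap_open => //; case: ic'.
rewrite -(derive_comp v (smooth_diff (atlas_transition ac ac') Ou) (smooth_diff (atlas_transition ac' ac) Ou')).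
have e q : overlap c c' q -> transition c' c (transition c c' q) = id q.
  by move=> Oq; have [] := transition_overlap ic ic' Oq.
by rewrite (derive_eq_on v oo Ou e) derive_id.
Qed.

Definition sub_chart (a : chart R M m) (U1 : set 'rV[R]_m) (Phi h : 'rV[R]_m -> 'rV[R]_m) : chart R M m :=
  Chart (chart_dom a `&` [set p | U1 (chart_map a p)]) (Phi \o chart_map a) (chart_inv a \o h).

Lemma sub_chartP a U1 u0 Phi h r : atlas_chart a -> box_chart U1 u0 Phi h r -> U1 `<=` chart_im a ->
  atlas_chart (sub_chart a U1 Phi h) /\ chart_im (sub_chart a U1 Phi h) = ball (Phi u0) r.
Proof.
move=> [ia co] [[oU1 U1u r0] sP sh b1 b2] sub; have [oda oia mK cm ci] := ia.
have im : chart_im (sub_chart a U1 Phi h) = ball (Phi u0) r.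
  apply/seteqP; split=> y.
    by move=> [p [dp /= Up] <-]; have [] := b1 _ Up.
  move=> /b2[Uh Ph]; have [d e] := chart_invK ia (sub _ Uh).
  by exists (chart_inv a (h y)); rewrite /= ?e.
have cP q : U1 q -> {for q, continuous Phi}.
  by move=> Uq; apply: differentiable_continuous; exact: smooth_diff sP Uq.
have ch y : ball (Phi u0) r y -> {for y, continuous h}.
  by move=> By; apply: differentiable_continuous; exact: smooth_diff sh By.
have ic : is_chart (sub_chart a U1 Phi h).
  split; rewrite ?im.
  - exact: open_preimage_in.
  - exact: ball_open.
  - by move=> p [dp /= Up]; rewrite (b1 _ Up).2 mK.
  - by move=> p [dp /= Up]; apply: continuous_comp; [exact: cm|exact: cP].
  - by move=> y By; apply: continuous_comp; [exact: ch|apply: ci; apply: sub; have [] := b2 _ By].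
split=> //; split=> // c' Ac'; have [ic' co'] := atlas_chartA Ac'.
have oda' : open (chart_dom c') by case: ic'.
have odb : open (chart_dom (sub_chart a U1 Phi h)) by case: ic.
split.
  have oO := overlap_open ic oda'.
  have mp q : overlap (sub_chart a U1 Phi h) c' q -> ball (Phi u0) r q /\ overlap a c' (h q).
    move=> /(overlapE c' q ic)[]; rewrite im => Bq dq; split=> //.
    apply/(overlapE c' (h q) ia); split=> //; apply: sub; by have [] := b2 _ Bq.
  apply: (smooth_comp oO (overlap_open ia oda') (f := h) (g := transition a c')).
  - by move=> q /mp[].
  - by apply: smooth_subset sh => q /mp[].
  - by have [] := co _ Ac'.
have oO := overlap_open ic' odb.
have mp q : overlap c' (sub_chart a U1 Phi h) q -> overlap c' a q /\ U1 (transition c' a q).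
  by move=> /(overlapE _ q ic')[iq [dq /= Uq]]; split=> //; apply/(overlapE _ q ic').
apply: (smooth_comp oO oU1 (f := transition c' a) (g := Phi)) => //.
- by move=> q /mp[].
- by apply: smooth_subset (co _ Ac').2 => q /mp[].
Qed.
End Charts.

(** * The foliation *)

Lemma wintgen_param_sub (R : realType) m (U U' : set 'rV[R]_m) F :
  open U' -> U' `<=` U -> wintgen_param U F -> wintgen_param U' F.
Proof.
move=> oU' s [oU sF F1 wp nu]; split=> //; first exact: smooth_subset s sF.
- by move=> q /s; exact: F1.
- by move=> q /s; exact: wp.
- by move=> q /s; exact: nu.
Qed.

Lemma box_chart_derive_inv (R : realType) m (U : set 'rV[R]_m) u0 Phi h r y w :
  box_chart U u0 Phi h r -> ball (Phi u0) r y -> 'D_('D_w h y) Phi (h y) = w.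
Proof.
move=> [_ sP sh _ b2] By; have [Uh Ph] := b2 _ By.
have ob : open (ball (Phi u0) r) by exact: ball_open.
rewrite -(derive_comp w (smooth_diff sh By) (smooth_diff sP Uh)).
have e q : ball (Phi u0) r q -> Phi (h q) = id q by move=> /b2[].
by rewrite (derive_eq_on w ob By e) derive_id.
Qed.

Section WintgenManifold.
Variables (R : realType) (m : nat) (m2 : (2 <= m)%N) (M : topologicalType).
Variables (A : set (chart R M m)) (sA : smooth_atlas A) (x : M -> 'rV[R]_m.+3).
Hypotheses (x_sphere : forall p, dot (x p) (x p) = 1) (x_immersion : immersion A x).
Hypotheses (x_wintgen : wintgen_ideal A x) (x_umbilic_free : umbilic_free A x).
Local Notation F c := (x \o chart_inv c).
Implicit Types c a : chart R M m.

Lemma atlas_param c : A c -> wintgen_param (chart_im c) (F c).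
Proof.
move=> Ac; have [ic _] := atlas_chartA sA Ac; split.
- by case: ic.
- by have := x_immersion.1 c Ac; rewrite setTI.
- by move=> q _; exact: x_sphere.
- by move=> q; exact: x_wintgen.
- by move=> q; exact: x_umbilic_free.
Qed.

Lemma F_transition c c' u : is_chart c -> is_chart c' -> overlap c c' u ->
  F c u = F c' (transition c c' u).
Proof. by move=> ic ic' /(overlapE c' u ic)[_ d']; rewrite /= /transition /= chart_mapK. Qed.

Lemma chart_smooth c : atlas_chart A c -> smooth_on (chart_im c) (F c).
Proof.
move=> ac; have [ic co] := ac; have [_ cov _] := sA.
apply: smooth_local => u iu; have [a Aa da] := cov (chart_inv c u).
have aa := atlas_chartA sA Aa; have [ia _] := aa.
have oo : open (overlap c a) by apply: overlap_open => //; case: ia.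
exists (overlap c a); first exact/(overlapE a u ic).
have [oia sFa _ _ _] := atlas_param Aa.
apply: (smooth_ext oo (f := fun q => F a (transition c a q))).
  apply: (smooth_comp oo oia _ (atlas_transition sA ac aa) sFa) => q Oq.
  have [[p [dp _] <-] _] := transition_overlap ic ia Oq; exact: chart_im_dom.
by move=> q Oq; rewrite -F_transition.
Qed.

Let push c c' u : atlas_chart A c -> atlas_chart A c' -> wintgen_param (overlap c c') (F c) ->
  overlap c c' u -> let u' := transition c c' u in
  [/\ mean_curv (F c) u = mean_curv (F c') u', wintgen_point (F c') u', ~ umbilic (F c') u',
      forall v, distr_perp (F c) u v <-> distr_perp (F c') u' ('D_v (transition c c') u) &
      forall v, (canonical_distr (F c) u v -> canonical_distr (F c') u' ('D_v (transition c c') u)) /\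
        moebius_metric (F c) u v v =
        moebius_metric (F c') u' ('D_v (transition c c') u) ('D_v (transition c c') u)].
Proof.
move=> ac ac' par Ou u'; have [ic _] := ac; have [ic' _] := ac'.
apply: (param_push m2 par _ (chart_smooth ac') _ (atlas_transition sA ac ac')) => //.
- by case: ic'.
- by move=> q _; exact: x_sphere.
- by move=> q Oq; have [[p [dp _] <-] _] := transition_overlap ic ic' Oq; exact: chart_im_dom.
- by move=> q Oq; exact: F_transition.
Qed.

(** Local existence of adapted frames is known in the charts of A only; transitions carry
it to the maximal atlas. *)
Lemma chart_param c : atlas_chart A c -> wintgen_param (chart_im c) (F c).
Proof.
move=> ac; have [ic co] := ac; have [_ cov _] := sA.
have key u : chart_im c u -> wintgen_point (F c) u /\ ~ umbilic (F c) u.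
  move=> iu; have [a Aa da] := cov (chart_inv c u).
  have aa := atlas_chartA sA Aa; have [ia _] := aa.
  have Ou : overlap c a u by apply/(overlapE a u ic).
  have [Ou' e] := transition_overlap ic ia Ou.
  have oo : open (overlap a c) by apply: overlap_open => //; case: ic.
  have sub : overlap a c `<=` chart_im a by move=> q /(overlapE c q ia)[].
  have [_ h1 h2 _ _] := push aa ac (wintgen_param_sub oo sub (atlas_param Aa)) Ou'.
  by rewrite e in h1 h2.
split; [by case: ic|exact: chart_smooth|by move=> q _; exact: x_sphere| |].
  by move=> q /key[].
by move=> q /key[].
Qed.

Lemma chart_push c c' u : atlas_chart A c -> atlas_chart A c' -> overlap c c' u ->
  let u' := transition c c' u in let D v := 'D_v (transition c c') u in
  [/\ mean_curv (F c) u = mean_curv (F c') u',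
      forall v, distr_perp (F c) u v <-> distr_perp (F c') u' (D v) &
      forall v, (canonical_distr (F c) u v -> canonical_distr (F c') u' (D v)) /\
        moebius_metric (F c) u v v = moebius_metric (F c') u' (D v) (D v)].
Proof.
move=> ac ac' Ou u' D; have [ic _] := ac; have [ic' _] := ac'.
have oo : open (overlap c c') by apply: overlap_open => //; case: ic'.
have sub : overlap c c' `<=` chart_im c by move=> q /(overlapE c' q ic)[].
by have [h1 _ _ h2 h3] := push ac ac' (wintgen_param_sub oo sub (chart_param ac)) Ou.
Qed.

(** In the chart with coordinates Phi the kernel of d(p2 o Phi) is the plaque direction. *)
Lemma sub_chart_perp a U1 u0 Phi h r : atlas_chart A a -> box_chart U1 u0 Phi h r ->
  U1 `<=` chart_im a ->
  (forall u v, U1 u -> distr_perp (F a) u v <-> p2 ('D_v Phi u) = 0) ->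
  forall y, ball (Phi u0) r y -> distr_perp (F (sub_chart a U1 Phi h)) y = @plaque_dir R m.
Proof.
move=> aa bc sub H y By; have [ac im] := sub_chartP sA aa bc sub.
set c := sub_chart _ _ _ _ in ac im *; have [ia _] := aa.
have [[oU1 _ _] sP _ b1 b2] := bc; have [Uh Ph] := b2 _ By.
have ov u : U1 u -> overlap a c u.
  move=> Uu; have [d e] := chart_invK ia (sub _ Uu).
  by apply/(overlapE c u ia); split; [exact: sub|split=> //=; rewrite e].
have tr u : U1 u -> transition a c u = Phi u.
  by move=> Uu; rewrite /transition /= (chart_invK ia (sub _ Uu)).2.
have [_ Hp _] := chart_push aa ac (ov _ Uh).
have main w : distr_perp (F c) y w <-> p2 w = 0.
  have := Hp ('D_w h y); rewrite (derive_eq_on _ oU1 Uh tr) (box_chart_derive_inv w bc By) tr // Ph.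
  by rewrite (H _ _ Uh) (box_chart_derive_inv w bc By) => ->.
by apply/seteqP; split=> w; [move=> /main|move=> /(plaque_dirE m2)] => h'; [apply/(plaque_dirE m2)|apply/main].
Qed.

(** All cubical charts of the maximal atlas adapted to D^perp. Their transitions preserve
plaques because D^perp does not depend on the chart. *)
Definition foliated_chart : set (chart R M m) := [set c |
  [/\ atlas_chart A c, exists lo hi, chart_im c = open_box lo hi &
      forall u, chart_im c u -> distr_perp (F c) u = @plaque_dir R m]].

Lemma foliated_chart_exists p : exists2 c, foliated_chart c & chart_dom c p.
Proof.
have [_ cov _] := sA; have [a Aa da] := cov p; have aa := atlas_chartA sA Aa.
pose u0 := chart_map a p; have iu0 : chart_im a u0 by exact: chart_im_dom.
have [U' [n1 [n2 [[oU' U'u sub] s1 s2 nON]]]] := normal_frame_exists (atlas_param Aa) iu0.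
have par := wintgen_param_sub oU' sub (atlas_param Aa).
have [U1 [Phi [h [r [b [zt [sub1 bc _ _ H]]]]]]] := local_curve m2 par s1 s2 nON U'u.
have subi : U1 `<=` chart_im a by move=> q /sub1/sub.
have [ac im] := sub_chartP sA aa bc subi.
exists (sub_chart a U1 Phi h); last by split=> //=; case: bc => [[]].
have [[_ _ r0] _ _ _ _] := bc.
split=> //.
  by exists (fun i => Phi u0 0 i - r), (fun i => Phi u0 0 i + r); rewrite im ball_open_box.
move=> y; rewrite im => By; apply: (sub_chart_perp aa bc subi) By => u v U1u.
by have [_ _ h3 _ _] := H u U1u; exact: h3.
Qed.

Theorem foliated_charts_atlas : foliated_atlas A foliated_chart /\ plaques_integral x foliated_chart.
Proof.
split; last by move=> c u [_ _ h] iu; exact: h.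
split.
- by move=> c [[ic _] h _].
- exact: foliated_chart_exists.
- by move=> c c' [[_ co] _ _]; exact: co.
move=> c c' [ac _ h] [ac' _ h']; split; first exact: (atlas_transition sA ac ac').
move=> u v Ou Pv; have [ic _] := ac; have [ic' _] := ac'.
have [_ H _] := chart_push ac ac' Ou; have [Ou' _] := transition_overlap ic ic' Ou.
rewrite -(h' (transition c c' u)); last by case/(overlapE c _ ic'): Ou'.
apply/H; rewrite h //.
by case/(overlapE c' _ ic): Ou.
Qed.

(** The plaque through p, in the last m - 2 coordinates of a foliated chart. *)
Theorem perp_integrable : distr_perp_integrable A x.
Proof.
move=> p; have [c [ac [lo [hi box]] pl] dp] := foliated_chart_exists p.
have [ic _] := ac; have [_ oi _ _ ci] := ic; have [_ cov _] := sA.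
pose E : 'M[R]_(m - 2, m) := \matrix_(i, j) (j == (i + 2)%N :> nat)%:R.
have ix (j : 'I_(m - 2)) : (j + 2 < m)%N by have := ltn_ord j; lia.
have sE (s : 'rV[R]_(m - 2)) j : (s *m E) 0 (Ordinal (ix j)) = s 0 j.
  rewrite mxE (bigD1 j) //= mxE eqxx mulr1 big1 ?addr0 // => i ij.
  by rewrite mxE eqn_add2r (_ : (j == i :> nat) = false) ?mulr0 //; apply: contra_neqF ij => /eqP e; exact: val_inj.
have E2 (s : 'rV[R]_(m - 2)) (j : 'I_m) : (j < 2)%N -> (s *m E) 0 j = 0.
  move=> j2; rewrite mxE big1 // => i _; rewrite mxE (_ : (j == (i + 2)%N :> nat) = false) ?mulr0 //.
  by apply/eqP => e; move: j2; rewrite e; lia.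
have Epl v : @plaque_dir R m v <-> exists s, s *m E = v.
  split; last by move=> [s <-] j; exact: E2.
  move=> h; exists (\row_j v 0 (Ordinal (ix j))); apply/rowP => j.
  have [j2|j2] := ltnP j 2; first by rewrite E2 // h.
  have jm : (j - 2 < m - 2)%N by have := ltn_ord j; lia.
  have -> : j = Ordinal (ix (Ordinal jm)) by apply: val_inj; rewrite /= subnK.
  by rewrite sE mxE.
have Einj (s s' : 'rV[R]_(m - 2)) : s *m E = s' *m E -> s = s'.
  by move=> e; apply/rowP => j; rewrite -sE e sE.
pose u0 := chart_map c p; pose k (s : 'rV[R]_(m - 2)) := u0 + s *m E.
have Dk s w : differentiable k s /\ 'D_w k s = w *m E.
  have [d1 d2] := diff_mulmxr E s w.
  have [d3 d4] := dv_addmx w (differentiable_cst u0 s) d1.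
  by rewrite d4 d2 derive_cst add0r.
have sk (O1 : set 'rV[R]_(m - 2)) : open O1 -> smooth_on O1 k.
  by move=> oO; apply: smooth_add => //; [exact: smooth_cst|exact: smooth_mulmxr].
pose U := [set s | chart_im c (k s)].
have oU : open U.
  have := open_preimage_in (openT : open [set: 'rV[R]_(m - 2)]) (f := k) _ oi; rewrite setTI; apply.
  by move=> s _; apply: differentiable_continuous; have [] := Dk s 0.
pose f s := chart_inv c (k s).
have cf s : U s -> {for s, continuous f}.
  move=> Us; apply: (continuous_comp (f := k)); last exact: ci.
  by apply: differentiable_continuous; have [] := Dk s 0.
exists U, f; split; last 2 first.
- by rewrite /U /= /k mul0mx addr0; exact: chart_im_dom.
- by rewrite /f /k mul0mx addr0 chart_mapK.
have ov s c' : U s -> chart_dom c' (f s) -> overlap c c' (k s) by move=> Us d; apply/(overlapE c' _ ic).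
have mf c' s : chart_map c' (f s) = transition c c' (k s) by [].
split; [exact: oU| | |].
- split; first exact: cf.
  move=> c' Ac'; have ac' := atlas_chartA sA Ac'; have [ic' _] := ac'.
  have od : open (chart_dom c') by case: ic'.
  have oo : open (U `&` f @^-1` chart_dom c') by exact: open_preimage_in.
  apply: (smooth_comp oo (overlap_open ic od) (f := k) (g := transition c c')) => //.
  + by move=> s [Us ds]; exact: ov.
  + exact: sk.
  + exact: (atlas_transition sA ac ac').
- move=> s s' /set_mem Us /set_mem Us' /(congr1 (chart_map c)); rewrite /f.
  rewrite (chart_invK ic Us).2 (chart_invK ic Us').2 => /addrI; exact: Einj.
move=> s c' Us Ac' ds; have ac' := atlas_chartA sA Ac'; have [ic' _] := ac'.
have Ok := ov _ _ Us ds; have [Ok' tk] := transition_overlap ic ic' Ok.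
have D (w : 'rV[R]_(m - 2)) : 'D_w (chart_map c' \o f) s = 'D_(w *m E) (transition c c') (k s).
  have [d1 <-] := Dk s w.
  exact: (derive_comp w d1 (smooth_diff (atlas_transition sA ac ac') Ok)).
have inv v := transition_derive_inv sA v ac ac' Ok.
have inv' v := transition_derive_inv sA v ac' ac Ok'.
split.
  move=> w w'; rewrite (D w) (D w') => h; apply: Einj.
  by rewrite -(inv (w *m E)) -(inv (w' *m E)) h.
have [_ H _] := chart_push ac ac' Ok.
rewrite (mf c' s); apply/seteqP; split=> v.
  move=> [w _ <-]; rewrite (D w); apply/H; rewrite (pl _ Us).
  by apply/Epl; exists w.
set w := 'D_v (transition c' c) (transition c c' (k s)) => hv.
have vw : v = 'D_w (transition c c') (k s) by have := inv' v; rewrite tk.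
have : distr_perp (F c) (k s) w by apply/H; rewrite -vw.
rewrite (pl _ Us) => /Epl[b bw].
by exists b => //; rewrite (D b) bw -vw.
Qed.
End WintgenManifold.

(** * The local space of leaves *)

Section LocalQuotient.
Variables (R : realType) (m : nat) (m2 : (2 <= m)%N) (M : topologicalType).
Variables (A : set (chart R M m)) (sA : smooth_atlas A) (x : M -> 'rV[R]_m.+3).
Hypotheses (x_sphere : forall p, dot (x p) (x p) = 1) (x_immersion : immersion A x).
Hypotheses (x_wintgen : wintgen_ideal A x) (x_umbilic_free : umbilic_free A x).
Local Notation F c := (x \o chart_inv c).
Variables (V : set M) (n1 n2 : M -> 'rV[R]_m.+3).

(* The data of local_curve in the coordinates of one chart a of M; the normal frame and
F enter only through the relations below. *)
Variables (a : chart R M m) (U : set 'rV[R]_m) (u0 : 'rV[R]_m) (Phi h : 'rV[R]_m -> 'rV[R]_m).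
Variables (r : R) (zt : 'rV[R]_2 -> 'rV[R[i]]_(1 + m.+3)) (j0 : 'I_(1 + m.+3)).
Local Notation z0 := (p2 (Phi u0)).
Local Notation Q := (ball z0 r).
Local Notation zp := (cDv (basis_vec R 0) zt).
Hypotheses (Aa : A a) (bc : box_chart U u0 Phi h r) (Usub : U `<=` chart_im a).
Hypothesis UV : forall u, U u -> V (chart_inv a u).
Hypotheses (szt : csmv Q zt) (za : forall z, Q z -> zt z 0 j0 = 1).
Hypothesis hol : forall z w, Q z -> cDv w zt z = cx w *: zp z.
Hypothesis gv : forall u, U u -> exists2 c, c != 0 &
  gvec (F a) (n1 \o chart_inv a) (n2 \o chart_inv a) u = c *: zt (p2 (Phi u)).
Hypothesis spU : forall u, U u -> spacelike_pair (zt (p2 (Phi u))) (zp (p2 (Phi u))).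
Hypothesis perpU : forall u v, U u -> distr_perp (F a) u v <-> p2 ('D_v Phi u) = 0.
Hypothesis metU : forall u v, U u -> canonical_distr (F a) u v ->
  let w := p2 ('D_v Phi u) in let z := p2 (Phi u) in
  cx w * conjc (cx w) * (lor (normal_part (zt z) (zp z)) (conj_vec (normal_part (zt z) (zp z)))
    / lor (zt z) (conj_vec (zt z))) =
  real_complex R (Num.sqrt ((m%:R - 1) / (4 * m%:R)) ^+ 2 * moebius_metric (F a) u v v).
Hypothesis lightU : forall u X, U u -> (X <= real_span (zt (p2 (Phi u))) (zp (p2 (Phi u))))%MS ->
  lor X (light_vec (F a u)) = 0.

Definition fol_chart := sub_chart a U Phi h.
Definition base_chart := disc_chart z0 r.
Definition base_proj p := disc_inv z0 r (p2 (chart_map fol_chart p)).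
Local Notation c := fol_chart.
Local Notation b := base_chart.
Local Notation pi := base_proj.
Local Notation W := (chart_dom c).
Local Notation G := (curve_map b zt).
Implicit Types (p q : M) (u v y : 'rV[R]_m).

Let aa : atlas_chart A a. Proof. exact: atlas_chartA. Qed.
Let ia : is_chart a. Proof. by case: aa. Qed.
Let ac : atlas_chart A c. Proof. by have [] := sub_chartP sA aa bc Usub. Qed.
Let ic : is_chart c. Proof. by case: ac. Qed.
Let im : chart_im c = ball (Phi u0) r. Proof. by have [] := sub_chartP sA aa bc Usub. Qed.
Let r0 : 0 < r. Proof. by case: bc => [[]]. Qed.
Let bim : chart_im b = Q. Proof. exact: disc_im. Qed.
Let bch : is_chart b. Proof. exact: disc_is_chart. Qed.

Lemma p2_chart y : ball (Phi u0) r y -> Q (p2 y).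
Proof. by move=> /rV_ballE H; apply/rV_ballE; exact: (p2_ball m2). Qed.

Let Wim p : W p -> ball (Phi u0) r (chart_map c p).
Proof. by move=> Wp; rewrite -im; exact: chart_im_dom. Qed.

Let WU p : W p -> U (chart_map a p). Proof. by case. Qed.

Lemma base_projK p : W p -> chart_map b (pi p) = p2 (chart_map c p).
Proof. by move=> Wp; apply: disc_invK => //; exact: p2_chart (Wim Wp). Qed.

Lemma base_proj_inj p q : W p -> W q -> pi p = pi q <-> p2 (chart_map c p) = p2 (chart_map c q).
Proof.
move=> Wp Wq; split; last by move=> e; rewrite /base_proj e.
by move=> /(congr1 (chart_map b)); rewrite !base_projK.
Qed.

Lemma curve_spacelike z : chart_im b z -> spacelike_pair (zt z) (zp z).
Proof.
rewrite bim => /rV_ballE Qz; have By : ball (Phi u0) r (q2 (Phi u0) z).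
  by apply/rV_ballE; exact: q2_ball.
have [_ _ _ _ b2] := bc; have [Uh Ph] := b2 _ By.
by have := spU Uh; rewrite Ph (p2_q2 m2).
Qed.

Let sztb : csmv (chart_im b) zt. Proof. by rewrite bim. Qed.
Let zab z : chart_im b z -> zt z 0 j0 = 1. Proof. by rewrite bim; exact: za. Qed.
Let holb z w : chart_im b z -> cDv w zt z = cx w *: zp z. Proof. by rewrite bim; exact: hol. Qed.

Let oOv c' : A c' -> open (overlap c' c).
Proof. by move=> Ac'; have [ic' _] := atlas_chartA sA Ac'; apply: overlap_open => //; case: ic. Qed.

Let pi_loc c' (q : 'rV[R]_m) : A c' -> overlap c' c q -> (chart_map b \o pi \o chart_inv c') q = p2 (transition c' c q).
Proof.
move=> Ac' Oq; have [ic' _] := atlas_chartA sA Ac'; have [_ Wq] := (overlapE c q ic').1 Oq.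
exact: base_projK.
Qed.

Lemma base_proj_derive c' u v : A c' -> overlap c' c u ->
  'D_v (chart_map b \o pi \o chart_inv c') u = p2 ('D_v (transition c' c) u).
Proof.
move=> Ac' Ou; have ac' := atlas_chartA sA Ac'.
rewrite (derive_eq_on v (oOv Ac') Ou (fun y Oy => pi_loc Ac' Oy)).
have [d1 <-] := diff_p2 (transition c' c u) ('D_v (transition c' c) u).
exact: (derive_comp v (smooth_diff (atlas_transition sA ac' ac) Ou) d1).
Qed.

Let plq y : ball (Phi u0) r y -> distr_perp (F c) y = @plaque_dir R m.
Proof. exact: (sub_chart_perp m2 sA x_sphere x_immersion x_wintgen x_umbilic_free aa bc Usub perpU). Qed.

Let push c1 c2 u := chart_push m2 sA x_sphere x_immersion x_wintgen x_umbilic_free (c := c1) (c' := c2) (u := u).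

Let ovim c' u : A c' -> overlap c' c u -> ball (Phi u0) r (transition c' c u).
Proof.
move=> Ac' Ou; have [ic' _] := atlas_chartA sA Ac'.
by rewrite -im; have [/(overlapE c' _ ic)[]] := transition_overlap ic' ic Ou.
Qed.

Lemma base_proj_kernel c' u v : A c' -> overlap c' c u ->
  distr_perp (F c') u v <-> p2 ('D_v (transition c' c) u) = 0.
Proof.
move=> Ac' Ou; have ac' := atlas_chartA sA Ac'; have [_ H _] := push ac' ac Ou.
rewrite (H v) (plq (ovim Ac' Ou)); exact: plaque_dirE.
Qed.

Let ovp c' p : chart_dom c' p -> W p -> overlap c' c (chart_map c' p).
Proof. exact: chart_overlap. Qed.

Theorem local_gauss_map : gauss_map_factors A x n1 n2 W pi G.
Proof.
move=> c' p Ac' Wp dp; have ac' := atlas_chartA sA Ac'; have [ic' _] := ac'.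
have [da Up] := Wp; rewrite /curve_map base_projK //.
have [k k0 e] := gv Up.
rewrite -(cline_scale (zt (p2 (chart_map c p))) k0) -e /gvec /= (chart_mapK ia da).
have [H _ _] := push aa ac' (chart_overlap da dp).
have te : transition a c' (chart_map a p) = chart_map c' p by rewrite /transition /= chart_mapK.
rewrite te in H; congr cline; rewrite /gauss_vec /curv_sphere H /=.
by rewrite (chart_mapK ia da) (chart_mapK ic' dp).
Qed.

Lemma base_proj_surj : pi @` W = [set: 'rV[R]_2].
Proof.
apply/seteqP; split=> // s _; pose z := chart_map b s.
have Qz : Q z by rewrite -bim; exists s.
have By : ball (Phi u0) r (q2 (Phi u0) z) by apply/rV_ballE; apply: q2_ball; exact/rV_ballE.
have iy : chart_im c (q2 (Phi u0) z) by rewrite im.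
have [dp e] := chart_invK ic iy; exists (chart_inv c (q2 (Phi u0) z)) => //.
by rewrite /base_proj e (p2_q2 m2); exact: disc_mapK.
Qed.

Let cpi p : W p -> {for p, continuous pi}.
Proof.
move=> Wp; have [_ _ _ cm _] := ic; have [_ _ _ _ ci] := bch.
have Qp : chart_im b (p2 (chart_map c p)) by rewrite bim; exact: p2_chart (Wim Wp).
have cp : {for chart_map c p, continuous (fun y => p2 y)}.
  by apply: differentiable_continuous; have [] := diff_p2 (chart_map c p) 0.
have cd : {for p2 (chart_map c p), continuous (disc_inv z0 r)} := ci _ Qp.
exact: (continuous_comp (cm _ Wp) (continuous_comp cp cd)).
Qed.

Lemma base_proj_smooth : smooth_map A [set b] W pi.
Proof.
split; first exact: cpi.
move=> c' _ Ac' ->; have ac' := atlas_chartA sA Ac'.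
have -> : chart_map c' @` (W `&` chart_dom c' `&` pi @^-1` chart_dom b) = overlap c' c.
  by rewrite /overlap /= preimage_setT setIT setIC.
have s : smooth_on (overlap c' c) (fun y => p2 (transition c' c y)).
  apply: smooth_mulmx; [exact: oOv|exact: (atlas_transition sA ac' ac)|apply: smooth_cst; exact: oOv].
by apply: (smooth_ext (oOv Ac') s) => y Oy; rewrite pi_loc.
Qed.

Lemma base_proj_submersion c' p : A c' -> W p -> chart_dom c' p ->
  range (fun v => 'D_v (chart_map b \o pi \o chart_inv c') (chart_map c' p)) = [set: 'rV[R]_2].
Proof.
move=> Ac' Wp dp; have ac' := atlas_chartA sA Ac'; have [ic' _] := ac'.
have Ou := ovp dp Wp; have [Ou' e] := transition_overlap ic' ic Ou.
apply/seteqP; split=> // w _.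
exists ('D_(w *m (P2 R m)^T) (transition c c') (transition c' c (chart_map c' p))) => //.
rewrite (base_proj_derive _ Ac' Ou).
have := transition_derive_inv sA (w *m (P2 R m)^T) ac ac' Ou'; rewrite e => ->.
by rewrite /p2 -mulmxA (P2_inv R m2) mulmx1.
Qed.

(** The segment of the cube between the two points is tangent to the plaques. *)
Lemma segment_leaf p q : W p -> W q -> p2 (chart_map c p) = p2 (chart_map c q) -> same_leaf A x W p q.
Proof.
move=> Wp Wq e; set y := chart_map c p in e *; set d := chart_map c q - y.
have d0 : p2 d = 0 by rewrite /d p2B e subrr.
pose k (t : R) := y + t *: d.
have dk (t s : R) : differentiable k t /\ 'D_s k t = s *: d.
  have [d1 d2] := dv_scale_mx s (smooth_diff (smooth_id openT) (I : [set: R] t)) (differentiable_cst d (t : R)).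
  have [d3 d4] := dv_addmx s (differentiable_cst y (t : R)) d1.
  by rewrite d4 d2 !derive_cst derive_id scaler0 addr0 add0r.
have sk (J : set R) : open J -> smooth_on J k.
  move=> oJ; apply: smooth_add => //; first exact: smooth_cst.
  by apply: smooth_scale => //; [exact: smooth_id|exact: smooth_cst].
pose J := [set t | ball (Phi u0) r (k t)].
have ob : open (ball (Phi u0) r) by exact: ball_open.
have ck t : {for t, continuous k} by apply: differentiable_continuous; have [] := dk t 0.
have oJ : open J.
  by have := open_preimage_in (openT : open [set: R]) (f := k) (fun t _ => ck t) ob; rewrite setTI.
have J01 (t : R) : 0 <= t <= 1 -> J t.
  by move=> t01; apply/rV_ballE; apply: rV_ball_segment t01 _ _; apply/rV_ballE; exact: Wim.
have [_ _ _ _ ci] := ic.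
pose gam t := chart_inv c (k t).
have Wg t : J t -> W (gam t).
  by move=> Jt; have [] := chart_invK ic (_ : chart_im c (k t)); rewrite ?im.
have Og c' t : A c' -> J t -> chart_dom c' (gam t) -> overlap c c' (k t).
  by move=> Ac' Jt dt; apply/(overlapE c' _ ic); split=> //; rewrite im.
exists J, gam; split.
- by [].
- split=> [t Jt|c' Ac'].
    by apply: (continuous_comp (f := k)); [exact: ck|apply: ci; rewrite im].
  have ac' := atlas_chartA sA Ac'; have [ic' _] := ac'.
  have od : open (chart_dom c') by case: ic'.
  have oo : open (J `&` gam @^-1` chart_dom c').
    apply: open_preimage_in => // t Jt.
    by apply: (continuous_comp (f := k)); [exact: ck|apply: ci; rewrite im].
  apply: (smooth_comp oo (overlap_open ic od) (f := k) (g := transition c c')).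
  + by move=> t [Jt dt]; exact: Og.
  + exact: sk.
  + exact: (atlas_transition sA ac ac').
- rewrite /gam /k scale0r addr0 scale1r /d addrC subrK /y.
  by split; exact: chart_mapK.
- by move=> t t01; apply: Wg; exact: J01.
move=> t c' t01 Ac' dt; have ac' := atlas_chartA sA Ac'.
have Ok := Og _ _ Ac' (J01 _ t01) dt.
have [d1 e1] := dk t 1; rewrite scale1r in e1.
have -> : 'D_1 (chart_map c' \o gam) t = 'D_d (transition c c') (k t).
  rewrite -e1; exact: (derive_comp (1 : R) d1 (smooth_diff (atlas_transition sA ac ac') Ok)).
have [_ H _] := push ac ac' Ok; apply/H.
by rewrite (plq (J01 _ t01)); apply/(plaque_dirE m2).
Qed.

(** Along a curve tangent to D^perp the first two coordinates have derivative zero. *)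
Lemma leaf_segment p q : same_leaf A x W p q -> p2 (chart_map c p) = p2 (chart_map c q).
Proof.
move=> [J [gam [[oJ J01] [cg sg] [<- <-] Wg tg]]].
have [_ cov _] := sA.
pose f (t : R) := p2 (chart_map c (gam t)).
have key (t : R) : 0 <= t <= 1 -> differentiable f t /\ 'D_1 f t = 0.
  move=> t01; have [c' Ac' dt] := cov (gam t); have ac' := atlas_chartA sA Ac'; have [ic' _] := ac'.
  have od : open (chart_dom c' `&` W) by apply: openI; [case: ic'|case: ic].
  have oJ' : open (J `&` gam @^-1` (chart_dom c' `&` W)) by exact: open_preimage_in.
  have J't : (J `&` gam @^-1` (chart_dom c' `&` W)) t.
    by split; [exact: J01|split=> //; exact: Wg].
  have dg : differentiable (chart_map c' \o gam) t by apply: (smooth_diff (sg c' Ac')); split=> //; exact: J01.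
  have Ou := ovp dt (Wg _ t01).
  have dtr := smooth_diff (atlas_transition sA ac' ac) Ou.
  have [d1 d2] := diff_p2 (transition c' c (chart_map c' (gam t))) ('D_('D_1 (chart_map c' \o gam) t) (transition c' c) (chart_map c' (gam t))).
  have dc1 := differentiable_compo dg dtr.
  have dc := differentiable_compo dc1 d1.
  have e s : (J `&` gam @^-1` (chart_dom c' `&` W)) s ->
      p2 (transition c' c ((chart_map c' \o gam) s)) = f s.
    by move=> [Js [ds Ws]]; rewrite /transition /= chart_mapK.
  split; first exact: (differentiable_eq_on oJ' J't e dc).
  rewrite -(derive_eq_on _ oJ' J't e).
  rewrite (derive_comp (1 : R) dc1 d1) (derive_comp (1 : R) dg dtr) d2.
  by apply/(base_proj_kernel _ Ac' Ou); exact: tg.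
apply/rowP => j.
have dj (t : R) : 0 <= t <= 1 -> differentiable (fun s => f s 0 j) (0 + t *: (1 : R)).
  move=> t01; rewrite add0r [_ *: _]mulr1.
  by have [d _] := key _ t01; exact: (differentiable_mxP _ _).1 d 0 j.
have [t [/andP[t0 t1]]] := MVT_line dj.
rewrite add0r add0r [_ *: _]mulr1 => E; apply/eqP; rewrite eq_sym -subr_eq0; apply/eqP.
have t01 : 0 <= t <= 1 by rewrite !ltW.
have [d D] := key _ t01.
by rewrite -/(f 1) -/(f 0) E -(derive_mxE _ 0 j d) D mxE.
Qed.

Theorem local_leaf_quotient : leaf_quotient A x W [set b] pi.
Proof.
split; [exact: base_proj_smooth|exact: base_proj_surj| |].
  by move=> c' _ p Ac' -> Wp dp _; exact: base_proj_submersion.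
move=> p q Wp Wq; rewrite base_proj_inj //; split; first exact: segment_leaf.
exact: leaf_segment.
Qed.

Theorem local_riemannian_submersion : riemannian_submersion_upto A x W [set b] pi G
  (Num.sqrt ((m%:R - 1) / (4 * m%:R))).
Proof.
move=> c' _ p Ac' -> Wp dp _ F0 u1 dpi; have ac' := atlas_chartA sA Ac'; have [ic' _] := ac'.
have [da Up] := Wp; have Ou := ovp dp Wp.
have Oa : overlap c' a (chart_map c' p) := chart_overlap dp da.
have te : transition c' a (chart_map c' p) = chart_map a p by rewrite /transition /= chart_mapK.
split.
  apply/seteqP; split=> v /=; rewrite /dpi (base_proj_derive _ Ac' Ou).
    by move=> hv; apply/(base_proj_kernel _ Ac' Ou).
  by move=> hv; apply/(base_proj_kernel _ Ac' Ou).
move=> O1 eta v L Oz cv.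
have [_ _ H] := push ac' aa Oa; have [Hc HM] := H v.
rewrite HM (lift_herm bch sztb zab holb curve_spacelike L Oz).
have e : dpi v = p2 ('D_('D_v (transition c' a) (chart_map c' p)) Phi (chart_map a p)).
  rewrite /dpi (base_proj_derive _ Ac' Ou) -te; congr p2.
  have d1 := smooth_diff (atlas_transition sA ac' aa) Oa.
  have [_ sP _ _ _] := bc.
  have d2 : differentiable Phi (transition c' a (chart_map c' p)) by rewrite te; exact: smooth_diff sP Up.
  exact: (derive_comp v d1 d2).
have cv' := Hc cv; rewrite te in cv' *.
by rewrite e base_projK //; exact: (metU Up cv').
Qed.

Lemma base_envelope p : W p -> envelope [set b] G (pi p, x p).
Proof.
move=> Wp; have [da Up] := Wp; apply/(curve_envelopeE bch erefl sztb zab holb); split=> //.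
move=> X; rewrite base_projK // => XA.
by have := lightU Up XA; rewrite /= (chart_mapK ia da).
Qed.
End LocalQuotient.

(** * The submanifold inside the envelope *)

Lemma row_mx_open (R : realType) (T : topologicalType) p q (g : T -> 'rV[R]_p)
    (B : set 'rV[R]_(p + q)) : continuous g -> open B ->
  open [set s : T * 'rV[R]_q | B (row_mx (g s.1) s.2)].
Proof.
move=> cg oB; rewrite openE => -[s y] /= Bs.
have /nbhs_ballP[e /= e0 He] := open_nbhs_nbhs (conj oB Bs).
exists ([set t | ball (g s) e (g t)], ball y e) => /=.
  split; last exact: nbhsx_ballx.
  by apply: (cg s); exact: nbhsx_ballx.
move=> [t w] /= [Bt Bw]; apply: He; move: Bt Bw; rewrite !ball_open_box // => Bt Bw i.
by case: (split_ordP i) => k ->; rewrite ?row_mxEl ?row_mxEr; [exact: Bt|exact: Bw].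
Qed.

(** In the coordinates phi of the submanifold the immersion becomes a map between spaces
of the same dimension with injective differential, to which the inverse function
theorem applies. *)
Lemma immersion_open_part (R : realType) m N (S : set 'rV[R]_N) (U : set 'rV[R]_m)
    (f : 'rV[R]_m -> 'rV[R]_N) u0 :
  embedded_submanifold m S -> open U -> U u0 -> smooth_on U f -> (forall u, U u -> S (f u)) ->
  (forall v, 'D_v f u0 = 0 -> v = 0) ->
  exists U', [/\ [/\ open U', U' u0 & U' `<=` U],
    forall u u', U' u -> U' u' -> f u = f u' -> u = u' &
    forall U2, open U2 -> U2 `<=` U' -> exists2 B : set 'rV[R]_N, open B &
      forall q, (exists2 u, U2 u & f u = q) <-> S q /\ B q].
Proof.
move=> emb oU Uu sf fS inj.
have [B [D [psi [phi [[oB Bu] oD [spsi sphi] SB psiK]]]]] := emb _ (fS _ Uu).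
have cf u : U u -> {for u, continuous f}.
  by move=> Uu'; apply: differentiable_continuous; exact: smooth_diff sf Uu'.
pose U1 := U `&` [set u | B (f u)].
have oU1 : open U1 by exact: open_preimage_in.
pose Th u := phi (f u).
have sf1 : smooth_on U1 f by apply: smooth_subset sf => u [].
have sTh : smooth_on U1 Th by apply: (smooth_comp oU1 oB (f := f) (g := phi)) => // u [].
have ThE u : U1 u -> D (Th u) /\ psi (Th u) = f u.
  move=> [Uu' Bf]; have : (S `&` B) (f u) by split=> //; exact: fS.
  by rewrite -SB => -[t Dt e]; rewrite /Th -e psiK.
have U1u : U1 u0 by [].
have injT v : 'D_v Th u0 = 0 -> v = 0.
  move=> h; apply: inj.
  have e u : U1 u -> psi (Th u) = f u by move=> /ThE[].
  rewrite -(derive_eq_on v oU1 U1u e).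
  have dpsi := smooth_diff spsi (ThE _ U1u).1.
  by rewrite (derive_comp v (smooth_diff sTh U1u) dpsi) h derive0v.
have [U' [V' [k [[oU' U'u sub] [oV' VE] k1 sk k2]]]] := inverse_function oU1 U1u sTh injT.
exists U'; split; first by split=> // u /sub[].
  by move=> u u' Uu' Uu2 e; rewrite -(k1 u) // -(k1 u') // /Th e.
move=> U2 oU2 s2; pose T := V' `&` [set t | U2 (k t)].
have oT : open T.
  apply: open_preimage_in => // t Vt; apply: differentiable_continuous.
  exact: smooth_diff sk Vt.
exists (B `&` [set q | T (phi q)]).
  apply: open_preimage_in => // q Bq; apply: differentiable_continuous.
  exact: smooth_diff sphi Bq.
move=> q; split.
  move=> [u U2u <-]; have U'u' := s2 _ U2u; have [Uu' Bf] := sub _ U'u'.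
  split; first exact: fS.
  by split=> //=; split; [rewrite VE; exists u|rewrite /= k1].
move=> [Sq [Bq /= [Vq U2q]]]; have : (S `&` B) q by [].
rewrite -SB => -[t Dt e]; move: Vq U2q; rewrite -e psiK // => Vt /= U2t.
have [Ut Tt] := k2 _ Vt; exists (k t) => //.
by have [_ <-] := ThE _ (sub _ Ut); rewrite Tt.
Qed.

Theorem theorem5p1 (R : realType) (m : nat) (m_ge2 : (2 <= m)%N)
    (M : topologicalType) (A : set (chart R M m))
    (M_manifold : smooth_manifold A)
    (x : M -> 'rV[R]_m.+3)
    (x_sphere : forall p, dot (x p) (x p) = 1)
    (x_immersion : immersion A x)
    (x_wintgen : wintgen_ideal A x)
    (x_umbilic_free : umbilic_free A x) :
  (* (2), on the whole of M *)
  (distr_perp_integrable A x /\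
   exists Phi, foliated_atlas A Phi /\ plaques_integral x Phi) /\
  forall (V : set M) (n1 n2 : M -> 'rV[R]_m.+3) (p0 : M),
    open V -> V p0 -> normal_frame A x V n1 n2 ->
  exists (W : set M) (S : topologicalType) (B : set (chart R S 2))
         (pi : M -> S) (G : S -> set 'rV[R[i]]_(1 + m.+3)),
  let Mhat := envelope B G in
  let iota := fun p => (pi p, x p) in
  [/\ [/\ open W, W p0 & W `<=` V],
      (* (1) *)
      [/\ riemann_surface B,
          gauss_map_factors A x n1 n2 W pi G,
          complex_curve B G,
          one_isotropic B G &
          spacelike_differential B G],
      (* (2), local quotient, and (3) *)
      leaf_quotient A x W B pi /\
      riemannian_submersion_upto A x W B pi G
        (Num.sqrt ((m%:R - 1) / (4 * m%:R))),
      (* (4) *)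
      [/\ osc_spacelike B G,
          forall b, B b -> embedded_submanifold m (in_coord b Mhat),
          tangent_to_family B G Mhat,
          {in W &, injective iota} &
          exists O : set (S * 'rV[R]_m.+3),
            open O /\ iota @` W = O `&` Mhat] &
      (* (5) *)
      round_sphere_bundle m.-1 B Mhat /\
      forall p, W p ->
        iota @` [set q | W q /\ same_leaf A x W p q] =
        iota @` W `&` [set q | q.1 = pi p]].
Proof.
have [_ _ sA] := M_manifold; split.
  split; first exact: (perp_integrable m_ge2).
  exists (foliated_chart A x); exact: (foliated_charts_atlas m_ge2).
move=> V n1 n2 p0 oV Vp0 [sn1 sn2 nON].
have [_ cov _] := sA; have [a Aa da] := cov p0; have aa := atlas_chartA sA Aa; have [ia _] := aa.
have [_ oia _ _ cia] := ia.
pose U := chart_im a `&` [set u | V (chart_inv a u)].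
have oU : open U by exact: open_preimage_in.
have UE : U = chart_map a @` (V `&` chart_dom a).
  apply/seteqP; split=> u.
    by move=> [iu Vu]; have [d e] := chart_invK ia iu; exists (chart_inv a u).
  by move=> [p [Vp dp] <-]; split; [exact: chart_im_dom|rewrite /= chart_mapK].
pose u0 := chart_map a p0.
have Uu0 : U u0 by rewrite UE; exists p0.
have par : wintgen_param U (x \o chart_inv a).
  apply: wintgen_param_sub oU _ (atlas_param sA x_sphere x_immersion x_wintgen x_umbilic_free Aa).
  by move=> u [].
have s1 : smooth_on U (n1 \o chart_inv a) by rewrite UE; exact: sn1.
have s2 : smooth_on U (n2 \o chart_inv a) by rewrite UE; exact: sn2.
have ON q : U q -> orthonormal_normals (x \o chart_inv a) q ((n1 \o chart_inv a) q) ((n2 \o chart_inv a) q).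
  by move=> [iq Vq]; have [d e] := chart_invK ia iq; have := nON a _ Aa Vq d; rewrite e.
have [U1 [Phi [h [r [j0 [zt [sub1 bc [szt za] hol H]]]]]]] := local_curve m_ge2 par s1 s2 ON Uu0.
have spU u : U1 u -> spacelike_pair (zt (p2 (Phi u))) (cDv (basis_vec R 0) zt (p2 (Phi u))).
  by move=> /H[].
have lightU u X : U1 u -> (X <= real_span (zt (p2 (Phi u))) (cDv (basis_vec R 0) zt (p2 (Phi u))))%MS ->
    lor X (light_vec ((x \o chart_inv a) u)) = 0.
  by move=> /H[_ _ _ _]; apply.
have [[oU1 U1u r0] sP _ b1 _] := bc.
have subi : U1 `<=` chart_im a by move=> u /sub1[].
(* Near p0 the map (pi, x) is an embedding onto an open part of the envelope over the
first disc; the second, smaller cube lies in the domain where this holds. *)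
pose D := disc_chart (p2 (Phi u0)) r.
have Dim : chart_im D = ball (p2 (Phi u0)) r by exact: disc_im.
have Dch : is_chart D by exact: disc_is_chart.
have sztD : csmv (chart_im D) zt by rewrite Dim.
have zaD z : chart_im D z -> zt z 0 j0 = 1 by rewrite Dim; exact: za.
have holD z w : chart_im D z -> cDv w zt z = cx w *: cDv (basis_vec R 0) zt z by rewrite Dim; exact: hol.
have spD z : chart_im D z -> spacelike_pair (zt z) (cDv (basis_vec R 0) zt z).
  exact: (curve_spacelike m_ge2 bc spU).
have emb := curve_envelope_submanifold Dch erefl sztD zaD holD spD.
have inE := in_coord_envelope Dch erefl sztD zaD holD.
pose f u : 'rV[R]_(2 + m.+3) := row_mx (p2 (Phi u)) ((x \o chart_inv a) u).
have [_ sF F1 wp _] := par.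
have sF1 : smooth_on U1 (x \o chart_inv a) := smooth_subset sub1 sF.
have sp2 : smooth_on U1 (fun u => p2 (Phi u)) by apply: smooth_mulmx => //; exact: smooth_cst.
have sf : smooth_on U1 f by exact: smooth_row_mx.
have fS u : U1 u -> in_coord D (envelope [set D] (curve_map D zt)) (f u).
  move=> U1u'; apply/inE; rewrite row_mxKl row_mxKr; split; first last.
  - by apply/lor_rowsP => X; exact: lightU.
  - exact: x_sphere.
  - by rewrite Dim; exact: (p2_chart m_ge2 (b1 _ U1u').1).
have injf v : 'D_v f u0 = 0 -> v = 0.
  have [_ ->] := dv_row_mx v (smooth_diff sp2 U1u) (smooth_diff sF1 U1u).
  move=> h0; have /eq_row_mx[_ Fv] : row_mx ('D_v (fun u => p2 (Phi u)) u0) ('D_v (x \o chart_inv a) u0) = row_mx 0 0.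
    by rewrite row_mx0.
  have [e [k1 [k2 [l1 [l2 [mu0 [eON _ _ _]]]]]]] := wp _ Uu0.
  rewrite (frame_coord Uu0 sF eON v) big1 // => k _.
  by rewrite /fff Fv dot0l scale0r.
have [U2 [[oU2 U2u sub2] injU2 openU2]] := immersion_open_part emb oU1 U1u sf fS injf.
have [U3 [r3 [bc3 sub3 _ r3r]]] := box_chart_shrink bc oU2 U2u.
have sub31 : U3 `<=` U1 by move=> u /sub3/sub2.
have [[oU3 U3u r30] _ _ b3 _] := bc3.
have sub3i : U3 `<=` chart_im a by move=> u /sub31/subi.
have Qsub : ball (p2 (Phi u0)) r3 `<=` ball (p2 (Phi u0)) r by exact: le_ball.
have szt3 : csmv (ball (p2 (Phi u0)) r3) zt := csmv_subset Qsub szt.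
have za3 z : ball (p2 (Phi u0)) r3 z -> zt z 0 j0 = 1 by move=> /Qsub; exact: za.
have hol3 z w : ball (p2 (Phi u0)) r3 z -> cDv w zt z = cx w *: cDv (basis_vec R 0) zt z.
  by move=> /Qsub; exact: hol.
have sp3 u : U3 u -> spacelike_pair (zt (p2 (Phi u))) (cDv (basis_vec R 0) zt (p2 (Phi u))).
  by move=> /sub31; exact: spU.
have gv3 u : U3 u -> exists2 c, c != 0 &
    gvec (x \o chart_inv a) (n1 \o chart_inv a) (n2 \o chart_inv a) u = c *: zt (p2 (Phi u)).
  by move=> /sub31/H[].
have perp3 u v : U3 u -> distr_perp (x \o chart_inv a) u v <-> p2 ('D_v Phi u) = 0.
  by move=> /sub31/H[_ _ h3 _ _]; exact: h3.
have met3 u v (U3u' : U3 u) := let: And5 _ _ _ h4 _ := H u (sub31 _ U3u') in h4 v.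
have light3 u X (U3u' : U3 u) := lightU u X (sub31 _ U3u').
pose b := base_chart u0 Phi r3.
have bim : chart_im b = ball (p2 (Phi u0)) r3 by exact: disc_im.
have bch : is_chart b by exact: disc_is_chart.
have sztb : csmv (chart_im b) zt by rewrite bim.
have zab z : chart_im b z -> zt z 0 j0 = 1 by rewrite bim; exact: za3.
have holb z w : chart_im b z -> cDv w zt z = cx w *: cDv (basis_vec R 0) zt z by rewrite bim; exact: hol3.
have spb z : chart_im b z -> spacelike_pair (zt z) (cDv (basis_vec R 0) zt z).
  exact: (curve_spacelike m_ge2 bc3 sp3).
pose c := fol_chart a U3 Phi h; pose pi := base_proj a U3 u0 Phi h r3.
have [[ic _] _] := sub_chartP sA aa bc3 sub3i.
have lq : leaf_quotient A x (chart_dom c) [set b] pi.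
  exact: (local_leaf_quotient m_ge2 sA x_sphere x_immersion x_wintgen x_umbilic_free Aa bc3 sub3i perp3).
have projK p : chart_dom c p -> chart_map b (pi p) = p2 (chart_map c p).
  exact: (base_projK m_ge2 sA Aa bc3 sub3i).
have env p : chart_dom c p -> envelope [set b] (curve_map b zt) (pi p, x p).
  exact: (base_envelope m_ge2 sA x_sphere Aa bc3 sub3i szt3 za3 hol3 light3).
have fE p : chart_dom c p -> f (chart_map a p) = row_mx (chart_map b (pi p)) (x p).
  by move=> Wp; rewrite projK // /f /= (chart_mapK ia) //; case: Wp.
exists (chart_dom c), 'rV[R]_2, [set b], pi, (curve_map b zt); split.
- split; first by case: ic.
    by split.
  by move=> p [dp /= /sub31/sub1[_]] /=; rewrite chart_mapK.
- split.
  + exact: disc_riemann_surface.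
  + exact: (local_gauss_map m_ge2 sA x_sphere x_immersion x_wintgen x_umbilic_free Aa bc3 sub3i gv3).
  + exact: (curve_is_complex bch erefl sztb zab holb spb).
  + exact: (curve_one_isotropic bch sztb zab holb spb).
  + exact: (curve_spacelike_differential bch sztb zab holb spb).
- split; first exact: lq.
  exact: (local_riemannian_submersion m_ge2 sA x_sphere x_immersion x_wintgen x_umbilic_free
    Aa bc3 sub3i szt3 za3 hol3 sp3 perp3 met3).
- split.
  + exact: (curve_osc_spacelike bch sztb zab holb spb).
  + by move=> _ ->; exact: (curve_envelope_submanifold bch erefl sztb zab holb spb).
  + exact: (curve_tangent bch erefl sztb zab holb).
  + move=> p q /set_mem Wp /set_mem Wq [e1 e2].
    have [dp Up] := Wp; have [dq Uq] := Wq.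
    rewrite -(chart_mapK ia dp) -(chart_mapK ia dq); congr (chart_inv a _).
    by apply: injU2; [exact: sub3|exact: sub3|rewrite !fE // e1 e2].
  + have [B oB HB] := openU2 U3 oU3 sub3.
    exists [set s | B (row_mx (chart_map b s.1) s.2)]; split.
      apply: row_mx_open => // s; have [_ _ _ cb _] := bch; exact: cb.
    apply/seteqP; split=> s.
      move=> [p Wp <-]; split; last exact: env.
      rewrite /= -fE //; have [_ Up] := Wp.
      by have [] := (HB (f (chart_map a p))).1 (ex_intro2 _ _ (chart_map a p) Up erefl).
    case: s => s y [/= Bs Es].
    have Ds : in_coord D (envelope [set D] (curve_map D zt)) (row_mx (chart_map b s) y).
      have [k1 k2] := (curve_envelopeE bch erefl sztb zab holb s y).1 Es.
      apply/inE; rewrite row_mxKl row_mxKr; split=> //; last exact/lor_rowsP.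
      by rewrite Dim; apply: Qsub; rewrite -bim; exists s.
    have [u U3u' fu] := (HB _).2 (conj Ds Bs).
    have [d e] := chart_invK ia (sub3i _ U3u').
    have Wp : chart_dom c (chart_inv a u) by split=> //=; rewrite e.
    exists (chart_inv a u) => //.
    have := fE _ Wp; rewrite e fu => /eq_row_mx[e1 ->]; congr (_, _).
    by rewrite -[s](chart_mapK bch (I : chart_dom b s)) e1 chart_mapK.
- split.
    apply: (curve_sphere_bundle bch erefl sztb zab holb spb); last by rewrite -subn1 subn_gt0.
    by case: (m) m_ge2 => // k _; rewrite /= addnC.
  have [_ _ _ leaf] := lq.
  move=> p Wp; apply/seteqP; split=> s.
    move=> [q [Wq L] <-]; split; first by exists q.
    by rewrite /=; apply/esym/leaf.
  move=> [[q Wq <-] /= e]; exists q => //; split=> //.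
  by apply/leaf.
Qed.
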